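(* For a surface $S$ and $n\ge 1$ let $F_n(S):\mathrm{PConf}_{n+1}(S)/\Sigma_n\to\mathrm{PConf}_n(S)/\Sigma_n$ be the fiber bundle $F_n(S)(x_0,\{x_1,\dots,x_n\})=\{x_1,\dots,x_n\}$. The following hold. (1) If $S=\mathbb{R}^2$ and $n>3$, then every continuous section of $F_n(\mathbb{R}^2)$ is ''adding a point at infinity''. (2) If $S=S^2$ and either $n>4$ or $n\in\{2,3\}$, then the bundle $F_n(S^2)$ does not have a continuous section.
   Context: $\mathrm{PConf}_n(S)=\{(x_1,\dots,x_n)\in S^n : x_i\ne x_j \text{ for } i\neq j\}$ with the subspace topology; the symmetric group $\Sigma_n$ acts on $\mathrm{PConf}_n(S)$ by permuting the points and on $\mathrm{PConf}_{n+1}(S)=\{(x_0,x_1,\dots,x_n)\}$ by permuting $x_1,\dots,x_n$ and fixing $x_0$. Adding a point at infinity: identify $\mathbb{R}^2$ with $S^2\setminus\{\infty\}$ by stereographic projection, where $\infty$ is the north pole, and give $S^2$ the round metric with distance $d$. Given a configuration $\{x_1,\dots,x_n\}\subset \mathbb{R}^2$ and a unit tangent vector $v_\infty$ to $S^2$ at $\infty$, put $\epsilon=\frac12\min_i d(x_i,\infty)$ and let $x_0\in\mathbb{R}^2$ be the point reached at time $\epsilon$ by the unit-speed geodesic of $S^2$ starting at $\infty$ in direction $v_\infty$; then $x_0\notin\{x_1,\dots,x_n\}$. A continuous choice of unit vector $v_\infty$ at $\infty$ depending on $\{x_1,\dots,x_n\}\in\mathrm{PConf}_n(\mathbb{R}^2)/\Sigma_n$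 thus gives a section of $F_n(\mathbb{R}^2)$. A section of $F_n(\mathbb{R}^2)$ is called ''adding a point at infinity'' if it is homotopic, through sections, to a section obtained in this way. *)

(* Defs.v *)
From HB Require Import structures.
From mathcomp Require Import all_boot all_order all_fingroup all_algebra.
From mathcomp Require Import generic_quotient.
From mathcomp Require Import all_classical all_reals all_analysis.

Set Implicit Arguments.
Unset Strict Implicit.
Unset Printing Implicit Defensive.

Import Order.TTheory GRing.Theory Num.Theory.
Import numFieldNormedType.Exports.

Local Open Scope classical_set_scope.
Local Open Scope quotient_scope.
Local Open Scope ring_scope.

(* Subspace topology of the product topology on [S^n]; the points of a
   configuration in [PConf n.+1 S] are numbered from 0, as in (x_0,...,x_n). *)
Definition PConf (n : nat) (S : topologicalType) : topologicalType :=
  set_type [set x : {ptws 'I_n -> S} | injective x].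

Definition pt {n : nat} {S : topologicalType} (x : PConf n S) : 'I_n -> S :=
  set_val x.

Section Configurations.
Variable S : topologicalType.

Lemma pt_inj n (x : PConf n S) : injective (pt x).
Proof. exact: set_mem (valP x). Qed.

Lemma PConf_eq n (x y : PConf n S) : pt x =1 pt y -> x = y.
Proof. by move=> /funext xy; apply: val_inj. Qed.

Definition mkPConf n (f : {ptws 'I_n -> S}) (f_inj : injective f) : PConf n S :=
  exist _ f (mem_set f_inj).

Lemma pt_perm_inj n (s : 'S_n) (x : PConf n S) : injective (pt x \o s).
Proof. exact: inj_comp (@pt_inj n x) perm_inj. Qed.

Definition permute n (s : 'S_n) (x : PConf n S) : PConf n S :=
  mkPConf (@pt_perm_inj n s x).

Lemma pt_permute n (s : 'S_n) (x : PConf n S) i : pt (permute s x) i = pt x (s i).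
Proof. by []. Qed.

Lemma permute1 n (x : PConf n S) : permute 1%g x = x.
Proof. by apply: PConf_eq => i; rewrite pt_permute perm1. Qed.

Lemma permuteM n (s t : 'S_n) (x : PConf n S) :
  permute s (permute t x) = permute (s * t)%g x.
Proof. by apply: PConf_eq => i; rewrite !pt_permute permM. Qed.

(* ['S_n] acts on [PConf n.+1 S] through the permutations of [0..n] fixing 0. *)
Definition permute0 n (s : 'S_n) (x : PConf n.+1 S) : PConf n.+1 S :=
  permute (lift_perm ord0 ord0 s) x.

Lemma permute01 n (x : PConf n.+1 S) : permute0 1%g x = x.
Proof. by rewrite /permute0 lift_perm1 permute1. Qed.

Lemma permute0M n (s t : 'S_n) (x : PConf n.+1 S) :
  permute0 s (permute0 t x) = permute0 (s * t)%g x.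
Proof. by rewrite /permute0 permuteM lift_permM. Qed.

Definition same_orbit n : rel (PConf n S) :=
  fun x y => `[< exists s : 'S_n, y = permute s x >].

Definition same_orbit0 n : rel (PConf n.+1 S) :=
  fun x y => `[< exists s : 'S_n, y = permute0 s x >].

Lemma same_orbit_equiv n : equiv_class_of (@same_orbit n).
Proof.
apply: EquivClass => [x | x y | y x z].
- by apply/asboolP; exists 1%g; rewrite permute1.
- apply/asboolP/asboolP => -[s ->]; exists s^-1%g;
    by rewrite permuteM mulVg permute1.
- move=> /asboolP[s ->] /asboolP[t ->]; apply/asboolP.
  by exists (t * s)%g; rewrite permuteM.
Qed.

Lemma same_orbit0_equiv n : equiv_class_of (@same_orbit0 n).
Proof.
apply: EquivClass => [x | x y | y x z].
- by apply/asboolP; exists 1%g; rewrite permute01.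
- apply/asboolP/asboolP => -[s ->]; exists s^-1%g;
    by rewrite permute0M mulVg permute01.
- move=> /asboolP[s ->] /asboolP[t ->]; apply/asboolP.
  by exists (t * s)%g; rewrite permute0M.
Qed.

Canonical same_orbit_equiv_rel n := EquivRelPack (@same_orbit_equiv n).
Canonical same_orbit0_equiv_rel n := EquivRelPack (@same_orbit0_equiv n).

End Configurations.

(* PConf_n(S)/Σ_n and PConf_{n+1}(S)/Σ_n with the quotient topology. *)
Definition UConf (n : nat) (S : topologicalType) : topologicalType :=
  quotient_topology {eq_quot (same_orbit_equiv_rel S n)}.

Definition UConf0 (n : nat) (S : topologicalType) : topologicalType :=
  quotient_topology {eq_quot (same_orbit0_equiv_rel S n)}.

Section Bundle.
Variables (n : nat) (S : topologicalType).

Definition uconf (x : PConf n S) : UConf n S :=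
  \pi_(quotient_topology {eq_quot (same_orbit_equiv_rel S n)}) x.

Definition uconf0 (x : PConf n.+1 S) : UConf0 n S :=
  \pi_(quotient_topology {eq_quot (same_orbit0_equiv_rel S n)}) x.

Lemma uconfP (x y : PConf n S) :
  uconf x = uconf y <-> exists s : 'S_n, y = permute s x.
Proof.
split=> [/eqquotP/asboolP // | xy].
by apply/eqquotP; apply/asboolP.
Qed.

Lemma uconf0P (x y : PConf n.+1 S) :
  uconf0 x = uconf0 y <-> exists s : 'S_n, y = permute0 s x.
Proof.
split=> [/eqquotP/asboolP // | xy].
by apply/eqquotP; apply/asboolP.
Qed.

Lemma pt_lift_inj (x : PConf n.+1 S) : injective (pt x \o lift ord0).
Proof. exact: inj_comp (@pt_inj _ _ x) lift_inj. Qed.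

Definition forget0 (x : PConf n.+1 S) : PConf n S := mkPConf (@pt_lift_inj x).

Lemma pt_forget0 (x : PConf n.+1 S) i : pt (forget0 x) i = pt x (lift ord0 i).
Proof. by []. Qed.

(* The bundle projection: the map induced by [forget0] on the quotients. *)
Definition bundle_proj (c : UConf0 n S) : UConf n S :=
  uconf (forget0
    (repr (c : quotient_topology {eq_quot (same_orbit0_equiv_rel S n)}))).

Lemma bundle_proj_uconf0 (x : PConf n.+1 S) : bundle_proj (uconf0 x) = uconf (forget0 x).
Proof.
rewrite /bundle_proj; set y := repr _.
have /uconf0P[s ->] : uconf0 y = uconf0 x by exact: reprK.
apply/uconfP; exists s; apply: PConf_eq => i.
by rewrite pt_forget0 !pt_permute pt_forget0 lift_perm_lift.
Qed.

Definition is_section (s : UConf n S -> UConf0 n S) : Prop :=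
  continuous s /\ forall c, bundle_proj (s c) = c.

Definition homotopic_sections (R : realType) (s s' : UConf n S -> UConf0 n S) :
    Prop :=
  exists H : R * UConf n S -> UConf0 n S,
    [/\ {within `[0, 1] `*` setT, continuous H},
        forall t c, 0 <= t <= 1 -> bundle_proj (H (t, c)) = c,
        forall c, H (0, c) = s c &
        forall c, H (1, c) = s' c].

End Bundle.

Section PlaneAndSphere.
Variable R : realType.

Definition plane : topologicalType := 'rV[R]_2.

Definition dot (u v : 'rV[R]_3) : R := (u *m v^T) 0 0.

Definition sphere : topologicalType := set_type [set p : 'rV[R]_3 | dot p p = 1].

Definition infty : 'rV[R]_3 := \row_(j < 3) [:: 0; 0; 1]`_j.

(* Inverse of the stereographic projection from [infty]: the second
   intersection with the sphere of the line through [infty] and (a, b, 0). *)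
Definition to_sphere (x : plane) : 'rV[R]_3 :=
  let a := (x : 'rV[R]_2) 0 0 in
  let b := (x : 'rV[R]_2) 0 1 in
  let q := a ^+ 2 + b ^+ 2 in
  \row_(j < 3) [:: 2 * a / (q + 1); 2 * b / (q + 1); (q - 1) / (q + 1)]`_j.

Definition sphere_dist (p q : 'rV[R]_3) : R := acos (dot p q).

Definition unit_tangent (p v : 'rV[R]_3) : Prop := dot p v = 0 /\ dot v v = 1.

(* Unit-speed geodesic (great circle) from [p] in the unit tangent direction [v]. *)
Definition geodesic (p v : 'rV[R]_3) (t : R) : 'rV[R]_3 :=
  cos t *: p + sin t *: v.

(* Distances on the unit sphere are at most [pi], so that the default value
   [pi] of the iterated minimum is harmless for [n >= 1]. *)
Definition infty_eps n (x : PConf n plane) : R :=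
  2^-1 * \big[Num.min/pi]_(i < n) sphere_dist (to_sphere (pt x i)) infty.

Definition obtained_from n (v : UConf n plane -> 'rV[R]_3)
    (s : UConf n plane -> UConf0 n plane) : Prop :=
  forall x : PConf n plane, exists y : PConf n.+1 plane,
    [/\ to_sphere (pt y ord0) = geodesic infty (v (uconf x)) (infty_eps x),
        forget0 y = x &
        s (uconf x) = uconf0 y].

Definition adding_point_at_infinity n (s : UConf n plane -> UConf0 n plane) :
    Prop :=
  exists (v : UConf n plane -> 'rV[R]_3) (s' : UConf n plane -> UConf0 n plane),
    [/\ continuous v,
        forall c, unit_tangent infty (v c),
        is_section s',
        obtained_from v s' &
        homotopic_sections R s s'].

End PlaneAndSphere.

(* Main.v *)
Require Import Defs.
From mathcomp Require Import all_boot all_order all_fingroup all_algebra.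
From mathcomp Require Import generic_quotient.
From mathcomp Require Import all_classical all_reals all_analysis.
From mathcomp Require Import ring lra zify.

Set Implicit Arguments.
Unset Strict Implicit.
Unset Printing Implicit Defensive.

Import Order.TTheory GRing.Theory Num.Theory.
Import numFieldNormedType.Exports.

Local Open Scope classical_set_scope.
Local Open Scope ring_scope.
(* Part (1).  A section over the plane is a continuous equivariant choice of a point f(x) off the
   configuration x.  Cut the plane along a curve through the points of x (the graph of a function
   of the first coordinate): the n + 1 windows of the curve are the generators of a free product
   of groups of order 2, and a path avoiding x spells a word.  Rotating x by a full turn gives a
   loop of the added point, seen from the rotating frame, whose word is, up to conjugacy, the
   same for all x and for all shears of the cut.  Exchanging two consecutive points transforms
   this word by a half twist, whose iterates lengthen every passage through a middle window; hence
   only the two unbounded windows occur.  A regular polygon together with its center shows that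
   the loop does wind, so the word is a nonzero power of the product of the two unbounded windows.
   Modulo words in the unbounded windows there is then exactly one label of f(x) that is fixed by
   the transport along the loop.  The label tells how to push f(x) back through the windows to
   infinity, continuously in x; the cut is discontinuous where two first coordinates agree, so
   this is done successively for enough shears, each with a weight vanishing at its bad
   configurations.

   Part (2).  Rotating a fixed configuration Q of the sphere by unit quaternions q, let F(q) be
   the added point seen from the rotated frame; F q changes by a symmetry of Q when q is
   multiplied by it.  For the two poles and a regular (n - 2)-gon on the equator, the loop
   of rotations about the poles contracts, so that F has winding number 0 around the axis,
   whereas the cyclic symmetry determines this number modulo the order of the symmetry to be
   nonzero.  For n = 3, the half-turns b1, b2 preserving an equatorial triangle give matrices in
   SL(2, Z), up to sign, with C1^4 = C2^4 = 1 and C1 C2 C1 = C2 C1 C2, whose parities contradict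
   each other. *)

(** Neither a fundamental group nor a covering space is formed. A cut is a real function together
    with the number of the window in which it vanishes, and any family of involutions transports
    labels along a path that meets the cut only inside windows. One lemma on homotopies of loops
    then serves for words, sides, winding numbers, cosets and integer matrices.

    The full turn is chosen because it is central among the motions of a configuration: its loop
    exists at every configuration and varies continuously with it, so a half twist must preserve its
    conjugacy class. The label of the added point is characterized by this loop and not by the
    choice of a path to infinity; its uniqueness makes it compatible with transport and with
    renumbering. The exclusion of the middle windows needs, for each of them, an unbounded window
    that is not next to it; with two points the only middle window is next to both.

    On the sphere, rotations are lifted to nonzero quaternions, where homotopies are straight cones
    and only the avoidance of 0 has to be checked. *)

Definition ct (P Q : topologicalType) (p : P) (f : P -> Q) := {for p, continuous f}.

(** * Continuity at a point *)

Section Continuity.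
Variables (R : realType) (P : topologicalType) (p : P).
Implicit Types (f g : P -> R).

Lemma ct_cst (Q : topologicalType) (c : Q) : ct p (fun=> c).
Proof. exact: cvg_cst. Qed.

Lemma ct_id : ct p (fun x => x).
Proof. exact: cvg_id. Qed.

Lemma ct_comp (Q T : topologicalType) (f : P -> Q) (g : Q -> T) :
  ct p f -> ct (f p) g -> ct p (fun x => g (f x)).
Proof. by move=> fc gc; exact: (@continuous_comp _ _ _ f g). Qed.

Lemma ct_pair (Q T : topologicalType) (f : P -> Q) (g : P -> T) :
  ct p f -> ct p g -> ct p (fun x => (f x, g x)).
Proof. by move=> fc gc; exact: (cvg_pair fc gc). Qed.

Lemma ct_fst (Q T : topologicalType) (f : P -> Q * T) : ct p f -> ct p (fun x => (f x).1).
Proof. by move=> fc; apply: (ct_comp fc); exact: cvg_fst. Qed.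

Lemma ct_snd (Q T : topologicalType) (f : P -> Q * T) : ct p f -> ct p (fun x => (f x).2).
Proof. by move=> fc; apply: (ct_comp fc); exact: cvg_snd. Qed.

Lemma ct_add f g : ct p f -> ct p g -> ct p (fun x => f x + g x).
Proof. by move=> fc gc; exact: continuousD. Qed.

Lemma ct_opp f : ct p f -> ct p (fun x => - f x).
Proof. by move=> fc; exact: continuousN. Qed.

Lemma ct_mul f g : ct p f -> ct p g -> ct p (fun x => f x * g x).
Proof. by move=> fc gc; exact: continuousM. Qed.

Lemma ct_inv f : f p != 0 -> ct p f -> ct p (fun x => (f x)^-1).
Proof. by move=> f0 fc; exact: continuousV. Qed.

Lemma ct_exp f n : ct p f -> ct p (fun x => f x ^+ n).
Proof.
move=> fc; elim: n => [|n IH]; first exact: ct_cst.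
have -> : (fun x => f x ^+ n.+1) = (fun x => f x * f x ^+ n).
  by apply/funext => x; rewrite exprS.
exact: ct_mul.
Qed.

Lemma ct_norm f : ct p f -> ct p (fun x => `|f x|).
Proof. by move=> fc; exact: cvg_norm. Qed.

Lemma ct_min f g : ct p f -> ct p g -> ct p (fun x => Num.min (f x) (g x)).
Proof.
move=> fc gc.
have -> : (fun x => Num.min (f x) (g x)) = (fun x => (f x + g x - `|f x - g x|) / 2).
  by apply/funext => x; rewrite minr_absE.
apply: ct_mul; last exact: ct_cst.
apply: ct_add; first exact: ct_add.
by apply/ct_opp/ct_norm/ct_add => //; exact: ct_opp.
Qed.

Lemma ct_max f g : ct p f -> ct p g -> ct p (fun x => Num.max (f x) (g x)).
Proof.
move=> fc gc.
have -> : (fun x => Num.max (f x) (g x)) = (fun x => (f x + g x + `|f x - g x|) / 2).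
  by apply/funext => x; rewrite maxr_absE.
apply: ct_mul; last exact: ct_cst.
apply: ct_add; first exact: ct_add.
by apply/ct_norm/ct_add => //; exact: ct_opp.
Qed.

Lemma ct_big (I : Type) (op : R -> R -> R) (idx : P -> R) (r : seq I) (Q : pred I)
    (F : I -> P -> R) :
  (forall f g, ct p f -> ct p g -> ct p (fun x => op (f x) (g x))) ->
  ct p idx -> (forall i, ct p (F i)) ->
  ct p (fun x => \big[op/idx x]_(i <- r | Q i) F i x).
Proof.
move=> opc ic Fc; elim: r => [|i r IH].
  by rewrite (_ : (fun x => _) = idx) //; apply/funext => x; rewrite big_nil.
have -> : (fun x => \big[op/idx x]_(j <- i :: r | Q j) F j x) =
    (fun x => if Q i then op (F i x) (\big[op/idx x]_(j <- r | Q j) F j x)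
              else \big[op/idx x]_(j <- r | Q j) F j x).
  by apply/funext => x; rewrite big_cons.
by case: (Q i) => //; exact: opc.
Qed.

Lemma ct_sum (I : Type) (r : seq I) (Q : pred I) (F : I -> P -> R) :
  (forall i, ct p (F i)) -> ct p (fun x => \sum_(i <- r | Q i) F i x).
Proof.
move=> Fc.
by apply: (@ct_big I +%R (fun=> 0) r Q F) => //; [exact: ct_add | exact: ct_cst].
Qed.

Lemma ct_cos f : ct p f -> ct p (fun x => cos (f x)).
Proof. by move=> fc; apply: (ct_comp fc); exact: continuous_cos. Qed.

Lemma ct_sin f : ct p f -> ct p (fun x => sin (f x)).
Proof. by move=> fc; apply: (ct_comp fc); exact: continuous_sin. Qed.

Lemma ct_sqrt f : ct p f -> ct p (fun x => Num.sqrt (f x)).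
Proof. by move=> fc; apply: (ct_comp fc); exact: sqrt_continuous. Qed.

Lemma ct_near (Q : topologicalType) (f g : P -> Q) :
  (\forall x \near p, f x = g x) -> ct p f -> ct p g.
Proof.
move=> fg fc; rewrite /ct /prop_for /continuous_at -(nbhs_singleton fg).
apply: cvg_trans fc; apply: near_eq_cvg.
by apply: filterS fg.
Qed.

End Continuity.

Ltac ct_step := match goal with
  | H : ct ?p ?f |- ct ?p ?f => exact H
  | |- ct _ (fun _ => ?c) => exact: ct_cst
  | |- ct _ (fun x => x) => exact: ct_id
  | |- ct _ (fun x => (@?f x, @?g x)) => apply: (ct_pair (f := f) (g := g))
  | |- ct _ (fun x => (@?f x + @?g x)%R) => apply: (ct_add (f := f) (g := g))
  | |- ct _ (fun x => (- (@?f x))%R) => apply: (ct_opp (f := f))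
  | |- ct _ (fun x => (@?f x * @?g x)%R) => apply: (ct_mul (f := f) (g := g))
  | |- ct _ (fun x => `|@?f x|%R) => apply: (ct_norm (f := f))
  | |- ct _ (fun x => Num.min (@?f x) (@?g x)) => apply: (ct_min (f := f) (g := g))
  | |- ct _ (fun x => Num.max (@?f x) (@?g x)) => apply: (ct_max (f := f) (g := g))
  | |- ct _ (fun x => (@?f x ^+ _)%R) => apply: (ct_exp (f := f))
  | |- ct _ (fun x => cos (@?f x)) => apply: (ct_cos (f := f))
  | |- ct _ (fun x => sin (@?f x)) => apply: (ct_sin (f := f))
  | |- ct _ (fun x => Num.sqrt (@?f x)) => apply: (ct_sqrt (f := f))
  | |- ct _ (fun x => (@?f x).1) => apply: (ct_fst (f := f))
  | |- ct _ (fun x => (@?f x).2) => apply: (ct_snd (f := f))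
  end.

Ltac ctac := repeat ct_step.

(** * Transport across a cut *)

Section Transport.
Variables (R : realType) (S : Type) (kappa : nat -> S -> S).
Hypothesis kappaK : forall j, involutive (kappa j).

(** Local constancy of [idx] is asked only on the cut: elsewhere the window number may jump, as it
    does when a point passes above or below a puncture. *)
Definition cut_ok (P : topologicalType) (bet : P -> R) (idx : P -> nat) (p : P) :=
  ct p bet /\ (bet p = 0 -> \forall q \near p, idx q = idx p).

(** The label at [q] of a path that has label [s] at [p], for [q] close to [p]. Points of the cut
    count as lying above it. The window is read at [p]: if [p] is on the cut it is constant nearby,
    and otherwise no crossing occurs nearby. *)
Definition tau (P : Type) (bet : P -> R) (idx : P -> nat) (p q : P) (s : S) : S :=
  if (0 <= bet p) == (0 <= bet q) then s else kappa (idx p) s.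

Definition coherent (P : Type) (bet : P -> R) (idx : P -> nat) (N : set P) :=
  forall q r v s, N q -> N r -> N v ->
    tau bet idx q v s = tau bet idx r v (tau bet idx q r s).

Lemma tau_id (P : Type) (bet : P -> R) idx p s : tau bet idx p p s = s.
Proof. by rewrite /tau eqxx. Qed.

Lemma tau_inj (P : Type) (bet : P -> R) idx p q : injective (tau bet idx p q).
Proof.
by move=> s t; rewrite /tau; case: eqP => // _ /(congr1 (kappa (idx p))); rewrite !kappaK.
Qed.

Lemma coherent_near (P : topologicalType) (bet : P -> R) idx p :
  cut_ok bet idx p -> exists2 N, nbhs p N & coherent bet idx N.
Proof.
move=> [bc idxc]; case: (eqVneq (bet p) 0) => [b0 | bN0].
  exists [set q | idx q = idx p]; first exact: idxc.
  move=> q r v s /= qp rp vp; rewrite /tau qp rp.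
  by do 3 case: (0 <= bet _) => //=; rewrite ?kappaK.
have [bp | bp] : 0 < bet p \/ bet p < 0.
- by case: (ltgtP (bet p) 0) bN0 => // _ _; [right | left].
- exists [set q | 0 < bet q]; first exact: (bc _ (lt_nbhsr bp)).
  by move=> q r v s /= /ltW q0 /ltW r0 /ltW v0; rewrite /tau q0 r0 v0.
- exists [set q | bet q < 0]; first exact: (bc _ (lt_nbhsl bp)).
  by move=> q r v s /=; rewrite /tau !ltNge => /negbTE-> /negbTE-> /negbTE->.
Qed.

(** A path in the covering space with fiber [S] defined by the involutions, given by its labels
    alone. *)
Definition is_lift (bet : R -> R) (idx : R -> nat) (w : R -> S) :=
  forall t : R, 0 <= t <= 1 ->
    \forall t' \near t, 0 <= t' <= 1 -> w t' = tau bet idx t t' (w t).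

Definition carries (bet : R -> R) (idx : R -> nat) (s s' : S) :=
  exists w, [/\ is_lift bet idx w, w 0 = s & w 1 = s'].

(** The subdivision times are cut off at [t], so that for [k = m] the result, as a function of [t],
    is a candidate lift. *)
Fixpoint steps (bet : R -> R) (idx : R -> nat) (m : nat) (t : R) (k : nat) (s : S) : S :=
  if k is k'.+1 then
    tau bet idx (Num.min t (k'%:R / m%:R)) (Num.min t (k'.+1%:R / m%:R))
      (steps bet idx m t k' s)
  else s.

Lemma steps_inj bet idx m t k : injective (steps bet idx m t k).
Proof.
elim: k => [|k IH] s s' //= h.
by apply: IH; apply: (tau_inj h).
Qed.

(** Compactness of the interval, in the form that makes a local choice of the parameter [i] uniform
    in [t]. *)
Lemma interval_covering (I : Type) (F : set_system I) (P : I -> R -> Prop) :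
  Filter F -> (forall t : R, 0 <= t <= 1 -> \forall t' \near t & i \near F, P i t') ->
  \forall i \near F, forall t : R, 0 <= t <= 1 -> P i t.
Proof.
move=> FF cov.
have /compact_near_coveringP/(_ I F P FF) : compact `[0%R, 1 : R]%classic.
  exact: segment_compact.
have h x : `[0%R, 1 : R]%classic x -> \forall x' \near x & i \near F, P i x'.
  by rewrite /= in_itv /=; exact: cov.
move=> /(_ h); apply: filterS => i Pi t t01; apply: Pi.
by rewrite /= in_itv.
Qed.

Section Family.
Variables (B : topologicalType) (bet : B * R -> R) (idx : B * R -> nat).

(** Only the slices [b] and [b'] are kept: transport over one is compared directly with transport
    over the other. *)
Definition tube (d : R) (b b' : B) (t : R) : set (B * R) :=
  [set q | (q.1 = b \/ q.1 = b') /\ `|q.2 - t| < d].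

Lemma coherent_tube b : (forall t, 0 <= t <= 1 -> cut_ok bet idx (b, t)) ->
  \forall b' \near b & d \near (0 : R)^'+, forall t, 0 <= t <= 1 -> coherent bet idx (tube d b b' t).
Proof.
move=> ok.
have : \forall p \near filter_prod (nbhs b) (0^'+), forall t, 0 <= t <= 1 ->
    coherent bet idx (tube p.2 b p.1 t).
  apply: interval_covering => t t01.
  have [N Np cohN] := coherent_near (ok _ t01).
  have [[V1 V2] /= [Vb Vt] VN] := Np.
  have [/= e e0 eV] := (@nbhs_ballP _ _ _ _).1 Vt.
  exists (ball t (e / 2), (V1 `*` [set d | d < e / 2])) => /=.
    split; first by apply: nbhsx_ballx; rewrite divr_gt0.
    exists (V1, [set d | d < e / 2]) => //=; split => //.
    by apply: nbhs_right_lt; rewrite divr_gt0.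
  move=> [u [b' d]] /= [ut [Vb' de]] q r v s qN rN vN.
  have inN x : tube d b b' u x -> N x.
    case: x => x1 x2 [/= x1b x2u]; apply: VN; split => /=.
      by case: x1b => -> //; exact: nbhs_singleton.
    apply: eV; rewrite /ball /= in ut *.
    have -> : t - x2 = (t - u) - (x2 - u) by ring.
    rewrite (le_lt_trans (ler_normB _ _)) //; move: ut x2u de; lra.
  by apply: cohN; exact: inN.
by apply: filterS => -[b' d].
Qed.

Lemma min_dist (t t' c : R) : `|Num.min t' c - Num.min t c| <= `|t' - t|.
Proof.
rewrite /Num.min; case: ltP => h1; case: ltP => h2 //; rewrite ?subrr ?normr_ge0 //;
  rewrite ler_norml; case: (lerP 0 (t' - t)) => h; rewrite ?(ger0_norm h) ?(ltr0_norm h); lra.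
Qed.

Lemma min_step (t c c' : R) : c <= c' -> `|Num.min t c' - Num.min t c| <= c' - c.
Proof.
move=> cc'; rewrite /Num.min; case: ltP => h1; case: ltP => h2;
  rewrite ler_norml; lra.
Qed.

(** A ladder with rungs from [b] to [b']: each small square lies in one coherent tube, hence
    commutes. With [b' = b] and two different times it also shows that [steps] is a lift. *)
Lemma steps_commute (d : R) b b' m t t' k s :
  (forall u, 0 <= u <= 1 -> coherent bet idx (tube d b b' u)) ->
  (0 < m)%N -> 0 <= t <= 1 -> 0 <= t' <= 1 -> `|t' - t| + m%:R^-1 < d ->
  steps (fun u => bet (b', u)) (fun u => idx (b', u)) m t' k (tau bet idx (b, 0) (b', 0) s) =
  tau bet idx (b, Num.min t (k%:R / m%:R)) (b', Num.min t' (k%:R / m%:R))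
    (steps (fun u => bet (b, u)) (fun u => idx (b, u)) m t k s).
Proof.
move=> coh m0 t01 t'01 tt'; elim: k => [|k IH] /=.
  by rewrite mul0r !min_r //; [case/andP: t'01 | case/andP: t01].
have kk : k%:R / m%:R <= k.+1%:R / m%:R :> R.
  by rewrite ler_pM2r ?ler_nat // invr_gt0 ltr0n.
have k1 : k.+1%:R / m%:R - k%:R / m%:R = m%:R^-1 :> R.
  by rewrite -mulrBl -natrB // subSnn mul1r.
have d0 : 0 < d by apply: le_lt_trans tt'; rewrite addr_ge0 // invr_ge0.
have mi0 : 0 < m%:R^-1 :> R by rewrite invr_gt0 ltr0n.
have kr0 : 0 <= k%:R / m%:R :> R by rewrite divr_ge0.
set u := Num.min t (k%:R / m%:R); set u' := Num.min t' (k%:R / m%:R) in IH *.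
set v := Num.min t (_ / _); set v' := Num.min t' (_ / _).
have u01 : 0 <= u <= 1.
  by case/andP: t01 => t0 t1; rewrite le_min t0 kr0 /= ge_min t1.
have uu' : `|u' - u| <= `|t' - t| by exact: min_dist.
have uv : `|v - u| <= m%:R^-1 by rewrite -k1; exact: min_step.
have uv' : `|v' - u'| <= m%:R^-1 by rewrite -k1; exact: min_step.
have Tu : tube d b b' u (b, u) by split; [left | rewrite /= subrr normr0].
have Tu' : tube d b b' u (b', u').
  by split; [right | apply: le_lt_trans uu' _; apply: le_lt_trans tt'; rewrite lerDl ltW].
have Tv : tube d b b' u (b, v).
  by split; [left | apply: le_lt_trans uv _; apply: le_lt_trans tt'; rewrite lerDr].
have Tv' : tube d b b' u (b', v').
  split; [by right | rewrite /=].
  have -> : v' - u = (u' - u) + (v' - u') by ring.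
  by apply: le_lt_trans tt'; rewrite (le_trans (ler_normD _ _)) // lerD.
rewrite IH.
transitivity (tau bet idx (b', u') (b', v')
  (tau bet idx (b, u) (b', u') (steps (fun u => bet (b, u)) (fun u => idx (b, u)) m t k s))).
  by [].
rewrite -(coh u u01 _ _ _ _ Tu Tu' Tv').
by rewrite (coh u u01 _ _ _ _ Tu Tv Tv').
Qed.


Local Notation betb b := (fun u => bet (b, u)).
Local Notation idxb b := (fun u => idx (b, u)).

Lemma frac_mm (m : nat) (t : R) : (0 < m)%N -> t <= 1 -> Num.min t (m%:R / m%:R) = t.
Proof. by move=> m0 t1; rewrite divff ?pnatr_eq0 -?lt0n // min_l. Qed.

Lemma small_step (e : R) : 0 < e -> exists2 m, (0 < m)%N & m%:R^-1 < e.
Proof.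
move=> e0; have h : e^-1 < (Num.bound e^-1)%:R by rewrite archi_boundP // invr_ge0 ltW.
exists (Num.bound e^-1); first by rewrite -(ltr0n R) (lt_trans _ h) // invr_gt0.
by rewrite invf_plt // posrE (lt_trans _ h) // invr_gt0.
Qed.

Lemma steps0 b m k s : steps (betb b) (idxb b) m 0 k s = s.
Proof.
elim: k => //= k ->.
by rewrite !min_l ?divr_ge0 // tau_id.
Qed.

Lemma lift_of_tube (d : R) b s : 0 < d ->
  (forall u, 0 <= u <= 1 -> coherent bet idx (tube d b b u)) ->
  exists2 w, is_lift (betb b) (idxb b) w & w 0 = s.
Proof.
move=> d0 coh.
have [m m0 md] : exists2 m, (0 < m)%N & m%:R^-1 < d / 2.
  by apply: small_step; rewrite divr_gt0.
exists (fun t => steps (betb b) (idxb b) m t m s); last exact: steps0.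
move=> t t01.
near=> t' => t'01.
have := @steps_commute d b b m t t' m s coh m0 t01 t'01.
rewrite tau_id !frac_mm //; [|by case/andP: t'01|by case/andP: t01].
apply.
have : `|t' - t| < d / 2.
  rewrite distrC; near: t'.
  by apply: nbhsx_ballx; rewrite divr_gt0.
move: md; lra.
Unshelve. all: by end_near.
Qed.

(** Uniqueness of lifts: the end of any lift is computed by [steps], which knows only its start. *)
Lemma lift_steps (d : R) b w : 0 < d ->
  (forall u, 0 <= u <= 1 -> coherent bet idx (tube d b b u)) ->
  is_lift (betb b) (idxb b) w ->
  \forall e \near (0 : R)^'+, forall m, (0 < m)%N -> m%:R^-1 < e ->
    w 1 = steps (betb b) (idxb b) m 1 m (w 0).
Proof.
move=> d0 coh wl.
have : \forall e \near (0 : R)^'+, forall t : R, 0 <= t <= 1 -> forall t' t'',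
    0 <= t' <= 1 -> 0 <= t'' <= 1 -> `|t' - t| < e -> `|t'' - t| < e ->
    w t'' = tau (betb b) (idxb b) t' t'' (w t').
  apply: interval_covering => t t01.
  have /nbhs_ballP[e /= e0 we] := wl _ t01.
  pose r := Num.min e d.
  have r0 : 0 < r by rewrite lt_min e0.
  exists (ball t (r / 2), [set x | x < r / 2]) => /=.
    split; first by apply: nbhsx_ballx; rewrite divr_gt0.
    by apply: nbhs_right_lt; rewrite divr_gt0.
  move=> [u f] /= [ut fr] t' t'' t'01 t''01 t'u t''u.
  have dist x : `|x - u| < f -> `|x - t| < r.
    rewrite /ball /= in ut.
    have -> : x - t = (x - u) - (t - u) by ring.
    by move=> xu; rewrite (le_lt_trans (ler_normB _ _)) //; move: ut fr xu; lra.
  have near_t x : 0 <= x <= 1 -> `|x - t| < r -> w x = tau (betb b) (idxb b) t x (w t).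
    move=> x01 xt; apply: we => //; rewrite /ball /= distrC.
    by apply: lt_le_trans xt _; rewrite ge_min lexx.
  rewrite (near_t t'' t''01 (dist _ t''u)) (near_t t' t'01 (dist _ t'u)).
  have inT x : `|x - t| < r -> tube d b b t (b, x).
    by move=> xt; split; [left | apply: lt_le_trans xt _; rewrite ge_min lexx orbT].
  apply: (coh t t01 (b, t) (b, t') (b, t'')); apply: inT.
  - by rewrite subrr normr0.
  - exact: dist.
  - exact: dist.
apply: filterS => e we m m0 me.
have claim k : (k <= m)%N -> w (k%:R / m%:R) = steps (betb b) (idxb b) m 1 k (w 0).
  have frac j : (j <= m)%N -> 0 <= (j%:R / m%:R : R) <= 1.
    move=> jm; rewrite divr_ge0 //= ler_pdivrMr ?ltr0n // mul1r ler_nat //.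
  elim: k => [|k IH] km /=; first by rewrite mul0r.
  have k01 := frac _ (ltnW km); have k101 := frac _ km.
  rewrite !min_r -?IH ?(ltnW km) //; [|by case/andP: k101 | by case/andP: k01].
  apply: (we (k%:R / m%:R)) => //; rewrite ?subrr ?normr0.
    by apply: lt_trans me; rewrite invr_gt0 ltr0n.
  by rewrite -mulrBl -natrB // subSnn mul1r gtr0_norm // invr_gt0 ltr0n.
have := claim m (leqnn m); rewrite divff // pnatr_eq0; by case: (m) m0.
Qed.

Lemma tube_other d b b' t : tube d b' b' t `<=` tube d b b' t.
Proof. by move=> q [qb qt]; split; [right; case: qb |]. Qed.

Lemma coherentS (P : Type) (be : P -> R) id (N N' : set P) :
  N' `<=` N -> coherent be id N -> coherent be id N'.
Proof. by move=> N'N coh q r v s Nq Nr Nv; apply: coh; exact: N'N. Qed.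

Lemma carries_near b s s' :
  (forall t, 0 <= t <= 1 -> cut_ok bet idx (b, t)) ->
  carries (betb b) (idxb b) s s' ->
  \forall b' \near b, carries (betb b') (idxb b')
    (tau bet idx (b, 0) (b', 0) s) (tau bet idx (b, 1) (b', 1) s').
Proof.
move=> /coherent_tube[[V D] /= [Vb D0] VD] [w [wl <- <-]].
near (0 : R)^'+ => d.
have d0 : 0 < d by [].
have Dd : D d by near: d.
have coh b' : V b' -> forall u, 0 <= u <= 1 -> coherent bet idx (tube d b b' u).
  by move=> Vb'; exact: (VD (b', d)).
near=> b'.
have Vb' : V b' by near: b'.
have coh' u : 0 <= u <= 1 -> coherent bet idx (tube d b' b' u).
  by move=> u01; apply: coherentS (coh _ Vb' _ u01); exact: tube_other.
have cohb u : 0 <= u <= 1 -> coherent bet idx (tube d b b u).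
  by move=> u01; exact: (coh _ (nbhs_singleton Vb)).
have [w' w'l w'0] := lift_of_tube (tau bet idx (b, 0) (b', 0) (w 0)) d0 coh'.
exists w'; split => //.
near (0 : R)^'+ => e.
have e0 : 0 < e by [].
have We : forall m, (0 < m)%N -> m%:R^-1 < e -> w 1 = steps (betb b) (idxb b) m 1 m (w 0).
  by near: e; exact: (lift_steps d0 cohb wl).
have We' : forall m, (0 < m)%N -> m%:R^-1 < e -> w' 1 = steps (betb b') (idxb b') m 1 m (w' 0).
  by near: e; exact: (lift_steps d0 coh' w'l).
pose r := Num.min e d.
have r0 : 0 < r by rewrite lt_min e0.
have [m m0 mr] := small_step r0.
have me : m%:R^-1 < e by apply: lt_le_trans mr _; rewrite ge_min lexx.
have md : m%:R^-1 < d by apply: lt_le_trans mr _; rewrite ge_min lexx orbT.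
rewrite (We' m) // w'0 (We m) //.
have := @steps_commute d b b' m 1 1 m (w 0) (coh _ Vb') m0.
by rewrite subrr normr0 add0r !frac_mm // ?lexx ?ler01; exact.
Unshelve. all: by end_near.
Qed.

Lemma carries_steps b s s' :
  (forall t, 0 <= t <= 1 -> cut_ok bet idx (b, t)) ->
  carries (betb b) (idxb b) s s' ->
  \forall e \near (0 : R)^'+, forall m, (0 < m)%N -> m%:R^-1 < e ->
    s' = steps (betb b) (idxb b) m 1 m s.
Proof.
move=> /coherent_tube[[V D] /= [Vb D0] VD] [w [wl <- <-]].
near (0 : R)^'+ => d.
have d0 : 0 < d by [].
have Dd : D d by near: d.
have cohb u : 0 <= u <= 1 -> coherent bet idx (tube d b b u).
  by apply: (VD (b, d)); split => //; exact: (nbhs_singleton Vb).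
exact: (lift_steps d0 cohb wl).
Unshelve. all: by end_near.
Qed.

Lemma carries_fun b s s' s'' :
  (forall t, 0 <= t <= 1 -> cut_ok bet idx (b, t)) ->
  carries (betb b) (idxb b) s s' -> carries (betb b) (idxb b) s s'' -> s' = s''.
Proof.
move=> ok /(carries_steps ok) h /(carries_steps ok) h'.
near (0 : R)^'+ => e.
have e0 : 0 < e by [].
have [m m0 me] := small_step e0.
transitivity (steps (betb b) (idxb b) m 1 m s).
  by move: m m0 me; near: e.
by apply/esym; move: m m0 me; near: e.
Unshelve. all: by end_near.
Qed.

Lemma carries_inj b s s' s'' :
  (forall t, 0 <= t <= 1 -> cut_ok bet idx (b, t)) ->
  carries (betb b) (idxb b) s s'' -> carries (betb b) (idxb b) s' s'' -> s = s'.
Proof.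
move=> ok /(carries_steps ok) h /(carries_steps ok) h'.
near (0 : R)^'+ => e.
have e0 : 0 < e by [].
have [m m0 me] := small_step e0.
apply: (@steps_inj (betb b) (idxb b) m 1 m).
transitivity s''; last by move: m m0 me; near: e.
by apply/esym; move: m m0 me; near: e.
Unshelve. all: by end_near.
Qed.

Lemma carries_ex b s :
  (forall t, 0 <= t <= 1 -> cut_ok bet idx (b, t)) ->
  exists s', carries (betb b) (idxb b) s s'.
Proof.
move=> /coherent_tube[[V D] /= [Vb D0] VD].
near (0 : R)^'+ => d.
have d0 : 0 < d by [].
have Dd : D d by near: d.
have cohb u : 0 <= u <= 1 -> coherent bet idx (tube d b b u).
  by apply: (VD (b, d)); split => //; exact: (nbhs_singleton Vb).
have [w wl w0] := lift_of_tube s d0 cohb.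
by exists (w 1), w.
Unshelve. all: by end_near.
Qed.

End Family.

Definition path_ok (bet : R -> R) (idx : R -> nat) :=
  forall t : R, 0 <= t <= 1 -> cut_ok bet idx t.

Lemma cut_ok_comp (P Q : topologicalType) (bet : Q -> R) idx (g : P -> Q) p :
  ct p g -> cut_ok bet idx (g p) ->
  cut_ok (fun x => bet (g x)) (fun x => idx (g x)) p.
Proof.
move=> gc [bc ic]; split; first exact: ct_comp.
by move=> /ic; exact: gc.
Qed.

Lemma path_ok_family bet idx : path_ok bet idx ->
  forall b t : R, 0 <= t <= 1 -> cut_ok (fun q : R * R => bet q.2) (fun q => idx q.2) (b, t).
Proof.
move=> ok b t t01; apply: (@cut_ok_comp _ _ bet idx snd).
  exact: cvg_snd.
exact: ok.
Qed.

Lemma path_fun bet idx s s' s'' : path_ok bet idx ->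
  carries bet idx s s' -> carries bet idx s s'' -> s' = s''.
Proof. by move=> /path_ok_family /(_ 0) ok; exact: (carries_fun ok). Qed.

Lemma path_inj bet idx s s' s'' : path_ok bet idx ->
  carries bet idx s s'' -> carries bet idx s' s'' -> s = s'.
Proof. by move=> /path_ok_family /(_ 0) ok; exact: (carries_inj ok). Qed.

Lemma path_ex bet idx s : path_ok bet idx -> exists s', carries bet idx s s'.
Proof. by move=> /path_ok_family /(_ 0) ok; exact: (carries_ex s ok). Qed.

Lemma carries_ext bet idx bet' idx' s s' :
  (forall t, 0 <= t <= 1 -> bet t = bet' t /\ idx t = idx' t) ->
  carries bet idx s s' -> carries bet' idx' s s'.
Proof.
move=> e [w [wl w0 w1]]; exists w; split => // t t01.
have := wl t t01; apply: filterS => t' h t'01; rewrite h //.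
by have [et it] := e t t01; have [et' _] := e t' t'01; rewrite /tau et it et'.
Qed.

(** Homotopy lifting. For every [u] the label [l u] is transported along the second variable; by
    [carries_near] the end labels form a lift along the opposite side, and uniqueness identifies it
    with the given one. *)
Lemma square (bet : R * R -> R) (idx : R * R -> nat) s s1 s2 s3 :
  (forall u t, 0 <= u <= 1 -> 0 <= t <= 1 -> cut_ok bet idx (u, t)) ->
  carries (fun t => bet (0, t)) (fun t => idx (0, t)) s s1 ->
  carries (fun u => bet (u, 1)) (fun u => idx (u, 1)) s1 s2 ->
  carries (fun u => bet (u, 0)) (fun u => idx (u, 0)) s s3 ->
  carries (fun t => bet (1, t)) (fun t => idx (1, t)) s3 s2.
Proof.
move=> ok bottom right_ [l [ll l0 l1]].
have ex (u : R) : exists r, 0 <= u <= 1 ->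
    carries (fun t => bet (u, t)) (fun t => idx (u, t)) (l u) r.
  have [u01|] := boolP (0 <= u <= 1); last by exists s.
  by have [r hr] := carries_ex (l u) (fun t => ok u t u01); exists r.
have {ex}[r hr] := choice ex.
have u0 : 0 <= (0 : R) <= 1 by rewrite lexx ler01.
have u1 : 0 <= (1 : R) <= 1 by rewrite ler01 lexx.
have r_lift : carries (fun u => bet (u, 1)) (fun u => idx (u, 1)) s1 (r 1).
  exists r; split => //; last first.
    apply: (@carries_fun _ bet idx 0 s _ _ (fun t => ok 0 t u0)) bottom.
    by rewrite -l0; exact: hr.
  move=> u u01; have h := @carries_near _ bet idx u _ _ (fun t => ok u t u01) (hr u u01).
  near=> u' => u'01.
  apply: (@carries_fun _ bet idx u' _ _ _ (fun t => ok u' t u'01) (hr u' u'01)).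
  have -> : l u' = tau bet idx (u, 0) (u', 0) (l u).
    by move: u'01; near: u'; exact: ll.
  by near: u'.
have ok1 : path_ok (fun u => bet (u, 1)) (fun u => idx (u, 1)).
  move=> u u01; apply: (@cut_ok_comp _ _ bet idx (fun u => (u, 1))); last exact: ok.
  by apply: ct_pair; [exact: ct_id | exact: ct_cst].
by rewrite -(path_fun ok1 r_lift right_) -l1; exact: hr.
Unshelve. all: by end_near.
Qed.

(** In a free homotopy of loops the base point follows a path, and transport around the loop is
    conjugated by transport along this path. *)
Lemma loop_homotopy (bet : R * R -> R) (idx : R * R -> nat) :
  (forall u t, 0 <= u <= 1 -> 0 <= t <= 1 -> cut_ok bet idx (u, t)) ->
  (forall u, 0 <= u <= 1 -> bet (u, 0) = bet (u, 1) /\ idx (u, 0) = idx (u, 1)) ->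
  forall s s' c c',
  carries (fun t => bet (0, t)) (fun t => idx (0, t)) s s' ->
  carries (fun u => bet (u, 0)) (fun u => idx (u, 0)) s c ->
  carries (fun u => bet (u, 0)) (fun u => idx (u, 0)) s' c' ->
  carries (fun t => bet (1, t)) (fun t => idx (1, t)) c c'.
Proof.
move=> ok per s s' c c' h hc hc'; apply: square h _ hc => //.
by apply: carries_ext hc' => u u01; exact: per.
Qed.

End Transport.

Lemma carries_equiv (R : realType) (S S' : Type) (kappa : nat -> S -> S)
    (kappa' : nat -> S' -> S') (g : S -> S') (bet : R -> R) idx s s' :
  (forall j s, g (kappa j s) = kappa' j (g s)) ->
  carries kappa bet idx s s' -> carries kappa' bet idx (g s) (g s').
Proof.
move=> gk [w [wl <- <-]]; exists (g \o w); split => // t t01.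
have := wl t t01; apply: filterS => t' h t'01 /=.
by rewrite h // /tau; case: ifP.
Qed.
Definition neq_rel : rel nat := fun a b => a != b.

(** * Reduced words in involutions *)

(** Normal forms of the left cosets, in the free product of groups of order 2, of the subgroup
    generated by the letters in [r]. For [r = pred0] this is the group itself. The head of a word is
    its last crossing. *)
Definition redb (r : pred nat) (w : seq nat) :=
  sorted neq_rel w && (if w is h :: t then ~~ r (last h t) else true).

Definition push (r : pred nat) (j : nat) (w : seq nat) : seq nat :=
  if w is h :: t then (if h == j then t else j :: w)
  else if r j then [::] else [:: j].

Lemma push_red r j w : redb r w -> redb r (push r j w).
Proof.
case: w => [|h t] /=; first by rewrite /redb; case: ifP => //= ->.
rewrite /redb /=; case: (eqVneq h j) => [_ | hj] /andP[pt rt].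
  by case: t pt rt => //= h' t /andP[_ ->] ->.
by rewrite /= {1}/neq_rel eq_sym hj pt.
Qed.

Lemma pushK r j w : redb r w -> push r j (push r j w) = w.
Proof.
case: w => [|h t] /=; first by move=> _; case: ifP => [rj | rj] /=; rewrite ?rj ?eqxx.
case: (eqVneq h j) => [<- | hj]; last by rewrite /= eqxx.
rewrite /redb /=; case: t => [|h' t] /=; first by move=> /negbTE ->.
by case/andP => /andP[nh _] _; rewrite eq_sym (negbTE nh).
Qed.

Definition Red (r : pred nat) : Type := {w : seq nat | redb r w}.

Definition kappa r j (w : Red r) : Red r := exist _ (push r j (val w)) (push_red j (valP w)).

Lemma kappaK r j : involutive (@kappa r j).
Proof. by move=> w; apply: val_inj; exact: pushK (valP w). Qed.

Definition red_nil r : Red r := exist _ [::] isT.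

Definition evalw (S : Type) (k : nat -> S -> S) (w : seq nat) (s : S) : S := foldr k s w.

Lemma evalw_cat S (k : nat -> S -> S) u v s : evalw k (u ++ v) s = evalw k u (evalw k v s).
Proof. exact: foldr_cat. Qed.

Definition rd (w : seq nat) : seq nat := evalw (push pred0) w [::].

Lemma redb_foldr r u w : redb r w -> redb r (evalw (push r) u w).
Proof. by move=> wr; elim: u => //= j u; exact: push_red. Qed.

Lemma rd_red u : redb pred0 (rd u).
Proof. exact: redb_foldr. Qed.

Lemma redbE w : redb pred0 w = sorted neq_rel w.
Proof. by rewrite /redb; case: w => //= h t; rewrite andbT. Qed.

Lemma rd_id w : redb pred0 w -> rd w = w.
Proof.
rewrite redbE /rd; elim: w => //= j w IH pw; rewrite IH; last exact: path_sorted pw.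
by case: w pw {IH} => //= h t; rewrite {1}/neq_rel eq_sym => /andP[/negbTE ->].
Qed.

Section Eval.
Variables (S : Type) (k : nat -> S -> S).
Hypothesis kK : forall j, involutive (k j).

Lemma evalw_push j w s : evalw k (push pred0 j w) s = k j (evalw k w s).
Proof. by case: w => //= h t; case: eqP => //= ->; rewrite kK. Qed.

Lemma evalw_rd u s : evalw k (rd u) s = evalw k u s.
Proof. by elim: u => //= j u <-; exact: evalw_push. Qed.

Lemma evalw_revK u s : evalw k (rev u) (evalw k u s) = s.
Proof.
elim: u => //= j u IH; rewrite rev_cons -cats1 evalw_cat /= kK.
exact: IH.
Qed.

Lemma evalw_Krev u s : evalw k u (evalw k (rev u) s) = s.
Proof. by rewrite -{1}[u]revK evalw_revK. Qed.

End Eval.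

Definition eqw (u v : seq nat) := rd u = rd v.

Lemma eqw_eval u v : eqw u v -> forall (S : Type) (k : nat -> S -> S),
  (forall j, involutive (k j)) -> forall s, evalw k u s = evalw k v s.
Proof. by move=> uv S k kK s; rewrite -evalw_rd // uv evalw_rd. Qed.

Lemma rd_val u : val (evalw (@kappa pred0) u (red_nil pred0)) = rd u.
Proof. by rewrite /rd; elim: u => //= j u ->. Qed.

(** The group acts on its own normal forms, so an identity that holds in all actions is an identity
    of words. Most equalities of words are obtained in this way. *)
Lemma eqw_of_eval u v : (forall (S : Type) (k : nat -> S -> S),
  (forall j, involutive (k j)) -> forall s, evalw k u s = evalw k v s) -> eqw u v.
Proof.
move=> uv; rewrite /eqw -!rd_val; congr val; apply: uv => j; exact: kappaK.
Qed.

Lemma eqw_refl u : eqw u u. Proof. by []. Qed.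
Lemma eqw_sym u v : eqw u v -> eqw v u. Proof. by rewrite /eqw => ->. Qed.
Lemma eqw_trans u v w : eqw u v -> eqw v w -> eqw u w. Proof. by rewrite /eqw => ->. Qed.

Lemma eqw_cat u u' v v' : eqw u u' -> eqw v v' -> eqw (u ++ v) (u' ++ v').
Proof.
move=> uu vv; apply: eqw_of_eval => S k kK s.
by rewrite !evalw_cat (eqw_eval vv kK) (eqw_eval uu kK).
Qed.

Lemma eqw_catK u v : eqw (u ++ rev u ++ v) v.
Proof. by apply: eqw_of_eval => S k kK s; rewrite !evalw_cat evalw_Krev. Qed.

Lemma eqw_revK u v : eqw (rev u ++ u ++ v) v.
Proof. by apply: eqw_of_eval => S k kK s; rewrite !evalw_cat evalw_revK. Qed.

Lemma eqw_rd u : eqw (rd u) u.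
Proof. exact: rd_id (rd_red u). Qed.

Lemma size_push r j w : (size (push r j w) <= (size w).+1)%N.
Proof. by case: w => [|h t] /=; case: ifP => //= _; rewrite ltnW. Qed.

Lemma size_evalw_push u w : (size (evalw (push pred0) u w) <= size u + size w)%N.
Proof. by elim: u => //= j u IH; apply: leq_trans (size_push _ _ _) _; rewrite addSn ltnS. Qed.

Lemma size_rd u : (size (rd u) <= size u)%N.
Proof. by have := size_evalw_push u [::]; rewrite addn0. Qed.

Lemma rd_cat u v : rd (u ++ v) = evalw (push pred0) u (rd v).
Proof. by rewrite /rd evalw_cat. Qed.

Lemma odd_rd u : odd (size (rd u)) = odd (size u).
Proof.
rewrite /rd; elim: u => //= j u <-.
by case: (evalw _ u _) => //= h t; case: ifP => //= _; rewrite negbK.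
Qed.

Lemma size_rd_ge u v : redb pred0 u -> (size u <= size (rd (u ++ v)) + size v)%N.
Proof.
move=> ur; have e : rd ((u ++ v) ++ rev v) = u.
  rewrite -[RHS](rd_id ur) -catA; apply: eqw_of_eval => S k kK s.
  by rewrite !evalw_cat evalw_Krev.
rewrite -{1}e.
apply: (@leq_trans (size (rd (rd (u ++ v) ++ rev v)))).
  by rewrite -(eqw_cat (eqw_rd (u ++ v)) (eqw_refl (rev v))).
by apply: leq_trans (size_rd _) _; rewrite size_cat size_rev.
Qed.

Lemma size_rd_ge_r u v : redb pred0 v -> (size v <= size (rd (u ++ v)) + size u)%N.
Proof.
move=> vr; have e : rd (rev u ++ u ++ v) = v by rewrite -[RHS](rd_id vr); exact: eqw_revK.
rewrite -{1}e.
apply: (@leq_trans (size (rd (rev u ++ rd (u ++ v))))).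
  by rewrite -(eqw_cat (eqw_refl (rev u)) (eqw_rd (u ++ v))).
by apply: leq_trans (size_rd _) _; rewrite size_cat size_rev addnC.
Qed.
(** Conjugacy that remembers on which side of the cut each loop is based: a path [g] between the
    base points has odd length exactly when the sides differ. The side matters because the half
    twist depends on the direction of each crossing. *)
Definition conjw (b : bool) (W : seq nat) (b' : bool) (W' : seq nat) :=
  exists g, eqw W' (g ++ W ++ rev g) /\ odd (size g) = b (+) b'.

Lemma conjw_eqw b W W' : eqw W W' -> conjw b W b W'.
Proof. by move=> WW; exists [::]; rewrite cats0 addbb; split => //; exact: eqw_sym. Qed.

Lemma conjw_sym b W b' W' : conjw b W b' W' -> conjw b' W' b W.
Proof.
move=> [g [WW og]]; exists (rev g); rewrite revK size_rev og addbC; split => //.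
apply: eqw_of_eval => S k kK s; rewrite !evalw_cat (eqw_eval WW kK) !evalw_cat.
by rewrite !evalw_revK.
Qed.

Lemma conjw_trans b W b' W' b'' W'' :
  conjw b W b' W' -> conjw b' W' b'' W'' -> conjw b W b'' W''.
Proof.
move=> [g [WW og]] [h [WW' oh]]; exists (h ++ g); split; last first.
  by rewrite size_cat oddD og oh; case: b b' b'' {og oh} => [] [] [].
apply: eqw_trans WW' _; rewrite rev_cat -!catA.
apply: eqw_cat => //; rewrite 2!catA -catA [(g ++ W) ++ _]catA.
by apply: eqw_cat => //; rewrite -catA.
Qed.

Lemma conjw_rot b u v : conjw b (u ++ v) (b (+) odd (size u)) (v ++ u).
Proof.
exists (rev u); rewrite revK size_rev addbA addbb; split => //.
by apply: eqw_sym; rewrite -!catA; exact: eqw_revK.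
Qed.

(* [sub F b v]: replace each letter of the path [v] by a path, depending on the
   direction in which it is crossed; the head of a path is its last crossing,
   and [b] is the side on which the path ends. *)
Fixpoint sub (F : bool -> nat -> seq nat) (b : bool) (v : seq nat) : seq nat :=
  if v is j :: v' then F b j ++ sub F (~~ b) v' else [::].

Lemma sub_cat F b u v : sub F b (u ++ v) = sub F b u ++ sub F (b (+) odd (size u)) v.
Proof.
elim: u b => [|j u IH] b /=; first by rewrite addbF.
by rewrite IH catA addbN addNb.
Qed.

(** * The half twists acting on words *)

Section Substitution.
Variable F : bool -> nat -> seq nat.
Hypothesis F_odd : forall b j, odd (size (F b j)).
Hypothesis F_cancel : forall b j, eqw (F b j ++ F (~~ b) j) [::].

Lemma odd_sub b u : odd (size (sub F b u)) = odd (size u).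
Proof. by elim: u b => //= j u IH b; rewrite size_cat oddD F_odd IH. Qed.

(** [F_cancel] says that crossing a window back and forth remains trivial after substitution; hence
    the substitution is defined on words up to cancellation. *)
Lemma sub_push b j w : eqw (sub F b (push pred0 j w)) (sub F b (j :: w)).
Proof.
case: w => [|h t] //=; case: eqP => //= ->; rewrite negbK catA.
by apply: eqw_sym; have := eqw_cat (F_cancel b j) (eqw_refl (sub F b t)).
Qed.

Lemma sub_rd b u : eqw (sub F b (rd u)) (sub F b u).
Proof.
elim: u b => //= j u IH b.
by apply: eqw_trans (sub_push _ _ _) _; apply: eqw_cat.
Qed.

Lemma sub_eqw b u v : eqw u v -> eqw (sub F b u) (sub F b v).
Proof.
by move=> uv; apply: eqw_trans (eqw_sym (sub_rd b u)) _; rewrite uv; exact: sub_rd.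
Qed.

Lemma sub_rev b u : eqw (sub F b (rev u)) (rev (sub F (b (+) odd (size u)) u)).
Proof.
set b' := b (+) _.
have := sub_eqw b' (eqw_catK u [::]); rewrite cats0 sub_cat.
rewrite /b' addbK -/b' => h.
apply: eqw_trans (eqw_sym (eqw_revK (sub F b' u) _)) _.
by have := eqw_cat (eqw_refl (rev (sub F b' u))) h; rewrite cats0.
Qed.

Lemma conjw_sub b W b' W' : ~~ odd (size W) ->
  conjw b W b' W' -> conjw b (sub F b W) b' (sub F b' W').
Proof.
move=> evW [g [WW og]]; exists (sub F b' g); rewrite odd_sub; split => //.
apply: eqw_trans (sub_eqw _ WW) _; rewrite !sub_cat og.
have -> : b' (+) (b (+) b') = b by rewrite addbC addbK.
rewrite (negbTE evW) addbF; do 2 apply: eqw_cat => //.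
apply: eqw_trans (sub_rev _ _) _; rewrite og.
by have -> : b (+) (b (+) b') = b' by rewrite addbA addbb.
Qed.

End Substitution.

Lemma sub_sub F F' b W : (forall b j, odd (size (F' b j))) ->
  sub F b (sub F' b W) = sub (fun b j => sub F b (F' b j)) b W.
Proof.
move=> F'o; elim: W b => //= j W IH b.
by rewrite sub_cat F'o addbT IH.
Qed.

Lemma eq_sub F F' b W : (forall b j, F b j = F' b j) -> sub F b W = sub F' b W.
Proof. by move=> FF; elim: W b => //= j W IH b; rewrite FF IH. Qed.

Fixpoint alt (a b m : nat) : seq nat := if m is m'.+1 then [:: a, b & alt a b m'] else [::].

Lemma size_alt a b m : size (alt a b m) = m.*2.
Proof. by elim: m => //= m ->. Qed.

Lemma alt_cat a b m m' : alt a b m ++ alt a b m' = alt a b (m + m').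
Proof. by elim: m => //= m ->. Qed.

Lemma rev_alt a b m : rev (alt a b m) = alt b a m.
Proof.
elim: m => //= m IH; rewrite !rev_cons IH -!cats1 -catA.
have -> : [:: b] ++ [:: a] = alt b a 1 by [].
by rewrite alt_cat addn1.
Qed.

Lemma sorted_alt a b m : a != b -> sorted neq_rel (alt a b m).
Proof.
move=> ab; elim: m => //= m; rewrite /neq_rel ab /=.
by case: m => //= m; rewrite [b == a]eq_sym ab.
Qed.

(* A rotation of the infinite dihedral group commutes with rotations and is
   inverted by reflections. *)
Lemma dihedral_move a b d : {subset d <= [:: a; b]} ->
  eqw [:: a, b & d] (d ++ (if odd (size d) then [:: b; a] else [:: a; b])).
Proof.
elim: d a b => [|c d IH] a b dab //=.
have dba : {subset d <= [:: b; a]}.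
  by move=> x xd; have := dab x; rewrite !inE xd orbT => /(_ isT); rewrite orbC.
have {}IH := IH b a dba.
have /orP[/eqP-> | /eqP->] : (c == a) || (c == b) by have := dab c; rewrite !inE eqxx; apply.
  apply: eqw_trans (eqw_cat (eqw_refl [:: a]) IH) _ => /=.
  by case: (odd (size d)).
apply: (@eqw_trans _ (a :: d)); first by apply: eqw_of_eval => S k kK s /=; rewrite kK.
apply: (@eqw_trans _ ([:: b] ++ [:: b, a & d])).
  by apply: eqw_of_eval => S k kK s /=; rewrite kK.
apply: eqw_trans (eqw_cat (eqw_refl [:: b]) IH) _ => /=.
by case: (odd (size d)).
Qed.

(** A rotation passes through [d], being inverted if [d] is a reflection, and then cancels. In a
    twisted word this removes the tails around a block that lies between two crossings of [i]. *)
Lemma dihedral_conj a b d m : {subset d <= [:: a; b]} ->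
  eqw (alt a b m ++ d ++ (if odd (size d) then alt a b m else alt b a m)) d.
Proof.
move=> dab; elim: m => [|m IH] /=; first by rewrite if_same cats0.
set X := if odd _ then alt a b m else _ in IH.
have -> : (if odd (size d) then [:: a, b & alt a b m] else [:: b, a & alt b a m]) =
   X ++ (if odd (size d) then [:: a; b] else [:: b; a]).
  rewrite /X; case: odd.
    by have := alt_cat a b m 1; rewrite addn1.
  by have := alt_cat b a m 1; rewrite addn1.
set Y := if odd _ then [:: a; b] else _.
have -> : [:: a, b & alt a b m ++ d ++ X ++ Y] = [:: a; b] ++ (alt a b m ++ d ++ X) ++ Y.
  by rewrite /= -!catA.
apply: eqw_trans (eqw_cat (eqw_refl _) (eqw_cat IH (eqw_refl Y))) _.
rewrite catA; apply: eqw_trans (eqw_cat (dihedral_move dab) (eqw_refl Y)) _.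
rewrite -catA -[X in eqw _ X]cats0; apply: eqw_cat => //.
by rewrite /Y; case: odd; apply: eqw_of_eval => S k kK s /=; rewrite !kK.
Qed.

(* The half twist exchanging the punctures adjacent to the wall [i]. *)
Definition half_twist (i : nat) (b : bool) (j : nat) : seq nat :=
  if j == i then (if b then [:: i.-1; i; i.+1] else [:: i.+1; i; i.-1]) else [:: j].

(** The [m]-th power of the full twist, which is the square of [half_twist]. *)
Definition twist (i m : nat) (b : bool) (j : nat) : seq nat :=
  if j == i then
    (if b then alt i.-1 i.+1 m ++ i :: alt i.-1 i.+1 m
     else alt i.+1 i.-1 m ++ i :: alt i.+1 i.-1 m)
  else [:: j].

Lemma half_twist_odd i b j : odd (size (half_twist i b j)).
Proof. by rewrite /half_twist; case: eqP; case: b. Qed.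

Lemma half_twist_cancel i b j : eqw (half_twist i b j ++ half_twist i (~~ b) j) [::].
Proof.
rewrite /half_twist; apply: eqw_of_eval => S k kK s.
by case: eqP => _; case: b => /=; rewrite !kK.
Qed.

Lemma twist_odd i m b j : odd (size (twist i m b j)).
Proof.
rewrite /twist; case: eqP => //= _.
by case: b; rewrite size_cat /= !size_alt oddD /= !odd_double.
Qed.

Lemma sub_fix (F : bool -> nat -> seq nat) b d :
  (forall b j, j \in d -> F b j = [:: j]) -> sub F b d = d.
Proof.
elim: d b => //= j d IH b Fd; rewrite Fd ?mem_head // IH // => b' j' j'd.
by apply: Fd; rewrite inE j'd orbT.
Qed.

Lemma mem_alt a b m x : x \in alt a b m -> x \in [:: a; b].
Proof.
by elim: m => //= m IH; rewrite !inE => /or3P[->|->|/IH]//; rewrite ?orbT ?inE.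
Qed.

Section Growth.
Variable i : nat.
Hypothesis i0 : (0 < i)%N.
Local Notation p := i.-1.
Local Notation q := i.+1.

Let pi_neq : p != i. Proof. by rewrite neq_ltn prednK // leqnn. Qed.
Let qi_neq : q != i. Proof. by rewrite neq_ltn leqnn orbT. Qed.
Let pq_neq : p != q. Proof. by rewrite neq_ltn prednK // leqW. Qed.

Lemma sub_alt F b x y m : (forall b j, j != i -> F b j = [:: j]) ->
  {subset [:: x; y] <= [:: p; q]} -> sub F b (alt x y m) = alt x y m.
Proof.
move=> Fi xy; apply: sub_fix => b' j /mem_alt /xy; rewrite !inE => /orP[]/eqP->; exact: Fi.
Qed.

Lemma twist_fix m b j : j != i -> twist i m b j = [:: j].
Proof. by rewrite /twist => /negbTE ->. Qed.

Lemma half_twist2 b W :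
  sub (half_twist i) b (sub (half_twist i) b W) = sub (twist i 1) b W.
Proof.
rewrite sub_sub; last exact: half_twist_odd.
apply: eq_sub => b' j; rewrite {2}/half_twist /twist.
case: eqP => [_ | /eqP ji].
  by case: b'; rewrite /= /half_twist (negbTE pi_neq) (negbTE qi_neq) eqxx.
by rewrite /= /half_twist (negbTE ji).
Qed.

Lemma twistS m b W : sub (twist i 1) b (sub (twist i m) b W) = sub (twist i m.+1) b W.
Proof.
rewrite sub_sub; last exact: twist_odd.
apply: eq_sub => b' j; rewrite {2}/twist {2}/twist.
case: eqP => [_ | /eqP ji]; last by rewrite /= twist_fix.
have st b'' x y : {subset [:: x; y] <= [:: p; q]} -> sub (twist i 1) b'' (alt x y m) = alt x y m.
  by apply: sub_alt => b0 j0; exact: twist_fix.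
have pqS : {subset [:: p; q] <= [:: p; q]} by [].
have qpS : {subset [:: q; p] <= [:: p; q]} by move=> x; rewrite !inE orbC.
have key x y b'' : {subset [:: x; y] <= [:: p; q]} ->
    sub (twist i 1) b'' (alt x y m ++ i :: alt x y m) = alt x y m ++ twist i 1 b'' i ++ alt x y m.
  by move=> xy; rewrite sub_cat st // size_alt odd_double addbF /= st.
have alt1 x y : alt x y m.+1 = alt x y m ++ [:: x; y] by have := alt_cat x y m 1; rewrite addn1 => <-.
by case: b'; rewrite key // /twist eqxx {1}alt1 /= -!catA.
Qed.

Lemma conjw_twist b W : ~~ odd (size W) ->
  conjw b W b (sub (half_twist i) b W) -> forall m, conjw b W b (sub (twist i m) b W).
Proof.
move=> evW h.
have h1 := conjw_sub (half_twist_odd i) (half_twist_cancel i) evW h.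
have {}h1 : conjw b W b (sub (twist i 1) b W) by rewrite -half_twist2; exact: conjw_trans h h1.
have tc m b' j : eqw (twist i m b' j ++ twist i m (~~ b') j) [::].
  rewrite /twist; case: eqP => _; last by apply: eqw_of_eval => S k kK s /=; rewrite kK.
  have key x y : eqw ((alt x y m ++ i :: alt x y m) ++ (alt y x m ++ i :: alt y x m)) [::].
    apply: eqw_of_eval => S k kK s; rewrite -[i :: alt x y m]cat1s -[i :: alt y x m]cat1s !evalw_cat -(rev_alt x y) evalw_Krev //.
    by rewrite -[evalw k [:: i] (evalw k [:: i] _)]/(k i (k i _)) kK evalw_Krev.
  by case: b' => /=; exact: key.
elim=> [|m IH].
  have -> : sub (twist i 0) b W = W.
    by apply: sub_fix => b' j _; rewrite /twist; case: eqP => [->|_] //; case: b'.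
  exact: conjw_eqw.
rewrite -twistS; apply: conjw_trans h1 _.
by apply: conjw_sub => //; exact: twist_odd.
Qed.

Definition foreign : pred nat := fun x => x \notin [:: p; q].

(** Counts the passages between [i] and the other foreign letters, native letters being skipped; [b]
    tells whether the previous foreign letter was [i]. *)
Fixpoint changes (b : bool) (V : seq nat) : nat :=
  if V is x :: V' then
    (if foreign x then ((b != (x == i)) + changes (x == i) V')%N else changes b V')
  else 0%N.

Lemma split_foreign V : (all (predC foreign) V) \/
  exists d e V', [/\ V = d ++ e :: V', all (predC foreign) d & foreign e].
Proof.
elim: V => [|x V IH]; first by left.
case: (boolP (foreign x)) => fx; first by right; exists [::], x, V.
case: IH => [h | [d [e [V' [-> h fe]]]]]; first by left; rewrite /= fx.
by right; exists (x :: d), e, V'; rewrite /= fx.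
Qed.

Lemma native_sub d : all (predC foreign) d -> {subset d <= [:: p; q]}.
Proof. by move=> /allP h x /h /=; rewrite /foreign negbK. Qed.

Lemma foreign_i : foreign i.
Proof. by rewrite /foreign !inE eq_sym (negbTE pi_neq) eq_sym (negbTE qi_neq). Qed.

Lemma rd_native d : all (predC foreign) d -> all (predC foreign) (rd d).
Proof.
rewrite /rd; elim: d => //= x d IH /andP[fx /IH].
by case: (evalw _ d _) => [|h t] /=; rewrite ?fx //; case: ifP => _ /=; rewrite ?fx // => /andP[].
Qed.

Lemma rd_native_cat d e Z : all (predC foreign) d -> foreign e -> sorted neq_rel (e :: Z) ->
  rd (d ++ e :: Z) = rd d ++ e :: Z.
Proof.
move=> nd fe eZ.
have rZ : rd (e :: Z) = e :: Z by apply: rd_id; rewrite redbE.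
rewrite rd_cat rZ /rd; elim: d nd => //= x d IH /andP[fx nd]; rewrite IH //.
have := rd_native nd; rewrite /rd; case: (evalw _ d _) => [|h t] /=.
  by case: eqP => // ex; move: fx; rewrite -ex /= fe.
by case: ifP.
Qed.

Lemma size_alt_ge x y m : x != y -> forall d,
  (m.*2 <= size (rd (alt x y m ++ d)) + size d)%N /\
  (m.*2 <= size (rd (d ++ alt x y m)) + size d)%N.
Proof.
move=> xy d; have r : redb pred0 (alt x y m) by rewrite redbE sorted_alt.
by rewrite -(size_alt x y m); split; [exact: size_rd_ge | exact: size_rd_ge_r].
Qed.

Lemma changes_native b d V : all (predC foreign) d -> changes b (d ++ V) = changes b V.
Proof. by elim: d => //= x d IH /andP[/negbTE -> /IH]. Qed.

Lemma sorted_cons e (Z : seq nat) :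
  sorted neq_rel Z -> ohead Z != Some e -> sorted neq_rel (e :: Z).
Proof. by case: Z => //= h t -> he; rewrite /neq_rel eq_sym andbT; apply: contraNneq he => ->. Qed.

Lemma native_head e d : all (predC foreign) d -> foreign e -> ohead d != Some e.
Proof. by case: d => //= h t /andP[fh _] fe; apply/eqP => -[he]; move: fh; rewrite /= he fe. Qed.

Section Bound.
Variable m : nat.

Let tail (b : bool) (e : nat) : seq nat :=
  if e == i then (if b then alt p q m else alt q p m) else [::].

Let twistE b e : twist i m b e = tail b e ++ e :: tail b e.
Proof. by rewrite /twist /tail; case: eqP => // ->; case: b. Qed.

Let tail_native b e : all (predC foreign) (tail b e).
Proof.
rewrite /tail; case: eqP => // _; apply/allP => x /=; rewrite /foreign negbK.
by case: b => /mem_alt //; rewrite !inE orbC.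
Qed.

Let sub_native b d : all (predC foreign) d -> sub (twist i m) b d = d.
Proof.
move=> /native_sub nd; apply: sub_fix => b' j /nd; rewrite !inE => /orP[]/eqP->;
  exact: twist_fix.
Qed.

(** The block between two consecutive foreign letters. If both are [i], their tails cancel through
    [d]; if only one is, a tail of length 2m survives up to the length of [d]. The block can vanish
    only between distinct letters, so no cancellation spreads across a foreign letter. *)
Lemma twist_block b e e' d : all (predC foreign) d -> foreign e -> foreign e' ->
  sorted neq_rel (e :: d ++ [:: e']) ->
  let R := rd (tail b e ++ d ++ tail (~~ b (+) odd (size d)) e') in
  (R = [::] -> e <> e') /\ (((e == i) != (e' == i)) * m.*2 <= size R + size d)%N.
Proof.
move=> nd fe fe' srt R.
have sd : redb pred0 d.
  by rewrite redbE; move: srt; rewrite /= cat_path => /andP[/path_sorted].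
have dnil : e = e' -> d <> [::].
  by move=> ee d0; move: srt; rewrite d0 /= /neq_rel ee eqxx.
rewrite /R /tail {R}.
case: (eqVneq e i) => [ei | ei]; case: (eqVneq e' i) => [e'i | e'i] /=.
- have -> : rd ((if b then alt p q m else alt q p m) ++ d ++
     (if ~~ b (+) odd (size d) then alt p q m else alt q p m)) = d.
    rewrite -[RHS](rd_id sd); case: b => /=; rewrite ?addTb ?addFb.
      by apply: dihedral_conj; exact: native_sub.
    rewrite if_neg; apply: dihedral_conj => x xd.
    by have := native_sub nd xd; rewrite !inE orbC.
  by split => // /dnil h ee; apply: h.
- rewrite mul1n cats0; split => [_ ee | ]; first by rewrite -ee ei eqxx in e'i.
  by case: b; apply: (size_alt_ge m _ d).1; rewrite // eq_sym.
- rewrite mul1n; split => [_ ee | ]; first by rewrite ee e'i eqxx in ei.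
  by case: (~~ b (+) _); apply: (size_alt_ge m _ d).2; rewrite // eq_sym.
- by rewrite cats0 (rd_id sd); split => // /dnil h ee; apply: h.
Qed.

(** Induction on the blocks. That [Z] does not begin with [e] is carried along with the bound, since
    it keeps the blocks from interacting. *)
Lemma twist_growth n V e b : (size V <= n)%N -> foreign e -> sorted neq_rel (e :: V) ->
  let Z := rd (tail b e ++ sub (twist i m) (~~ b) V) in
  sorted neq_rel (e :: Z) /\ (changes (e == i) V * m.*2 <= size Z + size V)%N.
Proof.
elim: n V e b => [|n IH] V e b Vn fe srt Z.
  move: Vn srt @Z; rewrite leqn0 size_eq0 => /eqP -> _ Z.
  split => //=; apply: sorted_cons; first by rewrite -redbE rd_red.
  rewrite /Z cats0; apply: native_head => //; exact: rd_native.
have [nV | [d [e' [V' [VE nd fe']]]]] := split_foreign V.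
  rewrite /Z sub_native //.
  have -> : changes (e == i) V = 0%N by have := changes_native (e == i) [::] nV; rewrite cats0.
  split => //; apply: sorted_cons; first by rewrite -redbE rd_red.
  by apply: native_head => //; apply: rd_native; rewrite all_cat tail_native.
have srt' : sorted neq_rel (e' :: V').
  by move: srt; rewrite VE /= cat_path /= => /and3P[].
have srtd : sorted neq_rel (e :: d ++ [:: e']).
  by move: srt; rewrite VE /= !cat_path /= => /and3P[-> -> _].
have V'n : (size V' <= n)%N.
  by move: Vn; rewrite VE size_cat /= addnS ltnS; apply: leq_trans; exact: leq_addl.
set b' := ~~ b (+) odd (size d).
have [sZ' cZ'] := IH V' e' b' V'n fe' srt'.
have [nil_neq blk] := twist_block b nd fe fe' srtd.
set Z' := rd (tail b' e' ++ _) in sZ' cZ'.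
have ZE : Z = rd (tail b e ++ d ++ tail b' e') ++ e' :: Z'.
  rewrite /Z VE sub_cat sub_native //= -/b' twistE -rd_native_cat //; last first.
    by rewrite !all_cat !tail_native nd.
  rewrite -!catA /=; do 3 apply: eqw_cat => //.
  by apply: (@eqw_cat [:: e'] [:: e']) => //; apply: eqw_sym; exact: eqw_rd.
split; last first.
  rewrite ZE VE changes_native //= fe' !size_cat /= mulnDl.
  move: blk cZ'; rewrite -/b' => blk cZ'.
  apply: leq_trans (leq_add blk cZ') _.
  by clear; lia.
apply: sorted_cons; first by rewrite -redbE rd_red.
rewrite ZE; have := rd_native (_ : all (predC foreign) (tail b e ++ d ++ tail b' e')).
rewrite !all_cat !tail_native nd => /(_ isT).
move: nil_neq; rewrite -/b'; case: (rd _) => [/(_ erefl) ee _ | h t _ /=].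
  by apply/eqP => -[] /esym.
by move=> /andP[/negbTE fh _]; apply/eqP => -[he]; move: fe; rewrite -he fh.
Qed.

Lemma twist_growth_head b V : sorted neq_rel (i :: V) ->
  (changes true V * m.*2 <= size (rd (sub (twist i m) b (i :: V))) + size V)%N.
Proof.
move=> srt; have [sZ cZ] := twist_growth b (leqnn (size V)) foreign_i srt.
move: cZ; rewrite eqxx => cZ; apply: leq_trans cZ _; rewrite leq_add2r /= twistE -catA /=.
set Z := rd _ in sZ *.
have -> : rd (tail b i ++ i :: tail b i ++ sub (twist i m) (~~ b) V) = rd (tail b i) ++ i :: Z.
  rewrite -rd_native_cat ?tail_native ?foreign_i //.
  apply: eqw_cat => //; apply: (@eqw_cat [:: i] [:: i]) => //.
  by apply: eqw_sym; exact: eqw_rd.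
by rewrite size_cat /= addnS leqW // leq_addl.
Qed.

End Bound.

Lemma changes_i b u V : (changes true V <= changes b (u ++ i :: V))%N.
Proof.
elim: u b => [|x u IH] b /=; first by rewrite foreign_i eqxx leq_addl.
by case: ifP => // _; apply: leq_trans (IH (x == i)) _; exact: leq_addl.
Qed.

Lemma changes_false u V : (changes true V < changes false (u ++ i :: V))%N.
Proof.
elim: u => [|x u IH] /=; first by rewrite foreign_i eqxx add1n.
case: ifP => // _; case: (x == i) => //=.
by rewrite ?add1n ltnS; exact: changes_i.
Qed.

Lemma changes_copies Y N : has [pred x | foreign x & x != i] Y ->
  (N <= changes true (Y ++ flatten (nseq N (i :: Y))))%N.
Proof.
move=> hY; elim: N => // N IH /=; apply: leq_ltn_trans IH _.
move: (Y ++ flatten _) => Z; elim: Y hY => //= x Y IHY.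
case: (boolP (foreign x)) => [fx | _] //=.
case: (x == i) => [h | _] /=; first by rewrite ?add0n; exact: IHY.
by rewrite ?add1n ltnS ltnW // changes_false.
Qed.

Lemma sub_power F b W N : (forall b j, odd (size (F b j))) -> ~~ odd (size W) ->
  sub F b (flatten (nseq N W)) = flatten (nseq N (sub F b W)).
Proof.
move=> Fo evW; elim: N => //= N IH.
by rewrite sub_cat (negbTE evW) addbF IH.
Qed.

Lemma eqw_power g W X N : eqw X (g ++ W ++ rev g) ->
  eqw (flatten (nseq N X)) (g ++ flatten (nseq N W) ++ rev g).
Proof.
move=> XW; apply: eqw_of_eval => S k kK s; rewrite !evalw_cat.
elim: N => [|N IH] /=; first by rewrite evalw_Krev.
by rewrite evalw_cat IH (eqw_eval XW kK) !evalw_cat evalw_revK.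
Qed.

Lemma size_power (W : seq nat) N : size (flatten (nseq N W)) = (N * size W)%N.
Proof. by elim: N => //= N IH; rewrite size_cat IH mulSn. Qed.

Lemma sorted_power (x : nat) Y N : path.cycle neq_rel (x :: Y) ->
  sorted neq_rel (flatten (nseq N.+1 (x :: Y))).
Proof.
rewrite /= rcons_path => /andP[xY lY].
elim: N => [|N IH] /=; first by rewrite cats0.
by rewrite cat_path xY /= lY.
Qed.

(* Twisting [m] times lengthens every passage between the wall [i] and the walls
   not adjacent to it by about [2m]; this is impossible within one conjugacy class. *)
Lemma no_foreign b W r : path.cycle neq_rel W -> ~~ odd (size W) ->
  conjw b W b (sub (half_twist i) b W) -> i \in W -> r \in W -> foreign r -> r = i.
Proof.
move=> cW evW h iW rW fr; apply/eqP; apply/negPn/negP => ri.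
have [k Y WY] := rot_to iW.
have rot_conj : conjw b W (b (+) odd (size (take k W))) (i :: Y).
  by rewrite -WY /rot; have := conjw_rot b (take k W) (drop k W); rewrite cat_take_drop.
set b' := b (+) _ in rot_conj.
have evY : ~~ odd (size (i :: Y)) by rewrite -WY size_rot.
have cY : path.cycle neq_rel (i :: Y) by rewrite -WY rot_cycle.
have hY : has [pred x | foreign x & x != i] Y.
  apply/hasP; exists r; last by rewrite /= fr.
  by move: rW; rewrite -(mem_rot k) WY inE (negbTE ri).
(* The exponent [m] depends only on the length [l] of the word, whereas the size of the conjugating
   [g] is not bounded in terms of [m]. Passing to powers with [N] larger than the size of [g] makes
   [g] negligible: a growth of 2Nm would have to fit into 2(N + 1)l plus twice the size of [g]. *)
set l := size (i :: Y); set m := (l.*2).+1.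
have h' : conjw b' (i :: Y) b' (sub (half_twist i) b' (i :: Y)).
  apply: conjw_trans (conjw_sym rot_conj) (conjw_trans h _).
  by apply: conjw_sub rot_conj; [exact: half_twist_odd | exact: half_twist_cancel |].
have [g [gW _]] := conjw_twist evY h' m.
have [N NE] : exists N, N = (size g).+1 by exists (size g).+1.
have sp : sorted neq_rel (i :: (Y ++ flatten (nseq N (i :: Y)))) := sorted_power N cY.
have PE : i :: (Y ++ flatten (nseq N (i :: Y))) = flatten (nseq N.+1 (i :: Y)) by [].
have := twist_growth_head m b' sp; rewrite PE sub_power //; last exact: twist_odd.
have -> := eqw_power N.+1 gW.
have := size_rd (g ++ flatten (nseq N.+1 (i :: Y)) ++ rev g).
have := changes_copies N hY.
rewrite ![size (_ ++ _)]size_cat size_rev !size_power -/l.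
have : (size Y <= l)%N by exact: leqnSn.
move: (changes _ _) (size (rd _)) => ch L yl h1 h2 h3.
have h4 : (N * m.*2 <= ch * m.*2)%N by rewrite leq_mul2r h1 orbT.
move: h2 h3 h4 NE yl; rewrite /m; clear; move: (size Y) (size g) l => y g' l.
move=> h2 h3 h4 NE yl; subst N.
have h5 := leq_trans h4 h3.
have h6 : (L + (y + g'.+1 * l) <= g' + (g'.+2 * l + g') + (l + g'.+1 * l))%N by lia.
have := leq_trans h5 h6; clear; rewrite -!addnn; nia.
Qed.

End Growth.
Lemma eqw_odd u v : eqw u v -> odd (size u) = odd (size v).
Proof. by rewrite /eqw -(odd_rd u) -(odd_rd v) => ->. Qed.

Lemma evalw_cons (S : Type) (k : nat -> S -> S) j u s :
  evalw k (j :: u) s = k j (evalw k u s).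
Proof. by []. Qed.

Lemma cyclic_reduction W : exists g W0,
  [/\ eqw W (g ++ W0 ++ rev g), {subset W0 <= W} & W0 = [::] \/ path.cycle neq_rel W0 \/ size W0 = 1%N].
Proof.
have rdS u : {subset rd u <= u}.
  rewrite /rd; elim: u => //= j u IH x.
  have : x \in push pred0 j (evalw (push pred0) u [::]) ->
      (x == j) || (x \in evalw (push pred0) u [::]).
    case: (evalw _ _ _) => [|h t] /=; first by rewrite !inE orbF.
    by case: ifP => _; rewrite !inE ?orbA // => ->; rewrite !orbT.
  by move=> h /h /orP[/eqP-> | /IH]; rewrite inE ?eqxx // => ->; rewrite orbT.
suff H : forall k V, (size V <= k)%N -> sorted neq_rel V -> exists g W0,
    [/\ eqw V (g ++ W0 ++ rev g), {subset W0 <= V} & W0 = [::] \/ path.cycle neq_rel W0 \/ size W0 = 1%N].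
  have [|g [W0 [e s h]]] := H _ (rd W) (leqnn _); first by rewrite -redbE rd_red.
  exists g, W0; split => //; last by move=> x /s /rdS.
  by apply: eqw_trans e; apply: eqw_sym; exact: eqw_rd.
elim=> [|k IH] V.
  by rewrite leqn0 size_eq0 => /eqP -> _; exists [::], [::]; split => //; left.
case: V => [|x V] Vk srt; first by exists [::], [::]; split => //; left.
case/lastP: V Vk srt => [|V y] Vk srt; first by exists [::], [:: x]; split => //; right; right.
case: (eqVneq y x) => [yx | yx]; last first.
  exists [::], (x :: rcons V y); rewrite cats0; split => //; right; left.
  by rewrite /= rcons_path last_rcons /neq_rel yx andbT.
have srtV : sorted neq_rel V.
  by move: srt; rewrite /= rcons_path => /andP[/path_sorted].
have Vk' : (size V <= k)%N by move: Vk; rewrite /= size_rcons; lia.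
have [g [W0 [e s h]]] := IH V Vk' srtV.
exists (x :: g), W0; split => //; last by move=> z /s zV; rewrite inE mem_rcons inE zV !orbT.
rewrite yx rev_cons -!cats1; apply: eqw_of_eval => S f fK t.
by rewrite !(evalw_cat, evalw_cons) (eqw_eval e fK) !evalw_cat.
Qed.

(* Action of the letters on the half lines cut out by the [i]-th puncture: it computes
   winding numbers about this puncture. *)
Definition dih (i j : nat) (m : int) : int := if (j < i)%N then - m else 1 - m.

Lemma dihK i j : involutive (dih i j).
Proof. by move=> m; rewrite /dih; case: (j < i)%N; rewrite ?opprK // opprB addrC subrK. Qed.

Definition winds (i : nat) (W : seq nat) := exists m, evalw (dih i) W m != m.

Lemma winds_conj i W W' g : eqw W (g ++ W' ++ rev g) -> winds i W -> winds i W'.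
Proof.
move=> WW [m mW]; exists (evalw (dih i) (rev g) m); apply: contra_neq mW => h.
by rewrite (eqw_eval WW (dihK i)) !evalw_cat h (evalw_Krev (dihK i)).
Qed.

(** The punctures [i] and [i.+1] bound the window [i], and the half twist exchanges them. *)
Lemma dih_half_twist i b W m : (0 < i)%N ->
  evalw (dih i) (sub (half_twist i) b W) m = evalw (dih i.+1) W m.
Proof.
move=> i0; elim: W b => // j W IH b; rewrite evalw_cons -[sub _ _ _]/(_ ++ _) evalw_cat IH.
set x := evalw _ W m; rewrite /half_twist; case: (eqVneq j i) => [-> | ji].
  have pi : (i.-1 < i)%N by rewrite prednK.
  have qi : (i.+1 < i)%N = false by rewrite ltnNge leqnSn.
  by case: b; rewrite /evalw /= /dih pi qi ltnn ltnSn; lia.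
have ji' : (j < i.+1)%N = (j < i)%N by rewrite ltnS leq_eqVlt (negbTE ji).
by rewrite /evalw /= /dih ji'.
Qed.

Lemma winds_half_twist i b W : (0 < i)%N -> winds i (sub (half_twist i) b W) <-> winds i.+1 W.
Proof. by move=> i0; split => -[m mW]; exists m; move: mW; rewrite dih_half_twist. Qed.

Lemma evalw_iter (S : Type) (k : nat -> S -> S) (f : S -> S) W s :
  (forall j s, j \in W -> k j s = f s) -> evalw k W s = iter (size W) f s.
Proof.
elim: W => //= j W IH h; rewrite h ?mem_head // IH // => j' s' j'W.
by apply: h; rewrite inE j'W orbT.
Qed.

Lemma iter_invol (S : Type) (f : S -> S) m s : involutive f -> ~~ odd m -> iter m f s = s.
Proof.
move=> fK /negbTE om; have := odd_double_half m; rewrite om add0n => <-.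
by elim: (m./2) => // k IH; rewrite doubleS /= fK.
Qed.

(** The twists spread winding from one puncture to all of them. Winding about the first puncture
    requires the letter 0 and winding about the last one the letter [n]: otherwise a single
    involution acts, an even number of times. A middle letter would then coexist with 0 and [n],
    against [no_foreign]. *)
Theorem twist_invariant_word n b W : (2 < n)%N -> ~~ odd (size W) ->
  (forall j, j \in W -> (j <= n)%N) ->
  (forall i, (0 < i < n)%N -> conjw b W b (sub (half_twist i) b W)) ->
  (exists2 i, (0 < i <= n)%N & winds i W) ->
  exists g W0, [/\ eqw W (g ++ W0 ++ rev g), path.cycle neq_rel W0, W0 != [::] &
                   {subset W0 <= [:: 0; n]%N}].
Proof.
move=> n2 evW Wn tw [i0 i0n wi0].
have [g [W0 [WW0 W0W W0c]]] := cyclic_reduction W.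
have evW0 : ~~ odd (size W0).
  by move: evW; rewrite (eqw_odd WW0) !size_cat size_rev !oddD addbCA addbb addbF.
set b0 := b (+) odd (size g).
have cW : conjw b0 W0 b W by exists g; split; last by rewrite /b0; case: (b) (odd _) => [] [].
have tw0 i : (0 < i < n)%N -> conjw b0 W0 b0 (sub (half_twist i) b0 W0).
  move=> i0n'; apply: (conjw_trans cW (conjw_trans (tw i i0n') _)).
  apply: conjw_sym; apply: (conjw_sub _ _ _ cW) => //; first exact: half_twist_odd.
  exact: half_twist_cancel.
have windsS i : (0 < i < n)%N -> winds i W0 <-> winds i.+1 W0.
  move=> i0n'; have [h [hW _]] := tw0 i i0n'.
  have [h' [hW' _]] := conjw_sym (tw0 i i0n').
  have /andP[ipos _] := i0n'; rewrite -(winds_half_twist b0 W0 ipos).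
  by split; [exact: winds_conj hW' | exact: winds_conj hW].
have winds1 i : (i < n)%N -> winds 1 W0 <-> winds i.+1 W0.
  elim: i => // i IH lt_in; rewrite IH ?(ltnW lt_in) //.
  by apply: windsS; rewrite lt_in.
have w1 : winds 1 W0.
  move: i0n (winds_conj WW0 wi0); case: (i0) => // i lt_in w.
  by apply/(winds1 i).
have wn : winds n W0 by rewrite -(prednK (ltnW (ltnW n2))); apply/winds1; rewrite ?prednK // ltnW // ltnW.
have W0n j : j \in W0 -> (j <= n)%N by move=> /W0W /Wn.
have in0 : 0%N \in W0.
  apply/negPn/negP => W00; have [m] := w1.
  rewrite (@evalw_iter _ _ (fun m => 1 - m)) ?iter_invol ?eqxx //.
    by move=> x; rewrite /= opprB addrC subrK.
  move=> j s jW; rewrite /dih; case: j jW => // jW; by rewrite jW in W00.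
have inn : n \in W0.
  apply/negPn/negP => W0n'; have [m] := wn.
  rewrite (@evalw_iter _ _ (fun m => - m)) ?iter_invol ?eqxx //; first exact: opprK.
  move=> j s jW; rewrite /dih ltn_neqAle W0n // andbT; case: eqP => // jn.
  by rewrite -jn jW in W0n'.
have cyc : path.cycle neq_rel W0.
  by case: W0c => [W00 | [] // W01]; [rewrite W00 in in0 | rewrite W01 in evW0].
exists g, W0; split => //; first by apply: contraTneq in0 => ->.
move=> j jW; rewrite !inE; apply/negPn/negP; rewrite negb_or => /andP[j0 jn].
have jmid : (0 < j < n)%N by rewrite lt0n j0 ltn_neqAle jn W0n.
have /andP[jpos jltn] := jmid.
have nofor r : r \in W0 -> foreign j r -> r = j.
  exact: (no_foreign jpos cyc evW0 (tw0 j jmid) jW).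
(* The letter 0 is next to 1 only, and [n] is not next to 1 because [2 < n]: one of the two is
   always foreign to [j]. *)
case: (eqVneq j 1%N) => j1.
  have := nofor n inn; rewrite /foreign j1 !inE negb_or.
  have -> : n != 0%N by rewrite -lt0n (leq_trans _ n2).
  have -> : n != 2%N by rewrite neq_ltn n2 orbT.
  by move=> /(_ isT) nj; rewrite nj in n2.
have := nofor 0%N in0; rewrite /foreign !inE negb_or /=.
have -> : 0%N != j.-1 by rewrite eq_sym -lt0n -subn1 subn_gt0 ltn_neqAle eq_sym j1.
by move=> /(_ isT) /esym jz; rewrite jz in j0.
Qed.
(** * The cut through a planar configuration *)

Section Cut.
Variables (R : realType) (n : nat).
Local Notation V := (R * R)%type.
Implicit Types (x : 'I_n -> V) (z : V) (a : R).

Definition cell x := injective (fun k => (x k).1).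

(** The radius of the peaks [hat], small enough for each to vanish at the other points. The default
    1 caps it, so that well spaced points get tents of radius 1. *)
Definition gap x : R :=
  \big[Num.min/1]_(p : 'I_n * 'I_n | p.1 != p.2) `|(x p.1).1 - (x p.2).1|.

Definition hat x (k : 'I_n) a : R := Num.max 0 (1 - `|a - (x k).1| / gap x).

(* A curve through all the points: the graph of [phi x]. *)
Definition phi x a : R := \sum_k (x k).2 * hat x k a.

Definition height x z : R := z.2 - phi x z.1.

Definition rank x a : nat := (\sum_(k < n) ((x k).1 < a)%R)%N.

Lemma gap_gt0 x : cell x -> 0 < gap x.
Proof.
move=> cx; rewrite /gap; elim/big_ind: _ => //.
  by move=> s t s0 t0; rewrite lt_min s0.
by move=> [j k] /= jk; rewrite normr_gt0 subr_eq0; apply: contra_neq jk => /cx.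
Qed.

Lemma gap_le x j k : j != k -> gap x <= `|(x j).1 - (x k).1|.
Proof. by move=> jk; rewrite /gap (bigD1 (j, k)) //= ge_min lexx. Qed.

Lemma gap_le1 x : gap x <= 1.
Proof.
rewrite /gap; elim/big_rec: _ => // p t _ t1.
by rewrite ge_min t1 orbT.
Qed.

Lemma hat_ge0 x k a : 0 <= hat x k a.
Proof. by rewrite /hat le_max lexx. Qed.

Lemma hat_le1 x k a : cell x -> hat x k a <= 1.
Proof.
move=> cx; rewrite /hat ge_max ler01 /= gerBl divr_ge0 ?normr_ge0 // ltW //.
exact: gap_gt0.
Qed.

Lemma hat_self x k : hat x k (x k).1 = 1.
Proof. by rewrite /hat subrr normr0 mul0r subr0 max_r. Qed.

Lemma hat_other x j k : cell x -> j != k -> hat x j (x k).1 = 0.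
Proof.
move=> cx jk; rewrite /hat max_l // subr_le0 ler_pdivlMr ?gap_gt0 // mul1r distrC.
exact: gap_le.
Qed.

Lemma phi_at x k : cell x -> phi x (x k).1 = (x k).2.
Proof.
move=> cx; rewrite /phi (bigD1 k) //= hat_self mulr1 big1 ?addr0 // => j jk.
by rewrite hat_other ?mulr0.
Qed.

Lemma phi_bound x a : cell x -> `|phi x a| <= \sum_k `|(x k).2|.
Proof.
move=> cx; apply: le_trans (ler_norm_sum _ _ _) _; apply: ler_sum => k _.
by rewrite normrM ler_piMr // ger0_norm ?hat_ge0 // hat_le1.
Qed.

Lemma height0_neq x z : cell x -> (forall k, z <> x k) -> height x z = 0 ->
  forall k, z.1 != (x k).1.
Proof.
move=> cx zx /eqP; rewrite /height subr_eq0 => /eqP hz k; apply/negP => /eqP zk.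
by apply: (zx k); case: z {zx} hz zk => z1 z2 /= -> ->; rewrite phi_at // -surjective_pairing.
Qed.

Section CutContinuity.
Variables (P : topologicalType) (p : P) (x : P -> 'I_n -> V).
Hypothesis xc : forall k, ct p (fun q => x q k).

Lemma ct_coord1 k : ct p (fun q => (x q k).1).
Proof. exact: ct_fst (@xc k). Qed.

Lemma ct_coord2 k : ct p (fun q => (x q k).2).
Proof. exact: ct_snd (@xc k). Qed.

Lemma ct_gap : ct p (fun q => gap (x q)).
Proof.
apply: ct_big => [f g | | [j k]]; [exact: ct_min | exact: ct_cst | ].
by apply: ct_norm; apply: ct_add; last apply: ct_opp; exact: ct_coord1.
Qed.

Lemma ct_phi (a : P -> R) : cell (x p) -> ct p a -> ct p (fun q => phi (x q) (a q)).
Proof.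
move=> cx ac; apply: ct_sum => k; apply: ct_mul; first exact: ct_coord2.
apply: ct_max; first exact: ct_cst.
apply: ct_add; first exact: ct_cst.
apply/ct_opp/ct_mul; last by apply: ct_inv; [rewrite gt_eqF // gap_gt0 | exact: ct_gap].
by apply: ct_norm; apply: ct_add => //; apply: ct_opp; exact: ct_coord1.
Qed.

Lemma ct_height (z : P -> V) : cell (x p) -> ct p z -> ct p (fun q => height (x q) (z q)).
Proof.
move=> cx zc; apply: ct_add; first exact: ct_snd.
by apply/ct_opp/ct_phi => //; exact: ct_fst.
Qed.

Lemma near_lt (f g : P -> R) : ct p f -> ct p g -> f p < g p -> \forall q \near p, f q < g q.
Proof.
move=> fc gc fg.
have hc : ct p (fun q => g q - f q) by apply: ct_add => //; exact: ct_opp.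
have h0 : 0 < g p - f p by rewrite subr_gt0.
have hq : \forall q \near p, 0 < g q - f q := hc _ (lt_nbhsr h0).
by apply: filterS hq => q; rewrite subr_gt0.
Qed.

Lemma near_forall (I : finType) (Q : I -> P -> Prop) :
  (forall i, \forall q \near p, Q i q) -> \forall q \near p, forall i, Q i q.
Proof. by move=> h; apply: filter_forall. Qed.

Lemma near_rank (a : P -> R) : ct p a -> (forall k, a p != (x p k).1) ->
  \forall q \near p, rank (x q) (a q) = rank (x p) (a p).
Proof.
move=> ac ax.
have : \forall q \near p, forall k, ((x q k).1 < a q) = ((x p k).1 < a p).
  apply: near_forall => k; have ak := @ct_coord1 k.
  case: (ltgtP (x p k).1 (a p)) (ax k) => [lt _|gt _|_] //.
    exact: near_lt.
  apply: filterS (near_lt ac ak gt) => q lt; apply/negbTE.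
  by rewrite -leNgt ltW.
by apply: filterS => q h; apply: eq_bigr => k _; rewrite h.
Qed.

(** A point of the cut that avoids the configuration has a first coordinate different from all of
    theirs, so it stays in its window. *)
Lemma cut_ok_planar (z : P -> V) : cell (x p) -> ct p z -> (forall k, z p <> x p k) ->
  cut_ok (fun q => height (x q) (z q)) (fun q => rank (x q) (z q).1) p.
Proof.
move=> cx zc zx; split; first exact: ct_height.
move=> h0; apply: near_rank; first exact: ct_fst.
exact: height0_neq.
Qed.

End CutContinuity.
End Cut.
Lemma ct_ptws (P : topologicalType) (I : eqType) (T : topologicalType) (p : P)
    (g : P -> {ptws I -> T}) : (forall i, ct p (fun q => g q i)) -> ct p g.
Proof.
move=> gi; apply/cvg_sup => i A [_ [[C oC <-] Cgp] CA].
have h : \forall q \near p, C (g q i) by apply: gi; exact: open_nbhs_nbhs.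
by apply: filterS h => q Cq; apply: CA.
Qed.

(** * Words spelled by paths *)

Section Words.
Variable R : realType.
Implicit Types (h : R -> R) (r : R -> nat) (W : seq nat).

(** Transport for the group acting on itself; by [wordof_carries] this word determines the transport
    in every other action. *)
Definition wordof h r W := exists w : Red pred0,
  val w = W /\ carries (@kappa pred0) h r (red_nil pred0) w.

Lemma wordof_ex h r : path_ok h r -> exists W, wordof h r W.
Proof.
by move=> ok; have [w hw] := path_ex (@kappaK pred0) (red_nil pred0) ok; exists (val w), w.
Qed.

Lemma wordof_carries h r W (S : Type) (k : nat -> S -> S) s :
  (forall j, involutive (k j)) -> wordof h r W -> carries k h r s (evalw k W s).
Proof.
move=> kK [w [<- hw]].
pose g (v : Red pred0) := evalw k (val v) s.
have gk j v : g (kappa j v) = k j (g v) by exact: evalw_push.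
exact: (carries_equiv gk hw).
Qed.

Lemma wordof_fun h r W (S : Type) (k : nat -> S -> S) s s' :
  (forall j, involutive (k j)) -> path_ok h r -> wordof h r W -> carries k h r s s' ->
  s' = evalw k W s.
Proof. by move=> kK ok hW hs; exact: (path_fun kK ok hs (wordof_carries _ kK hW)). Qed.

(** The side is itself a label, on which every window acts by negation. This yields the parity of
    words. *)
Lemma side_lift h r : carries (fun=> negb) h r (0 <= h 0) (0 <= h 1).
Proof.
exists (fun t => 0 <= h t); split => // t _; near=> t' => _.
by rewrite /tau; case: (0 <= h t); case: (0 <= h t').
Unshelve. all: by end_near.
Qed.

Lemma evalw_negb W b : evalw (fun=> negb) W b = odd (size W) (+) b.
Proof. by elim: W => //= j W IH; rewrite /evalw /= -/(evalw _ _ _) IH addNb. Qed.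

Lemma wordof_odd h r W : path_ok h r -> wordof h r W ->
  odd (size W) = (0 <= h 0) (+) (0 <= h 1).
Proof.
move=> ok hW; have := wordof_fun (fun=> negbK) ok hW (side_lift h r).
by rewrite evalw_negb => ->; rewrite addbC addbK.
Qed.

Lemma carries_inv (S : Type) (k : nat -> S -> S) (Q : S -> Prop) h r s s' :
  (forall j, involutive (k j)) -> path_ok h r ->
  (forall t s, 0 <= t <= 1 -> Q s -> Q (k (r t) s)) ->
  carries k h r s s' -> Q s -> Q s'.
Proof.
move=> kK ok Qk hs Qs.
have := carries_steps kK (path_ok_family ok (0 : R)) hs.
move=> H; near (0 : R)^'+ => e.
have e0 : 0 < e by [].
have [m m0 me] := small_step e0.
have -> : s' = steps k h r m 1 m s by move: m m0 me; near: e.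
elim: {2}m => //= k' IH; rewrite /tau; case: ifP => // _; apply: Qk => //.
by rewrite le_min ler01 divr_ge0 //= ge_min lexx.
Unshelve. all: by end_near.
Qed.

Lemma wordof_letters h r W n : path_ok h r -> (forall t, 0 <= t <= 1 -> (r t <= n)%N) ->
  wordof h r W -> forall j, j \in W -> (j <= n)%N.
Proof.
move=> ok rn [w [<- hw]].
apply: (carries_inv (@kappaK pred0) (Q := fun w : Red pred0 => forall j, j \in val w -> (j <= n)%N)
  ok _ hw) => //= t [v vr] t01 /= vn j.
case: v vr vn => [|x v] _ vn /=; first by rewrite inE => /eqP ->; exact: rn.
case: ifP => _ jv; first by apply: vn; rewrite inE jv orbT.
by move: jv; rewrite inE => /orP[/eqP-> | /vn //]; exact: rn.
Qed.

Lemma conj_homotopy (h : R * R -> R) (r : R * R -> nat) W W' :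
  (forall u t, 0 <= u <= 1 -> 0 <= t <= 1 -> cut_ok h r (u, t)) ->
  (forall u, 0 <= u <= 1 -> h (u, 0) = h (u, 1) /\ r (u, 0) = r (u, 1)) ->
  wordof (fun t => h (0, t)) (fun t => r (0, t)) W ->
  wordof (fun t => h (1, t)) (fun t => r (1, t)) W' ->
  conjw (0 <= h (0, 0)) W (0 <= h (1, 0)) W'.
Proof.
move=> ok per hW hW'.
have u1 : 0 <= (1 : R) <= 1 by rewrite ler01 lexx.
have u0 : 0 <= (0 : R) <= 1 by rewrite lexx ler01.
have okl : path_ok (fun u => h (u, 0)) (fun u => r (u, 0)).
  move=> u u01; apply: (@cut_ok_comp _ _ _ h r (fun u => (u, 0))); last exact: ok.
  by apply: ct_pair; [exact: ct_id | exact: ct_cst].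
have okt : path_ok (fun t => h (1, t)) (fun t => r (1, t)).
  move=> t t01; apply: (@cut_ok_comp _ _ _ h r (fun t => (1, t))); last exact: ok.
  by apply: ct_pair; [exact: ct_cst | exact: ct_id].
have [L hL] := wordof_ex okl; exists L; split; last exact: wordof_odd okl hL.
have kK := @kappaK pred0.
apply: (@eqw_trans _ ((W' ++ L) ++ rev L)).
  by apply: eqw_of_eval => S k kK' s; rewrite !evalw_cat evalw_Krev.
rewrite catA; apply: eqw_cat => //.
have hWc := wordof_carries (red_nil pred0) kK hW.
have hLc s := wordof_carries s kK hL.
have top := loop_homotopy kK ok per hWc (hLc _) (hLc _).
have := wordof_fun kK okt hW' top.
by rewrite -!evalw_cat => /(congr1 val); rewrite !rd_val.
Qed.

End Words.

(** * Sections over the plane as symmetric maps, and the loop of the full turn *)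

Section PlanarSections.
Variables (R : realType) (n : nat).
Local Notation V := (R * R)%type.
Local Notation Cfg := {ptws 'I_n -> V}.
Implicit Types (x : Cfg) (z : V).

Record planar_section (f : Cfg -> V) : Prop := PlanarSection {
  psec_cont : forall x, injective x -> ct x f;
  psec_sym : forall x (s : 'S_n), f (fun k => x (s k)) = f x;
  psec_avoid : forall x k, injective x -> f x <> x k }.

Definition rot (t : R) z : V := (cos t * z.1 - sin t * z.2, sin t * z.1 + cos t * z.2).

(** Cutting along a graph after a shear amounts to cutting along another curve; this is how the cuts
    are varied. *)
Definition shear (s : R) z : V := (z.1 - s * z.2, z.2).

Lemma rotD s t z : rot s (rot t z) = rot (s + t) z.
Proof. by rewrite /rot /= cosD sinD; congr (_, _); ring. Qed.

Lemma rot0 z : rot 0 z = z.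
Proof. by case: z => a b; rewrite /rot cos0 sin0 /=; congr (_, _); ring. Qed.

Lemma rot_inj t : injective (rot t).
Proof. by apply: (can_inj (g := rot (- t))) => z; rewrite rotD addNr rot0. Qed.

Lemma shearD s t z : shear s (shear t z) = shear (s + t) z.
Proof. by rewrite /shear /=; congr (_, _); ring. Qed.

Lemma shear0 z : shear 0 z = z.
Proof. by case: z => a b; rewrite /shear /=; congr (_, _); ring. Qed.

Lemma shear_inj s : injective (shear s).
Proof. by apply: (can_inj (g := shear (- s))) => z; rewrite shearD addNr shear0. Qed.

Section CtMaps.
Variables (P : topologicalType) (p : P).

Lemma ct_rot (t : P -> R) (z : P -> V) : ct p t -> ct p z -> ct p (fun q => rot (t q) (z q)).
Proof.
move=> tc zc; have z1 := ct_fst zc; have z2 := ct_snd zc; rewrite /rot.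
by ctac.
Qed.

Lemma ct_shear (s : P -> R) (z : P -> V) : ct p s -> ct p z -> ct p (fun q => shear (s q) (z q)).
Proof.
move=> tc zc; have z1 := ct_fst zc; have z2 := ct_snd zc; rewrite /shear.
by ctac.
Qed.

End CtMaps.

Definition turn (t : R) x : Cfg := fun k => rot (2 * pi * t) (x k).
Definition slant (s : R) x : Cfg := fun k => shear s (x k).

(* The loop described by the added point, seen in a frame rotating with the
   configuration. *)
Definition uloop (f : Cfg -> V) x (t : R) : V := rot (- (2 * pi * t)) (f (turn t x)).

Lemma turn_inj t x : injective x -> injective (turn t x).
Proof. by move=> xi j k /rot_inj /xi. Qed.

Lemma slant_inj s x : injective x -> injective (slant s x).
Proof. by move=> xi j k /shear_inj /xi. Qed.

Lemma cell_inj x : cell x -> injective x.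
Proof. by move=> cx j k /(congr1 fst) /cx. Qed.

Lemma turn0 x : turn 0 x = x.
Proof. by apply/funext => k; rewrite /turn mulr0 rot0. Qed.

Lemma rot2pi z : rot (2 * pi) z = z.
Proof. by rewrite mulr_natl /rot cos2pi sin2pi; case: z => a b /=; congr (_, _); ring. Qed.

Lemma turn1 x : turn 1 x = x.
Proof. by apply/funext => k; rewrite /turn mulr1 rot2pi. Qed.

Lemma uloop0 f x : uloop f x 0 = f x.
Proof. by rewrite /uloop turn0 mulr0 oppr0 rot0. Qed.

Lemma uloop1 f x : uloop f x 1 = f x.
Proof.
rewrite /uloop turn1 mulr1 -{1}[f x]rot2pi rotD addNr; exact: rot0.
Qed.

Section OneSection.
Variable f : Cfg -> V.
Hypothesis fs : planar_section f.

Lemma uloop_avoid x t k : injective x -> uloop f x t <> x k.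
Proof.
move=> xi /(congr1 (rot (2 * pi * t))); rewrite /uloop rotD subrr rot0.
exact: (psec_avoid fs (turn_inj xi)).
Qed.

Lemma uloop_perm x (s : 'S_n) t : uloop f (fun k => x (s k)) t = uloop f x t.
Proof. by rewrite /uloop -(psec_sym fs (turn t x) s). Qed.

Lemma ct_uloop (P : topologicalType) (p : P) (x : P -> Cfg) (t : P -> R) :
  injective (x p) -> (forall k, ct p (fun q => x q k)) -> ct p t ->
  ct p (fun q => uloop f (x q) (t q)).
Proof.
move=> xi xc tc; apply: ct_rot; first by ctac.
apply: ct_comp; last by apply: (psec_cont fs); exact: turn_inj.
by apply: ct_ptws => k; apply: ct_rot => //; ctac.
Qed.

End OneSection.
End PlanarSections.

(** * The single conjugacy class of the loops *)

Section WordClass.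
Variables (R : realType) (n : nat).
Local Notation V := (R * R)%type.
Local Notation Cfg := {ptws 'I_n -> V}.
Implicit Types (x y : Cfg) (z : V).

Lemma path_ok_planar (x : Cfg) (g : R -> V) : cell x -> (forall t : R, ct t g) ->
  (forall t k, g t <> x k) ->
  path_ok (fun t => height x (g t)) (fun t => rank x (g t).1).
Proof.
move=> cx gc gx t _; apply: (@cut_ok_planar R n R t (fun=> x) _ g) => //.
by move=> k; exact: ct_cst.
Qed.

Lemma planar_homotopy (x : R -> Cfg) (g : R * R -> V) W W' :
  (forall u : R, 0 <= u <= 1 -> cell (x u)) -> (forall (u : R) k, ct u (fun u => x u k)) ->
  (forall u t : R, 0 <= u <= 1 -> 0 <= t <= 1 -> ct (u, t) g) ->
  (forall (u t : R) k, 0 <= u <= 1 -> 0 <= t <= 1 -> g (u, t) <> x u k) ->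
  (forall u : R, 0 <= u <= 1 -> g (u, 0) = g (u, 1)) ->
  wordof (fun t => height (x 0) (g (0, t))) (fun t => rank (x 0) (g (0, t)).1) W ->
  wordof (fun t => height (x 1) (g (1, t))) (fun t => rank (x 1) (g (1, t)).1) W' ->
  conjw (0 <= height (x 0) (g (0, 0))) W (0 <= height (x 1) (g (1, 0))) W'.
Proof.
move=> cx xc gc gx per hW hW'.
apply: (@conj_homotopy R (fun q => height (x q.1) (g q)) (fun q => rank (x q.1) (g q).1)) => //.
  move=> u t u01 t01; apply: (@cut_ok_planar R n (R * R)%type (u, t) (fun q => x q.1)).
  - by move=> k; apply: (@ct_comp _ _ _ _ fst (fun u => x u k)); [exact: ct_fst (@ct_id _ _) | exact: xc].
  - exact: cx.
  - exact: gc.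
  - by move=> k; exact: gx.
by move=> u u01 /=; rewrite per.
Qed.

Definition same_order x y := forall j k, ((x j).1 < (x k).1) = ((y j).1 < (y k).1).

Definition mix (u : R) x y : Cfg :=
  fun k => ((1 - u) * (x k).1 + u * (y k).1, (1 - u) * (x k).2 + u * (y k).2).

Lemma mix_cell u x y : 0 <= u <= 1 -> cell x -> cell y -> same_order x y -> cell (mix u x y).
Proof.
move=> /andP[u0 u1] cx cy o j k; rewrite /mix /=.
have main a b : (x a).1 < (x b).1 ->
    (1 - u) * (x a).1 + u * (y a).1 < (1 - u) * (x b).1 + u * (y b).1.
  move=> ab; have ab' : (y a).1 < (y b).1 by rewrite -o.
  have [u00|u0'] := eqVneq u 0; first by rewrite u00 subr0 !mul1r !mul0r !addr0.
  have up : 0 < u by rewrite lt_def u0' u0.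
  by apply: ler_ltD; [rewrite ler_wpM2l ?subr_ge0 // ltW | rewrite ltr_pM2l].
case: (ltgtP (x j).1 (x k).1) => [/main|/main|/cx //] h e.
  by move: h; rewrite e ltxx.
by move: h; rewrite e ltxx.
Qed.

Lemma ct_mix x y (u : R) k : ct u (fun u => mix u x y k).
Proof. by rewrite /mix; ctac. Qed.

Lemma mix0 x y : mix 0 x y = x.
Proof.
apply/funext => k; rewrite /mix subr0 !mul1r !mul0r !addr0; by case: (x k).
Qed.

Lemma mix1 x y : mix 1 x y = y.
Proof.
apply/funext => k; rewrite /mix subrr !mul0r !mul1r !add0r; by case: (y k).
Qed.

Lemma rank_le_n x a : (rank x a <= n)%N.
Proof.
rewrite -[leqRHS]card_ord -sum1_card; apply: leq_sum => k _.
by case: ltP.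
Qed.

Lemma rank_mono x a b : a <= b -> (rank x a <= rank x b)%N.
Proof.
move=> ab; apply: leq_sum => k _.
by case: (ltP (x k).1 a) => // ka; rewrite (lt_le_trans ka ab).
Qed.

Lemma rank_point_lt x j k : (x j).1 < (x k).1 -> (rank x (x j).1 < rank x (x k).1)%N.
Proof.
move=> jk; rewrite /rank (bigD1 j) //= [leqRHS](bigD1 j) //= ltxx jk add0n add1n ltnS.
apply: leq_sum => i _; case: (ltP (x i).1 (x j).1) => // ij.
by rewrite (lt_trans ij jk).
Qed.

Lemma rank_point_ltn x k : (rank x (x k).1 < n)%N.
Proof.
rewrite -[leqRHS]card_ord -sum1_card /rank (bigD1 k) //= [leqRHS](bigD1 k) //= ltxx add0n.
rewrite add1n ltnS; apply: leq_sum => i _; by case: ltP.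
Qed.

Lemma sort_cfg x : cell x ->
  exists s : 'S_n, forall j k : 'I_n, (j < k)%N -> (x (s j)).1 < (x (s k)).1.
Proof.
move=> cx; pose r k := Ordinal (rank_point_ltn x k).
have rinj : injective r.
  move=> j k /(congr1 val) /= rjk; apply: cx => /=.
  by case: (ltgtP (x j).1 (x k).1) => // /rank_point_lt; rewrite rjk ltnn.
exists (perm rinj)^-1%g => j k jk; rewrite ltNge; apply/negP => le.
have := rank_mono x le.
have e i : rank x (x ((perm rinj)^-1%g i)).1 = i.
  have : val (perm rinj ((perm rinj)^-1%g i)) = val i by rewrite permKV.
  by rewrite permE.
by rewrite !e leqNgt jk.
Qed.

Lemma sorted_lt x (s : 'S_n) : (forall j k : 'I_n, (j < k)%N -> (x (s j)).1 < (x (s k)).1) ->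
  forall j k, ((x (s j)).1 < (x (s k)).1) = (j < k)%N.
Proof.
move=> h j k; case: (ltngtP j k) => [/h //| /h |/val_inj ->]; last exact: ltxx.
by move=> kj; apply/negbTE; rewrite -leNgt ltW.
Qed.

Lemma height_perm x (s : 'S_n) z : height (fun k => x (s k)) z = height x z.
Proof.
rewrite /height; congr (_ - _).
have gapE : gap (fun k => x (s k)) = gap x.
  rewrite /gap [RHS](reindex_inj (h := fun p : 'I_n * 'I_n => (s p.1, s p.2))) /=.
    by apply: eq_bigl => -[j k] /=; rewrite (inj_eq perm_inj).
  by move=> [a b] [c d] /= [/perm_inj -> /perm_inj ->].
rewrite /phi [RHS](reindex_inj (@perm_inj _ s)) /=; apply: eq_bigr => k _.
by rewrite /hat gapE.
Qed.

Lemma rank_perm x (s : 'S_n) a : rank (fun k => x (s k)) a = rank x a.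
Proof. by rewrite /rank [RHS](reindex_inj (@perm_inj _ s)). Qed.

Section Class.
Variable f : Cfg -> V.
Hypothesis fs : planar_section f.

Definition secword s x W :=
  wordof (fun t => height (slant s x) (shear s (uloop f x t)))
         (fun t => rank (slant s x) (shear s (uloop f x t)).1) W.

Definition secside s x := 0 <= height (slant s x) (shear s (f x)).

Lemma slant_cell_inj s x : cell (slant s x) -> injective x.
Proof. by move=> /cell_inj cx j k jk; apply: cx; rewrite /slant jk. Qed.

Lemma slant_loop_ok s x : cell (slant s x) ->
  path_ok (fun t => height (slant s x) (shear s (uloop f x t)))
          (fun t => rank (slant s x) (shear s (uloop f x t)).1).
Proof.
move=> cx; have xi := slant_cell_inj cx.
apply: (@path_ok_planar (slant s x) (fun t => shear s (uloop f x t))) => //.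
  move=> t; apply: ct_shear; first exact: ct_cst.
  apply: (@ct_uloop R n f fs R t (fun=> x) id); [exact: xi | | exact: ct_id].
  by move=> k; exact: ct_cst.
move=> t k /shear_inj; exact: (uloop_avoid fs).
Qed.

Lemma secword_ex s x : cell (slant s x) -> exists W, secword s x W.
Proof. by move=> cx; exact: wordof_ex (slant_loop_ok cx). Qed.

Lemma secword_even s x W : cell (slant s x) -> secword s x W -> ~~ odd (size W).
Proof.
move=> cx hW; rewrite (wordof_odd (slant_loop_ok cx) hW) uloop0 uloop1.
by rewrite addbb.
Qed.

Lemma slant0 x : slant 0 x = x.
Proof. by apply/funext => k; rewrite /slant shear0. Qed.

(** The shear is moved gradually from the frame into the argument of [f]. The configuration in view
    is [slant s x] all along, so the cut stays fixed. *)
Lemma secword_slant s x W W' : cell (slant s x) -> secword s x W -> secword 0 (slant s x) W' ->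
  conjw (secside s x) W (secside 0 (slant s x)) W'.
Proof.
move=> cx hW hW'; have xi := slant_cell_inj cx.
pose g (q : R * R) := shear (s * (1 - q.1)) (uloop f (slant (s * q.1) x) q.2).
have -> : secside s x = (0 <= height (slant s x) (g (0, 0))).
  by rewrite /g /= subr0 mulr1 mulr0 slant0 uloop0.
have -> : secside 0 (slant s x) = (0 <= height (slant s x) (g (1, 0))).
  by rewrite /secside /g /= subrr mulr1 mulr0 slant0 uloop0.
apply: (@planar_homotopy (fun=> slant s x)) => //.
- by move=> u k; exact: ct_cst.
- move=> u t _ _; apply: ct_shear; first by ctac.
  apply: (@ct_uloop R n f fs _ (u, t) (fun q => slant (s * q.1) x) snd).
  + exact: slant_inj.
  + by move=> k; apply: ct_shear; ctac.
  + exact: ct_snd (@ct_id _ _).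
- move=> u t k _ _; rewrite /g /=.
  have -> : slant s x k = shear (s * (1 - u)) (slant (s * u) x k).
    by rewrite /slant shearD; congr shear; ring.
  by move=> /shear_inj; apply: uloop_avoid; first exact: fs; exact: slant_inj.
- by move=> u _; rewrite /g /= uloop0 uloop1.
- by move: hW; rewrite /secword /g /= subr0 mulr1 mulr0 slant0.
- move: hW'; rewrite /secword /g /= subrr mulr1 mulr0 slant0.
  by [].
Qed.

Lemma shear0E : shear 0 = id :> (V -> V).
Proof. by apply/funext => z; exact: shear0. Qed.

Lemma secword0 x W : secword 0 x W =
  wordof (fun t => height x (uloop f x t)) (fun t => rank x (uloop f x t).1) W.
Proof. by rewrite /secword slant0 shear0E. Qed.

Lemma secword_mix x y W W' : cell x -> cell y -> same_order x y ->
  secword 0 x W -> secword 0 y W' -> conjw (secside 0 x) W (secside 0 y) W'.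
Proof.
move=> cx cy o hW hW'.
pose g (q : R * R) := uloop f (mix q.1 x y) q.2.
have side (v : R) w : mix v x y = w -> secside 0 w = (0 <= height w (g (v, 0))).
  by move=> e; rewrite /secside /g /= e slant0 shear0 uloop0.
rewrite (side 0 x (mix0 x y)) (side 1 y (mix1 x y)).
have := @planar_homotopy (fun u => mix u x y) g W W'.
rewrite !mix0 !mix1; apply.
- by move=> u u01; exact: mix_cell.
- by move=> u k; exact: ct_mix.
- move=> u t u01 _; apply: (@ct_uloop R n f fs _ (u, t) (fun q => mix q.1 x y) snd).
  + by apply: cell_inj; exact: mix_cell.
  + by move=> k; rewrite /mix /=; ctac.
  + exact: ct_snd (@ct_id _ _).
- by move=> u t k u01 _; apply: uloop_avoid => //; apply: cell_inj; exact: mix_cell.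
- by move=> u _; rewrite /g /= uloop0 uloop1.
- suff <- : secword 0 x W = wordof (fun t => height x (g (0, t))) (fun t => rank x (g (0, t)).1) W by [].
  by rewrite secword0 /g; congr wordof; apply/funext => t; rewrite [(0, t).1]/= mix0.
- suff <- : secword 0 y W' = wordof (fun t => height y (g (1, t))) (fun t => rank y (g (1, t)).1) W' by [].
  by rewrite secword0 /g; congr wordof; apply/funext => t; rewrite [(1, t).1]/= mix1.
Qed.

Lemma secword_perm x (p : 'S_n) W : secword 0 x W -> secword 0 (fun k => x (p k)) W.
Proof.
rewrite /secword !slant0.
have -> : (fun t => height (fun k => x (p k)) (shear 0 (uloop f (fun k => x (p k)) t))) =
          (fun t => height x (shear 0 (uloop f x t))).
  by apply/funext => t; rewrite height_perm uloop_perm.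
have -> // : (fun t => rank (fun k => x (p k)) (shear 0 (uloop f (fun k => x (p k)) t)).1) =
          (fun t => rank x (shear 0 (uloop f x t)).1).
by apply/funext => t; rewrite rank_perm uloop_perm.
Qed.

Lemma secside_perm x (p : 'S_n) : secside 0 (fun k => x (p k)) = secside 0 x.
Proof. by rewrite /secside !slant0 height_perm (psec_sym fs). Qed.

(** After renumbering, both configurations have increasing first coordinates, and such
    configurations form a convex set. *)
Lemma secword_class s x s' x' W W' : cell (slant s x) -> cell (slant s' x') ->
  secword s x W -> secword s' x' W' -> conjw (secside s x) W (secside s' x') W'.
Proof.
move=> cx cx' hW hW'.
have c0 y : cell y -> cell (slant 0 y) by rewrite slant0.
have [W0 hW0] := secword_ex (c0 _ cx); have [W0' hW0'] := secword_ex (c0 _ cx').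
apply: (conjw_trans (secword_slant cx hW hW0)).
apply: conjw_sym; apply: (conjw_trans (secword_slant cx' hW' hW0')); apply: conjw_sym.
have [p sp] := sort_cfg cx; have [p' sp'] := sort_cfg cx'.
rewrite -(secside_perm (slant s x) p) -(secside_perm (slant s' x') p').
apply: secword_mix.
- by move=> j k /cx /perm_inj.
- by move=> j k /cx' /perm_inj.
- by move=> j k; rewrite (sorted_lt sp) (sorted_lt sp').
- exact: secword_perm.
- exact: secword_perm.
Qed.

End Class.
End WordClass.
Lemma eqw_conj W W' c : eqw (W' ++ c) (c ++ W) -> eqw W' (c ++ W ++ rev c).
Proof.
move=> E; apply: (@eqw_trans _ ((W' ++ c) ++ rev c)).
  by apply: eqw_of_eval => S kk kK' s; rewrite !evalw_cat evalw_Krev.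
by rewrite catA; apply: eqw_cat.
Qed.

(** * Comparison of two cuts *)

Section TwoCuts.
Variables (R : realType) (h0 h2 : R -> R) (r0 r2 : R -> nat) (i : nat).
Hypothesis i0 : (0 < i)%N.
Hypothesis ok0 : path_ok h0 r0.
Hypothesis ok2 : path_ok h2 r2.
(** The cuts enclose a region above the first and below the second, next to the window [i.-1], and a
    region below the first and above the second, next to [i.+1]. Along the window [i] they coincide
    with opposite orientations. *)
Hypothesis low_right : forall t, h0 t = 0 -> 0 < h2 t -> r0 t = i.+1.
Hypothesis low_left : forall t, h0 t = 0 -> h2 t < 0 -> r0 t = i.-1.
Hypothesis high_left : forall t, h2 t = 0 -> 0 < h0 t -> r2 t = i.-1.
Hypothesis high_right : forall t, h2 t = 0 -> h0 t < 0 -> r2 t = i.+1.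
Hypothesis common : forall t, h0 t = 0 -> h2 t = 0 -> r2 t = r0 t /\
  \forall t' \near t,
    (r0 t = i -> h2 t' = - h0 t') /\
    (r0 t <> i -> (0 <= h0 t' -> h2 t' < 0 -> r0 t = i.-1) /\
                  (h0 t' < 0 -> 0 <= h2 t' -> r0 t = i.+1)).

Local Notation G := (Red pred0).
Local Notation k := (@kappa pred0).

Let twisted (b : bool) (w : G) : G :=
  evalw k (sub (half_twist i) b (val w)) (red_nil pred0).

Let twistedK b j w : twisted (~~ b) (k j w) = evalw k (half_twist i (~~ b) j) (twisted b w).
Proof.
have kK := @kappaK pred0.
rewrite /twisted /= (eqw_eval (sub_push (half_twist_cancel i) _ _ _) kK) /=.
by rewrite evalw_cat negbK.
Qed.

(* Word from the region above (resp. below) both cuts to the regions between them. *)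
Let corr (b0 b2 : bool) : seq nat :=
  if b0 == b2 then [::] else if b0 then [:: i.-1] else [:: i.+1].

Let on_middle (t : R) : bool := [&& h0 t == 0, h2 t == 0 & r0 t == i].

(** The label for the second cut, computed from the label for the first. On the common window [i]
    the orientations are opposite, while a point of a cut counts as above it; such a point is put
    above the second cut, hence below the first, after crossing [i]. *)
Let read (w : R -> G) (t : R) : G :=
  if on_middle t then evalw k (corr false true) (twisted false (k i (w t)))
  else evalw k (corr (0 <= h0 t) (0 <= h2 t)) (twisted (0 <= h0 t) (w t)).

Let near_sign (h : R -> R) (t : R) : ct t h -> h t != 0 ->
  \forall t' \near t, h t' != 0 /\ (0 <= h t') = (0 <= h t).
Proof.
move=> hc; case: (ltgtP (h t) 0) => // ht _.
  by apply: filterS (near_lt hc (@ct_cst _ t _ (0 : R)) ht) => t' lt; rewrite lt_eqF // leNgt lt.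
by apply: filterS (near_lt (@ct_cst _ t _ (0 : R)) hc ht) => t' lt; rewrite gt_eqF // ltW.
Qed.

Let kinv : forall j, involutive (k j) := @kappaK pred0.

Lemma read_lift w : is_lift k h0 r0 w -> is_lift k h2 r2 (read w).
Proof.
move=> wl t t01; have [h0c r0c] := ok0 t01; have [h2c r2c] := ok2 t01.
have wn := wl t t01.
have pi : i.-1 == i = false by apply/negbTE; rewrite neq_ltn prednK // leqnn.
have qi : i.+1 == i = false by apply/negbTE; rewrite neq_ltn leqnn orbT.
have tw b j wt : j != i -> twisted (~~ b) (k j wt) = k j (twisted b wt).
  by move=> ji; rewrite twistedK /half_twist (negbTE ji).
have [h0t | h0t] := eqVneq (h0 t) 0; have [h2t | h2t] := eqVneq (h2 t) 0.
- have [rr nr] := common h0t h2t.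
  have r0n := r0c h0t; have r2n := r2c h2t.
  near=> t' => t'01.
  have r0' : r0 t' = r0 t by near: t'.
  have r2' : r2 t' = r2 t by near: t'.
  have wt' : w t' = tau k h0 r0 t t' (w t) by move: t'01; near: t'.
  have [mid nmid] : (r0 t = i -> h2 t' = - h0 t') /\
    (r0 t <> i -> (0 <= h0 t' -> h2 t' < 0 -> r0 t = i.-1) /\
                  (h0 t' < 0 -> 0 <= h2 t' -> r0 t = i.+1)) by near: t'.
  rewrite /read /on_middle wt' /tau r0' h0t h2t lexx !eqxx /= rr.
  have [ri | /eqP ri] := eqVneq (r0 t) i.
    rewrite ri (mid ri) oppr_eq0 andbT andbb.
    case: (ltgtP (h0 t') 0) => ht' /=.
    + by rewrite oppr_ge0 (ltW ht').
    + by rewrite oppr_ge0 leNgt ht' /= (twistedK true) /half_twist /= eqxx /evalw /= !kinv.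
    + by rewrite ht' oppr0 lexx.
  have {nmid}[nl nr'] := nmid ri.
  rewrite !andbF.
  case: (leP 0 (h0 t')) => h0t'; case: (leP 0 (h2 t')) => h2t' //=.
  + by rewrite (nl h0t' h2t').
  + by rewrite (tw true) ?(introN eqP ri) // (nr' h0t' h2t') kinv.
  + by rewrite (tw true) ?(introN eqP ri).
- have r0n := r0c h0t; have s2 := near_sign h2c h2t.
  have rj : r0 t = if 0 <= h2 t then i.+1 else i.-1.
    case: (ltP (h2 t) 0) => s; first exact: low_left.
    by apply: low_right => //; rewrite lt_def h2t.
  near=> t' => t'01.
  have r0' : r0 t' = r0 t by near: t'.
  have wt' : w t' = tau k h0 r0 t t' (w t) by move: t'01; near: t'.
  have [/negbTE h2t' s2'] : h2 t' != 0 /\ (0 <= h2 t') = (0 <= h2 t) by near: t'.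
  rewrite /read /on_middle wt' /tau h2t' (negbTE h2t) !andbF /= h0t lexx s2' eqxx.
  case: (leP 0 (h0 t')) => h0t' //=.
  have ji : r0 t != i by rewrite rj; case: ifP; rewrite ?qi ?pi.
  rewrite (tw true) // rj; case: ifP => _ //=.
  by rewrite /evalw /= kinv.
- have r2n := r2c h2t; have s0 := near_sign h0c h0t.
  have rj : r2 t = if 0 <= h0 t then i.-1 else i.+1.
    case: (ltP (h0 t) 0) => s; first exact: high_right.
    by apply: high_left => //; rewrite lt_def h0t.
  near=> t' => t'01.
  have wt' : w t' = tau k h0 r0 t t' (w t) by move: t'01; near: t'.
  have [/negbTE h0t' s0'] : h0 t' != 0 /\ (0 <= h0 t') = (0 <= h0 t) by near: t'.
  rewrite /read /on_middle wt' /tau h0t' (negbTE h0t) /= s0' eqxx h2t lexx rj.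
  case: (leP 0 (h2 t')) => h2t' //=.
  by case: (0 <= h0 t); rewrite /evalw //= kinv.
- have s0 := near_sign h0c h0t; have s2 := near_sign h2c h2t.
  near=> t' => t'01.
  have wt' : w t' = tau k h0 r0 t t' (w t) by move: t'01; near: t'.
  have [/negbTE h0t' s0'] : h0 t' != 0 /\ (0 <= h0 t') = (0 <= h0 t) by near: t'.
  have [/negbTE h2t' s2'] : h2 t' != 0 /\ (0 <= h2 t') = (0 <= h2 t) by near: t'.
  by rewrite /read /on_middle wt' /tau h0t' (negbTE h0t) /= s0' s2' !eqxx.
Unshelve. all: by end_near.
Qed.

Lemma two_cuts W W' : h0 0 = h0 1 -> h2 0 = h2 1 -> r0 0 = r0 1 ->
  wordof h0 r0 W -> wordof h2 r2 W' ->
  conjw (0 <= h0 0) (sub (half_twist i) (0 <= h0 0) W) (0 <= h2 0) W'.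
Proof.
move=> e0 e2 er [w [<- [l [ll l0 l1]]]] hW'.
have hl : carries k h2 r2 (read l 0) (read l 1) by exists (read l); split => //; exact: read_lift.
have := wordof_fun kinv ok2 hW' hl.
rewrite /read /on_middle -e0 -e2 -er l0 l1.
have tE b u : twisted b u = evalw k (sub (half_twist i) b (val u)) (red_nil pred0) by [].
case: ifP => [/and3P[/eqP h00 /eqP h20 _] | _].
  rewrite h00 h20 lexx !(twistedK true) tE.
  set c := corr false true; set d := half_twist i (~~ true) i.
  rewrite -!evalw_cat => /(congr1 val); rewrite !rd_val /= => E.
  exists (c ++ d); split; last by rewrite /c /d /half_twist eqxx.
  by apply: eqw_conj; move: E; rewrite /eqw !cats0 -!catA => <-.
set c := corr _ _.
rewrite !tE -!evalw_cat => /(congr1 val); rewrite !rd_val /= cats0 => E.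
exists c; split; last by rewrite /c /corr; case: (0 <= h0 0); case: (0 <= h2 0).
by apply: eqw_conj; rewrite /eqw E.
Qed.

End TwoCuts.

(** * The half twist as a change of cut *)

Section Wave.
Variable R : realType.

Definition tent (u : R) : R := Num.max 0 (1 - `|u|).
(** The graph of [wave] is the cut of [twist_cfg]; the cut of the same configuration after the shear
    of slope 2 is the graph of [- wave]. *)
Definition wave (a : R) : R := tent (a - 1) - tent (a + 1).

Lemma waveP a : [\/ a <= -2 /\ wave a = 0, -2 <= a <= -1 /\ wave a = - (a + 2),
  -1 <= a <= 1 /\ wave a = a | (1 <= a <= 2 /\ wave a = 2 - a) \/ (2 <= a /\ wave a = 0)].
Proof.
have Tge u : 1 <= `|u| -> tent u = 0 by move=> h; rewrite /tent max_l //; lra.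
have Tle u : `|u| <= 1 -> tent u = 1 - `|u| by move=> h; rewrite /tent max_r //; lra.
rewrite /wave; have [h1|h1] := leP a (-2).
  by constructor 1; rewrite !Tge ?subrr //; rewrite ler_normr; apply/orP; right; lra.
have [h2|h2] := leP a (-1).
  constructor 2; rewrite (Tge (a - 1)); last by rewrite ler_normr; apply/orP; right; lra.
  rewrite (Tle (a + 1)); last by rewrite ler_norml; lra.
  have [h|h] := ger0P (a + 1); split; lra.
have [h3|h3] := leP a 1.
  constructor 3.
  have [h0|h0] := leP a 0.
    rewrite (Tge (a - 1)); last by rewrite ler_normr; apply/orP; right; lra.
    rewrite (Tle (a + 1)); last by rewrite ler_norml; lra.
    have [h|h] := ger0P (a + 1); split; lra.
  rewrite (Tle (a - 1)); last by rewrite ler_norml; lra.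
  rewrite (Tge (a + 1)); last by rewrite ler_normr; apply/orP; left; lra.
  have [h|h] := ger0P (a - 1); split; lra.
constructor 4; have [h4|h4] := leP a 2; [left|right].
  rewrite (Tle (a - 1)); last by rewrite ler_norml; lra.
  rewrite (Tge (a + 1)); last by rewrite ler_normr; apply/orP; left; lra.
  have [h|h] := ger0P (a - 1); split; lra.
by rewrite !Tge ?subrr; [split; lra | rewrite ler_normr; apply/orP; left; lra ..].
Qed.


Ltac wave_cases a b :=
  case: (waveP a) => [[? ->]|[? ->]|[? ->]|[[? ->]|[? ->]]];
  case: (waveP b) => [[? ->]|[? ->]|[? ->]|[[? ->]|[? ->]]]; lra.

Lemma waveN a : wave (- a) = - wave a.
Proof.
have e1 : - a - 1 = - (a + 1) by ring.
have e2 : - a + 1 = - (a - 1) by ring.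
by rewrite /wave /tent e1 e2 !normrN opprB.
Qed.

(** The first cut is the broken line through (-2, 0), (-1, -1), (1, 1), (2, 0). In the same
    coordinates the second one, [b = - wave (a - 2 * b)], passes through (-2, 0), (1, 1), (-1, -1),
    (2, 0). They enclose two triangles whose common side joins (-1, -1) to (1, 1). The inequalities
    of this section describe this picture. *)
Lemma wave_right a b : b = wave a -> 0 < b + wave (a - 2 * b) -> 1 < a < 3.
Proof. by wave_cases a (a - 2 * b). Qed.

Lemma wave_left a b : b = wave a -> b + wave (a - 2 * b) < 0 -> -3 < a < -1.
Proof.
move=> e l; have := @wave_right (- a) (- b); rewrite waveN -e => /(_ erefl).
have -> : - a - 2 * - b = - (a - 2 * b) by ring.
rewrite waveN => h; have {}h : 1 < - a < 3 by apply: h; lra.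
lra.
Qed.

Lemma wave_far a : (a <= -2 -> wave a = 0) /\ (2 <= a -> wave a = 0).
Proof. by split=> h; case: (waveP a) => [[? ->]|[? ->]|[? ->]|[[? ->]|[? ->]]]; lra. Qed.

Lemma wave_mid a : -1 <= a <= 1 -> wave a = a.
Proof. by move=> h; case: (waveP a) => [[? ->]|[? ->]|[? ->]|[[? ->]|[? ->]]]; lra. Qed.

Lemma wave_excl_left a b : a < -1 -> a - 2 * b < -1 -> b - wave a < 0 ->
  0 <= b + wave (a - 2 * b) -> False.
Proof.
have l c : c < -1 -> c <= -2 /\ wave c = 0 \/ -2 <= c <= -1 /\ wave c = - (c + 2).
  by case: (waveP c) => [[? ->]|[? ->]|[? ->]|[[? ->]|[? ->]]] ?; [left|right|lra..]; split; lra.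
by move=> /l[[? ->]|[? ->]] /l[[? ->]|[? ->]]; lra.
Qed.

Lemma wave_excl_right a b : 1 < a -> 1 < a - 2 * b -> 0 <= b - wave a ->
  b + wave (a - 2 * b) < 0 -> False.
Proof.
have l c : 1 < c -> 2 <= c /\ wave c = 0 \/ 1 <= c <= 2 /\ wave c = 2 - c.
  by case: (waveP c) => [[? ->]|[? ->]|[? ->]|[[? ->]|[? ->]]] ?; [lra..|right|left]; split; lra.
by move=> /l[[? ->]|[? ->]] /l[[? ->]|[? ->]]; lra.
Qed.

Lemma wave_common a b : b = wave a -> b = - wave (a - 2 * b) -> (a, b) <> (-1, -1) ->
  (a, b) <> (1, 1) ->
  [\/ a <= -2 /\ b = 0, -1 < a < 1 /\ b = a | 2 <= a /\ b = 0].
Proof.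
move=> e0 e2 nA nB.
have [l|l] := leP a (-2).
  by constructor 1; split=> //; rewrite e0 (proj1 (wave_far a)).
have [g|g] := leP 2 a.
  by constructor 3; split=> //; rewrite e0 (proj2 (wave_far a)).
have h : -1 <= a <= 1 by move: e0 e2; wave_cases a (a - 2 * b).
have {e0} ba : b = a by rewrite e0 wave_mid.
have am : a != -1 by apply/eqP => e; apply: nA; rewrite ba e.
have ap : a != 1 by apply/eqP => e; apply: nB; rewrite ba e.
by constructor 2; split=> //; rewrite !lt_neqAle eq_sym am ap.
Qed.

End Wave.

Section TwistConfiguration.
Variables (R : realType) (n i : nat).
Local Notation V := (R * R)%type.
Local Notation Cfg := {ptws 'I_n -> V}.
Hypothesis i0 : (0 < i)%N.
Hypothesis ltin : (i < n)%N.

(* All points are on the horizontal axis except two consecutive ones, which the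
   shear of slope 2 puts in the opposite order. *)
Definition twist_cfg : Cfg := fun k =>
  (2 * (k : nat)%:R - 2 * i%:R + 1, if k.+1 == i then -1 else if (k : nat) == i then 1 else 0).

Let iA : 'I_n := Ordinal (leq_ltn_trans (leq_pred i) ltin).
Let iB : 'I_n := Ordinal ltin.

Let iAS : (iA.+1 == i) = true. Proof. by rewrite /= prednK // eqxx. Qed.
Let iBA : iB != iA.
Proof. by rewrite -val_eqE /= neq_ltn orbC prednK // leqnn. Qed.
Let iBS : (iB.+1 == i) = false.
Proof. by apply/negbTE; rewrite neq_ltn /= leqnn orbT. Qed.

Lemma twist_cfg_A : twist_cfg iA = (-1, -1).
Proof.
rewrite /twist_cfg iAS /=; congr (_, _).
by rewrite -[in X in _ - 2 * X](prednK i0) -natr1; ring.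
Qed.

Lemma twist_cfg_B : twist_cfg iB = (1, 1).
Proof. by rewrite /twist_cfg iBS /= eqxx; congr (_, _); ring. Qed.

Lemma twist_cfg_other k : k != iA -> k != iB -> (twist_cfg k).2 = 0.
Proof.
rewrite -!val_eqE /= => kA kB; rewrite /twist_cfg /= (negbTE kB).
by rewrite -[i]prednK // eqSS (negbTE kA).
Qed.

Lemma twist_cfg_lt (j k : 'I_n) : (j < k)%N -> (twist_cfg j).1 + 1 <= (twist_cfg k).1.
Proof.
move=> jk; have : (j.+1%:R <= (k : nat)%:R :> R) by rewrite ler_nat.
by rewrite /twist_cfg /= -natr1; lra.
Qed.

Lemma gap_spaced (x : Cfg) : (forall j k, j != k -> 1 <= `|(x j).1 - (x k).1|) ->
  cell x /\ gap x = 1.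
Proof.
move=> xs; split.
  move=> j k jk; apply/eqP/negPn/negP => /xs; rewrite jk subrr normr0; lra.
apply/eqP; rewrite eq_le gap_le1 andTb /gap; elim/big_ind: _ => //.
  by move=> s t s1 t1; rewrite le_min s1.
by move=> [j k] jk; exact: xs.
Qed.

Let swap : 'S_n := tperm iA iB.

Lemma slant_twist_1 k : (slant 2 twist_cfg k).1 = (twist_cfg (swap k)).1.
Proof.
rewrite /slant /shear [LHS]/fst /swap; case: tpermP => [->|->|/eqP kA /eqP kB].
- by rewrite twist_cfg_A twist_cfg_B; cbn; ring.
- by rewrite twist_cfg_A twist_cfg_B; cbn; ring.
- by rewrite (twist_cfg_other kA kB) mulr0 subr0.
Qed.

Lemma twist_spaced j k : j != k -> 1 <= `|(twist_cfg j).1 - (twist_cfg k).1|.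
Proof.
rewrite -val_eqE neq_ltn => /orP[] /twist_cfg_lt h; rewrite ler_normr; apply/orP.
  by right; lra.
by left; lra.
Qed.

Lemma slant_twist_spaced j k : j != k ->
  1 <= `|(slant 2 twist_cfg j).1 - (slant 2 twist_cfg k).1|.
Proof.
by move=> jk; rewrite !slant_twist_1; apply: twist_spaced; rewrite (inj_eq perm_inj).
Qed.

Lemma phi_two (x : Cfg) a : gap x = 1 -> (forall k, k != iA -> k != iB -> (x k).2 = 0) ->
  phi x a = (x iA).2 * tent (a - (x iA).1) + (x iB).2 * tent (a - (x iB).1).
Proof.
move=> gx xk; rewrite /phi (bigD1 iA) //= (bigD1 iB) //= big1.
  by rewrite addr0 /hat gx !divr1.
by move=> k /andP[kA kB]; rewrite xk // mul0r.
Qed.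

Lemma height_twist z : height twist_cfg z = z.2 - wave z.1.
Proof.
have [_ g] := gap_spaced twist_spaced.
rewrite /height phi_two //; last exact: twist_cfg_other.
by rewrite twist_cfg_A twist_cfg_B /wave /= opprK; congr (_ - _); ring.
Qed.

Lemma height_slant_twist z :
  height (slant 2 twist_cfg) (shear 2 z) = z.2 + wave (z.1 - 2 * z.2).
Proof.
have [_ g] := gap_spaced slant_twist_spaced.
rewrite /height phi_two //; last exact: twist_cfg_other.
rewrite !slant_twist_1 /swap tpermL tpermR /slant /shear twist_cfg_A twist_cfg_B /wave /= opprK.
by ring.
Qed.

Lemma rank_slant_twist a : rank (slant 2 twist_cfg) a = rank twist_cfg a.
Proof.
rewrite /rank [RHS](reindex_inj (@perm_inj _ swap)); apply: eq_bigr => k _.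
by rewrite slant_twist_1.
Qed.

Lemma sum_lt (m N : nat) : (\sum_(k < N) (k < m) = minn N m)%N.
Proof.
elim: N => [|N IH]; first by rewrite big_ord0 min0n.
rewrite big_ord_recr /= IH; case: ltnP => h; lia.
Qed.

Lemma rank_twist a m : (m <= n)%N ->
  (forall k : 'I_n, ((twist_cfg k).1 < a) = (k < m)%N) -> rank twist_cfg a = m.
Proof.
move=> mn h; rewrite /rank; transitivity (\sum_(k < n) (k < m)%N)%N.
  by apply: eq_bigr => k _; rewrite h.
by rewrite sum_lt; exact/minn_idPr.
Qed.

Lemma rank_twist_near a (m : nat) : (m <= n)%N ->
  2 * m%:R - 2 * i%:R - 1 < a < 2 * m%:R - 2 * i%:R + 1 -> rank twist_cfg a = m.
Proof.
move=> mn /andP[a1 a2]; apply: rank_twist => // k; rewrite /twist_cfg /=.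
case: (ltnP k m) => km.
  have : (k.+1%:R <= m%:R :> R) by rewrite ler_nat.
  by rewrite -natr1; lra.
have : (m%:R <= (k : nat)%:R :> R) by rewrite ler_nat.
by move=> h; apply/negbTE; rewrite -leNgt; lra.
Qed.

Lemma rank_twist_right a : 1 < a < 3 -> rank twist_cfg a = i.+1.
Proof. by move=> h; apply: rank_twist_near => //; rewrite -natr1; lra. Qed.

Lemma rank_twist_middle a : -1 < a < 1 -> rank twist_cfg a = i.
Proof. by move=> h; apply: rank_twist_near; [exact: ltnW | lra]. Qed.

Lemma rank_twist_left a : -3 < a < -1 -> rank twist_cfg a = i.-1.
Proof.
move=> h; apply: rank_twist_near; first by apply: leq_trans (leq_pred _) (ltnW ltin).
have : i%:R = i.-1%:R + 1 :> R by rewrite natr1 prednK.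
by move=> ->; lra.
Qed.

Lemma rank_cases a : (a <= -2 -> (rank twist_cfg a < i)%N) /\ (2 <= a -> (i < rank twist_cfg a)%N).
Proof.
split=> h.
  by rewrite (leq_ltn_trans (rank_mono twist_cfg h)) // rank_twist_left ?prednK //; lra.
by rewrite (leq_trans _ (rank_mono twist_cfg h)) // rank_twist_right //; lra.
Qed.

Lemma twist_cuts (u : R -> V) W W' : (forall t : R, ct t u) -> (forall t k, u t <> twist_cfg k) ->
  u 0 = u 1 ->
  wordof (fun t => height twist_cfg (u t)) (fun t => rank twist_cfg (u t).1) W ->
  wordof (fun t => height (slant 2 twist_cfg) (shear 2 (u t)))
    (fun t => rank (slant 2 twist_cfg) (shear 2 (u t)).1) W' ->
  conjw (0 <= height twist_cfg (u 0)) (sub (half_twist i) (0 <= height twist_cfg (u 0)) W)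
    (0 <= height (slant 2 twist_cfg) (shear 2 (u 0))) W'.
Proof.
move=> uc ua per hW hW'.
have [c0 _] := gap_spaced twist_spaced; have [c2 _] := gap_spaced slant_twist_spaced.
apply: (two_cuts i0 _ _ _ _ _ _ _ _ _ _ hW hW').
- by apply: path_ok_planar.
- apply: (@path_ok_planar _ _ (slant 2 twist_cfg) (fun t => shear 2 (u t))) => //.
    by move=> t; apply: ct_shear; [exact: ct_cst | exact: uc].
  by move=> t k /shear_inj; exact: ua.
- move=> t; rewrite height_twist height_slant_twist => e0 g2; apply: rank_twist_right.
  by apply: wave_right g2; lra.
- move=> t; rewrite height_twist height_slant_twist => e0 g2; apply: rank_twist_left.
  by apply: wave_left g2; lra.
- move=> t; rewrite height_twist height_slant_twist rank_slant_twist /= => e0 g2.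
  (* The map from (a, b) to (a - 2b, - b) is an involution that exchanges the two cuts. *)
  apply: rank_twist_left; apply: (@wave_left _ _ (- (u t).2)); first by lra.
  have -> : (u t).1 - 2 * (u t).2 - 2 * - (u t).2 = (u t).1 by ring.
  lra.
- move=> t; rewrite height_twist height_slant_twist rank_slant_twist /= => e0 g2.
  apply: rank_twist_right; apply: (@wave_right _ _ (- (u t).2)); first by lra.
  have -> : (u t).1 - 2 * (u t).2 - 2 * - (u t).2 = (u t).1 by ring.
  lra.
- move=> t; rewrite height_twist height_slant_twist rank_slant_twist /= => e0 e2.
  have u1 := ct_fst (uc t); have u2 := ct_snd (uc t).
  have u3 : ct t (fun t => (u t).1 - 2 * (u t).2) by ctac.
  have near1 (c : R) (g : R -> R) : ct t g -> g t < c -> \forall t' \near t, g t' < c.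
    by move=> gc gt; apply: (near_lt gc (g := fun=> c)) => //; exact: ct_cst.
  have near2 (c : R) (g : R -> R) : ct t g -> c < g t -> \forall t' \near t, c < g t'.
    by move=> gc gt; apply: (near_lt (f := fun=> c) _ gc) => //; exact: ct_cst.
  have [||||[a2 b0]|[a1 ba]|[a2 b0]] := @wave_common R (u t).1 (u t).2.
  + lra.
  + lra.
  + rewrite -twist_cfg_A => e; apply: (ua t iA); rewrite -e; by case: (u t).
  + rewrite -twist_cfg_B => e; apply: (ua t iB); rewrite -e; by case: (u t).
  + rewrite b0 mulr0 subr0; split=> //; have [rl _] := rank_cases (u t).1; have {}rl := rl a2.
    have [al|al] := ltP (u t).1 (-2).
      near=> t'; split=> [ri|_]; first by rewrite ri ltnn in rl.
      have l1 : (u t').1 < -2 by near: t'; exact: near1.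
      have l2 : (u t').1 - 2 * (u t').2 < -2 by near: t'; apply: near1 => //; rewrite b0; lra.
      rewrite !height_twist !height_slant_twist.
      have -> : wave (u t').1 = 0 by apply: (proj1 (wave_far _)); exact: ltW.
      have -> : wave ((u t').1 - 2 * (u t').2) = 0 by apply: (proj1 (wave_far _)); exact: ltW.
      rewrite subr0 addr0.
      by split=> h1 h2; [have := le_lt_trans h1 h2 | have := le_lt_trans h2 h1]; rewrite ltxx.
    near=> t'; split=> [ri|_]; first by rewrite ri ltnn in rl.
    have l1 : (u t').1 < -1 by near: t'; apply: near1 => //; lra.
    have l2 : (u t').1 - 2 * (u t').2 < -1 by near: t'; apply: near1 => //; rewrite b0; lra.
    split; first by move=> _ _; apply: rank_twist_left; lra.
    rewrite !height_twist !height_slant_twist.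
    by move=> h h'; exfalso; move: h h'; exact: wave_excl_left.
  + have ri : rank twist_cfg (u t).1 = i by exact: rank_twist_middle.
    rewrite ri rank_twist_middle; last by lra.
    split=> //; near=> t'; split=> // _.
    have l1 : (u t').1 < 1 by near: t'; apply: near1 => //; lra.
    have l2 : (u t').1 - 2 * (u t').2 < 1 by near: t'; apply: near1 => //; lra.
    have l3 : -1 < (u t').1 by near: t'; apply: near2 => //; lra.
    have l4 : -1 < (u t').1 - 2 * (u t').2 by near: t'; apply: near2 => //; lra.
    by rewrite !height_twist !height_slant_twist !wave_mid; lra.
  + rewrite b0 mulr0 subr0; split=> //; have [_ rl] := rank_cases (u t).1; have {}rl := rl a2.
    have [al|al] := ltP 2 (u t).1.
      near=> t'; split=> [ri|_]; first by rewrite ri ltnn in rl.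
      have l1 : 2 < (u t').1 by near: t'; exact: near2.
      have l2 : 2 < (u t').1 - 2 * (u t').2 by near: t'; apply: near2 => //; rewrite b0; lra.
      rewrite !height_twist !height_slant_twist.
      have -> : wave (u t').1 = 0 by apply: (proj2 (wave_far _)); exact: ltW.
      have -> : wave ((u t').1 - 2 * (u t').2) = 0 by apply: (proj2 (wave_far _)); exact: ltW.
      rewrite subr0 addr0.
      by split=> h1 h2; [have := le_lt_trans h1 h2 | have := le_lt_trans h2 h1]; rewrite ltxx.
    near=> t'; split=> [ri|_]; first by rewrite ri ltnn in rl.
    have l1 : 1 < (u t').1 by near: t'; apply: near2 => //; lra.
    have l2 : 1 < (u t').1 - 2 * (u t').2 by near: t'; apply: near2 => //; rewrite b0; lra.
    split; last by move=> _ _; apply: rank_twist_right; lra.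
    rewrite !height_twist !height_slant_twist.
    by move=> h h'; exfalso; move: h h'; exact: wave_excl_right.
- by rewrite per.
- by rewrite per.
- by rewrite per.
Unshelve. all: by end_near.
Qed.

End TwistConfiguration.

(** The twist configuration is seen through two cuts that differ by a half twist, and both words
    belong to the one class of all loops. *)
Lemma section_twist (R : realType) (n i : nat) (f : {ptws 'I_n -> (R * R)%type} -> (R * R)%type) s x W :
  planar_section f -> (0 < i < n)%N -> cell (slant s x) -> secword f s x W ->
  conjw (secside f s x) W (secside f s x) (sub (half_twist i) (secside f s x) W).
Proof.
move=> fs /andP[i0 ltin] cx hW; pose X : {ptws 'I_n -> (R * R)%type} := twist_cfg R i.
have [c0 _] := gap_spaced (@twist_spaced R n i).
have [c2 _] := gap_spaced (@slant_twist_spaced R n i i0 ltin).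
have c0' : cell (slant 0 X) by rewrite slant0.
have [W0 hW0] := secword_ex fs c0'; have [W2 hW2] := secword_ex fs c2.
have x0 := secword_class fs cx c0' hW hW0; have x2 := secword_class fs cx c2 hW hW2.
have Xi : injective X := cell_inj c0.
have := @twist_cuts R n i i0 ltin (uloop f X) W0 W2.
rewrite -secword0 uloop0 => /(_ _ _ _ hW0 hW2) tw.
have {}tw : conjw (secside f 0 X) (sub (half_twist i) (secside f 0 X) W0) (secside f 2 X) W2.
  rewrite /secside slant0 shear0; apply: tw.
  - move=> t; apply: (@ct_uloop R n f fs R t (fun=> X) id) => // k; exact: ct_cst.
  - by move=> t k; exact: (uloop_avoid fs).
  - by rewrite uloop1.
apply: (conjw_trans x2); apply: conjw_sym; apply: (conjw_trans _ tw).
exact: (conjw_sub (half_twist_odd i) (half_twist_cancel i) (secword_even fs cx hW) x0).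
Qed.
(** * Winding numbers *)

Section Angles.
Variable R : realType.
Local Notation V := (R * R)%type.
Implicit Types (z : V) (v w : R -> V) (al be : R -> R).

Lemma ct_acos (P : topologicalType) (p : P) (f : P -> R) :
  ct p f -> (forall q, -1 <= f q <= 1) -> ct p (fun q => acos (f q)).
Proof.
move=> fc f1; have b q := f1 q.
have a0 q : 0 <= acos (f q) by apply: acos_ge0.
have ap q : acos (f q) <= pi by apply: acos_lepi.
have cK q : cos (acos (f q)) = f q by apply: acosK; rewrite in_itv /= f1.
have lt_a q c : 0 <= c <= pi -> f q < cos c -> c < acos (f q).
  by move=> c0p; rewrite -{1}(cK q) ltr_cos // in_itv //= a0 ap.
have gt_a q c : 0 <= c <= pi -> cos c < f q -> acos (f q) < c.
  by move=> c0p; rewrite -{1}(cK q) ltr_cos // in_itv //= a0 ap.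
apply/cvgrPdist_lt => e e0 /=.
have lo : \forall q \near p, acos (f p) - e < acos (f q).
  have [h|h] := ltP (acos (f p) - e) 0; first by near=> q; exact: lt_le_trans h (a0 q).
  have hc : f p < cos (acos (f p) - e).
    rewrite -{1}(cK p) ltr_cos ?in_itv /= ?a0 ?ap ?h //=; last by have := ap p; lra.
    by lra.
  have := near_lt fc (@ct_cst P p R (cos (acos (f p) - e))) hc.
  by apply: filterS => q; apply: lt_a; have := ap p; lra.
have hi : \forall q \near p, acos (f q) < acos (f p) + e.
  have [h|h] := ltP pi (acos (f p) + e); first by near=> q; exact: le_lt_trans (ap q) h.
  have hc : cos (acos (f p) + e) < f p.
    rewrite -{2}(cK p) ltr_cos ?in_itv /= ?a0 ?ap ?h //=; last by have := a0 p; lra.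
    by lra.
  have := near_lt (@ct_cst P p R (cos (acos (f p) + e))) fc hc.
  by apply: filterS => q; apply: gt_a; have := a0 p; lra.
near=> q; have h1 : acos (f p) - e < acos (f q) by near: q.
have h2 : acos (f q) < acos (f p) + e by near: q.
by rewrite ltr_norml; lra.
Unshelve. all: by end_near.
Qed.

Definition dirof (a : R) z := exists2 r, 0 < r & z = (r * cos a, r * sin a).

Definition turning v (d : R) := exists al, [/\ forall t : R, ct t al,
  forall t : R, 0 <= t <= 1 -> dirof (al t) (v t) & al 1 - al 0 = d].

Lemma cos_eq1 (y : R) : cos y = 1 -> exists m : int, y = 2 * pi * m%:~R.
Proof.
have pi0 := pi_gt0 R.
have periodI (m : int) (x : R) : cos (x + 2 * pi * m%:~R) = cos x.
  have pn k (u : R) : cos (u + 2 * pi * k%:R) = cos u.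
    by have := periodicn (@cosD2pi R) k u; rewrite -[_ *+ k]mulr_natr -[pi *+ 2]mulr_natl.
  case: m => k; first exact: pn.
  by rewrite NegzE -{2}[x](subrK (2 * pi * k.+1%:R)) pn mulrNz mulrN.
pose m := Num.floor (y / (2 * pi)); set u := y - 2 * pi * m%:~R.
have [u0 u2] : 0 <= u /\ u < 2 * pi.
  have p2 : 0 < 2 * pi :> R by lra.
  have /andP[] : m%:~R <= y / (2 * pi) < (m + 1)%:~R by rewrite real_floor_itv ?num_real.
  by rewrite ler_pdivlMr // ltr_pdivrMr // intrD /u => *; split; nra.
move=> y1; exists m; have {y1} : cos u = 1.
  by have := periodI m u; rewrite {1}/u subrK y1 => <-.
move=> u1; suff: u = 0 by rewrite /u; lra.
have [up|up] := leP u pi.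
  by apply: cos_inj; rewrite ?in_itv /= ?cos0 ?u0 ?up ?lexx ?ltW.
have : 2 * pi - u = 0.
  apply: cos_inj; rewrite ?in_itv /= ?cos0 ?lexx ?(ltW pi0) //.
    by lra.
  by rewrite addrC -[2 * pi]mulr1 -[1](mulr1z (1 : R)) periodI cosN.
lra.
Qed.

Lemma dirof_eq a b z : dirof a z -> dirof b z -> cos (a - b) = 1.
Proof.
move=> [r r0 ->] [s s0 [e1 e2]].
have rs : r = s.
  have : r ^+ 2 = s ^+ 2.
    have ha := cos2Dsin2 a; have hb := cos2Dsin2 b.
    transitivity ((r * cos a) ^+ 2 + (r * sin a) ^+ 2).
      by rewrite !exprMn -mulrDr ha mulr1.
    by rewrite e1 e2 !exprMn -mulrDr hb mulr1.
  move/eqP; rewrite eqf_sqr => /orP[/eqP//|/eqP rs]; lra.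
move: e1 e2; rewrite rs => /(mulfI (lt0r_neq0 s0)) ea /(mulfI (lt0r_neq0 s0)) eb.
by rewrite cosB ea eb -!expr2 cos2Dsin2.
Qed.

Lemma odd_multiple (x : R) (k : int) : 0 < k ->
  exists2 l : int, x <= (2 * l%:~R + 1) * pi <= x + 2 * pi * k%:~R & True.
Proof.
move=> k0; have pi0 := pi_gt0 R.
have k1 : 1 <= k%:~R :> R by rewrite -[1](mulr1z (1 : R)) ler_int.
pose m := Num.floor ((x + pi) / (2 * pi)); exists m => //.
have p2 : 0 < 2 * pi :> R by lra.
have /andP[] : m%:~R <= (x + pi) / (2 * pi) < (m + 1)%:~R by rewrite real_floor_itv ?num_real.
by rewrite ler_pdivlMr // ltr_pdivrMr // intrD => *; nra.
Qed.

Lemma cos_odd_pi (l : int) : cos ((2 * l%:~R + 1) * pi) = -1 :> R.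
Proof.
have pn k (u : R) : cos (u + 2 * pi * k%:R) = cos u.
  by have := periodicn (@cosD2pi R) k u; rewrite -[_ *+ k]mulr_natr -[pi *+ 2]mulr_natl.
case: l => k.
  rewrite (_ : _ * pi = pi + 2 * pi * k%:R) ?pn ?cospi //; by ring.
rewrite -cosN (_ : - _ = pi + 2 * pi * k%:R) ?pn ?cospi // NegzE mulrNz -natr1.
by ring.
Qed.

(* By the intermediate value theorem the difference of the two angles would
   otherwise pass through an odd multiple of [pi]. *)
Lemma turning_opposite al be : (forall t : R, ct t al) -> (forall t : R, ct t be) ->
  (forall t, 0 <= t <= 1 -> cos (al t - be t) != -1) ->
  cos (al 0 - be 0) = cos (al 1 - be 1) -> sin (al 0 - be 0) = sin (al 1 - be 1) ->
  al 1 - al 0 = be 1 - be 0.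
Proof.
move=> ac bc no ec es; pose g t := al t - be t.
have gc : {within `[0, 1 : R], continuous g}.
  by apply: continuous_subspaceT => t; apply: (@ct_add R R t al (fun t => - be t)) => //; exact: ct_opp.
have [m gm] : exists m : int, g 1 - g 0 = 2 * pi * m%:~R.
  by apply: cos_eq1; rewrite cosB /g ec es -!expr2 cos2Dsin2.
suff m0 : m = 0 by move: gm; rewrite m0 mulr0 /g; lra.
have key (k : int) (x y : R) : 0 < k -> y = x + 2 * pi * k%:~R ->
    Num.min (g 0) (g 1) = x -> Num.max (g 0) (g 1) = y -> False.
  move=> k0 yx gx gy; have [l lx _] := odd_multiple x k0.
  have [|t t01 gt] := @IVT R g 0 1 ((2 * l%:~R + 1) * pi) ler01 gc.
    by rewrite gx gy yx.
  move: t01; rewrite in_itv /= => /no; rewrite -/(g t) gt cos_odd_pi eqxx //.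
have pi0 := pi_gt0 R.
case: (ltgtP m 0) => // mm; exfalso.
  have m1 : m%:~R < 0 :> R by rewrite ltrz0.
  have g10 : g 1 <= g 0 by nra.
  apply: (@key (- m) (g 1) (g 0)); first by rewrite oppr_gt0.
  - by rewrite mulrNz; lra.
  - exact/min_idPr.
  - exact/max_idPl.
have m1 : 0 < m%:~R :> R by rewrite ltr0z.
have g10 : g 0 <= g 1 by nra.
apply: (@key m (g 0) (g 1)) => //; first by lra.
- exact/min_idPl.
- exact/max_idPr.
Qed.

Lemma turning_uniq v d d' : turning v d -> turning v d' -> d = d'.
Proof.
move=> [al [ac ad <-]] [be [bc bd <-]].
have c1 t : 0 <= t <= 1 -> cos (al t - be t) = 1 by move=> h; apply: dirof_eq (ad t h) (bd t h).
have s0 t : 0 <= t <= 1 -> sin (al t - be t) = 0.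
  by move=> /c1 h; apply/eqP; rewrite -sqrf_eq0 sin2cos2 h expr1n subrr.
have i0 : 0 <= (0 : R) <= 1 by rewrite lexx ler01.
have i1 : 0 <= (1 : R) <= 1 by rewrite lexx ler01.
apply: turning_opposite => //; rewrite ?c1 ?s0 // => t /c1 ->.
by apply/eqP => h; lra.
Qed.

End Angles.

Section Turning.
Variable R : realType.
Local Notation V := (R * R)%type.
Implicit Types (z : V) (v w : R -> V) (al be : R -> R).

Definition nrm z : R := Num.sqrt (z.1 ^+ 2 + z.2 ^+ 2).

Lemma nrm_sq z : nrm z ^+ 2 = z.1 ^+ 2 + z.2 ^+ 2.
Proof. by rewrite sqr_sqrtr // addr_ge0 ?sqr_ge0. Qed.

Lemma nrm_ge0 z : 0 <= nrm z. Proof. exact: sqrtr_ge0. Qed.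

Lemma nrm_gt0 z : z <> (0, 0) -> 0 < nrm z.
Proof.
move=> z0; rewrite lt_def nrm_ge0 andbT -sqrf_eq0 nrm_sq paddr_eq0 ?sqr_ge0 //.
by apply/negP => /andP[]; rewrite !sqrf_eq0 => /eqP z1 /eqP z2; apply: z0; case: z z1 z2 => ? ? /= -> ->.
Qed.

Lemma ct_nrm (P : topologicalType) (p : P) (z : P -> V) : ct p z -> ct p (fun q => nrm (z q)).
Proof. by move=> zc; have z1 := ct_fst zc; have z2 := ct_snd zc; apply: ct_sqrt; ctac. Qed.

Definition slope z : R := acos (- z.1 / nrm z).

Lemma slope_bound z : -1 <= - z.1 / nrm z <= 1.
Proof.
have [->|n0] := eqVneq (nrm z) 0; first by rewrite invr0 mulr0; lra.
have np : 0 < nrm z by rewrite lt_def n0 nrm_ge0.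
have := nrm_sq z; have := sqr_ge0 z.2.
rewrite ler_pdivlMr // ler_pdivrMr // => *; apply/andP; split; nra.
Qed.

Lemma ct_slope (P : topologicalType) (p : P) (z : P -> V) : ct p z -> z p <> (0, 0) ->
  ct p (fun q => slope (z q)).
Proof.
move=> zc z0; apply: ct_acos; last by move=> q; exact: slope_bound.
have z1 := ct_fst zc; apply: ct_mul; first by ctac.
by apply: ct_inv; [apply: lt0r_neq0; exact: nrm_gt0 | exact: ct_nrm].
Qed.

(** The angle, up to [pi], of the point with label [m] on the side [b]. To the left of the origin
    [slope] is 0, and the label [m] above meets [- m] below; to the right it is [pi], and [m] meets
    [1 - m]. These are the two cases of [dih]. *)
Definition sheet (b : bool) (m : int) (a : R) : R := if b then 2 * pi * m%:~R - a else a - 2 * pi * m%:~R.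

Lemma dirof_sheet z m : z <> (0, 0) -> dirof (pi + sheet (0 <= z.2) m (slope z)) z.
Proof.
move=> z0; have n0 := nrm_gt0 z0; exists (nrm z) => //.
have cs : cos (slope z) = - z.1 / nrm z by apply: acosK; rewrite in_itv /= slope_bound.
have ss : sin (slope z) = `|z.2| / nrm z.
  have s0 : 0 <= sin (slope z).
    have h0 : 0 <= slope z by apply: acos_ge0; exact: slope_bound.
    have hp : slope z <= pi by apply: acos_lepi; exact: slope_bound.
    move: h0; rewrite le_eqVlt => /orP[/eqP <-|h0]; first by rewrite sin0.
    move: hp; rewrite le_eqVlt => /orP[/eqP ->|hp]; first by rewrite sinpi.
    by apply: ltW; apply: sin_gt0_pi; rewrite h0.
  have r0 : 0 <= `|z.2| / nrm z by rewrite divr_ge0 ?normr_ge0 ?nrm_ge0.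
  apply/eqP; rewrite -(eqrXn2 (n := 2)) // sin2cos2 cs !exprMn real_normK ?num_real // sqrrN.
  by rewrite !exprVn nrm_sq; apply/eqP; field; rewrite -nrm_sq sqrf_eq0 lt0r_neq0.
have per (m' : int) (u : R) : cos (u + 2 * pi * m'%:~R) = cos u /\ sin (u + 2 * pi * m'%:~R) = sin u.
  have pn k (u' : R) : cos (u' + 2 * pi * k%:R) = cos u' /\ sin (u' + 2 * pi * k%:R) = sin u'.
    have := periodicn (@cosD2pi R) k u'; have := periodicn (@sinD2pi R) k u'.
    by rewrite -[_ *+ k]mulr_natr -[pi *+ 2]mulr_natl.
  case: m' => k; first exact: pn.
  have [h1 h2] := pn k.+1 (u - 2 * pi * k.+1%:R); move: h1 h2; rewrite subrK => -> ->.
  by rewrite NegzE mulrNz mulrN.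
rewrite /sheet; case: z z0 n0 cs ss => a b /= z0 n0 cs ss.
have [b0|b0] := leP 0 b.
  rewrite (_ : pi + _ = - slope (a, b) + pi + 2 * pi * m%:~R); last by ring.
  have [-> ->] := per m (- slope (a, b) + pi).
  rewrite cosDpi sinDpi cosN sinN opprK cs ss ger0_norm //.
  by congr (_, _); field; exact: lt0r_neq0.
rewrite (_ : pi + _ = pi + slope (a, b) + 2 * pi * (- m)%:~R); last by rewrite mulrNz; ring.
have [-> ->] := per (- m) (pi + slope (a, b)).
rewrite addrC cosDpi sinDpi cs ss ltr0_norm //.
by congr (_, _); field; exact: lt0r_neq0.
Qed.

Definition clamp01 (t : R) : R := Num.max 0 (Num.min 1 t).

Lemma clamp01_in t : 0 <= clamp01 t <= 1.
Proof. by rewrite /clamp01 le_max lexx /= ge_max ler01 ge_min lexx. Qed.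

Lemma clamp01_id t : 0 <= t <= 1 -> clamp01 t = t.
Proof. by move=> /andP[t0 t1]; rewrite /clamp01 (min_idPr t1) (max_idPr t0). Qed.

Lemma ct_clamp01 (P : topologicalType) (p : P) (f : P -> R) : ct p f -> ct p (fun q => clamp01 (f q)).
Proof. by move=> fc; apply: ct_max; [exact: ct_cst | apply: ct_min => //; exact: ct_cst]. Qed.

(* Two points near a common point of the cut, on opposite sides of it, have
   opposite labels up to the shift by the word letter; both label functions are
   made so that the angle only moves by the variation of [slope]. *)
Lemma lift_turning i v r m m' : (forall t : R, ct t v) -> (forall t, v t <> (0, 0)) ->
  path_ok (fun t => (v t).2) r ->
  (forall t, (v t).2 = 0 -> if (v t).1 < 0 then (r t < i)%N else (i <= r t)%N) ->
  carries (dih i) (fun t => (v t).2) r m m' -> v 0 = v 1 ->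
  turning v ((if 0 <= (v 0).2 then 1 else -1) * (2 * pi * (m' - m)%:~R)).
Proof.
move=> vc v0 ok ri [w [wl w0 w1]] per.
pose A t := pi + sheet (0 <= (v t).2) (w t) (slope (v t)).
exists (fun t => A (clamp01 t)).
have i0 : 0 <= (0 : R) <= 1 by rewrite lexx ler01.
have i1 : 0 <= (1 : R) <= 1 by rewrite lexx ler01.
split; last first.
- rewrite !clamp01_id // /A /sheet -per w0 w1 intrD mulrNz; case: ifP => _; ring.
- by move=> t t01; rewrite clamp01_id //; exact: dirof_sheet.
move=> t0; have t01 := clamp01_in t0; set t := clamp01 t0 in t01 *.
have sc u : ct u (fun u => slope (v u)) by apply: ct_slope.
have key : \forall t' \near t, 0 <= t' <= 1 -> `|A t - A t'| <= `|slope (v t) - slope (v t')|.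
  have wn := wl t t01; have v2 := ct_snd (vc t).
  have same s s' : 0 <= s <= 1 -> (0 <= (v s).2) = (0 <= (v s').2) -> w s' = w s ->
      `|A s - A s'| <= `|slope (v s) - slope (v s')|.
    move=> _ e ew; rewrite /A /sheet ew -e; case: ifP => _; last first.
      by rewrite (_ : _ - _ = slope (v s) - slope (v s')) //; ring.
    by rewrite -normrN (_ : - (_ - _) = slope (v s) - slope (v s')) //; ring.
  have [v20|v20] := eqVneq (v t).2 0; last first.
    have sn : \forall t' \near t, (0 <= (v t').2) = (0 <= (v t).2).
      move: v20; rewrite neq_lt => /orP[h|h].
        have := near_lt v2 (@ct_cst R t R 0) h.
        by apply: filterS => t' h'; rewrite !leNgt h h'.
      have := near_lt (@ct_cst R t R 0) v2 h.
      by apply: filterS => t' h'; rewrite !ltW.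
    near=> t' => t'01; apply: same => //; first by symmetry; near: t'.
    rewrite (_ : w t' = tau (dih i) (fun t => (v t).2) r t t' (w t)); last first.
      by move: t'01; near: t'.
    by rewrite /tau (_ : (0 <= (v t').2) = (0 <= (v t).2)) ?eqxx //; near: t'.
  near=> t' => t'01.
  have wt' : w t' = tau (dih i) (fun t => (v t).2) r t t' (w t) by move: t'01; near: t'.
  have := ri t v20; move: wt'; rewrite /tau.
  case: eqP => [e ew _|ne ew rt]; first by apply: same.
  have nv : 0 < nrm (v t) := nrm_gt0 (v0 t).
  have nvE : nrm (v t) = `|(v t).1| by rewrite /nrm v20 expr0n /= addr0 sqrtr_sqr.
  rewrite /A /sheet ew /dih; move: ne rt; rewrite v20 lexx.
  have sl : slope (v t) = acos (- (v t).1 / `|(v t).1|) by rewrite /slope nvE.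
  case: (leP 0 (v t').2) => // _ _.
  case: (ltP (v t).1 0) => [v1 ->|v1].
    have -> : slope (v t) = 0 by rewrite sl ltr0_norm // divff ?oppr_eq0 ?ltr0_neq0 // acos1.
    rewrite mulrNz le_eqVlt; apply/orP; left; apply/eqP; congr (`|_|).
    by ring.
  rewrite leqNgt => /negbTE ->.
  have -> : slope (v t) = pi.
    by rewrite sl ger0_norm // mulNr divff ?acosN1 // -normr_gt0 -nvE.
  rewrite intrD mulrNz le_eqVlt; apply/orP; left; apply/eqP; congr (`|_|).
  by ring.
have cc : ct t0 clamp01 by exact: (ct_clamp01 (@ct_id R t0)).
have sn : ct t0 (fun s => slope (v (clamp01 s))) by exact: (ct_comp cc (sc t)).
have kn : \forall s \near t0,
    `|A t - A (clamp01 s)| <= `|slope (v t) - slope (v (clamp01 s))|.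
  near=> s; have : 0 <= clamp01 s <= 1 := clamp01_in s.
  by near: s; exact: (cc _ key).
apply/cvgrPdist_lt => e e0; move/cvgrPdist_lt: sn => /(_ e e0).
by apply: filterS2 kn => s; exact: le_lt_trans.
Unshelve. all: by end_near.
Qed.

End Turning.
Section TurningLoops.
Variable R : realType.
Local Notation V := (R * R)%type.
Implicit Types (z : V) (v w : R -> V).

(** The first axis without the origin is a cut with two windows, and the action [dih 1] produces the
    angle. *)
Lemma any_turning v : (forall t : R, ct t v) -> (forall t, v t <> (0, 0)) -> v 0 = v 1 ->
  exists d, turning v d.
Proof.
move=> vc v0 per; pose r t : nat := (0 < (v t).1).
have ok : path_ok (fun t => (v t).2) r.
  move=> t _; split; first exact: ct_snd (vc t).
  move=> v2; have v1 : (v t).1 != 0.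
    by apply/eqP => v1; apply: (v0 t); case: (v t) v1 v2 => ? ? /= -> ->.
  move: v1; rewrite neq_lt => /orP[h|h].
    have := near_lt (ct_fst (vc t)) (@ct_cst R t R 0) h.
    by apply: filterS => q hq; rewrite /r !ltNge !ltW.
  have := near_lt (@ct_cst R t R 0) (ct_fst (vc t)) h.
  by apply: filterS => q hq; rewrite /r h hq.
have [m' hm] := path_ex (@dihK 1) 0 ok.
eexists; apply: (lift_turning vc v0 ok _ hm per).
move=> t v2; have v1 : (v t).1 != 0.
  by apply/eqP => v1; apply: (v0 t); case: (v t) v1 v2 => ? ? /= -> ->.
by move: v1; rewrite /r neq_lt; case: (ltgtP (v t).1 0).
Qed.

(** The last hypothesis says that [v t] and [w t] never point in opposite directions. *)
Lemma turning_close v w d : turning v d -> (forall t : R, ct t w) -> (forall t, w t <> (0, 0)) ->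
  v 0 = v 1 -> w 0 = w 1 ->
  (forall t, 0 <= t <= 1 -> (v t).1 * (w t).2 = (v t).2 * (w t).1 ->
     0 <= (v t).1 * (w t).1 + (v t).2 * (w t).2) ->
  turning w d.
Proof.
move=> [al [ac ad <-]] wc w0 vper wper no.
have [d' [be [bc bd hd]]] := any_turning wc w0 wper.
exists be; split=> //; symmetry.
have i0 : 0 <= (0 : R) <= 1 by rewrite lexx ler01.
have i1 : 0 <= (1 : R) <= 1 by rewrite lexx ler01.
have same a b a' b' z z' : dirof a z -> dirof b z' -> dirof a' z -> dirof b' z' ->
    cos (a - b) = cos (a' - b') :> R /\ sin (a - b) = sin (a' - b') :> R.
  move=> h1 h2 h3 h4; have e1 := dirof_eq h1 h3; have e2 := dirof_eq h4 h2.
  have z1 (y : R) : cos y = 1 -> sin y = 0.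
    by move=> h; apply/eqP; rewrite -sqrf_eq0 sin2cos2 h expr1n subrr.
  have s1 := z1 _ e1; have s2 := z1 _ e2.
  have -> : a - b = (a' - b') + ((a - a') + (b' - b)) by ring.
  by rewrite !(cosD (a' - b')) !(sinD (a' - b')) !(cosD (a - a')) !(sinD (a - a')) e1 e2 s1 s2; split; ring.
have [ec es] := same _ _ _ _ _ _ (ad 0 i0) (bd 0 i0)
   (eq_ind_r (fun z => dirof (al 1) z) (ad 1 i1) vper) (eq_ind_r (fun z => dirof (be 1) z) (bd 1 i1) wper).
apply: turning_opposite => // t t01; apply/eqP => eN.
have [r r0 er] := ad t t01; have [s s0 es'] := bd t t01.
have := no t t01; rewrite er es' /=.
have sN : sin (al t - be t) = 0.
  by apply/eqP; rewrite -sqrf_eq0 sin2cos2 eN sqrrN expr1n subrr.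
move: eN sN; rewrite cosB sinB => eN sN h.
have {h} : 0 <= r * cos (al t) * (s * cos (be t)) + r * sin (al t) * (s * sin (be t)).
  apply: h; apply/eqP; rewrite -subr_eq0; apply/eqP.
  rewrite (_ : _ - _ = - (r * s) * (sin (al t) * cos (be t) - cos (al t) * sin (be t))).
    by rewrite sN mulr0.
  by ring.
rewrite (_ : _ + _ = r * s * (cos (al t) * cos (be t) + sin (al t) * sin (be t))); last by ring.
by rewrite eN; have := mulr_gt0 r0 s0; lra.
Qed.

Lemma turning_rot v d (k : R) : turning v d -> turning (fun t => rot (k * t) (v t)) (d + k).
Proof.
move=> [al [ac ad <-]]; exists (fun t => al t + k * t); split; last by ring.
  by move=> t; have ht := ac t; ctac.
move=> t /ad[r r0 ->]; exists r => //; rewrite /rot cosD sinD /=.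
by congr (_, _); ring.
Qed.

Lemma turning_ext v w d : (forall t, 0 <= t <= 1 -> v t = w t) -> turning v d -> turning w d.
Proof. by move=> e [al [ac ad h]]; exists al; split=> // t t01; rewrite -e //; exact: ad. Qed.

Lemma turning_int v d : v 0 = v 1 -> turning v d -> exists m : int, d = 2 * pi * m%:~R.
Proof.
move=> per [al [ac ad <-]]; apply: cos_eq1.
have i0 : 0 <= (0 : R) <= 1 by rewrite lexx ler01.
have i1 : 0 <= (1 : R) <= 1 by rewrite lexx ler01.
by apply: (dirof_eq (ad 1 i1)); rewrite -per; exact: ad.
Qed.

Lemma turning_periodic v d (N : nat) : (0 < N)%N -> (forall t : R, v (t + N%:R^-1) = v t) ->
  turning v d -> exists m : int, d = N%:R * (2 * pi * m%:~R).
Proof.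
move=> N0 per [al [ac ad <-]].
have Np : 0 < N%:R :> R by rewrite ltr0n.
pose w t := v (t / N%:R); pose be (j : nat) (t : R) := al ((j%:R + t) / N%:R).
have perj j (t : R) : v ((j%:R + t) / N%:R) = w t.
  elim: j => [|j IH]; first by rewrite add0r.
  by rewrite -IH -(per ((j%:R + t) / _)) -natr1 /=; congr v; ring.
have wper : w 0 = w 1 by rewrite -(perj 1%N 0) addr0 /w.
have tj j : (j < N)%N -> turning w (be j 1 - be j 0).
  move=> jN; exists (be j); split=> // t.
    have h : ct t (fun t => (j%:R + t) / N%:R : R) by ctac.
    exact: (ct_comp h (ac _)).
  move=> /andP[t0 t1]; rewrite -(perj j t); apply: ad.
  have : j.+1%:R <= N%:R :> R by rewrite ler_nat.
  rewrite -natr1 => jN1; have j0 : 0 <= j%:R :> R by rewrite ler0n.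
  by rewrite divr_ge0 ?(ltW Np) ?addr_ge0 //= ler_pdivrMr // mul1r; lra.
have [m0 hm] := turning_int wper (tj 0%N N0); exists m0.
have step k : (k <= N)%N -> al (k%:R / N%:R) - al 0 = k%:R * (2 * pi * m0%:~R).
  elim: k => [|k IH] kN; first by rewrite mul0r subrr mul0r.
  have := turning_uniq (tj k kN) (tj 0%N N0); rewrite hm /be addr0 natr1 => h.
  by rewrite -[k.+1%:R in RHS]natr1 mulrDl mul1r -(IH (ltnW kN)) -h; ring.
by have := step N (leqnn N); rewrite divff // lt0r_neq0.
Qed.

End TurningLoops.

(** * Winding around the center of a wheel *)

Section WheelConfiguration.
Variables (R : realType) (N : nat).
Local Notation V := (R * R)%type.
Local Notation Cfg := {ptws 'I_N.+2 -> V}.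

Definition wheel : Cfg := fun k =>
  if (k : nat) is k'.+1 then rot (2 * pi * (k'%:R / N.+1%:R)) (1, 0) else (0, 0).

Definition wheel_next (k : 'I_N.+2) : 'I_N.+2 :=
  inord (if (k : nat) == 0%N then 0%N else if (k : nat) == N.+1 then 1%N else k.+1).

Lemma wheel_nextE k : wheel_next k = (if (k : nat) == 0 then 0 else if (k : nat) == N.+1 then 1 else k.+1)%N :> nat.
Proof. by rewrite /wheel_next inordK //; have := ltn_ord k; case: ifP => // _; case: ifP => //; lia. Qed.

Lemma wheel_next_inj : injective wheel_next.
Proof.
move=> j k /(congr1 val) /=; rewrite !wheel_nextE => h; apply: val_inj => /=.
by move: h; do ?case: eqP; lia.
Qed.

Lemma rot_origin (t : R) : rot t (0, 0) = (0, 0).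
Proof. by rewrite /rot !mulr0 subr0 addr0. Qed.

Lemma turn_wheel : turn N.+1%:R^-1 wheel = fun k => wheel (perm wheel_next_inj k).
Proof.
apply/funext => k; rewrite permE /turn /wheel wheel_nextE.
case: (k : nat) (ltn_ord k) => [|k'] kN; first by rewrite rot_origin.
rewrite rotD /=; case: eqP => [[->]|_].
  rewrite mul0r mulr0 rot0 (_ : _ + _ = 2 * pi) ?rot2pi // -mulrDr -{1}[_^-1]mul1r -mulrDl.
  by rewrite addrC natr1 divff ?mulr1 // pnatr_eq0.
congr (rot _ _); rewrite -[k'.+1%:R]natr1; ring.
Qed.

Lemma polygon_neq (j k : nat) : (j < k <= N)%N ->
  rot (2 * pi * (j%:R / N.+1%:R)) (1, 0) <> rot (2 * pi * (k%:R / N.+1%:R)) (1, 0) :> V.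
Proof.
have pi0 := pi_gt0 R.
move=> /andP[jk kN] /(congr1 (rot (- (2 * pi * (j%:R / N.+1%:R))))); rewrite !rotD addNr rot0.
rewrite /rot /= !mulr1 !mulr0 subr0 => -[/esym /cos_eq1[m hm] _].
have Np : 0 < N.+1%:R :> R by rewrite ltr0n.
have {hm} : k%:R - j%:R = N.+1%:R * m%:~R :> R.
  apply: (mulfI (x := 2 * pi / N.+1%:R)); first by rewrite mulf_neq0 ?invr_neq0 ?lt0r_neq0 //; lra.
  transitivity (2 * pi * m%:~R : R); first by rewrite -hm; ring.
  by field; exact: lt0r_neq0.
move/eqP; rewrite -(natrB _ (ltnW jk)) -[N.+1%:R]/((Posz N.+1)%:~R) -intrM.
rewrite -[(k - j)%:R]/((Posz (k - j)%N)%:~R) eqr_int => /eqP h; have [m0|m1] := lerP m 0; nia.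
Qed.

Lemma wheel_inj : injective wheel.
Proof.
have pi0 := pi_gt0 R.
have nz (k : nat) : rot (2 * pi * (k%:R / N.+1%:R)) (1, 0) <> (0, 0) :> V.
  move=> /(congr1 (rot (- (2 * pi * (k%:R / N.+1%:R))))); rewrite rotD addNr rot0 rot_origin.
  by move=> [h]; have := oner_neq0 R; rewrite h eqxx.
move=> j k; rewrite /wheel => e; apply: val_inj => /=; move: e.
case: (j : nat) (ltn_ord j) => [|j'] jN; case: (k : nat) (ltn_ord k) => [|k'] kN //.
- by move/esym/nz.
- by move/nz.
- case: (ltngtP j' k') => [h|h|-> //]; first by move/polygon_neq; rewrite h; case; lia.
  by move/esym/polygon_neq; rewrite h; case; lia.
Qed.

Lemma wheel0 : wheel ord0 = (0, 0).
Proof. by []. Qed.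

End WheelConfiguration.

Section Winding.
Variables (R : realType) (n : nat).
Local Notation V := (R * R)%type.
Local Notation Cfg := {ptws 'I_n -> V}.

(* The rank of a point is the letter just before it. *)
Lemma rank_around (x : Cfg) k a : cell x -> a != (x k).1 ->
  if a < (x k).1 then (rank x a < (rank x (x k).1).+1)%N else ((rank x (x k).1).+1 <= rank x a)%N.
Proof.
move=> cx ak; case: (ltgtP a (x k).1) ak => // h _; first by rewrite ltnS; apply: rank_mono; exact: ltW.
rewrite /rank (bigD1 k) //= [ltnRHS](bigD1 k) //= ltxx h add0n add1n ltnS.
by apply: leq_sum => j _; case: (ltP (x j).1 (x k).1) => // jk; rewrite (lt_trans jk h).
Qed.

(** The position relative to the cut and the position relative to the point [x k] have the same
    first coordinate, and on the vertical line through [x k] they coincide; so they are never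
    opposite and turn equally. *)
Lemma not_winds_turning (x : Cfg) k (g : R -> V) W : cell x -> (forall t : R, ct t g) ->
  (forall t j, g t <> x j) -> g 0 = g 1 ->
  wordof (fun t => height x (g t)) (fun t => rank x (g t).1) W ->
  ~ winds (rank x (x k).1).+1 W ->
  turning (fun t => ((g t).1 - (x k).1, (g t).2 - (x k).2)) 0.
Proof.
move=> cx gc gx per hW nw; set i := (_).+1 in nw.
pose v t : V := ((g t).1 - (x k).1, height x (g t)).
have vc (t : R) : ct t v.
  apply: ct_pair; first by have := ct_fst (gc t) => ?; ctac.
  by apply: (@ct_height _ _ _ t (fun=> x)) => // ?; exact: ct_cst.
have on t : (v t).1 = 0 -> (v t).2 = (g t).2 - (x k).2.
  by rewrite /v /height /= => /eqP; rewrite subr_eq0 => /eqP ->; rewrite phi_at.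
have v0 t : v t <> (0, 0).
  move=> e; apply: (gx t k); have := on t; rewrite e /= => /(_ erefl) /esym/eqP.
  rewrite subr_eq0 => /eqP e2; move: (congr1 fst e) => /= /eqP; rewrite subr_eq0 => /eqP e1.
  by case: (g t) (x k) e1 e2 => ? ? [? ?] /= -> ->.
have ok := path_ok_planar cx gc gx.
have hc := wordof_carries (0 : int) (@dihK i) hW.
have t0 : turning v 0.
  have fixW : evalw (dih i) W 0 = 0 by apply/eqP/negPn/negP => h; apply: nw; exists 0.
  rewrite fixW in hc; have := @lift_turning R i v (fun t => rank x (g t).1) 0 0 vc v0 ok _ hc.
  rewrite subrr !mulr0; apply; last by rewrite /v per.
  move=> t vt2; have ne : (g t).1 != (x k).1.
    by apply/eqP => e; apply: (v0 t); rewrite [v t]surjective_pairing vt2 /v /= e subrr.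
  by rewrite /v /= subr_lt0; exact: rank_around.
have gxk t : ((g t).1 - (x k).1, (g t).2 - (x k).2) <> (0, 0).
  move=> [/eqP + /eqP]; rewrite !subr_eq0 => /eqP e1 /eqP e2; apply: (gx t k).
  by case: (g t) (x k) e1 e2 => ? ? [? ?] /= -> ->.
apply: (turning_close t0) => //.
- by move=> t; have h1 := ct_fst (gc t); have h2 := ct_snd (gc t); ctac.
- by rewrite /v per.
- by rewrite per.
move=> t _ /=; have := on t; rewrite /v /=; set a := _ - _; set h := height _ _; set b := _ - _.
have [-> /(_ erefl) -> _|a0 _ e] := eqVneq a 0; first by rewrite mul0r add0r -expr2 sqr_ge0.
have -> : b = h by apply: (mulfI a0); rewrite e mulrC.
by rewrite -!expr2 addr_ge0 ?sqr_ge0.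
Qed.

End Winding.

Section SectionWinds.
Variables (R : realType) (N : nat).
Local Notation V := (R * R)%type.
Local Notation Cfg := {ptws 'I_N.+2 -> V}.

(* In the rotating frame the section sees the wheel with its [N.+1]-fold
   symmetry, so that it turns around the center [1] modulo [N.+1] times. *)
Lemma section_winds (f : Cfg -> V) s x W : (0 < N)%N -> planar_section f -> cell (slant s x) ->
  (exists s', cell (slant s' (@wheel R N))) -> secword f s x W ->
  exists2 i, (0 < i <= N.+2)%N & winds i W.
Proof.
move=> N0 fs cx [s' cs'] hW; pose X := slant s' (@wheel R N).
pose i := (rank X (X ord0).1).+1.
have ii : (0 < i <= N.+2)%N by apply/andP; split=> //; exact: rank_point_ltn.
exists i => //; have [W' hW'] := secword_ex fs cs'.
have [g [hg _]] := secword_class fs cs' cx hW' hW.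
apply: (winds_conj (W := W') (g := rev g)).
  rewrite revK; apply: eqw_of_eval => S k kK t.
  by rewrite !evalw_cat (eqw_eval hg kK) !evalw_cat !evalw_revK.
apply: contrapT => nw; have xi := @wheel_inj R N.
have uc (t : R) : ct t (uloop f (@wheel R N)).
  by apply: (@ct_uloop R _ f fs R t (fun=> @wheel R N) id) => // k; exact: ct_cst.
have ua t k := @uloop_avoid R _ f fs _ t k xi.
have uper : uloop f (@wheel R N) 0 = uloop f (@wheel R N) 1 by rewrite uloop0 uloop1.
have u0 (t : R) : uloop f (@wheel R N) t <> (0, 0) by rewrite -(wheel0 R N); exact: ua.
have X0 : X ord0 = (0, 0) by rewrite /X /slant wheel0 /shear mulr0 subr0.
have sc (t : R) : ct t (fun t => shear s' (uloop f (@wheel R N) t)).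
  by apply: ct_shear; [exact: ct_cst | exact: uc].
have t1 := @not_winds_turning R _ X ord0 (fun t => shear s' (uloop f (@wheel R N) t)) W' cs' sc.
have {}t1 := t1 (fun t k h => ua t k (shear_inj h)) (congr1 (shear s') uper) hW' nw.
have {}t1 : turning (fun t => shear s' (uloop f (@wheel R N) t)) 0.
  apply: turning_ext t1 => t _; rewrite X0 !subr0; by case: shear.
(* A shear has no eigenvalue other than 1, so it never reverses a direction. *)
have t2 : turning (uloop f (@wheel R N)) 0.
  apply: (turning_close t1) => //; first by rewrite uper.
  move=> t _; case: (uloop _ _ t) => a b; rewrite /shear /=.
  have [-> _|b0 e] := eqVneq b 0; first by rewrite mulr0 subr0 !mulr0 addr0 -expr2 sqr_ge0.
  have : s' * b = 0 by apply: (mulIf b0); rewrite mul0r -(subrr (b * a)) -{2}e; ring.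
  by move=> ->; rewrite subr0 -!expr2 addr_ge0 ?sqr_ge0.
(* In the fixed frame one full turn is added. The symmetry of the wheel makes the number of turns a
   multiple of [N.+1], whereas it is 1. *)
have t3 : turning (fun t => f (turn t (@wheel R N))) (2 * pi).
  have := turning_rot (2 * pi) t2; rewrite add0r; apply: turning_ext => t _.
  by rewrite /uloop rotD subrr rot0.
have per (t : R) : f (turn (t + N.+1%:R^-1) (@wheel R N)) = f (turn t (@wheel R N)).
  have -> : turn (t + N.+1%:R^-1) (@wheel R N) =
      fun k => turn t (@wheel R N) (perm (@wheel_next_inj N) k).
    apply/funext => k; rewrite /turn mulrDr -rotD.
    by have := congr1 (fun c => c k) (@turn_wheel R N); rewrite /turn => ->.
  by rewrite (psec_sym fs (turn t _)).
have [m hm] := turning_periodic (ltn0Sn N) per t3.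
have pi0 := pi_gt0 R.
have {hm} : 1 = (Posz N.+1 * m)%:~R :> R.
  apply: (mulfI (x := 2 * pi)); first by rewrite mulf_neq0 ?lt0r_neq0 //; lra.
  by rewrite mulr1 {1}hm intrM; ring.
rewrite -[1](mulr1z (1 : R)) => /eqP; rewrite eqr_int => /eqP h.
by have [m0|m1] := lerP m 0; nia.
Qed.

End SectionWinds.
(** * The closing word of a section *)

Section GenericShear.
Variables (R : realType) (n : nat).
Local Notation V := (R * R)%type.
Local Notation Cfg := {ptws 'I_n -> V}.

(* Each pair of points excludes at most one of the [n * n + 1] shears. *)
Lemma generic_shear (x : Cfg) : injective x ->
  exists s : 'I_(n * n).+1, cell (slant (s : nat)%:R x).
Proof.
move=> xi; apply: contrapT => none.
have bad (s : 'I_(n * n).+1) : exists p : 'I_n * 'I_n,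
    p.1 != p.2 /\ (slant (s : nat)%:R x p.1).1 = (slant (s : nat)%:R x p.2).1.
  apply: contrapT => h; apply: none; exists s => j k jk; apply/eqP/negPn/negP => njk.
  by apply: h; exists (j, k).
pose p s := projT1 (cid (bad s)); have pP s := projT2 (cid (bad s)).
have pinj : injective p.
  move=> s s' e; have [nij h] := pP s; have [_ h'] := pP s'.
  move: nij h h'; rewrite -/(p s) -/(p s') -e; case: (p s) => i j /= nij h h'.
  have ne : (x i).2 != (x j).2.
    apply/eqP => e2; move: nij; apply/negP; rewrite negbK; apply/eqP; apply: xi.
    move: h; rewrite e2 => /addIr e1; move: e1 e2; case: (x i) (x j) => ? ? [? ?] /=.
    by move=> -> ->.
  have : ((s : nat)%:R - (s' : nat)%:R) * ((x i).2 - (x j).2) = 0.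
    by rewrite mulrBl !mulrBr; move: h h'; lra.
  move/eqP; rewrite mulf_eq0 !subr_eq0 (negbTE ne) orbF eqr_nat => /eqP ss.
  exact: val_inj.
have := leq_card p pinj; rewrite card_prod !card_ord; lia.
Qed.

End GenericShear.

Section ClosingWord.
Variable n : nat.

Definition ends : pred nat := fun j => (j == 0)%N || (j == n).

(** A letter [c] that is not an end shields what follows it: before [c], ends multiply as in the
    group. *)
Lemma push_ends j u c v : ends j -> ~~ ends c ->
  push ends j (u ++ c :: v) = push pred0 j u ++ c :: v.
Proof.
case: u => [|h u] /= ej ec; last by case: eqP.
by case: eqP => // cj; move: ec; rewrite cj ej.
Qed.

Lemma evalw_ends W u c v : {subset W <= ends} -> ~~ ends c ->
  evalw (push ends) W (u ++ c :: v) = evalw (push pred0) W u ++ c :: v.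
Proof.
move=> + ec; elim: W => //= j W IH We; rewrite /evalw /= -/(evalw _ _ _) IH.
  by apply: push_ends => //; apply: We; rewrite inE eqxx.
by move=> k kW; apply: We; rewrite inE kW orbT.
Qed.

Lemma val_evalw r W (v : Red r) : val (evalw (@kappa r) W v) = evalw (push r) W (val v).
Proof. by elim: W => //= j W; rewrite /evalw /= => ->. Qed.

(** Unless [v] is the root it has a first letter that is not an end, and [W] multiplies the part
    before it as in the group. A nonempty reduced word is not the identity, so it moves this
    part. *)
Lemma ends_fixed W (v : Red ends) : {subset W <= ends} -> path.cycle neq_rel W -> W != [::] ->
  evalw (@kappa ends) W v = v <-> v = red_nil ends.
Proof.
move=> We cW W0; split=> [|->].
  move=> /(congr1 val); rewrite val_evalw; case: v => v /= vr h; apply: val_inj => /=.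
  case: v vr h => // h t vr; have [_ le] := andP vr; set v := h :: t in vr *.
  have hv : has (predC ends) v by apply/hasP; exists (last h t); rewrite ?mem_last.
  move=> h'; exfalso; move: h'; have [i hi] : exists i, v = take i v ++ nth 0%N v i :: drop i.+1 v /\ ~~ ends (nth 0%N v i).
    exists (find (predC ends) v); rewrite -drop_nth -?has_find // cat_take_drop; split=> //.
    exact: (nth_find 0%N hv).
  case: hi; set u := take i v; set c := nth 0%N v i; set v' := drop _ _ => ecs ec.
  rewrite [in RHS]ecs [in X in evalw _ _ X]ecs evalw_ends // => e.
  have {}e : evalw (push pred0) W u = u.
    have := congr1 size e; rewrite !size_cat => /addIn sz.
    by move/eqP: e; rewrite eqseq_cat // => /andP[/eqP].
  have ur : rd u = u.
    apply: rd_id; rewrite redbE; move: vr; rewrite ecs => /andP[+ _].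
    by move=> /cat_sorted2[].
  have e0 : eqw (W ++ u) u by rewrite /eqw rd_cat ur e.
  have : eqw W [::].
    apply: eqw_of_eval => S k kK s; have := eqw_eval e0 kK (evalw k (rev u) s).
    by rewrite evalw_cat evalw_Krev.
  rewrite /eqw rd_id; first by move=> W00; rewrite W00 in W0.
  by rewrite redbE; case: (W) cW => //= a l; rewrite rcons_path => /andP[].
apply: val_inj; rewrite val_evalw /=; elim: W We {cW W0} => //= j W IH We.
rewrite IH; last by move=> k kW; apply: We; rewrite inE kW orbT.
have ej : ends j by apply: (We j); rewrite inE eqxx.
by rewrite /push ej.
Qed.

End ClosingWord.

Section Closing.
Variables (R : realType) (n : nat).
Local Notation V := (R * R)%type.
Local Notation Cfg := {ptws 'I_n -> V}.

(** The labels are cosets modulo words in the unbounded windows: each names a way to infinity, up to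
    motions near infinity. *)
Definition closing (f : Cfg -> V) s x (v : Red (ends n)) :=
  carries (@kappa (ends n)) (fun t => height (slant s x) (shear s (uloop f x t)))
    (fun t => rank (slant s x) (shear s (uloop f x t)).1) v v.

(** The word is a conjugate of [W0] by [g], so its fixed points are the translates by [g] of those
    of [W0], which fixes the root only. *)
Theorem closing_unique (f : Cfg -> V) s x : (2 < n)%N -> planar_section f -> cell (slant s x) ->
  exists v0, forall v, closing f s x v <-> v = v0.
Proof.
move=> n2 fs cx; have [W hW] := secword_ex fs cx.
have ok := slant_loop_ok fs cx.
have Wn : forall j, j \in W -> (j <= n)%N.
  by apply: wordof_letters ok _ hW => t _; exact: rank_le_n.
have tw i : (0 < i < n)%N -> conjw (secside f s x) W (secside f s x) (sub (half_twist i) (secside f s x) W).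
  by move=> i0n; exact: section_twist.
have wi : exists2 i, (0 < i <= n)%N & winds i W.
  clear ok Wn tw; case: n n2 f s x fs cx hW => [|[|N]] // n2 f s x fs cx hW.
  apply: section_winds hW => //; have [s' cs'] := generic_shear (@wheel_inj R N).
  by exists (s' : nat)%:R.
have [g [W0 [e cW W0n Ws]]] := twist_invariant_word n2 (secword_even fs cx hW) Wn tw wi.
have kK := @kappaK (ends n).
have We : {subset W0 <= ends n} by move=> j /Ws; rewrite !inE.
exists (evalw (@kappa (ends n)) g (red_nil (ends n))) => v.
have cv : closing f s x v <-> evalw (@kappa (ends n)) W v = v.
  split=> [h|h]; first by rewrite -(wordof_fun kK ok hW h).
  by rewrite /closing -{2}h; exact: wordof_carries.
rewrite cv (eqw_eval e kK) !evalw_cat; split=> [h|->].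
  have : evalw (@kappa (ends n)) W0 (evalw (@kappa (ends n)) (rev g) v) =
         evalw (@kappa (ends n)) (rev g) v by rewrite -{2}h evalw_revK.
  by move/(ends_fixed _ We cW W0n) => <-; rewrite evalw_Krev.
by rewrite (evalw_revK kK); congr evalw; apply/(ends_fixed _ We cW W0n).
Qed.

End Closing.
(** * Pushing a point across the cut *)

Section Windows.
Variables (R : realType) (n : nat).
Local Notation V := (R * R)%type.
Local Notation Cfg := {ptws 'I_n -> V}.
Implicit Types (y : Cfg) (z : V) (a : R) (j : nat) (k : 'I_n).

Definition below y j k := (rank y (y k).1 < j)%N.

(** The nearest point to [a] in the closed window [j]. *)
Definition clamp y j a : R :=
  \big[Num.min/(\big[Num.max/a]_(k | below y j k) (y k).1)]_(k | ~~ below y j k) (y k).1.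

Definition span y : R := 1 + \sum_k `|(y k).1|.

(** [span] replaces the missing end of an unbounded window. *)
Definition window_mid y j : R :=
  (\big[Num.max/- span y]_(k | below y j k) (y k).1 +
   \big[Num.min/span y]_(k | ~~ below y j k) (y k).1) / 2.

Definition in_window y j a := forall k, if below y j k then (y k).1 < a else a < (y k).1.

Definition in_closed_window y j a :=
  forall k, if below y j k then (y k).1 <= a else a <= (y k).1.

Lemma below_lt y j k l : below y j k -> ~~ below y j l -> (y k).1 < (y l).1.
Proof.
move=> bk; rewrite ltNge; apply: contra => /(rank_mono y); rewrite /below => h.
exact: leq_ltn_trans h bk.
Qed.

Lemma bigmax_ge (I : finType) (Q : pred I) (F : I -> R) (c : R) :
  c <= \big[Num.max/c]_(i | Q i) F i /\ forall i, Q i -> F i <= \big[Num.max/c]_(i | Q i) F i.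
Proof.
split; first by elim/big_rec: _ => // i u _ cu; rewrite le_max cu orbT.
by move=> i Qi; rewrite (bigD1 i) //= le_max lexx.
Qed.

Lemma bigmin_le (I : finType) (Q : pred I) (F : I -> R) (c : R) :
  \big[Num.min/c]_(i | Q i) F i <= c /\ forall i, Q i -> \big[Num.min/c]_(i | Q i) F i <= F i.
Proof.
split; first by elim/big_rec: _ => // i u _ cu; rewrite ge_min cu orbT.
by move=> i Qi; rewrite (bigD1 i) //= ge_min lexx.
Qed.

Lemma clamp_in y j a : in_closed_window y j (clamp y j a).
Proof.
move=> k; case: ifPn => bk.
  rewrite /clamp; apply: (big_ind (fun u => (y k).1 <= u)).
  - exact: ((bigmax_ge (below y j) (fun k => (y k).1) _).2 k bk).
  - by move=> u v ku kv; rewrite le_min ku.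
  - by move=> l nl; exact: ltW (below_lt bk nl).
exact: ((bigmin_le (fun k => ~~ below y j k) (fun k => (y k).1) _).2 k bk).
Qed.

Lemma clamp_id y j a : in_closed_window y j a -> clamp y j a = a.
Proof.
move=> ca; rewrite /clamp.
have -> : \big[Num.max/a]_(k | below y j k) (y k).1 = a.
  elim/big_rec: _ => // k u bk ->; have := ca k; rewrite bk => h.
  exact/max_idPr.
elim/big_rec: _ => // k u bk ->; have := ca k; rewrite (negbTE bk) => h.
exact/min_idPr.
Qed.

Lemma span_gt y k : - span y < (y k).1 < span y.
Proof.
rewrite -ltr_norml /span (bigD1 k) //=.
have : 0 <= \sum_(i | i != k) `|(y i).1| by apply: sumr_ge0.
lra.
Qed.

Lemma window_mid_in y j : in_window y j (window_mid y j).
Proof.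
set lo := \big[Num.max/- span y]_(k | below y j k) (y k).1.
set hi := \big[Num.min/span y]_(k | ~~ below y j k) (y k).1.
have sp : - span y < span y.
  by rewrite /span; have : 0 <= \sum_k `|(y k).1| by [apply: sumr_ge0]; lra.
have lohi : lo < hi.
  apply: (big_ind (fun u => u < hi)).
  - apply: (big_ind (fun u => - span y < u)) => //.
      by move=> u v su sv; rewrite lt_min su.
    by move=> k _; have /andP[] := span_gt y k.
  - by move=> u v uh vh; rewrite gt_max uh.
  - move=> k bk; apply: (big_ind (fun u => (y k).1 < u)).
    + by have /andP[] := span_gt y k.
    + by move=> u v ku kv; rewrite lt_min ku.
    + by move=> l; exact: below_lt bk.
have e : window_mid y j = (lo + hi) / 2 by [].
move=> k; case: ifPn => bk; rewrite e.
  have := (bigmax_ge (below y j) (fun k => (y k).1) (- span y)).2 k bk; rewrite -/lo; lra.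
by have := (bigmin_le (fun k => ~~ below y j k) (fun k => (y k).1) (span y)).2 k bk; rewrite -/hi; lra.
Qed.

Lemma window_convex y j c m (th : R) : in_closed_window y j c -> in_window y j m ->
  0 < th <= 1 -> in_window y j (c + th * (m - c)).
Proof. by move=> cc mm th1 k; have := cc k; have := mm k; case: ifP => _ *; nra. Qed.

Lemma in_window_neq y j a k : in_window y j a -> a != (y k).1.
Proof. by move=> /(_ k); case: ifP => _; case: ltgtP. Qed.

Lemma rank_window y a : (forall k, a != (y k).1) -> in_closed_window y (rank y a) a.
Proof.
move=> na k; rewrite /below; case: (ltgtP a (y k).1) (na k) => // h _.
  by rewrite ltnNge (rank_mono y (ltW h)).
rewrite (_ : (_ < _)%N = true) //.
rewrite /rank (bigD1 k) //= [ltnRHS](bigD1 k) //= ltxx h add0n add1n ltnS.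
by apply: leq_sum => l _; case: (ltP (y l).1 (y k).1) => // lk; rewrite (lt_trans lk h).
Qed.

Definition sg (b : bool) : R := if b then 1 else -1.

Lemma sgK b (u : R) : sg b * (sg b * u) = u.
Proof. by case: b; rewrite /sg ?mul1r // mulN1r mulN1r opprK. Qed.

Lemma sgN b : sg (~~ b) = - sg b. Proof. by case: b; rewrite /sg ?opprK. Qed.

(* Crossing of the cut through its [j]-th window, starting from the side [b]: first
   slide over the window while moving away from the cut, then cross. *)
Definition move y j b (t : R) z : V :=
  let h := sg b * height y z in
  let c := clamp y j z.1 in
  let d := h + `|z.1 - c| in
  let th := `|d| / (1 + `|d|) in
  let a := z.1 + Num.min 1 (2 * t) * (c + th * (window_mid y j - c) - z.1) in
  (a, sg b * (h + Num.min 1 (2 * t) * d - Num.max 0 (2 * t - 1) * (h + 2 * d)) + phi y a).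

Lemma move0 y j b z : move y j b 0 z = z.
Proof.
rewrite /move mulr0 (min_idPr ler01) add0r max_l; last by lra.
rewrite !mul0r !addr0 subr0 sgK /height; case: z => a be /=; congr (_, _); ring.
Qed.

(** This makes the motions started from the two sides agree on the cut. *)
Lemma move_static y j b t z : height y z = 0 -> in_closed_window y j z.1 -> move y j b t z = z.
Proof.
move=> h0 /clamp_id ca; rewrite /move ca h0 subrr normr0 !mulr0 addr0 normr0 !mul0r !mulr0.
rewrite !addr0 subrr !mulr0 !addr0 subr0 mulr0 add0r.
by move: h0; rewrite /height; case: z {ca} => a be /= /eqP; rewrite subr_eq0 => /eqP ->.
Qed.

Lemma height_move y j b t z : height y (move y j b t z) =
  let h := sg b * height y z in let d := h + `|z.1 - clamp y j z.1| in
  sg b * (h + Num.min 1 (2 * t) * d - Num.max 0 (2 * t - 1) * (h + 2 * d)).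
Proof. by rewrite /height /move /= addrK. Qed.

Lemma move_side y j b z : 0 <= sg b * height y z -> 0 <= sg (~~ b) * height y (move y j b 1 z).
Proof.
move=> h0; rewrite height_move /= sgN mulNr sgK mulr1 (min_idPl _); last by lra.
rewrite (max_idPr _); last by lra.
by have := normr_ge0 (z.1 - clamp y j z.1); lra.
Qed.

(** In the first half the height, signed by [b], increases from a nonnegative value, so it can
    vanish only at the start. In the second half the point lies over the interior of the window,
    where there is no point of [y]. *)
Lemma move_avoid y j b t z : cell y -> (forall k, z <> y k) -> 0 <= sg b * height y z ->
  0 <= t <= 1 -> forall k, move y j b t z <> y k.
Proof.
move=> cy zy h0 /andP[t0 t1] k e.
have c0 := clamp_in y j z.1; have n0 := normr_ge0 (z.1 - clamp y j z.1).
have e1 : (move y j b t z).1 = (y k).1 by rewrite e.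
have e2 : height y (move y j b t z) = 0 by rewrite e /height phi_at // subrr.
move: e2; rewrite height_move /=; set h := _ * height y z in h0 *.
set d := h + `|_| => e2.
have d0 : 0 <= d by rewrite addr_ge0.
have [dz|dz] := eqVneq d 0.
  have hz : h = 0 by move: dz; rewrite /d; lra.
  have nz : `|z.1 - clamp y j z.1| = 0 by move: dz; rewrite /d; lra.
  have ez : z.1 = clamp y j z.1 by move/eqP: nz; rewrite normr_eq0 subr_eq0 => /eqP.
  apply: (zy k); rewrite -e move_static //; last by rewrite ez.
  by have := sgK b (height y z); rewrite -/h hz mulr0.
have dp : 0 < d by rewrite lt_def dz.
have {}e2 : h + Num.min 1 (2 * t) * d - Num.max 0 (2 * t - 1) * (h + 2 * d) = 0.
  by rewrite -(sgK b (_ - _)) e2 mulr0.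
have [th|th] := leP t 2^-1.
  move: e2; rewrite min_r; last by lra.
  rewrite max_l; last by lra.
  rewrite mul0r subr0 => e2; have t0' : t = 0 by nra.
  by apply: (zy k); rewrite -e t0' move0.
have := @in_window_neq y j (move y j b t z).1 k.
rewrite e1 eqxx => ne; suff: false by []; apply: ne.
rewrite -e1 /move /= -/h -/d min_l; last by lra.
rewrite mul1r addrC subrK; apply: window_convex => //; first exact: window_mid_in.
rewrite (ger0_norm d0) divr_gt0 //=; last by lra.
by rewrite ler_pdivrMr; lra.
Qed.

End Windows.

(** * Repulsion to infinity *)

Section Repulsion.
Variables (R : realType) (n : nat).
Local Notation V := (R * R)%type.
Local Notation Cfg := {ptws 'I_n -> V}.
Implicit Types (x y : Cfg) (z : V) (a : R) (j : nat) (k : 'I_n).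

Lemma dot_le_nrm z z' : z.1 * z'.1 + z.2 * z'.2 <= nrm z * nrm z'.
Proof.
have h0 : 0 <= nrm z * nrm z' by rewrite mulr_ge0 ?nrm_ge0.
apply: le_trans (ler_norm _) _; rewrite -(ler_pXn2r (n := 2)) ?nnegrE ?normr_ge0 //.
rewrite real_normK ?num_real // exprMn !nrm_sq; have := sqr_ge0 (z.1 * z'.2 - z.2 * z'.1); nra.
Qed.

Lemma nrm_triangle z z' : nrm (z.1 + z'.1, z.2 + z'.2) <= nrm z + nrm z'.
Proof.
rewrite -(ler_pXn2r (n := 2)) ?nnegrE ?nrm_ge0 ?addr_ge0 ?nrm_ge0 //.
rewrite nrm_sq /= !sqrrD !nrm_sq; have := dot_le_nrm z z'; lra.
Qed.

Lemma nrm_scale (l : R) z : 0 <= l -> nrm (l * z.1, l * z.2) = l * nrm z.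
Proof.
move=> l0; apply/eqP; rewrite -(eqrXn2 (n := 2)) ?nrm_ge0 ?mulr_ge0 ?nrm_ge0 //.
by rewrite exprMn !nrm_sq /=; apply/eqP; ring.
Qed.

Lemma nrm_le_l1 z : nrm z <= `|z.1| + `|z.2|.
Proof.
rewrite -(ler_pXn2r (n := 2)) ?nnegrE ?nrm_ge0 ?addr_ge0 ?normr_ge0 //.
rewrite nrm_sq sqrrD !real_normK ?num_real //; have := mulr_ge0 (normr_ge0 z.1) (normr_ge0 z.2).
lra.
Qed.

Definition xmin y : R := \big[Num.min/span y]_k (y k).1.
Definition xmax y : R := \big[Num.max/- span y]_k (y k).1.

Lemma xmin_le y k : xmin y <= (y k).1.
Proof. exact: (proj2 (bigmin_le predT (fun k => (y k).1) (span y))). Qed.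

Lemma xmax_ge y k : (y k).1 <= xmax y.
Proof. exact: (proj2 (bigmax_ge predT (fun k => (y k).1) (- span y))). Qed.

Lemma xmin_attained y : (0 < n)%N -> exists k, xmin y = (y k).1.
Proof.
move=> n0; have [k _ hk] := arg_minP (P := predT) (i0 := Ordinal n0) (fun k => (y k).1) isT.
exists k; apply/eqP; rewrite eq_le xmin_le andTb; apply: (big_ind (fun u => (y k).1 <= u)).
- by have /andP[_ /ltW] := span_gt y k.
- by move=> u v ku kv; rewrite le_min ku.
- by move=> l _; exact: hk.
Qed.

Lemma xmax_attained y : (0 < n)%N -> exists k, xmax y = (y k).1.
Proof.
move=> n0; have [k _ hk] := arg_maxP (P := predT) (i0 := Ordinal n0) (fun k => (y k).1) isT.
exists k; apply/eqP; rewrite eq_le xmax_ge andbT; apply: (big_ind (fun u => u <= (y k).1)).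
- by have /andP[/ltW] := span_gt y k.
- by move=> u v ku kv; rewrite ge_max ku.
- by move=> l _; exact: hk.
Qed.

Definition hull y a : R := Num.max (xmin y) (Num.min (xmax y) a).
Definition depth y a : R := Num.max 0 (Num.min (a - xmin y) (xmax y - a)).

(* The center of repulsion: the nearest point of the cut above the convex hull of the
   first coordinates, lowered so as to repel also the points of the cut. *)
Definition anchor y b z : V := (hull y z.1, phi y (hull y z.1) - sg R b * depth y z.1).

Definition away y b z : V := (z.1 - (anchor y b z).1, z.2 - (anchor y b z).2).

(** Lengths are measured in the unsheared plane: at [mu = 1] the displacement exceeds the norm of
    [z] by [B + 1], which brings the point beyond the radius [B]. *)
Definition repel (s B mu : R) y b z : V :=
  let l := mu * (B + 1 + nrm (shear (- s) z)) / nrm (shear (- s) (away y b z)) in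
  (z.1 + l * (away y b z).1, z.2 + l * (away y b z).2).

Lemma repel0 s B y b z : repel s B 0 y b z = z.
Proof. by rewrite /repel !mul0r !addr0; case: z. Qed.

Lemma hull_cases y a : (0 < n)%N ->
  [\/ a < xmin y /\ hull y a = xmin y, [/\ xmin y <= a, a <= xmax y & hull y a = a] |
      xmax y < a /\ hull y a = xmax y].
Proof.
move=> n0; have mm : xmin y <= xmax y.
  exact: le_trans (xmin_le y (Ordinal n0)) (xmax_ge y (Ordinal n0)).
rewrite /hull; case: (ltP a (xmin y)) => [h|h].
  by constructor 1; split=> //; rewrite min_r ?max_l ?(ltW h) // (le_trans (ltW h)).
case: (ltP (xmax y) a) => [h'|h'].
  by constructor 3; split=> //; rewrite max_r.
by constructor 2; split=> //; rewrite max_r.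
Qed.

Lemma depth_ge0 y a : 0 <= depth y a. Proof. by rewrite le_max lexx. Qed.

(** Over the unbounded windows both sides repel from the same anchor. This matches the fact that
    these windows fix the root label. *)
Lemma repel_static_side y b z : (0 < n)%N -> (z.1 < xmin y) || (xmax y < z.1) ->
  anchor y b z = anchor y (~~ b) z.
Proof.
move=> n0 h; rewrite /anchor sgN; suff -> : depth y z.1 = 0 by rewrite !mulr0.
by rewrite /depth max_l // ge_min; case/orP: h => h; apply/orP; [left|right]; lra.
Qed.

Lemma away_neq0 y b z : (0 < n)%N -> cell y -> (forall k, z <> y k) -> 0 <= sg R b * height y z ->
  away y b z <> (0, 0).
Proof.
move=> n0 cy zy h0 [/eqP + /eqP]; rewrite /anchor /= !subr_eq0.
case: (hull_cases y z.1 n0) => [[l ->]|[l r ->] _|[r ->]]; try by case: ltgtP l; case: ltgtP r.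
- by move/eqP => e; rewrite e ltxx in l.
- move/eqP => e; have he : sg R b * height y z + depth y z.1 = 0.
    rewrite /height e; have := sgK b (depth y z.1); rewrite /sg; case: b {h0 e} => h; ring.
  have d0 := depth_ge0 y z.1.
  have hz : height y z = 0 by rewrite -(sgK b (height y z)) (_ : sg R b * height y z = 0) ?mulr0 //; lra.
  have na := height0_neq cy zy hz.
  have : depth y z.1 = 0 by lra.
  have [k ek] := xmin_attained y n0; have [k' ek'] := xmax_attained y n0.
  rewrite /depth => dz; have : Num.min (z.1 - xmin y) (xmax y - z.1) <= 0.
    by rewrite -[X in _ <= X]dz le_max lexx orbT.
  rewrite ge_min => /orP[] h.
    by have := na k; rewrite -ek; case/eqP; lra.
  by have := na k'; rewrite -ek'; case/eqP; lra.
- by move/eqP => e; rewrite e ltxx in r.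
Qed.

(** Over the hull the motion is vertical and away from the cut, which contains the points of [y];
    beside the hull the first coordinate only moves outwards. *)
Lemma repel_avoid s B mu y b z : (0 < n)%N -> cell y -> (forall k, z <> y k) ->
  0 <= sg R b * height y z -> 0 <= mu -> 0 <= B -> forall k, repel s B mu y b z <> y k.
Proof.
move=> n0 cy zy h0 mu0 B0 k; rewrite /repel; set l := _ / _ => e.
have l0 : 0 <= l by rewrite divr_ge0 ?nrm_ge0 // mulr_ge0 // !addr_ge0 ?nrm_ge0.
have e1 : z.1 + l * (away y b z).1 = (y k).1 by rewrite -e.
have e2 : z.2 + l * (away y b z).2 = (y k).2 by rewrite -e.
move: e1 e2; rewrite /away /anchor /=.
have k1 := xmin_le y k; have k2 := xmax_ge y k.
case: (hull_cases y z.1 n0) => [[lt ->]|[lt rt ->]|[rt ->]]; [nra| |nra].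
rewrite subrr mulr0 addr0 => e1 e2; have := phi_at k cy; rewrite -e1 => pk.
have d0 := depth_ge0 y z.1.
have {e2} he : sg R b * height y z + l * (sg R b * height y z + depth y z.1) = 0.
  by rewrite /height pk; move: e2; rewrite pk /sg; case: (b); lra.
have hz : height y z = 0.
  by rewrite -(sgK b (height y z)) (_ : sg R b * height y z = 0) ?mulr0 //; nra.
by have := height0_neq cy zy hz k; rewrite e1 eqxx.
Qed.

Lemma shear_lin s (l : R) z z' : shear s (z.1 + l * z'.1, z.2 + l * z'.2) =
  ((shear s z).1 + l * (shear s z').1, (shear s z).2 + l * (shear s z').2).
Proof. by rewrite /shear /=; congr (_, _); ring. Qed.

Lemma repel_far s B y b z : 0 <= B -> away y b z <> (0, 0) -> B < nrm (shear (- s) (repel s B 1 y b z)).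
Proof.
move=> B0 a0; have a0' : shear (- s) (away y b z) <> (0, 0).
  by move=> /(congr1 (shear s)); rewrite shearD subrr shear0 /shear /= mulr0 subr0; exact: a0.
have N0 := nrm_gt0 a0'.
rewrite /repel shear_lin; set l := _ / _; set z0 := shear _ z; set v := shear _ _.
have l0 : 0 <= l by rewrite divr_ge0 ?nrm_ge0 // mul1r !addr_ge0 ?nrm_ge0.
have lN : l * nrm v = B + 1 + nrm z0 by rewrite /l mul1r divfK // lt0r_neq0.
have := nrm_triangle (z0.1 + l * v.1, z0.2 + l * v.2) (- z0.1, - z0.2).
have -> : nrm (- z0.1, - z0.2) = nrm z0 by rewrite /nrm /= !sqrrN.
rewrite [X in nrm X <= _](_ : _ = (l * v.1, l * v.2)); last first.
  by congr (_, _); rewrite [LHS]addrC addKr.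
by rewrite nrm_scale // lN; lra.
Qed.

Lemma nrm_away (l : R) z0 c : 0 <= l -> nrm c <= nrm z0 ->
  nrm z0 <= nrm (z0.1 + l * (z0.1 - c.1), z0.2 + l * (z0.2 - c.2)).
Proof.
move=> l0 le; rewrite -(ler_pXn2r (n := 2)) ?nnegrE ?nrm_ge0 // !nrm_sq /=.
have cs := dot_le_nrm z0 c; have z00 := nrm_ge0 z0; have zz := nrm_sq z0.
have h : nrm z0 * nrm c <= nrm z0 ^+ 2 by rewrite expr2 ler_wpM2l.
have h2 : 0 <= z0.1 * (z0.1 - c.1) + z0.2 * (z0.2 - c.2) by lra.
have := mulr_ge0 l0 h2.
have := sqr_ge0 (l * (z0.1 - c.1)); have := sqr_ge0 (l * (z0.2 - c.2)).
by rewrite !sqrrD; lra.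
Qed.

Lemma repel_out s B mu y b z : 0 <= mu -> 0 <= B ->
  nrm (shear (- s) (anchor y b z)) <= nrm (shear (- s) z) ->
  nrm (shear (- s) z) <= nrm (shear (- s) (repel s B mu y b z)).
Proof.
move=> mu0 B0 le; rewrite /repel shear_lin; set l := _ / _; set z0 := shear _ z in le *.
have l0 : 0 <= l by rewrite divr_ge0 ?nrm_ge0 // mulr_ge0 // !addr_ge0 ?nrm_ge0.
set c := shear (- s) (anchor y b z) in le *.
have -> : shear (- s) (away y b z) = (z0.1 - c.1, z0.2 - c.2).
  by rewrite /away /z0 /c /shear /=; congr (_, _); ring.
exact: nrm_away.
Qed.

End Repulsion.

(** * The motion attached to a label *)

Section Push.
Variables (R : realType) (n : nat).
Local Notation V := (R * R)%type.
Local Notation Cfg := {ptws 'I_n -> V}.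
Implicit Types (x y : Cfg) (z : V) (a : R) (j : nat) (w : seq nat).

(* The crossing of the letter of depth [k] (counted from the root of the state) takes
   place for [sig] between [1 / (2 k + 2)] and [1 / (2 k)], the push to infinity for
   [sig] between [1 / 2] and [1]. *)
Definition amount (k : nat) (sig : R) : R :=
  clamp01 (2 * sig * k%:R * (k%:R + 1) - k%:R).

Definition final (sig : R) : R := Num.max 0 (2 * sig - 1).

Fixpoint escape (s B : R) y w b (sig : R) z : V :=
  if w is j :: w' then escape s B y w' (~~ b) sig (move y j b (amount (size w) sig) z)
  else repel s B (final sig) y b z.

Lemma amount_in k sig : 0 <= amount k sig <= 1. Proof. exact: clamp01_in. Qed.

(** The letter of depth [k] starts to cross exactly when that of depth [k.+1] has finished, so at
    most one motion is under way. *)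
Lemma amount_next k sig : amount k.+1 sig != 1 -> amount k sig = 0.
Proof.
rewrite /amount /clamp01 -[k.+1%:R]natr1; have k0 : 0 <= k%:R :> R := ler0n R k.
set u := _ - (k%:R + 1); set v := _ - k%:R => u1.
have ul : u < 1.
  by rewrite ltNge; apply: contra u1 => h; rewrite min_l // max_r.
have vl : v <= 0.
  have h1 : 2 * sig * (k%:R + 1) < 1.
    rewrite ltNge; apply/negP => h1.
    have : 0 <= (2 * sig * (k%:R + 1) - 1) * (k%:R + 2) by apply: mulr_ge0; lra.
    by move: ul; rewrite /u; lra.
  have : 0 <= k%:R * (1 - 2 * sig * (k%:R + 1)) by apply: mulr_ge0; lra.
  by rewrite /v; lra.
by rewrite min_r ?max_l //; lra.
Qed.

Lemma amount_final sig : amount 1 sig != 1 -> final sig = 0.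
Proof.
rewrite /amount /clamp01 /final mulr1 => u1.
have ul : 2 * sig * (1 + 1) - 1 < 1.
  by rewrite ltNge; apply: contra u1 => h; rewrite min_l // max_r.
by rewrite max_l //; lra.
Qed.

Lemma amount_late k sig : (0 < k)%N -> 2^-1 <= sig -> amount k sig = 1.
Proof.
move=> k0 h; rewrite /amount /clamp01; have k1 : 1 <= k%:R :> R by rewrite ler1n.
by rewrite min_l ?max_r //; nra.
Qed.

Lemma amount0 k : amount k 0 = 0.
Proof.
by rewrite /amount /clamp01 mulr0 !mul0r sub0r min_r ?max_l ?oppr_le0 //.
Qed.

Lemma final0 : final 0 = 0.
Proof. by rewrite /final mulr0 sub0r max_l ?oppr_le0. Qed.

Lemma final1 : final 1 = 1.
Proof. by rewrite /final mulr1 max_r; lra. Qed.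

Lemma escape_id s B y w b sig z : (forall k, (0 < k <= size w)%N -> amount k sig = 0) ->
  final sig = 0 -> escape s B y w b sig z = z.
Proof.
move=> am f0; elim: w b z am => [|j w IH] b z am /=; first by rewrite f0 repel0.
rewrite am ?leqnn // move0 IH // => k /andP[k0 kw]; apply: am.
by rewrite k0 (leq_trans kw).
Qed.

Lemma escape0 s B y w b z : escape s B y w b 0 z = z.
Proof. by apply: escape_id => [k _|]; rewrite ?amount0 ?final0. Qed.

Lemma amount_below k sig : amount k.+1 sig != 1 ->
  (forall k', (0 < k' <= k)%N -> amount k' sig = 0) /\ final sig = 0.
Proof.
have z1 : (0 : R) != 1 by rewrite eq_sym oner_neq0.
elim: k => [|k IH] h; first by split; [case=> // k' /andP[] | exact: amount_final].
have e := amount_next h; have [|am f0] := IH; first by rewrite e.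
split=> // k' /andP[k'0]; rewrite leq_eqVlt => /orP[/eqP -> //|k'k].
by apply: am; rewrite k'0.
Qed.

Lemma escape_avoid s B y w b sig z : (0 < n)%N -> cell y -> 0 <= B -> (forall k, z <> y k) ->
  0 <= sg R b * height y z -> forall k, escape s B y w b sig z <> y k.
Proof.
move=> n0 cy B0; elim: w b z => [|j w IH] b z zy h0 /=.
  by apply: repel_avoid => //; rewrite /final le_max lexx.
have av := move_avoid (j := j) cy zy h0 (amount_in (size w).+1 sig).
have [e|ne] := eqVneq (amount (size w).+1 sig) 1.
  by apply: IH => //; rewrite e; exact: move_side.
by have [am f0] := amount_below ne; rewrite escape_id.
Qed.

Lemma escape_far s B y w b z : (0 < n)%N -> cell y -> 0 <= B -> (forall k, z <> y k) ->
  0 <= sg R b * height y z -> B < nrm (shear (- s) (escape s B y w b 1 z)).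
Proof.
move=> n0 cy B0; elim: w b z => [|j w IH] b z zy h0 /=.
  by rewrite final1; apply: repel_far => //; exact: away_neq0.
have e : amount (size w).+1 1 = 1 by apply: amount_late => //; rewrite invf_le1 ?ler1n.
rewrite e; apply: IH; last exact: move_side.
by apply: move_avoid => //; rewrite ler01 lexx.
Qed.

Lemma repel_wall s B mu y b z j : (0 < n)%N -> (forall k, z.1 != (y k).1) -> rank y z.1 = j ->
  ends n j -> repel s B mu y b z = repel s B mu y (~~ b) z.
Proof.
move=> n0 na rj ej; suff e : anchor y b z = anchor y (~~ b) z by rewrite /repel /away e.
apply: repel_static_side => //.
have [k ek] := xmin_attained y n0; have [k' ek'] := xmax_attained y n0.
have win := rank_window na; rewrite rj in win.
case/orP: ej => /eqP ej.
  have := win k; rewrite /below ej ltn0 -ek => h.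
  by rewrite lt_def h andbT ek eq_sym na.
have := win k'; rewrite /below ej rank_point_ltn -ek' => h.
by rewrite orbC lt_def h andbT ek' na.
Qed.

(** Seen from the other side, a point of the cut has a label with one letter more or less, and
    crossing that letter does not move it. Since letters are timed from the root, the remaining ones
    keep their schedule. At the root, an unbounded window leaves the label unchanged, and both sides
    repel alike. *)
Lemma escape_wall s B y (v : Red (ends n)) b sig z : (0 < n)%N -> cell y -> (forall k, z <> y k) ->
  height y z = 0 ->
  escape s B y (val v) b sig z = escape s B y (val (kappa (rank y z.1) v)) (~~ b) sig z.
Proof.
move=> n0 cy zy h0; have na := height0_neq cy zy h0.
have win := rank_window na.
have st b' t : move y (rank y z.1) b' t z = z by exact: move_static.
case: v => -[|h w] vr /=.
  case: ifPn => ej /=; last by rewrite st negbK.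
  exact: repel_wall ej.
case: eqP => [->|_] /=; first by rewrite st.
by rewrite !st !negbK.
Qed.

End Push.

(** * Continuity of the motion *)

Section PushContinuity.
Variables (R : realType) (n : nat) (P : topologicalType) (p : P).
Local Notation V := (R * R)%type.
Local Notation Cfg := {ptws 'I_n -> V}.
Variable y : P -> Cfg.
Hypothesis yc : forall k, ct p (fun q => y q k).
Hypothesis cy : cell (y p).

Let y1 k : ct p (fun q => (y q k).1). Proof. exact: ct_fst (@yc k). Qed.

Lemma near_below : \forall q \near p, forall j k, below (y q) j k = below (y p) j k.
Proof.
have : \forall q \near p, forall l k, ((y q l).1 < (y q k).1) = ((y p l).1 < (y p k).1).
  apply: near_forall => l; apply: near_forall => k.
  case: (ltgtP (y p l).1 (y p k).1) => [h|h|/cy ->].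
  - exact: near_lt (@y1 l) (@y1 k) h.
  - by apply: filterS (near_lt (@y1 k) (@y1 l) h) => q h'; apply/negbTE; rewrite -leNgt ltW.
  - by near=> q; rewrite ltxx.
apply: filterS => q h j k; rewrite /below; congr (_ < _)%N.
by apply: eq_bigr => l _; rewrite h.
Unshelve. all: by end_near.
Qed.

Lemma ct_clamp j (a : P -> R) : ct p a -> ct p (fun q => clamp (y q) j (a q)).
Proof.
move=> ac; pose g q := \big[Num.min/(\big[Num.max/a q]_(k | below (y p) j k) (y q k).1)]_(k | ~~ below (y p) j k) (y q k).1.
apply: (@ct_near _ _ _ g).
  apply: filterS near_below => q h; rewrite /g /clamp.
  under [RHS]eq_bigl => k do rewrite h.
  apply: (congr1 (fun u => \big[Num.min/u]_(k | ~~ below (y p) j k) (y q k).1)).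
  by apply: eq_bigl => k; rewrite h.
rewrite /g; apply: ct_big => // [f f'|]; first exact: ct_min.
by apply: ct_big => // f f'; exact: ct_max.
Qed.

Lemma ct_span : ct p (fun q => span (y q)).
Proof. by apply: ct_add; [exact: ct_cst | apply: ct_sum => k; apply: ct_norm]. Qed.

Lemma ct_window_mid j : ct p (fun q => window_mid (y q) j).
Proof.
pose g q := (\big[Num.max/- span (y q)]_(k | below (y p) j k) (y q k).1 +
   \big[Num.min/span (y q)]_(k | ~~ below (y p) j k) (y q k).1) / 2.
have sc := ct_span.
apply: (@ct_near _ _ _ g).
  apply: filterS near_below => q h; rewrite /g /window_mid; congr (_ / _); congr (_ + _).
    by apply: eq_bigl => k; rewrite h.
  by apply: eq_bigl => k; rewrite h.
rewrite /g; apply: ct_mul; last exact: ct_cst.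
apply: ct_add; apply: ct_big => //; try exact: ct_opp; move=> f f'; [exact: ct_max | exact: ct_min].
Qed.

Lemma ct_xmin : ct p (fun q => xmin (y q)).
Proof. by apply: ct_big => // [f f'|]; [exact: ct_min | exact: ct_span]. Qed.

Lemma ct_xmax : ct p (fun q => xmax (y q)).
Proof. by apply: ct_big => // [f f'|]; [exact: ct_max | apply: ct_opp; exact: ct_span]. Qed.

Lemma ct_hull (a : P -> R) : ct p a -> ct p (fun q => hull (y q) (a q)).
Proof. by move=> ac; apply: ct_max; [exact: ct_xmin | apply: ct_min => //; exact: ct_xmax]. Qed.

Lemma ct_depth (a : P -> R) : ct p a -> ct p (fun q => depth (y q) (a q)).
Proof.
move=> ac; have h1 := ct_xmin; have h2 := ct_xmax.
by apply: ct_max; [exact: ct_cst | apply: ct_min; ctac].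
Qed.

Lemma ct_move j b (t : P -> R) (z : P -> V) : ct p t -> ct p z ->
  ct p (fun q => move (y q) j b (t q) (z q)).
Proof.
move=> tc zc; have z1 := ct_fst zc; have hc := ct_height (@yc) cy zc.
have cc := @ct_clamp j _ z1; have mc := @ct_window_mid j.
pose d q := sg R b * height (y q) (z q) + `|(z q).1 - clamp (y q) j (z q).1|.
have dc : ct p d by rewrite /d; apply: ct_add; [ctac | apply: ct_norm; ctac].
have nc := ct_norm dc.
have ic : ct p (fun q => (1 + `|d q|)^-1).
  by apply: ct_inv; [rewrite lt0r_neq0 // ltr_pwDl | ctac].
have tc1 : ct p (fun q => Num.min 1 (2 * t q)) by apply: ct_min; ctac.
have tc2 : ct p (fun q => Num.max 0 (2 * t q - 1)) by apply: ct_max; ctac.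
pose a q := (z q).1 + Num.min 1 (2 * t q) * (clamp (y q) j (z q).1 +
  `|d q| / (1 + `|d q|) * (window_mid (y q) j - clamp (y q) j (z q).1) - (z q).1).
have ac : ct p a by rewrite /a; ctac.
have pc := ct_phi (@yc) cy ac.
have -> : (fun q => move (y q) j b (t q) (z q)) = (fun q => (a q,
  sg R b * (sg R b * height (y q) (z q) + Num.min 1 (2 * t q) * d q -
    Num.max 0 (2 * t q - 1) * (sg R b * height (y q) (z q) + 2 * d q)) + phi (y q) (a q))) by [].
by ctac.
Qed.

Lemma ct_repel s b (B mu : P -> R) (z : P -> V) : ct p B -> ct p mu -> ct p z ->
  away (y p) b (z p) <> (0, 0) -> ct p (fun q => repel s (B q) (mu q) (y q) b (z q)).
Proof.
move=> Bc mc zc a0; have z1 := ct_fst zc; have z2 := ct_snd zc.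
have hc := ct_hull z1; have dc := ct_depth z1; have pc := ct_phi (@yc) cy hc.
have awc : ct p (fun q => away (y q) b (z q)).
  by rewrite /away /anchor /=; ctac.
have aw1 := ct_fst awc; have aw2 := ct_snd awc.
have sc (f : P -> V) : ct p f -> ct p (fun q => nrm (shear (- s) (f q))).
  by move=> fc; apply: ct_nrm; apply: ct_shear => //; exact: ct_cst.
have ic : ct p (fun q => (nrm (shear (- s) (away (y q) b (z q))))^-1).
  apply: ct_inv; last exact: sc.
  apply: lt0r_neq0; apply: nrm_gt0 => /(congr1 (shear s)); rewrite shearD subrr shear0.
  by rewrite /shear /= mulr0 subr0.
have zn := sc _ zc.
have lc : ct p (fun q => mu q * (B q + 1 + nrm (shear (- s) (z q))) /
  nrm (shear (- s) (away (y q) b (z q)))) by ctac.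
by rewrite /repel; ctac.
Qed.

Lemma ct_amount k (sig : P -> R) : ct p sig -> ct p (fun q => amount k (sig q)).
Proof. by move=> sc; apply: ct_clamp01; ctac. Qed.

Lemma ct_final (sig : P -> R) : ct p sig -> ct p (fun q => final (sig q)).
Proof. by move=> sc; apply: ct_max; ctac. Qed.

(** The repulsion is continuous only away from its anchor. Before time 1/2 it is at rest; afterwards
    all crossings are complete, and the point is on the side that keeps it off the anchor. *)
Lemma ct_escape s w b (B sig : P -> R) (z : P -> V) : (0 < n)%N -> ct p B -> ct p sig -> ct p z ->
  sig p < 2^-1 \/ (forall k, z p <> y p k) /\ 0 <= sg R b * height (y p) (z p) /\ 0 <= sig p <= 1 ->
  ct p (fun q => escape s (B q) (y q) w b (sig q) (z q)).
Proof.
move=> n0 Bc sc; elim: w b z => [|j w IH] b z zc /= H.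
  have [lt|ge] := ltP (sig p) 2^-1.
    apply: (ct_near _ zc).
    have := near_lt sc (@ct_cst P p R 2^-1) lt; apply: filterS => q hq.
    by rewrite (_ : final (sig q) = 0) ?repel0 // /final max_l //; lra.
  case: H => [|[zy [h0 _]]]; first by rewrite ltNge ge.
  by apply: ct_repel => //; [exact: ct_final | exact: away_neq0].
apply: IH; first by apply: ct_move => //; exact: ct_amount.
have [lt|ge] := ltP (sig p) 2^-1; first by left.
case: H => [|[zy [h0 s01]]]; first by rewrite ltNge ge.
right; rewrite amount_late //; split; last by split=> //; exact: move_side.
by apply: move_avoid => //; rewrite ler01 lexx.
Qed.

End PushContinuity.

Section PushLift.
Variables (R : realType) (n : nat) (P : topologicalType) (p : P).
Local Notation V := (R * R)%type.
Local Notation Cfg := {ptws 'I_n -> V}.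

Lemma ct_glue (Q : topologicalType) (g f1 f2 : P -> Q) : ct p f1 -> ct p f2 ->
  f1 p = g p -> f2 p = g p -> (\forall q \near p, g q = f1 q \/ g q = f2 q) -> ct p g.
Proof.
move=> c1 c2 e1 e2 h A Ag.
have h1 : \forall q \near p, A (f1 q) by apply: c1; rewrite e1.
have h2 : \forall q \near p, A (f2 q) by apply: c2; rewrite e2.
change (\forall q \near p, A (g q)).
by apply: filterS (filterI h (filterI h1 h2)) => q [[->|->] []].
Qed.

Definition pushed (s B : R) (y : Cfg) (v : Red (ends n)) (sig : R) (z : V) : V :=
  escape s B y (val v) (0 <= height y z) sig z.

Lemma sg_height (y : Cfg) z : 0 <= sg R (0 <= height y z) * height y z.
Proof. by rewrite /sg; case: (leP 0 (height y z)) => h; [rewrite mul1r | rewrite mulN1r oppr_ge0 ltW]. Qed.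

(** Near a point of the cut there are two branches, one for each side; both are continuous and, by
    [escape_wall], they agree at the point. *)
Lemma ct_pushed s (y : P -> Cfg) (v : P -> Red (ends n)) (B sig : P -> R) (z : P -> V) :
  (0 < n)%N -> (forall k, ct p (fun q => y q k)) -> cell (y p) -> ct p B -> ct p sig -> ct p z ->
  (forall k, z p <> y p k) -> 0 <= sig p <= 1 ->
  (\forall q \near p, v q = tau (@kappa (ends n)) (fun q => height (y q) (z q))
      (fun q => rank (y q) (z q).1) p q (v p)) ->
  ct p (fun q => pushed s (B q) (y q) (v q) (sig q) (z q)).
Proof.
move=> n0 yc cy Bc sc zc zy s01 vl; set b := 0 <= height (y p) (z p).
have hc := ct_height (@yc) cy zc.
have c1 : ct p (fun q => escape s (B q) (y q) (val (v p)) b (sig q) (z q)).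
  by apply: ct_escape => //; right; split=> //; split=> //; exact: sg_height.
have [h0|h0] := eqVneq (height (y p) (z p)) 0; last first.
  apply: (ct_near _ c1).
  have sn : \forall q \near p, (0 <= height (y q) (z q)) = b.
    rewrite /b; move: h0; rewrite neq_lt => /orP[h|h].
      have := near_lt hc (@ct_cst P p R 0) h.
      by apply: filterS => q h'; rewrite !leNgt h h'.
    have := near_lt (@ct_cst P p R 0) hc h.
    by apply: filterS => q h'; rewrite !ltW.
  by apply: filterS2 vl sn => q -> e; rewrite /tau /pushed e /b eqxx.
have bT : b = true by rewrite /b h0 lexx.
pose v' := kappa (rank (y p) (z p).1) (v p).
have c2 : ct p (fun q => escape s (B q) (y q) (val v') (~~ b) (sig q) (z q)).
  apply: ct_escape => //; right; split=> //; split=> //.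
  by rewrite h0 mulr0.
apply: (ct_glue c1 c2) => //.
  by rewrite /pushed -/b (escape_wall s (B p) (v p) b (sig p) n0 cy zy h0).
apply: filterS vl => q; rewrite /tau /pushed -/b bT; case: (0 <= height (y q) (z q)) => /= ->.
  by left.
by right.
Qed.

End PushLift.

(** * Independence of the numbering *)

Section Symmetry.
Variables (R : realType) (n : nat).
Local Notation V := (R * R)%type.
Local Notation Cfg := {ptws 'I_n -> V}.
Variables (y : Cfg) (p : 'S_n).
Let yp : Cfg := fun k => y (p k).

Lemma gap_perm : gap yp = gap y.
Proof.
rewrite /gap [RHS](reindex_inj (h := fun q : 'I_n * 'I_n => (p q.1, p q.2))) /=.
  by apply: eq_bigl => -[j k] /=; rewrite (inj_eq perm_inj).
by move=> [a b] [c d] /= [/perm_inj -> /perm_inj ->].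
Qed.

Lemma phi_perm a : phi yp a = phi y a.
Proof. by have := @height_perm R n y p (a, 0); rewrite /height /= !sub0r => /oppr_inj. Qed.

Lemma below_perm j k : below yp j k = below y j (p k).
Proof. by rewrite /below rank_perm. Qed.

Lemma span_perm : span yp = span y.
Proof. by rewrite /span [in RHS](reindex_inj (@perm_inj _ p)). Qed.

Lemma clamp_perm j a : clamp yp j a = clamp y j a.
Proof.
rewrite /clamp [RHS](reindex_inj (@perm_inj _ p)).
rewrite [X in \big[_/X]_(_ | _) _ = \big[_/_]_(_ | _) _](_ : _ = \big[Num.max/a]_(k | below y j k) (y k).1).
  by apply: eq_bigl => k; rewrite below_perm.
rewrite [RHS](reindex_inj (@perm_inj _ p)).
by apply: eq_bigl => k; rewrite below_perm.
Qed.

Lemma window_mid_perm j : window_mid yp j = window_mid y j.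
Proof.
rewrite /window_mid span_perm; congr ((_ + _) / _).
  by rewrite [RHS](reindex_inj (@perm_inj _ p)); apply: eq_bigl => k; rewrite below_perm.
by rewrite [RHS](reindex_inj (@perm_inj _ p)); apply: eq_bigl => k; rewrite below_perm.
Qed.

Lemma xmin_perm : xmin yp = xmin y.
Proof. by rewrite /xmin span_perm [RHS](reindex_inj (@perm_inj _ p)). Qed.

Lemma xmax_perm : xmax yp = xmax y.
Proof. by rewrite /xmax span_perm [RHS](reindex_inj (@perm_inj _ p)). Qed.

Lemma away_perm b z : away yp b z = away y b z.
Proof. by rewrite /away /anchor /hull /depth xmin_perm xmax_perm phi_perm. Qed.

Lemma pushed_perm s B (v : Red (ends n)) sig z : pushed s B yp v sig z = pushed s B y v sig z.
Proof.
rewrite /pushed height_perm; move: (0 <= height y z) => b; elim: (val v) b z => [|j w IH] b z /=.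
  by rewrite /repel away_perm.
rewrite IH; congr escape; rewrite /move height_perm clamp_perm window_mid_perm.
by rewrite phi_perm.
Qed.

End Symmetry.

Section Evaluation.
Variables (R : realType) (n : nat).
Local Notation V := (R * R)%type.
Local Notation Cfg := {ptws 'I_n -> V}.

Lemma ct_eval (x : Cfg) k : ct x (fun x => x k).
Proof. exact: (@proj_continuous _ (fun=> V) k x). Qed.

Lemma gap_eq0 (y : Cfg) : ~ cell y -> gap y = 0.
Proof.
move=> nc; apply/eqP; rewrite eq_le; apply/andP; split; last first.
  by apply: (big_ind (fun u => 0 <= u)) => // u v u0 v0; rewrite le_min u0.
rewrite leNgt; apply/negP => g0; apply: nc => j k /= e.
apply/eqP/negPn/negP => jk; have := gap_le y jk.
by rewrite /= e subrr normr0 leNgt g0.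
Qed.

Lemma shearK s z : shear (- s) (shear s z) = z :> V.
Proof. by rewrite shearD addNr shear0. Qed.

End Evaluation.

(** * Loops near infinity *)

Section Far.
Variables (R : realType) (n : nat).
Local Notation V := (R * R)%type.
Local Notation Cfg := {ptws 'I_n -> V}.
Implicit Types (x : Cfg) (z : V).

Definition shears : nat := (n * n).+1.
Definition shear_of (s : 'I_shears) : R := (s : nat)%:R.

Definition size_of x : R := \sum_k (`|(x k).1| + `|(x k).2|).

(* A multiple of the size of the configuration beyond which the cuts of all the shears
   have only the letters [0] and [n]. *)
Definition far_radius x : R := 4 * shears%:R ^+ 2 * size_of x.

Lemma size_of_ge x k : `|(x k).1| + `|(x k).2| <= size_of x.
Proof.
rewrite /size_of (bigD1 k) //= lerDl; apply: sumr_ge0 => j _.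
by rewrite addr_ge0 ?normr_ge0.
Qed.

Lemma size_of_ge0 x : 0 <= size_of x.
Proof. by apply: sumr_ge0 => j _; rewrite addr_ge0 ?normr_ge0. Qed.

Lemma far_radius_ge0 x : 0 <= far_radius x.
Proof. by rewrite mulr_ge0 ?size_of_ge0 // mulr_ge0 ?sqr_ge0 //; lra. Qed.

Lemma far_radius_perm x (p : 'S_n) : far_radius (fun k => x (p k)) = far_radius x.
Proof. by rewrite /far_radius /size_of [in RHS](reindex_inj (@perm_inj _ p)). Qed.

Lemma ct_far_radius x : ct x far_radius.
Proof.
apply: ct_mul; first exact: ct_cst.
apply: ct_sum => k; have h := @ct_eval R n x k; have h1 := ct_fst h; have h2 := ct_snd h.
by ctac.
Qed.

Section OneShear.
Variables (x : Cfg) (s : 'I_shears).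
Hypotheses (n0 : (0 < n)%N) (cx : cell (slant (shear_of s) x)).
Local Notation y := (slant (shear_of s) x).
Local Notation S := (shear_of s).
Local Notation M := (size_of x).

Let S0 : 0 <= S. Proof. by rewrite /shear_of ler0n. Qed.
Let SK : S + 1 <= shears%:R. Proof. by rewrite /shear_of natr1 ler_nat. Qed.

Lemma slant_le k : `|(y k).1| <= (S + 1) * M.
Proof.
have h := size_of_ge x k; have a0 := normr_ge0 (x k).1; have b0 := normr_ge0 (x k).2.
apply: le_trans (ler_normB _ _) _; rewrite normrM (ger0_norm S0).
have M0 := size_of_ge0 x; have h1 : S * `|(x k).2| <= S * M by rewrite ler_wpM2l //; lra.
lra.
Qed.

Lemma phi_le a : `|phi y a| <= M.
Proof.
apply: le_trans (phi_bound a cx) _; apply: ler_sum => k _ /=.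
by rewrite lerDr normr_ge0.
Qed.

Lemma hull_le a : `|hull y a| <= (S + 1) * M.
Proof.
have [k ek] := xmin_attained y n0; have [k' ek'] := xmax_attained y n0.
have := slant_le k; have := slant_le k'; rewrite -ek -ek' !ler_norml.
by case: (hull_cases y a n0) => [[? ->]|[? ? ->]|[? ->]]; lra.
Qed.

Lemma depth_le a : depth y a <= 2 * (S + 1) * M.
Proof.
have [k ek] := xmin_attained y n0; have [k' ek'] := xmax_attained y n0.
have := slant_le k; have := slant_le k'; rewrite -ek -ek' !ler_norml => h1 h2.
rewrite /depth ge_max ge_min; have M0 := size_of_ge0 x.
have : 0 <= (S + 1) * M by rewrite mulr_ge0 //; have := S0; lra.
move=> h3; apply/andP; split; first by lra.
have [h|h] := leP a (xmax y); apply/orP; [left|right]; lra.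
Qed.

Lemma unshear_le z : nrm (shear (- S) z) <= `|z.1| + (S + 1) * `|z.2|.
Proof.
apply: le_trans (nrm_le_l1 _) _; rewrite /shear /= mulNr opprK.
apply: le_trans (lerD (ler_normD _ _) (lexx _)) _; rewrite normrM (ger0_norm S0).
lra.
Qed.

Lemma radius_bound : (S + 1) * M + (S + 1) * (M + 2 * (S + 1) * M) <= far_radius x.
Proof.
have M0 := size_of_ge0 x; rewrite /far_radius; have s1 := SK; have s0 := S0.
have h : (S + 1) ^+ 2 <= shears%:R ^+ 2 by rewrite lerXn2r // nnegrE; lra.
have h' : (S + 1) ^+ 2 * M <= shears%:R ^+ 2 * M by rewrite ler_wpM2r.
have h2 : (S + 1) * M <= (S + 1) ^+ 2 * M.
  by rewrite ler_wpM2r // expr2 ler_peMl //; lra.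
lra.
Qed.

Lemma anchor_le b z : nrm (shear (- S) (anchor y b z)) <= far_radius x.
Proof.
apply: le_trans (unshear_le _) _; apply: le_trans radius_bound; rewrite /anchor /=.
apply: lerD; first exact: hull_le.
rewrite ler_wpM2l //; first by have := S0; lra.
apply: le_trans (ler_normB _ _) _; apply: lerD; first exact: phi_le.
rewrite normrM (ger0_norm (depth_ge0 y z.1)).
rewrite (_ : `|sg R b| = 1) ?mul1r ?depth_le // /sg; case: b => //.
  by rewrite normr1.
by rewrite normrN1.
Qed.

(** On the cut the second coordinate is bounded, so a far point has a first coordinate beyond all
    those of the configuration. *)
Lemma far_wall z : (forall k, z <> x k) -> far_radius x < nrm z ->
  height y (shear S z) = 0 -> ends n (rank y (shear S z).1).
Proof.
move=> zx zf h0; set z' := shear S z in h0 *; have M0 := size_of_ge0 x.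
have zy k : z' <> y k by move=> /shear_inj; exact: zx.
have na := height0_neq cx zy h0; have win := rank_window na.
have b2 : `|z'.2| <= M.
  by move: h0; rewrite /height => /eqP; rewrite subr_eq0 => /eqP ->; exact: phi_le.
have bz : nrm z <= `|z'.1| + (S + 1) * M.
  have := unshear_le z'; rewrite /z' shearK -/z' => h; apply: le_trans h _.
  by rewrite lerD2l ler_wpM2l //; have := S0; lra.
have rb := radius_bound.
have b1 : (S + 1) * M < `|z'.1|.
  have : 0 <= (S + 1) * (2 * (S + 1) * M) by have s0 := S0; rewrite !mulr_ge0 //; lra.
  lra.
move: b1; rewrite lter_normr => /orP[] b1; rewrite /ends; apply/orP; [right|left].
  rewrite eqn_leq rank_le_n /=; rewrite -[X in (X <= _)%N]card_ord -sum1_card; apply: leq_sum => k _.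
  suff -> : (y k).1 < z'.1 by [].
  by have := slant_le k; rewrite ler_norml; lra.
rewrite /rank big1 // => k _; apply/eqP; rewrite eqb0 -leNgt.
by have := slant_le k; rewrite ler_norml; lra.
Qed.

Lemma far_carries (g : R -> V) : (forall t : R, ct t g) -> (forall t k, g t <> x k) ->
  (forall t, 0 <= t <= 1 -> far_radius x < nrm (g t)) ->
  carries (@kappa (ends n)) (fun t => height y (shear S (g t)))
    (fun t => rank y (shear S (g t)).1) (red_nil (ends n)) (red_nil (ends n)).
Proof.
move=> gc gx gf; exists (fun=> red_nil (ends n)); split=> // t t01.
have [h0|h0] := eqVneq (height y (shear S (g t))) 0.
  near=> t' => _; rewrite /tau; case: ifP => // _; apply: val_inj => /=.
  by rewrite (far_wall (gx t) (gf t t01) h0).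
have hc : ct t (fun t => height y (shear S (g t))).
  apply: (@ct_height _ _ _ t (fun=> y)) => //; first by move=> k; exact: ct_cst.
  by apply: ct_shear; [exact: ct_cst | exact: gc].
have sn : \forall t' \near t, (0 <= height y (shear S (g t'))) = (0 <= height y (shear S (g t))).
  move: h0; rewrite neq_lt => /orP[h|h].
    have := near_lt hc (@ct_cst R t R 0) h.
    by apply: filterS => q h'; rewrite !leNgt h h'.
  have := near_lt (@ct_cst R t R 0) hc h.
  by apply: filterS => q h'; rewrite !ltW.
by apply: filterS sn => t' e _; rewrite /tau e eqxx.
Unshelve. all: by end_near.
Qed.

End OneShear.
End Far.
(** * Pushing a section to infinity *)

Section Homotopies.
Variables (R : realType) (n : nat).
Local Notation V := (R * R)%type.
Local Notation Cfg := {ptws 'I_n -> V}.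
Implicit Types (f g : Cfg -> V) (F G : R -> Cfg -> V).

Definition section_homotopy F :=
  (forall (t : R) (x : Cfg), injective x -> ct (t, x) (fun q : R * Cfg => F q.1 q.2)) /\
  forall t, planar_section (F t).

Definition homotopic f g := exists F, [/\ section_homotopy F, F 0 = f & F 1 = g].

Lemma homotopic_refl f : planar_section f -> homotopic f f.
Proof.
move=> fs; exists (fun=> f); split=> //; split=> // t x xi.
exact: (ct_comp (ct_snd (@ct_id _ (t, x))) (psec_cont fs xi)).
Qed.

Lemma homotopic_trans f g h : homotopic f g -> homotopic g h -> homotopic f h.
Proof.
move=> [F [[Fc Fs] F0 F1]] [G [[Gc Gs] G0 G1]].
pose H t := if t <= 2^-1 then F (2 * t) else G (2 * t - 1).
exists H; split; last 2 first.
- by rewrite /H invr_ge0 ler0n mulr0.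
- rewrite /H leNgt invf_lt1 ?ltr1n // mulr1 (_ : 2 - 1 = 1) //; lra.
split=> [t x xi|t]; last by rewrite /H; case: ifP.
have tc : ct (t, x) (fun q : R * Cfg => q.1) by exact: ct_fst (@ct_id _ (t, x)).
have xc : ct (t, x) (fun q : R * Cfg => q.2) by exact: ct_snd (@ct_id _ (t, x)).
have c1 : ct (t, x) (fun q : R * Cfg => F (2 * q.1) q.2).
  have h1 : ct (t, x) (fun q : R * Cfg => (2 * q.1, q.2)) by apply: ct_pair => //; ctac.
  exact: (ct_comp h1 (Fc (2 * t) x xi)).
have c2 : ct (t, x) (fun q : R * Cfg => G (2 * q.1 - 1) q.2).
  have h1 : ct (t, x) (fun q : R * Cfg => (2 * q.1 - 1, q.2)) by apply: ct_pair => //; ctac.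
  exact: (ct_comp h1 (Gc (2 * t - 1) x xi)).
case: (ltgtP t 2^-1) => [lt|gt|e].
- apply: (ct_near _ c1); have := near_lt tc (@ct_cst _ (t, x) R 2^-1) lt.
  by apply: filterS => q lq; rewrite /H ltW.
- apply: (ct_near _ c2); have := near_lt (@ct_cst _ (t, x) R 2^-1) tc gt.
  by apply: filterS => q lq; rewrite /H leNgt lq.
apply: (ct_glue c1 c2) => /=; rewrite /H e ?lexx //.
  by rewrite mulfV // subrr F1 G0.
by near=> q; case: ifP => _; [left | right].
Unshelve. all: by end_near.
Qed.

Lemma ct_curry F (s : R) (x : Cfg) : ct (s, x) (fun q : R * Cfg => F q.1 q.2) -> ct x (F s).
Proof.
move=> c; have h : ct x (fun y : Cfg => (s, y)) by apply: ct_pair; [exact: ct_cst | exact: ct_id].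
exact: (ct_comp h c).
Qed.

End Homotopies.

Section Weights.
Variables (R : realType) (n : nat).
Local Notation V := (R * R)%type.
Local Notation Cfg := {ptws 'I_n -> V}.
Implicit Types (x : Cfg) (s : 'I_(shears n)).

Definition max_gap x : R := \big[Num.max/0]_(s : 'I_(shears n)) gap (slant (shear_of R s) x).

(** It vanishes when the gap is at most one third of the largest one, hence near the bad
    configurations of the shear, and equals 1 from two thirds on, hence for the best shear. *)
Definition weight s x : R := clamp01 (3 * gap (slant (shear_of R s) x) / max_gap x - 1).

Lemma cell_gap (y : Cfg) : 0 < gap y -> cell y.
Proof. by move=> g0; apply: contrapT => /gap_eq0 e; rewrite e ltxx in g0. Qed.

Lemma ct_slant (S : R) x k : ct x (fun x : Cfg => slant S x k).
Proof. by apply: ct_shear; [exact: ct_cst | exact: ct_eval]. Qed.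

Lemma ct_slant_gap (S : R) x : ct x (fun x : Cfg => gap (slant S x)).
Proof. by apply: (@ct_gap _ _ _ x (fun x : Cfg => slant S x)) => k; exact: ct_slant. Qed.

Lemma max_gap_attained x : injective x ->
  exists s, [/\ 0 < max_gap x, max_gap x = gap (slant (shear_of R s) x) & cell (slant (shear_of R s) x)].
Proof.
move=> xi; have [s0 c0] := generic_shear xi.
have [s _ hs] := arg_maxP (P := predT) (i0 := s0) (fun s => gap (slant (shear_of R s) x)) isT.
have g0 : 0 < gap (slant (shear_of R s) x) by apply: lt_le_trans (gap_gt0 c0) (hs s0 isT).
have e : max_gap x = gap (slant (shear_of R s) x).
  apply/eqP; rewrite eq_le (proj2 (bigmax_ge predT _ 0)) // andbT.
  apply: (big_ind (fun u => u <= _)); first exact: ltW.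
    by move=> u v ku kv; rewrite ge_max ku.
  by move=> s' _; exact: hs.
by exists s; split=> //; [rewrite e | exact: cell_gap].
Qed.

Lemma ct_weight_arg s x : injective x ->
  ct x (fun x : Cfg => 3 * gap (slant (shear_of R s) x) / max_gap x - 1).
Proof.
move=> xi; have [_ [g0 _ _]] := max_gap_attained xi.
have gc := @ct_slant_gap (shear_of R s) x.
have mc : ct x max_gap.
  apply: ct_big => [f g|| s']; [exact: ct_max | exact: ct_cst | exact: ct_slant_gap].
have ic := ct_inv (lt0r_neq0 g0) mc.
by ctac.
Qed.

Lemma weight_ct s x : injective x -> ct x (weight s).
Proof. by move=> xi; apply: ct_clamp01; exact: ct_weight_arg. Qed.

Lemma weight_near0 s x : injective x -> ~ cell (slant (shear_of R s) x) ->
  \forall x' \near x, weight s x' = 0.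
Proof.
move=> xi nc; have c := @ct_weight_arg s x xi.
have lt : 3 * gap (slant (shear_of R s) x) / max_gap x - 1 < 0.
  by rewrite gap_eq0 // mulr0 mul0r sub0r oppr_lt0.
have := near_lt c (@ct_cst _ x R 0) lt; apply: filterS => x' h.
by rewrite /weight /clamp01 min_r ?max_l //; [exact: ltW | apply: ltW; apply: lt_trans h _; lra].
Qed.

Lemma weight1 x : injective x -> exists s, weight s x = 1 /\ cell (slant (shear_of R s) x).
Proof.
move=> xi; have [s [g0 e c]] := max_gap_attained xi; exists s; split=> //.
rewrite /weight -e mulfK ?lt0r_neq0 // /clamp01 min_l ?max_r //; lra.
Qed.

Lemma weight_perm s x (p : 'S_n) : weight s (fun k => x (p k)) = weight s x.
Proof.
rewrite /weight; have e (S : R) : gap (slant S (fun k => x (p k))) = gap (slant S x).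
  exact: (gap_perm (slant S x) p).
by rewrite e /max_gap; under eq_bigr do rewrite e.
Qed.

End Weights.

Section State.
Variables (R : realType) (n : nat).
Local Notation V := (R * R)%type.
Local Notation Cfg := {ptws 'I_n -> V}.
Variable f : Cfg -> V.

Definition state (S : R) (x : Cfg) : Red (ends n) :=
  if pselect (exists v, closing f S x v) is left e then projT1 (cid e) else red_nil (ends n).

Hypotheses (n2 : (2 < n)%N) (fs : planar_section f).

Lemma stateP (S : R) x v : cell (slant S x) -> closing f S x v <-> v = state S x.
Proof.
move=> cx; have [v0 hv0] := closing_unique n2 fs cx.
rewrite /state; case: pselect => [e|ne]; last by case: ne; exists v0; apply/hv0.
by case: cid => v1 /= /hv0 ->; exact: hv0.
Qed.

Lemma near_cell (S : R) (x : Cfg) : cell (slant S x) -> \forall x' \near x, cell (slant S x').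
Proof.
move=> cx; have := near_lt (@ct_cst _ x R 0) (@ct_slant_gap R n S x) (gap_gt0 cx).
by apply: filterS => x'; exact: cell_gap.
Qed.

(** The closing label transported to a nearby configuration is again closing, and uniqueness
    identifies it. *)
Lemma state_near (S : R) (x : Cfg) : cell (slant S x) ->
  \forall x' \near x, state S x' = tau (@kappa (ends n))
    (fun x => height (slant S x) (shear S (f x)))
    (fun x => rank (slant S x) (shear S (f x)).1) x x' (state S x).
Proof.
move=> cx; have xi := slant_cell_inj cx.
pose bet (q : Cfg * R) := height (slant S q.1) (shear S (uloop f q.1 q.2)).
pose idx (q : Cfg * R) := rank (slant S q.1) (shear S (uloop f q.1 q.2)).1.
have ok (t : R) : 0 <= t <= 1 -> cut_ok bet idx (x, t).
  move=> _; apply: (@cut_ok_planar R n _ (x, t) (fun q => slant S q.1)) => //.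
  - move=> k; exact: (ct_comp (ct_fst (@ct_id _ (x, t))) (@ct_slant R n S x k)).
  - apply: ct_shear; first exact: ct_cst.
    apply: (@ct_uloop R n f fs _ (x, t) fst snd) => //.
      by move=> k; exact: (ct_comp (ct_fst (@ct_id _ (x, t))) (@ct_eval R n x k)).
    exact: ct_snd (@ct_id _ (x, t)).
  - by move=> k /shear_inj; exact: (uloop_avoid fs).
have cl : closing f S x (state S x) by apply/stateP.
have := carries_near (@kappaK (ends n)) ok cl.
apply: filterS2 (near_cell cx) => x' cx' h; symmetry; apply/(stateP _ cx').
have b0 z : bet (z, 0) = height (slant S z) (shear S (f z)) by rewrite /bet uloop0.
have b1 z : bet (z, 1) = height (slant S z) (shear S (f z)) by rewrite /bet uloop1.
have i0 z : idx (z, 0) = rank (slant S z) (shear S (f z)).1 by rewrite /idx uloop0.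
have i1 z : idx (z, 1) = rank (slant S z) (shear S (f z)).1 by rewrite /idx uloop1.
by move: h; rewrite /closing /tau !b0 !b1 i0 i1.
Qed.

Lemma state_perm (S : R) (x : Cfg) (p : 'S_n) : cell (slant S x) ->
  state S (fun k => x (p k)) = state S x.
Proof.
move=> cx; have cx' : cell (slant S (fun k => x (p k))) by move=> j k /cx /perm_inj.
symmetry; apply/(stateP _ cx').
have := proj2 (stateP (state S x) cx) erefl; rewrite /closing.
have e1 t : height (slant S (fun k => x (p k))) (shear S (uloop f (fun k => x (p k)) t)) =
    height (slant S x) (shear S (uloop f x t)).
  by rewrite (@uloop_perm R n f fs x p t); exact: (height_perm (slant S x) p).
have e2 t : rank (slant S (fun k => x (p k))) (shear S (uloop f (fun k => x (p k)) t)).1 =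
    rank (slant S x) (shear S (uloop f x t)).1.
  by rewrite (@uloop_perm R n f fs x p t); exact: (rank_perm (slant S x) p).
by move: e1 e2 => /funext -> /funext ->.
Qed.

End State.

(** * One stage of the push, for one shear *)

Section Stage.
Variables (R : realType) (n : nat).
Local Notation V := (R * R)%type.
Local Notation Cfg := {ptws 'I_n -> V}.
Variables (f : Cfg -> V) (s : 'I_(shears n)).
Hypotheses (n2 : (2 < n)%N) (fs : planar_section f).
Local Notation S := (shear_of R s).

Let n0 : (0 < n)%N. Proof. exact: ltn_trans n2. Qed.

Definition stage (sig : R) (x : Cfg) : V :=
  shear (- S) (pushed S (far_radius x) (slant S x) (state f S x) (clamp01 sig * weight s x)
    (shear S (f x))).

Lemma stage_id sig x : clamp01 sig * weight s x = 0 -> stage sig x = f x.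
Proof. by move=> e; rewrite /stage /pushed e escape0 shearK. Qed.

Lemma weight_notcell (x : Cfg) : ~ cell (slant S x) -> weight s x = 0.
Proof.
move=> nc; rewrite /weight gap_eq0 // mulr0 mul0r /clamp01 sub0r min_r ?max_l //; lra.
Qed.

Lemma slant_avoid (x : Cfg) : injective x -> forall k, shear S (f x) <> slant S x k.
Proof. by move=> xi k /shear_inj; exact: (psec_avoid fs xi). Qed.

Lemma push_amount_in (sig : R) (x : Cfg) : 0 <= clamp01 sig * weight s x <= 1.
Proof.
have /andP[a0 a1] := clamp01_in sig; have /andP[b0 b1] : 0 <= weight s x <= 1 := clamp01_in _.
by rewrite mulr_ge0 //= mulr_ile1.
Qed.

Lemma ct_stage (sig : R) (x : Cfg) : injective x ->
  ct (sig, x) (fun q : R * Cfg => stage q.1 q.2).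
Proof.
move=> xi.
have sc : ct (sig, x) (fun q : R * Cfg => q.1) by exact: ct_fst (@ct_id _ (sig, x)).
have xc : ct (sig, x) (fun q : R * Cfg => q.2) by exact: ct_snd (@ct_id _ (sig, x)).
have fc : ct (sig, x) (fun q : R * Cfg => f q.2) := ct_comp xc (psec_cont fs xi).
have wc : ct (sig, x) (fun q : R * Cfg => weight s q.2) := ct_comp xc (@weight_ct R n s x xi).
have [cx|nc] := pselect (cell (slant S x)); last first.
  apply: (ct_near _ fc); have := xc _ (@weight_near0 R n s x xi nc).
  by move=> h; near=> q; rewrite stage_id // (_ : weight s q.2 = 0) ?mulr0 //; near: q.
apply: ct_shear; first exact: ct_cst.
apply: (@ct_pushed R n _ (sig, x) S (fun q => slant S q.2) (fun q => state f S q.2)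
   (fun q => far_radius q.2) (fun q => clamp01 q.1 * weight s q.2) (fun q => shear S (f q.2))) => //.
- by move=> k; exact: (ct_comp xc (@ct_slant R n S x k)).
- exact: (ct_comp xc (@ct_far_radius R n x)).
- by apply: ct_mul => //; exact: ct_clamp01.
- by apply: ct_shear; first exact: ct_cst.
- exact: slant_avoid.
- exact: push_amount_in.
- exact: (xc _ (state_near n2 fs cx)).
Unshelve. all: by end_near.
Qed.

Lemma stage_avoid (sig : R) (x : Cfg) k : injective x -> stage sig x <> x k.
Proof.
move=> xi; have [cx|nc] := pselect (cell (slant S x)); last first.
  by rewrite stage_id ?weight_notcell ?mulr0 //; exact: (psec_avoid fs).
move=> /(congr1 (shear S)); rewrite /stage shearD subrr shear0.
apply: escape_avoid => //; [exact: far_radius_ge0 | exact: slant_avoid | exact: sg_height].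
Qed.

Lemma stage_section sig : planar_section (stage sig).
Proof.
split=> [x xi|x p|x k xi]; [| |exact: stage_avoid].
  apply: (@ct_curry R n stage sig x); exact: ct_stage.
rewrite /stage (weight_perm s x p) far_radius_perm (psec_sym fs).
have [cx|nc] := pselect (cell (slant S x)).
  rewrite (@state_perm R n f n2 fs S x p cx).
  by rewrite (@pushed_perm R n (slant S x) p).
by rewrite weight_notcell // mulr0 /pushed !escape0.
Qed.

Lemma stage_homotopy : section_homotopy stage.
Proof. by split=> [t x xi|t]; [exact: ct_stage | exact: stage_section]. Qed.

Lemma stage0 : stage 0 = f.
Proof.
by apply/funext => x; apply: stage_id; rewrite clamp01_id ?mul0r // lexx ler01.
Qed.

(** The loops of the intermediate sections form a free homotopy whose base point follows
    [stage u x], and a closing label is carried along with it. *)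
Lemma stage_loop (x : Cfg) (S' : R) v c : cell (slant S' x) ->
  closing f S' x v ->
  carries (@kappa (ends n)) (fun u => height (slant S' x) (shear S' (stage u x)))
    (fun u => rank (slant S' x) (shear S' (stage u x)).1) v c ->
  closing (stage 1) S' x c.
Proof.
move=> cx cl hb; have xi := slant_cell_inj cx.
pose g (q : R * R) := uloop (stage q.1) x q.2.
have gc (q : R * R) : ct q g.
  have q2 : ct q (fun q : R * R => q.2) := ct_snd (@ct_id _ q).
  apply: ct_rot; first by ctac.
  have tc : ct q (fun q : R * R => turn q.2 x : Cfg).
    apply: ct_ptws => k; apply: ct_rot; last exact: ct_cst.
    by ctac.
  have pc : ct q (fun q : R * R => (q.1, turn q.2 x : Cfg)).
    by apply: ct_pair => //; exact: ct_fst (@ct_id _ q).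
  have sc := @ct_stage q.1 (turn q.2 x) (turn_inj xi).
  exact: (ct_comp pc sc).
have ok u t : 0 <= u <= 1 -> 0 <= t <= 1 -> cut_ok (fun q : R * R => height (slant S' x) (shear S' (g q)))
    (fun q => rank (slant S' x) (shear S' (g q)).1) (u, t).
  move=> _ _; apply: (@cut_ok_planar R n _ (u, t) (fun=> slant S' x)) => //.
  - by move=> k; exact: ct_cst.
  - by apply: ct_shear; [exact: ct_cst | exact: gc].
  - by move=> k /shear_inj; exact: (uloop_avoid (stage_section u)).
have g0 u : g (u, 0) = stage u x by rewrite /g uloop0.
have g1 u : g (u, 1) = stage u x by rewrite /g uloop1.
have per u : 0 <= u <= 1 -> height (slant S' x) (shear S' (g (u, 0))) = height (slant S' x) (shear S' (g (u, 1))) /\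
    rank (slant S' x) (shear S' (g (u, 0))).1 = rank (slant S' x) (shear S' (g (u, 1))).1.
  by rewrite g0 g1.
apply: (loop_homotopy (@kappaK (ends n)) ok per (s := v) (s' := v)).
- by apply: carries_ext cl => t _; rewrite /g stage0.
- by apply: carries_ext hb => u _; rewrite g0.
- by apply: carries_ext hb => u _; rewrite g0.
Qed.

Definition far_section (g : Cfg -> V) (x : Cfg) := far_radius x < nrm (g x) /\
  forall s' : 'I_(shears n), cell (slant (shear_of R s') x) -> closing g (shear_of R s') x (red_nil (ends n)).

Lemma stage_path (x : Cfg) : injective x -> (forall u : R, ct u (fun u => stage u x)) /\
  forall u k, stage u x <> x k.
Proof.
move=> xi; split=> [u|u k]; last exact: stage_avoid.
have h : ct u (fun u : R => (u, x)) by apply: ct_pair; [exact: ct_id | exact: ct_cst].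
have sc := @ct_stage u x xi.
exact: (ct_comp h sc).
Qed.

(** A far point with the root label undergoes only the repulsion, which never brings it nearer; what
    earlier stages have achieved is kept. *)
Lemma stage_keeps (x : Cfg) : injective x -> far_section f x -> far_section (stage 1) x.
Proof.
move=> xi [ff fc].
have far u : far_radius x < nrm (stage u x).
  have [cx|nc] := pselect (cell (slant S x)); last first.
    by rewrite stage_id // weight_notcell ?mulr0.
  have e : state f S x = red_nil (ends n) by symmetry; apply/(stateP n2 fs _ cx); exact: fc.
  rewrite /stage e /pushed /=; apply: (lt_le_trans ff).
  rewrite -{1}(shearK S (f x)); apply: repel_out.
  - by rewrite /final le_max lexx.
  - exact: far_radius_ge0.
  - by rewrite shearK; apply: le_trans (ltW ff); exact: anchor_le.
have [pc pa] := stage_path xi.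
split=> // s' cs'; apply: (stage_loop cs' (fc s' cs')).
exact: far_carries.
Qed.

(** The push is governed by the label for its own shear, but the root must be closing for every
    shear. For this the loop of [f] itself is pushed, with its labels, to a loop near infinity,
    where the root is fixed for all shears. *)
Lemma stage_reaches (x : Cfg) : injective x -> weight s x = 1 -> cell (slant S x) ->
  far_section (stage 1) x.
Proof.
move=> xi w1 cx; have [pc pa] := stage_path xi.
have [w [wl w0 w1']] := proj2 (stateP n2 fs (state f S x) cx) erefl.
(* The label [w] returns to its start because the state is closing, so that [h] is a homotopy of
   closed loops. The configuration is fixed throughout. *)
pose h (q : R * R) := shear (- S) (pushed S (far_radius x) (slant S x) (w (clamp01 q.2))
  (clamp01 q.1) (shear S (uloop f x (clamp01 q.2)))).
have i0 : 0 <= (0 : R) <= 1 by rewrite lexx ler01.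
have i1 : 0 <= (1 : R) <= 1 by rewrite lexx ler01.
have uc (t : R) : ct t (uloop f x).
  by apply: (@ct_uloop R n f fs R t (fun=> x) id) => // k; exact: ct_cst.
have ua t k : shear S (uloop f x t) <> slant S x k by move=> /shear_inj; exact: (uloop_avoid fs).
have hc (q : R * R) : ct q h.
  have q1 : ct q (fun q : R * R => clamp01 q.1) by apply: ct_clamp01; exact: ct_fst (@ct_id _ q).
  have q2 : ct q (fun q : R * R => clamp01 q.2) by apply: ct_clamp01; exact: ct_snd (@ct_id _ q).
  apply: ct_shear; first exact: ct_cst.
  apply: (@ct_pushed R n _ q S (fun=> slant S x) (fun q => w (clamp01 q.2)) (fun=> far_radius x)
    (fun q => clamp01 q.1) (fun q => shear S (uloop f x (clamp01 q.2)))) => //.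
  - by move=> k; exact: ct_cst.
  - exact: ct_cst.
  - by apply: ct_shear; [exact: ct_cst | exact: (ct_comp q2 (uc _))].
  - exact: clamp01_in.
  near=> q'; have : 0 <= clamp01 q'.2 <= 1 := clamp01_in _.
  by near: q'; exact: (q2 _ (wl _ (clamp01_in q.2))).
have ha q k : h q <> x k.
  move=> /(congr1 (shear S)); rewrite /h shearD subrr shear0.
  apply: escape_avoid => //; [exact: far_radius_ge0 | exact: sg_height].
have h0 u : h (u, 0) = stage u x by rewrite /h /stage clamp01_id //= w0 uloop0 w1 mulr1.
have h1 u : h (u, 1) = stage u x by rewrite /h /stage clamp01_id //= w1' uloop1 w1 mulr1.
have hl t : 0 <= t <= 1 -> h (0, t) = uloop f x t.
  by move=> t01; rewrite /h !clamp01_id //= /pushed escape0 shearK.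
have hf t : far_radius x < nrm (h (1, t)).
  rewrite /h /pushed (clamp01_id i1).
  by apply: escape_far => //; [exact: far_radius_ge0 | exact: sg_height].
split; first by rewrite -(h0 1); exact: hf.
move=> s' cs'; set S' := shear_of R s'; set rt := red_nil (ends n).
have kK := @kappaK (ends n).
have ok u t : 0 <= u <= 1 -> 0 <= t <= 1 -> cut_ok (fun q : R * R => height (slant S' x) (shear S' (h q)))
    (fun q => rank (slant S' x) (shear S' (h q)).1) (u, t).
  move=> _ _; apply: (@cut_ok_planar R n _ (u, t) (fun=> slant S' x)) => //.
  - by move=> k; exact: ct_cst.
  - by apply: ct_shear; [exact: ct_cst | exact: hc].
  - by move=> k /shear_inj; exact: ha.
have per u : 0 <= u <= 1 -> height (slant S' x) (shear S' (h (u, 0))) = height (slant S' x) (shear S' (h (u, 1))) /\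
    rank (slant S' x) (shear S' (h (u, 0))).1 = rank (slant S' x) (shear S' (h (u, 1))).1.
  by rewrite h0 h1.
have okb : path_ok (fun u => height (slant S' x) (shear S' (stage u x)))
    (fun u => rank (slant S' x) (shear S' (stage u x)).1).
  apply: (@path_ok_planar R n (slant S' x) (fun u => shear S' (stage u x))) => //.
    by move=> t; apply: ct_shear; [exact: ct_cst | exact: pc].
  by move=> t k /shear_inj; exact: pa.
have okl : path_ok (fun t => height (slant S' x) (shear S' (uloop f x t)))
    (fun t => rank (slant S' x) (shear S' (uloop f x t)).1) := slant_loop_ok fs cs'.
have ok1 : path_ok (fun t => height (slant S' x) (shear S' (h (1, t))))
    (fun t => rank (slant S' x) (shear S' (h (1, t))).1).
  move=> t t01; apply: (@cut_ok_comp _ _ _ (fun q => height (slant S' x) (shear S' (h q)))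
    (fun q => rank (slant S' x) (shear S' (h q)).1) (fun t => (1, t))); last exact: ok.
  by apply: ct_pair; [exact: ct_cst | exact: ct_id].
have [B hB] := wordof_ex okb.
have base v : carries (@kappa (ends n)) (fun u => height (slant S' x) (shear S' (stage u x)))
    (fun u => rank (slant S' x) (shear S' (stage u x)).1) v (evalw (@kappa (ends n)) B v).
  exact: wordof_carries.
have base' v : carries (@kappa (ends n)) (fun u => height (slant S' x) (shear S' (h (u, 0))))
    (fun u => rank (slant S' x) (shear S' (h (u, 0))).1) v (evalw (@kappa (ends n)) B v).
  by apply: carries_ext (base v) => u _; rewrite h0.
(* The root is carried back along the base path to a label [v]; once [v] is known to be closing for
   [f], [stage_loop] brings it forward to the root. *)
pose v := evalw (@kappa (ends n)) (rev B) rt.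
have Bv : evalw (@kappa (ends n)) B v = rt by rewrite /v evalw_Krev.
have [v' hv'] := path_ex kK v okl.
have hv'' : carries (@kappa (ends n)) (fun t => height (slant S' x) (shear S' (h (0, t))))
    (fun t => rank (slant S' x) (shear S' (h (0, t))).1) v v'.
  by apply: carries_ext hv' => t t01; rewrite hl.
have top := loop_homotopy kK ok per hv'' (base' v) (base' v').
have far : carries (@kappa (ends n)) (fun t => height (slant S' x) (shear S' (h (1, t))))
    (fun t => rank (slant S' x) (shear S' (h (1, t))).1) rt rt.
  apply: far_carries => // t.
  have c1 : ct t (fun t : R => (1 : R, t)) by apply: ct_pair; [exact: ct_cst | exact: ct_id].
  exact: (ct_comp c1 (hc _)).
rewrite Bv in top; have Bv' := path_fun kK ok1 far top.
have vv' : v = v' by apply: (path_inj kK okb (base v)); rewrite Bv Bv'; exact: base.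
rewrite -vv' in hv'; have := base v; rewrite Bv; exact: (stage_loop cs' hv').
Unshelve. all: by end_near.
Qed.

End Stage.

Section AllStages.
Variables (R : realType) (n : nat).
Local Notation V := (R * R)%type.
Local Notation Cfg := {ptws 'I_n -> V}.
Implicit Types (f g : Cfg -> V) (x : Cfg).

(** One stage for each shear in turn: every configuration has a shear of weight 1, and later stages
    keep what its stage has achieved. *)
Theorem section_far f : (2 < n)%N -> planar_section f ->
  exists g, [/\ planar_section g, homotopic f g & forall x, injective x -> far_radius x < nrm (g x)].
Proof.
move=> n2 fs; suff [g [gs fg gf]] : exists g, [/\ planar_section g, homotopic f g &
    forall x (s : 'I_(shears n)), injective x -> (s < shears n)%N -> weight s x = 1 ->
      cell (slant (shear_of R s) x) -> far_section g x].
  exists g; split=> // x xi; have [s [w1 cx]] := @weight1 R n x xi.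
  by have [] := gf x s xi (ltn_ord s) w1 cx.
suff H m : (m <= shears n)%N -> exists g, [/\ planar_section g, homotopic f g &
    forall x (s : 'I_(shears n)), injective x -> (s < m)%N -> weight s x = 1 ->
      cell (slant (shear_of R s) x) -> far_section g x] by exact: H (leqnn _).
elim: m => [|m IH] mn; first by exists f; split=> //; exact: homotopic_refl.
have [g [gs fg gf]] := IH (ltnW mn); pose s := Ordinal mn.
exists (stage g s 1); split.
- exact: stage_section.
- apply: (homotopic_trans fg); exists (stage g s); split=> //; [exact: stage_homotopy | exact: stage0].
move=> x s' xi; rewrite ltnS leq_eqVlt => /orP[/eqP e|lt] w1 cx.
  by have es : s' = s by [apply: val_inj]; rewrite es in w1 cx; exact: stage_reaches.
by apply: stage_keeps => //; exact: (gf x s').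
Qed.

End AllStages.
(** * Sections over unordered configurations *)

Section AddedPoint.
Local Open Scope quotient_scope.
Variables (n : nat) (S : topologicalType).
Implicit Types (X : PConf n S) (s : UConf n S -> UConf0 n S).

Lemma ct_subtype (P T : topologicalType) (A : set T) (p : P) (f : P -> set_type A) :
  ct p (fun q => set_val (f q)) -> ct p f.
Proof.
move=> c B; rewrite nbhsE => -[U [[C oC <-] Cf] UB].
have h : \forall q \near p, C (set_val (f q)) by apply: c; exact: open_nbhs_nbhs.
by apply: filterS h => q Cq; apply: UB.
Qed.

Lemma ct_set_val (T : topologicalType) (A : set T) (X : set_type A) :
  ct X (fun Y : set_type A => set_val Y).
Proof. exact: (@initial_continuous _ _ set_val X). Qed.

Lemma ct_point X k : ct X (fun Y : PConf n S => pt Y k).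
Proof.
exact: (ct_comp (@ct_set_val _ _ X) (@proj_continuous _ (fun=> S) k (set_val X))).
Qed.

Lemma uconf_permute (p : 'S_n) X : uconf (permute p X) = uconf X.
Proof. by symmetry; apply/uconfP; exists p. Qed.

Lemma ct_permute (p : 'S_n) X : ct X (permute p).
Proof. by apply: ct_subtype; apply: ct_ptws => k; exact: ct_point. Qed.

Lemma ct_pi_uconf X : ct X (fun Y : PConf n S => uconf Y).
Proof. exact: pi_continuous. Qed.

(** The preimage of the image of an open set is the union of its translates by the finite group. *)
Lemma uconf_open X (W : set (PConf n S)) : nbhs X W -> nbhs (uconf X) (@uconf n S @` W).
Proof.
rewrite nbhsE => -[U [oU UX] UW]; rewrite nbhsE; exists (@uconf n S @` U); last first.
  by move=> _ [Y UY <-]; exists Y => //; exact: UW.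
split; last by exists X.
have : @open (PConf n S) (\bigcup_(p : 'S_n) (permute p @^-1` U)).
  apply: bigcup_open => p _; apply: open_comp => // Y _; exact: ct_permute.
suff e : (fun Y : PConf n S => uconf Y) @^-1` (@uconf n S @` U) =
  \bigcup_(p : 'S_n) (permute p @^-1` U) by rewrite -e => h; exact: h.
apply/seteqP; split=> Y.
  by move=> [Z UZ /esym/uconfP[p e]]; exists p => //=; rewrite /preimage /= -e.
by move=> [p _ UpY]; exists (permute p Y) => //; exact: uconf_permute.
Qed.

(** The product of a quotient map with an identity need not be a quotient map; openness of [uconf]
    replaces this. *)
Lemma ct_uconf_family (P T : topologicalType) (p : P) (h : P * UConf n S -> T) X :
  ct (p, X) (fun q : P * PConf n S => h (q.1, uconf q.2)) -> ct (p, uconf X) h.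
Proof.
move=> c A hA; have [[U W] [Up WX] UW] := c A hA.
exists (U, @uconf n S @` W); first by split=> //; exact: uconf_open.
by move=> [q d] [/= Uq [Y WY <-]]; exact: (UW (q, Y)).
Qed.

Definition cons_point (z : S) (x : 'I_n -> S) (i : 'I_n.+1) : S :=
  if unlift ord0 i is Some j then x j else z.

Lemma cons_point_inj z X : (forall k, z <> pt X k) -> injective (cons_point z (pt X)).
Proof.
move=> av i j; rewrite /cons_point.
case: unliftP => [i'|] ->; case: unliftP => [j'|] -> //; first by move/pt_inj ->.
  by move/esym/av.
by move/av.
Qed.

Definition consPConf z X (av : forall k, z <> pt X k) : PConf n.+1 S :=
  mkPConf (cons_point_inj av).

Lemma pt_cons z X (av : forall k, z <> pt X k) i : pt (consPConf av) i = cons_point z (pt X) i.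
Proof. by []. Qed.

Lemma forget0_cons z X (av : forall k, z <> pt X k) : forget0 (consPConf av) = X.
Proof. by apply: PConf_eq => i; rewrite pt_forget0 pt_cons /cons_point liftK. Qed.

Lemma cons_permute z X (p : 'S_n) (av : forall k, z <> pt X k)
    (av' : forall k, z <> pt (permute p X) k) : uconf0 (consPConf av') = uconf0 (consPConf av).
Proof.
symmetry; apply/uconf0P; exists p; apply: PConf_eq => i.
rewrite pt_permute !pt_cons; case: (unliftP ord0 i) => [j|] ->; rewrite /cons_point.
  by rewrite lift_perm_lift !liftK pt_permute.
by rewrite lift_perm_id unlift_none.
Qed.

Definition new_point (c : UConf0 n S) : S :=
  pt (repr (c : quotient_topology {eq_quot (same_orbit0_equiv_rel S n)})) ord0.

Lemma permute0_new (p : 'S_n) (y : PConf n.+1 S) : pt (permute0 p y) ord0 = pt y ord0.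
Proof. by rewrite pt_permute lift_perm_id. Qed.

Lemma new_point_uconf0 (y : PConf n.+1 S) : new_point (uconf0 y) = pt y ord0.
Proof.
rewrite /new_point; set z := repr _; have /uconf0P[p ->] : uconf0 z = uconf0 y by exact: reprK.
by rewrite permute0_new.
Qed.

Lemma ct_new_point : continuous new_point.
Proof.
apply: (@repr_comp_continuous _ _ _ (fun y : PConf n.+1 S => pt y ord0)).
  move=> y; exact: (ct_comp (@ct_set_val _ _ y) (@proj_continuous _ (fun=> S) ord0 (set_val y))).
by move=> a b /eqP /uconf0P[p ->]; rewrite permute0_new.
Qed.

Definition added s X : S := new_point (s (uconf X)).

Section OneSection.
Variable s : UConf n S -> UConf0 n S.
Hypothesis hs : is_section s.

Lemma ct_added X : ct X (added s).
Proof.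
have sc : ct (uconf X) s := hs.1 (uconf X).
exact: (ct_comp (ct_comp (@ct_pi_uconf X) sc) (@ct_new_point _)).
Qed.

Lemma added_permute (p : 'S_n) X : added s (permute p X) = added s X.
Proof. by rewrite /added uconf_permute. Qed.

Lemma added_lift X : exists2 y : PConf n.+1 S, s (uconf X) = uconf0 y & forget0 y = X.
Proof.
pose y := repr (s (uconf X) : quotient_topology {eq_quot (same_orbit0_equiv_rel S n)}).
have ey : uconf0 y = s (uconf X) by exact: reprK.
have := hs.2 (uconf X); rewrite -ey bundle_proj_uconf0 => /uconfP[p e].
exists (permute0 p y); first by rewrite -?ey; apply/uconf0P; exists p.
by apply: PConf_eq => i; rewrite pt_forget0 !pt_permute lift_perm_lift e pt_permute pt_forget0.
Qed.

Lemma added_avoid X k : added s X <> pt X k.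
Proof.
have [y ey fy] := added_lift X; rewrite /added ey new_point_uconf0 -fy pt_forget0.
by move/pt_inj.
Qed.

Lemma added_cons X : s (uconf X) = uconf0 (consPConf (@added_avoid X)).
Proof.
have [y ey fy] := added_lift X; rewrite ey; congr uconf0.
apply: PConf_eq => i; rewrite pt_cons /cons_point.
case: unliftP => [j|] ->; first by rewrite -fy pt_forget0.
by rewrite /added ey new_point_uconf0.
Qed.

End OneSection.

Section Family.
Variables (P : topologicalType) (F : P -> PConf n S -> S).
Hypothesis Fc : forall t X, ct (t, X) (fun q : P * PConf n S => F q.1 q.2).
Hypothesis Fp : forall t (p : 'S_n) X, F t (permute p X) = F t X.
Hypothesis Fa : forall t X k, F t X <> pt X k.

Definition add_family (q : P * UConf n S) : UConf0 n S :=
  uconf0 (consPConf (@Fa q.1 (repr (q.2 : quotient_topology {eq_quot (same_orbit_equiv_rel S n)})))).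

Lemma consPConf_ext (X Y : PConf n S) (z w : S) (az : forall k, z <> pt X k) (aw : forall k, w <> pt Y k) :
  z = w -> X = Y -> consPConf az = consPConf aw.
Proof. by move=> zw XY; apply: PConf_eq => i; rewrite !pt_cons zw XY. Qed.

Lemma add_familyE t X : add_family (t, uconf X) = uconf0 (consPConf (@Fa t X)).
Proof.
rewrite /add_family /=; set Y := repr _.
have /uconfP[p e] : uconf X = uconf Y by symmetry; exact: reprK.
have e' := Fp t p X; rewrite -e in e'.
have av : forall k, F t X <> pt (permute p X) k by move=> k; rewrite pt_permute; exact: Fa.
rewrite -(cons_permute (@Fa t X) av); congr uconf0; exact: consPConf_ext.
Qed.

Lemma add_family_proj t c : bundle_proj (add_family (t, c)) = c.
Proof.
by rewrite /add_family bundle_proj_uconf0 forget0_cons; exact: reprK.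
Qed.

Lemma add_family_ct q : ct q add_family.
Proof.
case: q => t c; have <- : uconf (repr (c : quotient_topology {eq_quot (same_orbit_equiv_rel S n)})) = c.
  exact: reprK.
set X := repr _; apply: ct_uconf_family.
apply: (@ct_near _ _ _ (fun q : P * PConf n S => uconf0 (consPConf (@Fa q.1 q.2)))).
  by near=> q; rewrite add_familyE.
apply: (@ct_comp _ _ _ _ (fun q : P * PConf n S => consPConf (@Fa q.1 q.2)) (@uconf0 n S)); last first.
  exact: pi_continuous.
apply: ct_subtype; apply: ct_ptws => i.
change (ct (t, X) (fun q : P * PConf n S => cons_point (F q.1 q.2) (pt q.2) i)).
rewrite /cons_point; case: (unliftP ord0 i) => [j|] _; last exact: Fc.
exact: (ct_comp (ct_snd (@ct_id _ (t, X))) (@ct_point X j)).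
Unshelve. all: by end_near.
Qed.

End Family.
End AddedPoint.

(** * From sections over the plane to symmetric maps and back *)

Section PlaneSections.
Variables (R : realType) (n : nat).
Local Notation V := (R * R)%type.
Local Notation Cfg := {ptws 'I_n -> V}.
Local Notation PC := (PConf n (plane R)).

Definition to_pair (u : plane R) : V := ((u : 'rV[R]_2) 0 0, (u : 'rV[R]_2) 0 1).
Definition of_pair (z : V) : plane R := \row_(j < 2) (if j == 0 then z.1 else z.2).

Lemma to_pairK u : of_pair (to_pair u) = u.
Proof.
apply/rowP => j; rewrite mxE; case: (unliftP ord0 j) => [i|] -> //=.
by rewrite (ord1 i); congr (_ _ _); apply: val_inj.
Qed.

Lemma of_pairK z : to_pair (of_pair z) = z.
Proof. by case: z => a b; rewrite /to_pair !mxE. Qed.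

Lemma ct_mx (P : topologicalType) (p : P) (m k : nat) (f : P -> 'M[R]_(m, k)) :
  (forall i j, ct p (fun q => f q i j)) -> ct p f.
Proof.
move=> fc; apply/cvg_ballP => e e0.
have h : \forall q \near p, forall i j, ball (f p i j) e (f q i j).
  apply: near_forall => i; apply: near_forall => j.
  by have /cvg_ballP := fc i j; exact.
by apply: filterS h => q h; split.
Qed.

Lemma ct_entry (P : topologicalType) (p : P) (m k : nat) (f : P -> 'M[R]_(m, k)) i j :
  ct p f -> ct p (fun q => f q i j).
Proof. by move=> fc; exact: (ct_comp fc (@coord_continuous R m k i j (f p))). Qed.

Lemma ct_to_pair u : ct u to_pair.
Proof. by apply: ct_pair; apply: (ct_entry (p := u) (f := id)); exact: ct_id. Qed.

Lemma ct_of_pair z : ct z of_pair.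
Proof.
apply: (@ct_mx _ z 1 2 of_pair) => i j; rewrite /of_pair.
apply: (@ct_near _ _ _ (fun z : V => if j == 0 then z.1 else z.2)).
  by near=> q; rewrite mxE.
by case: (j == 0); [exact: ct_fst (@ct_id _ z) | exact: ct_snd (@ct_id _ z)].
Unshelve. all: by end_near.
Qed.

Definition coords (X : PC) : Cfg := fun k => to_pair (pt X k).

Lemma coords_inj X : injective (coords X).
Proof. by move=> j k /(can_inj to_pairK) /pt_inj. Qed.

Lemma ct_coords X : ct X coords.
Proof. by apply: ct_ptws => k; exact: (ct_comp (@ct_point n (plane R) X k) (@ct_to_pair _)). Qed.

Definition points (x : Cfg) (xi : injective x) : PC :=
  @mkPConf (plane R) n (fun k => of_pair (x k)) (inj_comp (can_inj of_pairK) xi).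

Lemma near_injective (x : Cfg) : injective x ->
  \forall y \near x, forall j k : 'I_n, j != k -> y j != y k.
Proof.
move=> xi.
apply: near_forall => j; apply: near_forall => k.
have [->|jk] := eqVneq j k; first by near=> y.
have dc : ct x (fun y : Cfg => nrm ((y j).1 - (y k).1, (y j).2 - (y k).2)).
  have hj := @ct_eval R n x j; have hk := @ct_eval R n x k.
  have j1 := ct_fst hj; have j2 := ct_snd hj; have k1 := ct_fst hk; have k2 := ct_snd hk.
  by apply: ct_nrm; ctac.
have d0 : 0 < nrm ((x j).1 - (x k).1, (x j).2 - (x k).2).
  apply: nrm_gt0 => -[/eqP + /eqP]; rewrite !subr_eq0 => /eqP e1 /eqP e2.
  move/eqP: jk; apply; apply: xi; case: (x j) (x k) e1 e2 => ? ? [? ?] /= -> ->.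
  by [].
apply: filterS (near_lt (@ct_cst _ x R 0) dc d0) => y yp _; apply/eqP => e.
move: yp; rewrite e !subrr (_ : nrm _ = 0) ?ltxx // /nrm /= expr0n /= addr0 sqrtr0 //.
Unshelve. all: by end_near.
Qed.

Section FromSection.
Variable s : UConf n (plane R) -> UConf0 n (plane R).
Hypothesis hs : is_section s.

(** The value where points coincide is constant, so that the symmetry holds on all of [Cfg]. *)
Definition planar_of (x : Cfg) : V :=
  if pselect (injective x) is left xi then to_pair (added s (points xi)) else (0, 0).

Lemma planar_ofE X : planar_of (coords X) = to_pair (added s X).
Proof.
rewrite /planar_of; case: pselect => [xi|]; last by case; exact: coords_inj.
congr (to_pair (added s _)); apply: PConf_eq => k.
exact: to_pairK.
Qed.

Lemma ct_planar_of (x : Cfg) : injective x -> ct x planar_of.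
Proof.
move=> xi A; rewrite /= /planar_of; case: pselect => // xi' hA.
have ac := ct_comp (@ct_added _ _ s hs (points xi')) (@ct_to_pair (added s (points xi'))).
have := ac A hA; rewrite nbhsE => -[U [[C oC <-] Cx] CA].
have oc : ct x (fun y : Cfg => (fun k => of_pair (y k)) : {ptws 'I_n -> plane R}).
  by apply: ct_ptws => k; exact: (ct_comp (@ct_eval R n x k) (@ct_of_pair _)).
have h : \forall y \near x, C ((fun k => of_pair (y k)) : {ptws 'I_n -> plane R}).
  by apply: oc; apply: open_nbhs_nbhs; split.
change (\forall y \near x, A (planar_of y)).
have Fx : Filter (nbhs x) := nbhs_filter x.
apply: filterS2 h (near_injective xi) => y Cy yi; rewrite /planar_of.
case: pselect => [yi'|[j k e]]; first exact: (CA (points yi')).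
by apply/eqP/negPn/negP => /yi; rewrite e eqxx.
Qed.

Lemma planar_of_section : planar_section planar_of.
Proof.
split=> [x xi|x p|x k xi]; first exact: ct_planar_of.
  rewrite /planar_of; case: pselect => [xi|ni]; case: pselect => [yi|nj] //.
  - rewrite -(added_permute s p (points yi)); congr (to_pair (added s _)).
    exact: PConf_eq.
  - by case: nj => j k jk; have := xi (p^-1%g j) (p^-1%g k); rewrite !permKV => /(_ jk) /perm_inj.
  - by case: ni => j k /yi /perm_inj.
rewrite /planar_of; case: pselect => // yi e.
by apply: (@added_avoid _ _ s hs (points yi) k); rewrite -[LHS]to_pairK e.
Qed.

End FromSection.

Section ToSection.
Variable F : R -> Cfg -> V.
Hypothesis FH : section_homotopy F.

Definition plane_family (t : R) (X : PC) : plane R := of_pair (F t (coords X)).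

Lemma plane_family_ct t X : ct (t, X) (fun q : R * PC => plane_family q.1 q.2).
Proof.
have hc : ct (t, X) (fun q : R * PC => (q.1, coords q.2)).
  apply: ct_pair; first exact: ct_fst (@ct_id _ (t, X)).
  exact: (ct_comp (ct_snd (@ct_id _ (t, X))) (@ct_coords X)).
have Fc := FH.1 t (coords X) (@coords_inj X).
exact: (ct_comp (ct_comp hc Fc) (@ct_of_pair _)).
Qed.

Lemma plane_family_permute t (p : 'S_n) X : plane_family t (permute p X) = plane_family t X.
Proof.
by congr of_pair; rewrite -(psec_sym (FH.2 t) (coords X) p).
Qed.

Lemma plane_family_avoid t X k : plane_family t X <> pt X k.
Proof.
move=> /(congr1 to_pair); rewrite of_pairK; apply: (psec_avoid (FH.2 t)); exact: coords_inj.
Qed.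

Definition section_family := add_family plane_family_avoid.

Lemma section_family_is_section t : is_section (fun c => section_family (t, c)).
Proof.
split=> [c|c]; last exact: add_family_proj.
have h : ct c (fun c : UConf n (plane R) => (t, c)) by apply: ct_pair; [exact: ct_cst | exact: ct_id].
exact: (ct_comp h (@add_family_ct _ _ _ _ plane_family_ct plane_family_permute _ (t, c))).
Qed.

Lemma section_family_homotopic :
  homotopic_sections R (fun c => section_family (0, c)) (fun c => section_family (1, c)).
Proof.
exists section_family; split=> // [|u c _]; last exact: add_family_proj.
by apply: continuous_subspaceT => q; exact: (add_family_ct plane_family_ct plane_family_permute).
Qed.

Lemma section_family_start s : is_section s -> F 0 = planar_of s ->
  (fun c => section_family (0, c)) = s.
Proof.
move=> hs F0; apply/funext => c.
have <- : uconf (repr c) = c by exact: reprK.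
rewrite /section_family (add_familyE plane_family_permute) (added_cons hs); congr uconf0.
by apply: consPConf_ext => //; rewrite /plane_family F0 planar_ofE to_pairK.
Qed.

End ToSection.
End PlaneSections.
(** * Adding a point at infinity *)

Section PointAtInfinity.
Variables (R : realType) (n : nat).
Local Notation V := (R * R)%type.
Local Notation Cfg := {ptws 'I_n -> V}.
Implicit Types (x : Cfg).

Definition sq_radius x : R := \big[Num.max/0]_k (nrm (x k) ^+ 2).

(* The stereographic distance to the origin of the point of the plane which is halfway
   to infinity from the farthest point of the configuration. *)
Definition halfway x : R := Num.sqrt (sq_radius x + 1) + Num.sqrt (sq_radius x).

Lemma sq_radius_ge0 x : 0 <= sq_radius x.
Proof. exact: (bigmax_ge predT (fun k => nrm (x k) ^+ 2) 0).1. Qed.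

Lemma sq_radius_ge x k : nrm (x k) ^+ 2 <= sq_radius x.
Proof. exact: ((bigmax_ge predT (fun k => nrm (x k) ^+ 2) 0).2 k isT). Qed.

Lemma lt_halfway x k : nrm (x k) < halfway x.
Proof.
have q0 := sq_radius_ge0 x.
have h : nrm (x k) <= Num.sqrt (sq_radius x).
  by rewrite -(ler_pXn2r (n := 2)) ?nnegrE ?nrm_ge0 ?sqrtr_ge0 // (sqr_sqrtr q0) sq_radius_ge.
apply: le_lt_trans h _; rewrite ltrDr sqrtr_gt0; lra.
Qed.

Lemma ct_halfway x : ct x halfway.
Proof.
have qc : ct x sq_radius.
  apply: ct_big => [f g||k]; [exact: ct_max | exact: ct_cst |].
  by apply: ct_exp; apply: ct_nrm; exact: ct_eval.
by apply: ct_add; apply: ct_sqrt => //; apply: ct_add => //; exact: ct_cst.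
Qed.

Variable g : Cfg -> V.
Hypotheses (gs : planar_section g) (gf : forall x, injective x -> far_radius x < nrm (g x)).

Definition radial (t : R) x : V :=
  let l := 1 - clamp01 t + clamp01 t * (halfway x / nrm (g x)) in (l * (g x).1, l * (g x).2).

Lemma far_nrm_gt0 x : injective x -> 0 < nrm (g x).
Proof. by move=> xi; apply: le_lt_trans (gf xi); exact: far_radius_ge0. Qed.

Lemma lt_far x k : injective x -> nrm (x k) < nrm (g x).
Proof.
move=> xi; apply: le_lt_trans (gf xi); apply: le_trans (nrm_le_l1 _) _.
apply: le_trans (size_of_ge x k) _; rewrite /far_radius ler_peMl ?size_of_ge0 //.
have : 1 <= (shears n)%:R :> R by rewrite ler1n.
by rewrite expr2; nra.
Qed.

Lemma nrm_radial t x : injective x ->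
  nrm (radial t x) = (1 - clamp01 t) * nrm (g x) + clamp01 t * halfway x.
Proof.
move=> xi; have g0 := far_nrm_gt0 xi; have /andP[t0 t1] := clamp01_in t.
have h0 : 0 < halfway x by rewrite ltr_wpDr ?sqrtr_ge0 // sqrtr_gt0; have := sq_radius_ge0 x; lra.
rewrite /radial nrm_scale; last by rewrite addr_ge0 ?subr_ge0 // mulr_ge0 // divr_ge0 // ltW.
by rewrite mulrDl -[_ * _ * nrm (g x)]mulrA divfK // lt0r_neq0.
Qed.

(** Along the ray the norm stays between those of [g x] and [halfway x], and both exceed the norms
    of all the points. *)
Lemma radial_homotopy : section_homotopy radial.
Proof.
have av t x k : injective x -> radial t x <> x k.
  move=> xi /(congr1 (@nrm R)); rewrite nrm_radial //.
  have h1 := lt_far k xi; have h2 := lt_halfway x k; have /andP[t0 t1] := clamp01_in t.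
  have [->|tp] := eqVneq (clamp01 t) 0; first by rewrite subr0 mul1r mul0r addr0; lra.
  have {}tp : 0 < clamp01 t by rewrite lt_def tp.
  have a : 0 <= (1 - clamp01 t) * (nrm (g x) - nrm (x k)) by apply: mulr_ge0; lra.
  have b : 0 < clamp01 t * (halfway x - nrm (x k)) by apply: mulr_gt0; lra.
  lra.
have cts (t : R) x : injective x -> ct (t, x) (fun q : R * Cfg => radial q.1 q.2).
  move=> xi; have xc : ct (t, x) (fun q : R * Cfg => q.2) := ct_snd (@ct_id _ (t, x)).
  have tc : ct (t, x) (fun q : R * Cfg => clamp01 q.1) := ct_clamp01 (ct_fst (@ct_id _ (t, x))).
  have gc : ct (t, x) (fun q : R * Cfg => g q.2) := ct_comp xc (psec_cont gs xi).
  have g1 := ct_fst gc; have g2 := ct_snd gc.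
  have hc : ct (t, x) (fun q : R * Cfg => halfway q.2) := ct_comp xc (@ct_halfway x).
  have nc : ct (t, x) (fun q : R * Cfg => (nrm (g q.2))^-1).
    by apply: ct_inv; [exact: lt0r_neq0 (far_nrm_gt0 xi) | exact: ct_nrm].
  by rewrite /radial; ctac.
split=> // t; split=> [x xi|x p|x k xi]; last exact: av.
  apply: (@ct_curry R n radial t x); exact: cts.
have e : halfway (fun k => x (p k)) = halfway x.
  by rewrite /halfway /sq_radius [in RHS](reindex_inj (@perm_inj _ p)).
by rewrite /radial e (psec_sym gs).
Qed.

Lemma radial0 : radial 0 = g.
Proof.
apply/funext => x; rewrite /radial clamp01_id ?lexx ?ler01 // subr0 mul0r addr0 !mul1r.
by case: (g x).
Qed.

Lemma radial1 x : radial 1 x = (halfway x * ((g x).1 / nrm (g x)), halfway x * ((g x).2 / nrm (g x))).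
Proof. by rewrite /radial clamp01_id ?lexx ?ler01 //; congr (_, _); ring. Qed.

End PointAtInfinity.

(** * Stereographic projection and distances to infinity *)

Section Stereographic.
Variables (R : realType) (n : nat).
Local Notation V := (R * R)%type.
Local Notation PC := (PConf n (plane R)).

Lemma to_sphere_infty (u : plane R) :
  dot (to_sphere u) (infty R) = (nrm (to_pair u) ^+ 2 - 1) / (nrm (to_pair u) ^+ 2 + 1).
Proof.
rewrite /dot mxE big_ord_recr big_ord_recr big_ord_recr big_ord0 /= !mxE /=.
by rewrite !mulr0 !add0r mulr1 nrm_sq.
Qed.

Lemma stereoE (q : R) : 0 <= q -> (q - 1) / (q + 1) = 1 - 2 * (q + 1)^-1.
Proof. by move=> q0; field; apply: lt0r_neq0; lra. Qed.

Lemma stereo_mono (q q' : R) : 0 <= q -> q <= q' -> (q - 1) / (q + 1) <= (q' - 1) / (q' + 1).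
Proof.
move=> q0 qq; have q0' : 0 <= q' := le_trans q0 qq.
rewrite !stereoE // lerD2l lerN2 ler_pM2l //.
by rewrite lef_pV2 ?posrE; lra.
Qed.

Lemma stereo_in (q : R) : 0 <= q -> -1 <= (q - 1) / (q + 1) <= 1.
Proof.
move=> q0; rewrite stereoE //.
have i0 : 0 < (q + 1)^-1 by rewrite invr_gt0; lra.
have i1 : (q + 1)^-1 <= 1 by rewrite invf_le1; lra.
lra.
Qed.

Lemma acos_anti (a b : R) : -1 <= a <= 1 -> -1 <= b <= 1 -> a <= b -> acos b <= acos a.
Proof.
move=> a1 b1 ab; rewrite leNgt; apply/negP => h.
have : cos (acos b) < cos (acos a).
  by rewrite ltr_cos // in_itv /= ?acos_ge0 ?acos_lepi.
by rewrite !acosK ?in_itv //= ltNge ab.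
Qed.

(** [acos] is decreasing, so the point nearest to infinity on the sphere is the one of largest norm
    in the plane. *)
Lemma infty_epsE (X : PC) : (0 < n)%N ->
  infty_eps X = 2^-1 * acos ((sq_radius (coords X) - 1) / (sq_radius (coords X) + 1)).
Proof.
move=> n0; congr (_ * _); set Q := sq_radius _.
have [k Qk] : exists k, Q = nrm (coords X k) ^+ 2.
  have [k _ hk] := arg_maxP (P := predT) (i0 := Ordinal n0) (fun k => nrm (coords X k) ^+ 2) isT.
  exists k; apply/eqP; rewrite eq_le sq_radius_ge andbT; apply: (big_ind (fun u => u <= _)).
  - exact: sqr_ge0.
  - by move=> u v ku kv; rewrite ge_max ku.
  - by move=> l _; exact: hk.
have Q0 : 0 <= Q := sq_radius_ge0 _.
have dE i : sphere_dist (to_sphere (pt X i)) (infty R) =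
    acos ((nrm (coords X i) ^+ 2 - 1) / (nrm (coords X i) ^+ 2 + 1)).
  by rewrite /sphere_dist to_sphere_infty.
apply/eqP; rewrite eq_le; apply/andP; split.
  by rewrite (bigD1 k) //= ge_min dE -Qk lexx.
apply: (big_ind (fun u => acos ((Q - 1) / (Q + 1)) <= u)).
- by apply: acos_lepi; exact: stereo_in.
- by move=> u v ku kv; rewrite le_min ku.
- move=> i _; rewrite dE; apply: acos_anti; rewrite ?stereo_in ?sqr_ge0 //.
  by apply: stereo_mono; [exact: sqr_ge0 | exact: sq_radius_ge].
Qed.

Lemma half_acos (q : R) : 0 <= q ->
  let e := 2^-1 * acos ((q - 1) / (q + 1)) in
  cos e = Num.sqrt q / Num.sqrt (q + 1) /\ sin e = (Num.sqrt (q + 1))^-1.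
Proof.
move=> q0 e; have qi := stereo_in q0; have a0 := acos_ge0 qi; have ap := acos_lepi qi.
have pi0 := pi_gt0 R.
have e2 : cos (e + e) = (q - 1) / (q + 1).
  by rewrite -mulrDl (_ : 2^-1 + 2^-1 = 1 :> R) ?mul1r ?acosK //; lra.
have q1 : 0 < q + 1 by lra.
have hc : cos e ^+ 2 = q / (q + 1).
  have := e2; rewrite cosD -!expr2 sin2cos2 => h.
  have : 2 * cos e ^+ 2 = (q - 1) / (q + 1) + 1 by rewrite -h; ring.
  move=> h2; have -> : cos e ^+ 2 = ((q - 1) / (q + 1) + 1) / 2 by rewrite -h2; field.
  by field; exact: lt0r_neq0.
have hs : sin e ^+ 2 = (q + 1)^-1 by rewrite sin2cos2 hc; field; exact: lt0r_neq0.
have c0 : 0 <= cos e.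
  rewrite -(cos_pihalf R) leNgt; apply/negP; rewrite ltr_cos ?in_itv /= ?/e; lra.
have s0 : 0 <= sin e.
  have : 0 <= e by rewrite /e; lra.
  rewrite le_eqVlt => /orP[/eqP <-|ep]; first by rewrite sin0.
  by apply: ltW; apply: sin_gt0_pi; rewrite ep /e; lra.
split; apply/eqP; rewrite -(eqrXn2 (n := 2)) ?invr_ge0 ?divr_ge0 ?sqrtr_ge0 //; apply/eqP.
  by rewrite hc expr_div_n !sqr_sqrtr // ltW.
by rewrite hs exprVn sqr_sqrtr // ltW.
Qed.

(** A point at distance e from infinity has norm cot(e/2) = (1 + cos e) / sin e. With the values in
    [half_acos] this is the sum of the square roots of [q + 1] and [q]. *)
Lemma halfway_stereo (q : R) : 0 <= q -> let r := Num.sqrt (q + 1) + Num.sqrt q in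
  2 * r / (r ^+ 2 + 1) = (Num.sqrt (q + 1))^-1 /\
  (r ^+ 2 - 1) / (r ^+ 2 + 1) = Num.sqrt q / Num.sqrt (q + 1).
Proof.
move=> q0 r; have a2 : Num.sqrt (q + 1) ^+ 2 = q + 1 by rewrite sqr_sqrtr //; lra.
have b2 : Num.sqrt q ^+ 2 = q by rewrite sqr_sqrtr.
have a0 : 0 < Num.sqrt (q + 1) by rewrite sqrtr_gt0; lra.
have b0 : 0 <= Num.sqrt q by rewrite sqrtr_ge0.
rewrite /r; move: (Num.sqrt (q + 1)) (Num.sqrt q) a2 b2 a0 b0 => a b a2 b2 a0 b0.
have n1 : a != 0 := lt0r_neq0 a0.
have n2 : (a + b) ^+ 2 + 1 != 0 by apply: lt0r_neq0; rewrite ltr_wpDl ?sqr_ge0.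
have e1 : (a + b) ^+ 2 + 1 = 2 * a * (a + b) by lra.
have e2 : (a + b) ^+ 2 - 1 = 2 * b * (a + b) by lra.
have n3 : a + b != 0 by apply: lt0r_neq0; lra.
by rewrite e1 e2; split; field; rewrite ?n1 ?n3.
Qed.

End Stereographic.

Section PartOne.
Variables (R : realType) (n : nat).
Local Notation V := (R * R)%type.
Local Notation PC := (PConf n (plane R)).
Local Open Scope quotient_scope.

Theorem plane_sections (s : UConf n (plane R) -> UConf0 n (plane R)) : (2 < n)%N ->
  is_section s -> adding_point_at_infinity s.
Proof.
move=> n2 hs; have fs := planar_of_section hs; have n0 : (0 < n)%N := ltn_trans (isT : 0 < 2)%N n2.
have [g [gs fg gf]] := section_far n2 fs.
have [F [FH F0 F1]] : homotopic (planar_of s) (radial g 1).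
  apply: homotopic_trans fg _; exists (radial g); split=> //; [exact: radial_homotopy | exact: radial0].
(* The tangent direction at infinity of the ray through the pushed point. *)
pose dir (X : PC) : 'rV[R]_3 := let z := g (coords X) in
  \row_(j < 3) [:: z.1 / nrm z; z.2 / nrm z; 0]`_j.
have dir_perm (p : 'S_n) X : dir (permute p X) = dir X.
  by rewrite /dir (_ : g _ = g (coords X)) // -(psec_sym gs (coords X) p).
have dir_ct X : ct X dir.
  have gc : ct X (fun X => g (coords X)) := ct_comp (@ct_coords R n X) (psec_cont gs (@coords_inj R n X)).
  have g1 := ct_fst gc; have g2 := ct_snd gc.
  have nc : ct X (fun X => (nrm (g (coords X)))^-1).
    by apply: ct_inv; [exact: lt0r_neq0 (far_nrm_gt0 gf (@coords_inj R n X)) | exact: ct_nrm].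
  apply: (@ct_mx R _ X 1 3 dir) => i j.
  apply: (@ct_near _ _ _ (fun X => [:: (g (coords X)).1 / nrm (g (coords X));
     (g (coords X)).2 / nrm (g (coords X)); 0]`_j)).
    by near=> q; rewrite /dir mxE.
  by case: j => -[|[|[|j]]] //= _; ctac.
pose v (c : UConf n (plane R)) : 'rV[R]_3 :=
  dir (repr (c : quotient_topology {eq_quot (same_orbit_equiv_rel (plane R) n)})).
have vE X : v (uconf X) = dir X.
  rewrite /v; set Y := repr _; have /uconfP[p e] : uconf X = uconf Y by symmetry; exact: reprK.
  by rewrite e dir_perm.
exists v, (fun c => section_family FH (1, c)); split.
- apply: (@repr_comp_continuous _ _ _ dir); first exact: dir_ct.
  by move=> X Y /eqP /uconfP[p ->]; rewrite dir_perm.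
- move=> c; have nz : 0 < nrm (g (coords (repr c))) := far_nrm_gt0 gf (@coords_inj R n _).
  rewrite /unit_tangent /dot !mxE !big_ord_recr !big_ord0 /= !mxE /=.
  rewrite !mul0r !mulr0 !addr0 !add0r; split=> //; rewrite -!expr2 !expr_div_n -mulrDl -nrm_sq.
  by rewrite divff // sqrf_eq0 lt0r_neq0.
- exact: section_family_is_section.
- move=> X; exists (consPConf (@plane_family_avoid R n F FH 1 X)); split; last first.
  + exact: (add_familyE (@plane_family_permute R n F FH)).
  + exact: forget0_cons.
  rewrite pt_cons /cons_point unlift_none vE infty_epsE // /plane_family F1 radial1.
  set x := coords X; set z := g x; have q0 := sq_radius_ge0 x.
  have nz : 0 < nrm z := far_nrm_gt0 gf (@coords_inj R n X).
  have [ce se] := half_acos q0; have [h1 h2] := halfway_stereo q0.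
  rewrite /geodesic ce se -/(halfway x) in h1 h2 *.
  have uu : (z.1 / nrm z) ^+ 2 + (z.2 / nrm z) ^+ 2 = 1.
    by rewrite !expr_div_n -mulrDl -nrm_sq divff // sqrf_eq0 lt0r_neq0.
  have nn : (halfway x * (z.1 / nrm z)) ^+ 2 + (halfway x * (z.2 / nrm z)) ^+ 2 = halfway x ^+ 2.
    by rewrite exprMn [(halfway x * (z.2 / nrm z)) ^+ 2]exprMn -mulrDr uu mulr1.
  apply/rowP => j; rewrite /to_sphere !mxE /= nn h2.
  case: j => -[|[|[|j]]] //= _; rewrite -?h1; try by ring.
- rewrite -{1}(section_family_start FH hs F0); exact: section_family_homotopic.
Unshelve. all: by end_near.
Qed.

End PartOne.
(** * Sections over the sphere *)

Section Quaternions.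
Variable R : realType.

Definition Quat : topologicalType := (R * R * R * R)%type.
Definition V3 : topologicalType := (R * R * R)%type.
Implicit Types (p q : Quat) (v : V3).

Definition qn2 q : R := let: (a, b, c, d) := q in a ^+ 2 + b ^+ 2 + c ^+ 2 + d ^+ 2.

Definition qmul p q : Quat :=
  let: (a, b, c, d) := p in let: (a', b', c', d') := q in
  (a * a' - b * b' - c * c' - d * d', a * b' + b * a' + c * d' - d * c',
   a * c' - b * d' + c * a' + d * b', a * d' + b * c' - c * b' + d * a').

Definition qconj q : Quat := let: (a, b, c, d) := q in (a, - b, - c, - d).

(* [q v q^*], which is [|q|^2] times a rotation of [v]. *)
Definition raw q v : V3 :=
  let: (a, b, c, d) := q in let: (x, y, z) := v in
  ((a ^+ 2 + b ^+ 2 - c ^+ 2 - d ^+ 2) * x + 2 * (b * c - a * d) * y + 2 * (b * d + a * c) * z,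
   2 * (b * c + a * d) * x + (a ^+ 2 - b ^+ 2 + c ^+ 2 - d ^+ 2) * y + 2 * (c * d - a * b) * z,
   2 * (b * d - a * c) * x + 2 * (c * d + a * b) * y + (a ^+ 2 - b ^+ 2 - c ^+ 2 + d ^+ 2) * z).

Definition scale3 (k : R) v : V3 := let: (x, y, z) := v in (k * x, k * y, k * z).

Definition sq3 v : R := let: (x, y, z) := v in x ^+ 2 + y ^+ 2 + z ^+ 2.

(** Dividing by the squared norm lets every nonzero quaternion act as a rotation, so that paths of
    rotations can be drawn with straight segments. The value at 0 keeps the action norm
    preserving. *)
Definition act q v : V3 := if qn2 q == 0 then v else scale3 (qn2 q)^-1 (raw q v).

Lemma qn2_mul p q : qn2 (qmul p q) = qn2 p * qn2 q.
Proof. by case: p q => [[[a b] c] d] [[[a' b'] c'] d']; rewrite /qn2 /qmul; ring. Qed.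

Lemma qn2_conj q : qn2 (qconj q) = qn2 q.
Proof. by case: q => [[[a b] c] d]; rewrite /qn2 /qconj; ring. Qed.

Lemma raw_mul p q v : raw (qmul p q) v = raw p (raw q v).
Proof.
case: p q v => [[[a b] c] d] [[[a' b'] c'] d'] [[x y] z]; rewrite /raw /qmul.
by congr (_, _, _); ring.
Qed.

Lemma raw_scale q k v : raw q (scale3 k v) = scale3 k (raw q v).
Proof.
case: q v => [[[a b] c] d] [[x y] z]; rewrite /raw /scale3.
by congr (_, _, _); ring.
Qed.

Lemma sq3_raw q v : sq3 (raw q v) = qn2 q ^+ 2 * sq3 v.
Proof.
by case: q v => [[[a b] c] d] [[x y] z]; rewrite /raw /sq3 /qn2; ring.
Qed.

Lemma sq3_act q v : sq3 (act q v) = sq3 v.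
Proof.
rewrite /act; case: eqP => // /eqP q0.
have -> : sq3 (scale3 (qn2 q)^-1 (raw q v)) = (qn2 q)^-1 ^+ 2 * sq3 (raw q v).
  by case: (raw q v) => [[x y] z]; rewrite /sq3 /scale3; ring.
by rewrite sq3_raw mulrA -exprMn mulVf // expr1n mul1r.
Qed.

Lemma act_mul p q v : qn2 p != 0 -> qn2 q != 0 -> act (qmul p q) v = act p (act q v).
Proof.
move=> p0 q0; rewrite /act qn2_mul mulf_eq0 (negbTE p0) (negbTE q0) /=.
rewrite raw_mul raw_scale; case: (raw p _) => [[x y] z]; rewrite /scale3 invfM.
by congr (_, _, _); ring.
Qed.

Lemma act_conjK q v : qn2 q != 0 -> act (qconj q) (act q v) = v.
Proof.
move=> q0; rewrite -act_mul ?qn2_conj //; rewrite /act qn2_mul qn2_conj (negbTE (mulf_neq0 q0 q0)).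
move: q0; case: q v => [[[a b] c] d] [[x y] z]; rewrite /qn2 /qmul /qconj /raw /scale3 => q0.
by congr (_, _, _); field.
Qed.

Lemma qconjK q : qconj (qconj q) = q.
Proof. by case: q => [[[a b] c] d]; rewrite /qconj !opprK. Qed.

Lemma act_Kconj q v : qn2 q != 0 -> act q (act (qconj q) v) = v.
Proof. by move=> q0; rewrite -{1}[q]qconjK act_conjK // qn2_conj. Qed.

Lemma act_inj q : injective (act q).
Proof.
have [q0|q0] := eqVneq (qn2 q) 0; first by move=> v w; rewrite /act q0 eqxx.
exact: (can_inj (g := act (qconj q))) (fun v => act_conjK v q0).
Qed.

Lemma ct_act (P : topologicalType) (x : P) (q : P -> Quat) (v : P -> V3) :
  ct x q -> ct x v -> qn2 (q x) != 0 -> ct x (fun y => act (q y) (v y)).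
Proof.
move=> qc vc q0.
have d := ct_snd qc; have abc := ct_fst qc; have c := ct_snd abc; have ab := ct_fst abc.
have b := ct_snd ab; have a := ct_fst ab.
have vz := ct_snd vc; have vxy := ct_fst vc; have vx := ct_fst vxy; have vy := ct_snd vxy.
have nE y : qn2 (q y) = (q y).1.1.1 ^+ 2 + (q y).1.1.2 ^+ 2 + (q y).1.2 ^+ 2 + (q y).2 ^+ 2.
  by case: (q y) => [[[? ?] ?] ?].
have nc : ct x (fun y => qn2 (q y)).
  have -> : (fun y => qn2 (q y)) = fun y => (q y).1.1.1 ^+ 2 + (q y).1.1.2 ^+ 2 + (q y).1.2 ^+ 2 + (q y).2 ^+ 2.
    by apply/funext.
  by ctac.
have ic := @ct_inv R P x (fun y => qn2 (q y)) q0 nc.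
have near0 : \forall y \near x, qn2 (q y) != 0.
  move: q0; rewrite neq_lt => /orP[h|h].
    by apply: filterS (near_lt nc (@ct_cst P x R 0) h) => y hy; rewrite neq_lt hy.
  by apply: filterS (near_lt (@ct_cst P x R 0) nc h) => y hy; rewrite neq_lt hy orbT.
apply: (@ct_near _ _ _ (fun y =>
  let a := (q y).1.1.1 in let b := (q y).1.1.2 in let c := (q y).1.2 in let d := (q y).2 in
  let vx := (v y).1.1 in let vy := (v y).1.2 in let vz := (v y).2 in let k := (qn2 (q y))^-1 in
  (k * ((a ^+ 2 + b ^+ 2 - c ^+ 2 - d ^+ 2) * vx + 2 * (b * c - a * d) * vy + 2 * (b * d + a * c) * vz),
   k * (2 * (b * c + a * d) * vx + (a ^+ 2 - b ^+ 2 + c ^+ 2 - d ^+ 2) * vy + 2 * (c * d - a * b) * vz),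
   k * (2 * (b * d - a * c) * vx + 2 * (c * d + a * b) * vy + (a ^+ 2 - b ^+ 2 - c ^+ 2 + d ^+ 2) * vz)))).
  apply: filterS near0 => y hy; rewrite /act (negbTE hy).
  by case: (q y) (v y) => [[[? ?] ?] ?] [[? ?] ?].
by cbv zeta; ctac.
Qed.

End Quaternions.
Section SphereSections.
Variables (R : realType) (n : nat).
Local Notation Sph := (sphere R).
Local Notation PS := (PConf n (sphere R)).

Definition to3 (u : Sph) : V3 R :=
  let m : 'rV[R]_3 := set_val u in (m 0 0, m 0 1, m 0 2).

Definition row3 (v : V3 R) : 'rV[R]_3 := \row_(j < 3) [:: v.1.1; v.1.2; v.2]`_j.

Lemma dot_row3 v : dot (row3 v) (row3 v) = sq3 v.
Proof.
case: v => [[x y] z]; rewrite /dot /sq3 mxE !big_ord_recr big_ord0 /= !mxE /=.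
by rewrite add0r -!expr2.
Qed.

Lemma row3_to3 u : row3 (to3 u) = set_val u.
Proof.
apply/rowP => j; rewrite mxE; case: j => -[|[|[|j]]] //= jj; congr (_ _ _); exact: val_inj.
Qed.

Definition of3 v (h : sq3 v = 1) : Sph :=
  exist _ (row3 v) (mem_set (etrans (dot_row3 v) h : [set p : 'rV[R]_3 | dot p p = 1] (row3 v))).

Lemma to3_of3 v (h : sq3 v = 1) : to3 (of3 h) = v.
Proof. by case: v h => [[x y] z] h; rewrite /to3 /= !mxE. Qed.

Lemma sq3_to3 u : sq3 (to3 u) = 1.
Proof. by rewrite -dot_row3 row3_to3; exact: set_mem (valP u). Qed.

Lemma to3_inj : injective to3.
Proof. by move=> u w /(congr1 row3); rewrite !row3_to3 => /val_inj. Qed.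

Lemma ct_to3 u : ct u to3.
Proof.
have c : ct u (fun w : Sph => (set_val w : 'rV[R]_3)) := @ct_set_val _ _ u.
by apply: ct_pair; [apply: ct_pair|]; exact: ct_entry.
Qed.

Lemma ct_of3 (P : topologicalType) (p : P) (v : P -> V3 R) (h : forall q, sq3 (v q) = 1) :
  ct p v -> ct p (fun q => of3 (h q)).
Proof.
move=> vc; apply: ct_subtype.
have v3 := ct_snd vc; have v12 := ct_fst vc; have v1 := ct_fst v12; have v2 := ct_snd v12.
apply: (@ct_mx R P p 1 3 (fun q => row3 (v q))) => i j.
apply: (@ct_near _ _ _ (fun q => [:: (v q).1.1; (v q).1.2; (v q).2]`_j)).
  by near=> q; rewrite mxE.
by case: j => -[|[|[|j]]].
Unshelve. all: by end_near.
Qed.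

Variable s : UConf n Sph -> UConf0 n Sph.
Hypothesis hs : is_section s.

Variable Q : 'I_n -> V3 R.
Hypothesis Qu : forall k, sq3 (Q k) = 1.
Hypothesis Qi : injective Q.

Lemma act_unit q k : sq3 (act q (Q k)) = 1.
Proof. by rewrite sq3_act. Qed.

Lemma turned_inj q : injective (fun k => of3 (act_unit q k)).
Proof. by move=> j k /(congr1 to3); rewrite !to3_of3 => /act_inj /Qi. Qed.

Definition turned q : PS := mkPConf (@turned_inj q).

(* The added point, seen from a frame moving with the configuration. *)
Definition relative (q : Quat R) : V3 R := act (qconj q) (to3 (added s (turned q))).

Lemma sq3_relative q : sq3 (relative q) = 1.
Proof. by rewrite sq3_act sq3_to3. Qed.

Lemma relative_avoid q k : qn2 q != 0 -> relative q <> Q k.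
Proof.
move=> q0 /(congr1 (act q)); rewrite act_Kconj // => e.
apply: (@added_avoid _ _ s hs (turned q) k); apply: to3_inj; rewrite e.
by rewrite [RHS](_ : _ = to3 (of3 (act_unit q k))) // to3_of3.
Qed.

Lemma ct_relative (P : topologicalType) (p : P) (q : P -> Quat R) :
  ct p q -> qn2 (q p) != 0 -> ct p (fun x => relative (q x)).
Proof.
move=> qc q0; apply: ct_act; last by rewrite qn2_conj.
  have d := ct_snd qc; have abc := ct_fst qc; have c := ct_snd abc; have ab := ct_fst abc.
  have b := ct_snd ab; have a := ct_fst ab.
  have -> : (fun x => qconj (q x)) = fun x => ((q x).1.1.1, - (q x).1.1.2, - (q x).1.2, - (q x).2).
    by apply/funext => x; case: (q x) => [[[? ?] ?] ?].
  by ctac.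
have tc : ct p (fun x => turned (q x)).
  apply: ct_subtype; apply: ct_ptws => k; apply: ct_of3.
  by apply: ct_act => //; exact: ct_cst.
exact: (ct_comp (ct_comp tc (@ct_added _ _ s hs _)) (@ct_to3 _)).
Qed.

(** A symmetry of [Q] only renumbers the rotated points: the added point is the same and only the
    frame changes. *)
Lemma relative_equivariant q g (p : 'S_n) : qn2 q != 0 -> qn2 g != 0 ->
  (forall k, act g (Q k) = Q (p k)) -> relative (qmul q g) = act (qconj g) (relative q).
Proof.
move=> q0 g0 gQ; have e : turned (qmul q g) = permute p (turned q).
  apply: PConf_eq => k; apply: to3_inj.
  rewrite pt_permute [LHS](_ : _ = to3 (of3 (act_unit (qmul q g) k))) // to3_of3.
  rewrite [RHS](_ : _ = to3 (of3 (act_unit q (p k)))) // to3_of3 -gQ.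
  exact: act_mul.
rewrite /relative e added_permute -act_mul ?qn2_conj //; congr act.
by case: (q) (g) => [[[? ?] ?] ?] [[[? ?] ?] ?]; rewrite /qconj /qmul; congr (_, _, _, _); ring.
Qed.

End SphereSections.

Section TurningNull.
Variable R : realType.
Local Notation V := (R * R)%type.

(** Transport along the constant loop is trivial, and transport along the initial loop is conjugate
    to it. *)
Lemma turning_null (g : R * R -> V) (c : V) : (forall q, ct q g) -> (forall q, g q <> (0, 0)) ->
  (forall u, g (u, 0) = g (u, 1)) -> (forall t, g (1, t) = c) -> turning (fun t => g (0, t)) 0.
Proof.
move=> gc g0 per top.
pose r (z : V) : nat := (0 < z.1).
have ok q : cut_ok (fun q => (g q).2) (fun q => r (g q)) q.
  split; first exact: ct_snd (gc q).
  move=> v2; have v1 : (g q).1 != 0.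
    by apply/eqP => v1; apply: (g0 q); case: (g q) v1 v2 => ? ? /= -> ->.
  move: v1; rewrite neq_lt => /orP[h|h].
    have := near_lt (ct_fst (gc q)) (@ct_cst _ q R 0) h.
    by apply: filterS => q' hq; rewrite /r !ltNge !ltW.
  have := near_lt (@ct_cst _ q R 0) (ct_fst (gc q)) h.
  by apply: filterS => q' hq; rewrite /r h hq.
have okp (m : R -> R * R) : (forall t : R, ct t m) -> path_ok (fun t => (g (m t)).2) (fun t => r (g (m t))).
  by move=> mc t _; exact: (cut_ok_comp (mc t) (ok _)).
have c1 (u t : R) : ct t (fun t : R => (u, t)) by apply: ct_pair; [exact: ct_cst | exact: ct_id].
have c2 (u t : R) : ct t (fun t : R => (t, u)) by apply: ct_pair; [exact: ct_id | exact: ct_cst].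
have [m hm] := path_ex (@dihK 1) (0 : int) (okp _ (@c1 0)).
have [d hd] := path_ex (@dihK 1) (0 : int) (okp _ (@c2 0)).
have [d' hd'] := path_ex (@dihK 1) m (okp _ (@c2 0)).
have hp u : 0 <= u <= 1 -> (g (u, 0)).2 = (g (u, 1)).2 /\ r (g (u, 0)) = r (g (u, 1)) by rewrite per.
have := loop_homotopy (@dihK 1) (fun u t _ _ => ok (u, t)) hp hm hd hd'.
move=> htop.
have hcst : carries (dih 1) (fun t => (g (1, t)).2) (fun t => r (g (1, t))) d d.
  exists (fun=> d); split=> // t _; near=> t' => _.
  by rewrite /tau !top eqxx.
have dd : d = d' := path_fun (@dihK 1) (okp _ (@c1 1)) hcst htop.
have m0 : 0 = m by apply: (path_inj (@dihK 1) (okp _ (@c2 0)) hd); rewrite dd.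
rewrite -m0 in hm.
have := @lift_turning R 1 (fun t => g (0, t)) (fun t => r (g (0, t))) 0 0 _ _ (okp _ (@c1 0)) _ hm (per 0).
rewrite subrr !mulr0; apply=> [t|t|t v2]; first exact: (ct_comp (@c1 0 t) (gc _)).
  exact: g0.
have v1 : (g (0, t)).1 != 0.
  by apply/eqP => v1; apply: (g0 (0, t)); case: (g (0, t)) v1 v2 => ? ? /= -> ->.
by move: v1; rewrite /r neq_lt; case: (ltgtP (g (0, t)).1 0).
Unshelve. all: by end_near.
Qed.

End TurningNull.

(** * The two poles and a regular polygon *)

Section PolesAndPolygon.
Variables (R : realType) (m : nat).
Hypothesis m1 : m != 1%N.

Definition axis (phi : R) : Quat R := (cos phi, 0, 0, sin phi).

Lemma qn2_axis phi : qn2 (axis phi) = 1.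
Proof. by rewrite /qn2 /axis expr0n /= !addr0 cos2Dsin2. Qed.

Lemma act_axis phi (v : V3 R) :
  act (axis phi) v = (rot (2 * phi) v.1, v.2).
Proof.
rewrite /act qn2_axis oner_eq0 invr1; case: v => [[x y] z].
have c2 : cos (2 * phi) = cos phi ^+ 2 - sin phi ^+ 2.
  by rewrite -[2 * phi]/((1 + 1) * phi) mulrDl mul1r cosD -!expr2.
have s2 : sin (2 * phi) = 2 * cos phi * sin phi.
  by rewrite -[2 * phi]/((1 + 1) * phi) mulrDl mul1r sinD; ring.
rewrite /axis /raw /scale3 /rot /= c2 s2; have h := cos2Dsin2 phi.
congr (_, _, _); [ring | ring |].
transitivity ((cos phi ^+ 2 + sin phi ^+ 2) * z); first by ring.
by rewrite h mul1r.
Qed.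

Lemma qconj_axis phi : qconj (axis phi) = axis (- phi).
Proof. by rewrite /axis /qconj oppr0 cosN sinN. Qed.

Definition beads (k : 'I_m.+2) : V3 R :=
  if (k : nat) is k'.+2 then (rot (2 * pi * (k'%:R / m%:R)) (1, 0), 0)
  else (0, 0, if (k : nat) == 0%N then 1 else -1).

Lemma beads_unit k : sq3 (beads k) = 1.
Proof.
rewrite /beads; case: k => -[|[|k]] /= _.
- by rewrite /sq3 expr0n expr1n /= !add0r.
- by rewrite /sq3 expr0n /= sqrrN expr1n !add0r.
- by rewrite /sq3 /rot /= !mulr1 !mulr0 subr0 addr0 expr0n /= addr0 cos2Dsin2.
Qed.

Lemma beads_inj : injective beads.
Proof.
move=> j k; rewrite /beads => e; apply: val_inj => /=; move: e.
case: j k => -[|[|j]] /= jm [] [|[|k]] //= km.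
1-6: by move=> /(congr1 snd) /= h; exfalso; lra.
case: m jm km => // N jm km e.
case: (ltngtP j k) => [h|h|-> //].
  by have /(congr1 fst) /= := e; move/polygon_neq; rewrite h; case; lia.
by have /(congr1 fst) /= := esym e; move/polygon_neq; rewrite h; case; lia.
Qed.

(** [axis (2 * pi * t)] rotates by 4 pi t, so the polygon reappears after time 1/(2m). The two poles
    alone are preserved by all rotations about the axis, and 4 is then a choice that does not divide
    2. *)
Definition symmetry_order : nat := if m == 0%N then 4%N else (2 * m)%N.

Definition beads_next (k : 'I_m.+2) : 'I_m.+2 :=
  inord (if (k < 2)%N then k : nat else if (k : nat) == m.+1 then 2%N else k.+1).

Lemma beads_nextE k : beads_next k =
  (if (k < 2)%N then k : nat else if (k : nat) == m.+1 then 2%N else k.+1) :> nat.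
Proof.
rewrite /beads_next inordK //; have := ltn_ord k; case: ifP => // k2; case: eqP => //; lia.
Qed.

Lemma beads_next_inj : injective beads_next.
Proof.
move=> j k /(congr1 val) /=; rewrite !beads_nextE => h; apply: val_inj => /=.
move: h; have := ltn_ord j; have := ltn_ord k.
by case: (ltnP j 2); case: (ltnP k 2); do ?case: eqP; lia.
Qed.

Lemma beads_turn k : beads (beads_next k) =
  (rot (2 * (2 * pi / symmetry_order%:R)) (beads k).1, (beads k).2).
Proof.
rewrite /beads beads_nextE; set th := 2 * (2 * pi / _).
case: k => -[|[|k]] /= km; [by rewrite rot_origin | by rewrite rot_origin |].
have m0 : (m == 0%N) = false by apply/negbTE; lia.
have mp : m%:R != 0 :> R by rewrite pnatr_eq0 m0.
transitivity (rot (th + 2 * pi * (k%:R / m%:R)) (1, 0), 0 : R); last by rewrite rotD.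
have -> : th = 2 * pi / m%:R by rewrite /th /symmetry_order m0 natrM; field.
case: eqP => [[km']|_] /=.
  rewrite mul0r mulr0 rot0 (_ : _ + _ = 2 * pi) ?rot2pi //.
  have -> : k%:R = m%:R - 1 :> R by rewrite -[m]prednK ?lt0n ?m0 // -km' -natr1 addrK.
  by field.
by congr (rot _ _, _); rewrite -[k.+1%:R]natr1; field.
Qed.

Lemma no_section_beads : ~ exists s : UConf m.+2 (sphere R) -> UConf0 m.+2 (sphere R), is_section s.
Proof.
move=> [s hs]; have pi0 := pi_gt0 R.
pose N := symmetry_order; have N2 : (2 < N)%N by rewrite /N /symmetry_order; case: eqP => // /eqP; lia.
(* At [q.1 = 0] the loop runs twice through the rotations about the poles. As a circle of
   quaternions it is contracted by a cone with vertex (0, 0, 1, 0). *)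
pose ql (q : R * R) : Quat R := ((1 - clamp01 q.1) * cos (2 * pi * q.2), 0, clamp01 q.1,
  (1 - clamp01 q.1) * sin (2 * pi * q.2)).
have ql0 q : qn2 (ql q) != 0.
  have h := cos2Dsin2 (2 * pi * q.2); rewrite /qn2 /ql !exprMn expr0n /= addr0.
  have -> : (1 - clamp01 q.1) ^+ 2 * cos (2 * pi * q.2) ^+ 2 + clamp01 q.1 ^+ 2 +
      (1 - clamp01 q.1) ^+ 2 * sin (2 * pi * q.2) ^+ 2 = (1 - clamp01 q.1) ^+ 2 *
      (cos (2 * pi * q.2) ^+ 2 + sin (2 * pi * q.2) ^+ 2) + clamp01 q.1 ^+ 2 by ring.
  rewrite h mulr1; apply: lt0r_neq0; have [->|c0] := eqVneq (clamp01 q.1) 0.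
    by rewrite subr0 expr1n expr0n /= addr0.
  by rewrite ltr_wpDl ?sqr_ge0 // exprn_even_gt0.
have qlc (q : R * R) : ct q ql.
  have q1 : ct q (fun q : R * R => clamp01 q.1) by apply: ct_clamp01; exact: ct_fst (@ct_id _ q).
  have q2 : ct q (fun q : R * R => q.2) by exact: ct_snd (@ct_id _ q).
  by rewrite /ql; ctac.
pose F := relative s beads_unit beads_inj.
pose g (q : R * R) : R * R := (F (ql q)).1.
have gc (q : R * R) : ct q g.
  have rc := @ct_relative R m.+2 s hs beads beads_unit beads_inj _ q ql (@qlc q) (ql0 q).
  exact: (ct_fst rc).
have g0 q : g q <> (0, 0).
  rewrite /g => e; have u : sq3 (F (ql q)) = 1 by exact: sq3_relative.
  have a0 := @relative_avoid R _ s hs beads beads_unit beads_inj (ql q) ord0 (ql0 q).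
  have a1 := @relative_avoid R _ s hs beads beads_unit beads_inj (ql q) (lift ord0 ord0) (ql0 q).
  move: e u a0 a1; rewrite -/F; case: (F (ql q)) => [[x y] z] /= [-> ->].
  rewrite /sq3 expr0n /= !add0r => /eqP; rewrite sqrf_eq1 => /orP[/eqP ->|/eqP ->].
    by case.
  by move=> _; case.
have per u : g (u, 0) = g (u, 1).
  by rewrite /g /ql /= mulr0 mulr1 cos0 sin0 mulr_natl cos2pi sin2pi.
have top t : g (1, t) = g (1, 0).
  by rewrite /g /ql /= clamp01_id ?lexx ?ler01 // subrr !mul0r.
have t0 := turning_null gc g0 per top.
pose w (t : R) : R * R := (to3 (added s (turned beads_unit beads_inj (axis (2 * pi * t))))).1.
have ql1 t : ql (0, t) = axis (2 * pi * t).
  by rewrite /ql /axis /= clamp01_id ?lexx ?ler01 // subr0 !mul1r.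
have gw t : rot (4 * pi * t) (g (0, t)) = w t.
  rewrite /g ql1 /F /relative qconj_axis act_axis rotD.
  by rewrite (_ : _ + _ = 0) ?rot0 //; ring.
(* In the fixed frame the added point turns twice, whereas the symmetry makes the number of turns a
   multiple of [N], which exceeds 2. *)
have tw : turning w (0 + 4 * pi).
  by apply: turning_ext (turning_rot (4 * pi) t0) => t _; exact: gw.
have wper (t : R) : w (t + N%:R^-1) = w t.
  rewrite /w; congr (to3 _).1.
  rewrite -(added_permute s (perm beads_next_inj) (turned _ _ (axis (2 * pi * t)))).
  congr (added s _); apply: PConf_eq => k; apply: to3_inj.
  rewrite pt_permute permE [LHS](_ : _ = act (axis (2 * pi * (t + N%:R^-1))) (beads k)); last exact: to3_of3.
  rewrite [RHS](_ : _ = act (axis (2 * pi * t)) (beads (beads_next k))); last exact: to3_of3.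
  rewrite !act_axis beads_turn rotD; congr (rot _ _, _).
  by rewrite -/N; ring.
have [k hk] := turning_periodic (ltn_trans (isT : (0 < 2)%N) N2) wper tw.
have {hk} : 2 = (Posz N * k)%:~R :> R.
  apply: (mulfI (x := 2 * pi)); first by rewrite mulf_neq0 ?lt0r_neq0 //; lra.
  transitivity (0 + 4 * pi : R); first by ring.
  by rewrite hk intrM; ring.
rewrite -[2]/((Posz 2)%:~R) => /eqP; rewrite eqr_int => /eqP h.
by have [k0|k1] := lerP k 0; nia.
Qed.

End PolesAndPolygon.
(** * Three points on the sphere *)

Section Relabel.
Variable R : realType.

(* Exchanging the two sides of the cut: the label of a path is unchanged, except at the
   times when it is on the cut. *)
Lemma carries_relabel (S S' : Type) (k : nat -> S -> S) (k' : nat -> S' -> S') (Phi : S -> S')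
    (sigma : nat -> nat) (h h' : R -> R) (r r' : R -> nat) s s' :
  (forall j s, Phi (k j s) = k' (sigma j) (Phi s)) -> (forall j, involutive (k' j)) ->
  path_ok h r -> (forall t, h' t = - h t) -> (forall t, h t = 0 -> r' t = sigma (r t)) ->
  h 0 != 0 -> h 1 != 0 -> carries k h r s s' -> carries k' h' r' (Phi s) (Phi s').
Proof.
move=> Pk kK ok hh rr h0 h1 [w [wl <- <-]].
exists (fun t => if h t == 0 then k' (sigma (r t)) (Phi (w t)) else Phi (w t)).
split; rewrite ?(negbTE h0) ?(negbTE h1) // => t t01.
have [hc rc] := ok t t01; have wn := wl t t01; rewrite /tau !hh.
have [ht|ht] := eqVneq (h t) 0.
  have {}rc := rc ht; near=> t' => t'01.
  have wt' : w t' = tau k h r t t' (w t) by move: t'01; near: t'.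
  have rt' : r t' = r t by near: t'.
  move: wt'; rewrite /tau !hh ht oppr0 lexx rt' (rr t ht) oppr_ge0.
  by case: (ltgtP (h t') 0) => [l|g|e] ->; rewrite ?Pk ?kK.
have sn : \forall t' \near t, h t' != 0 /\ (0 <= h t') = (0 <= h t).
  move: ht; rewrite neq_lt => /orP[ht|ht].
    have := near_lt hc (@ct_cst R t R 0) ht.
    by apply: filterS => q hq; rewrite neq_lt hq !leNgt hq ht.
  have := near_lt (@ct_cst R t R 0) hc ht.
  by apply: filterS => q hq; rewrite neq_lt hq orbT !ltW.
near=> t' => t'01.
have wt' : w t' = tau k h r t t' (w t) by move: t'01; near: t'.
have [ht' e] : h t' != 0 /\ (0 <= h t') = (0 <= h t) by near: t'.
rewrite (negbTE ht') wt' /tau e eqxx.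
rewrite hh; case: eqP => // ne; exfalso; apply: ne.
by move: e ht ht'; rewrite !oppr_ge0; case: (ltgtP (h t) 0); case: (ltgtP (h t') 0) => // -> _; rewrite ?eqxx.
Unshelve. all: by end_near.
Qed.

Lemma map_red (sigma : nat -> nat) (w : Red pred0) : injective sigma -> redb pred0 (map sigma (val w)).
Proof.
move=> si; rewrite redbE sorted_map; have := valP w; rewrite redbE.
by apply: sub_sorted => a b; rewrite /= /neq_rel (inj_eq si).
Qed.

Lemma wordof_relabel (sigma : nat -> nat) (h h' : R -> R) (r r' : R -> nat) W :
  injective sigma -> path_ok h r -> (forall t, h' t = - h t) ->
  (forall t, h t = 0 -> r' t = sigma (r t)) -> h 0 != 0 -> h 1 != 0 ->
  wordof h r W -> wordof h' r' (map sigma W).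
Proof.
move=> si ok hh rr h0 h1 [w [<- hw]].
pose Phi (w : Red pred0) : Red pred0 := Sub (map sigma (val w)) (map_red w si).
exists (Phi w); split=> //; have -> : red_nil pred0 = Phi (red_nil pred0) by exact: val_inj.
have Pk j (v : Red pred0) : Phi (kappa j v) = kappa (sigma j) (Phi v).
  apply: val_inj; rewrite !SubK /=; case: (val v) => [|a l] //=.
  by rewrite (inj_eq si); case: ifP.
exact: (carries_relabel Pk (@kappaK pred0) ok hh rr h0 h1 hw).
Qed.

End Relabel.


Definition M2 : Type := (int * int * int * int)%type.

Definition mm (A B : M2) : M2 :=
  let: (a, b, c, d) := A in let: (a', b', c', d') := B in
  (a * a' + b * c', a * b' + b * d', c * a' + d * c', c * b' + d * d').
Arguments mm : simpl never.
Definition mneg (A : M2) : M2 := let: (a, b, c, d) := A in (- a, - b, - c, - d).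
Definition mone : M2 := (1, 0, 0, 1).
Definition mdet (A : M2) : int := let: (a, b, c, d) := A in a * d - b * c.

(** The relations between the symmetries of the ideal triangle hold for their matrices up to sign
    only. *)
Definition eqpm (A B : M2) := A = B \/ A = mneg B.

Ltac mring := rewrite /mm /mneg /mone /mdet; congr (_, _, _, _); ring.

Lemma mmA A B C : mm A (mm B C) = mm (mm A B) C.
Proof. by case: A B C => [[[? ?] ?] ?] [[[? ?] ?] ?] [[[? ?] ?] ?]; mring. Qed.

Lemma mm1l A : mm mone A = A.
Proof. by case: A => [[[? ?] ?] ?]; mring. Qed.

Lemma mm1r A : mm A mone = A.
Proof. by case: A => [[[? ?] ?] ?]; mring. Qed.

Lemma mmN A B : mm A (mneg B) = mneg (mm A B) /\ mm (mneg A) B = mneg (mm A B).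
Proof. by case: A B => [[[? ?] ?] ?] [[[? ?] ?] ?]; split; mring. Qed.

Lemma mnegK A : mneg (mneg A) = A.
Proof. by case: A => [[[? ?] ?] ?]; rewrite /mneg !opprK. Qed.

Lemma mdet_mm A B : mdet (mm A B) = mdet A * mdet B.
Proof. by case: A B => [[[? ?] ?] ?] [[[? ?] ?] ?]; rewrite /mdet /mm; ring. Qed.

Lemma eqpm_sym A B : eqpm A B -> eqpm B A.
Proof. by move=> [->|->]; [left | right; rewrite mnegK]. Qed.

Lemma eqpm_trans A B C : eqpm A B -> eqpm B C -> eqpm A C.
Proof. by move=> [->|->] [->|->]; rewrite ?mnegK; [left|right|right|left]. Qed.

Lemma eqpm_mml A B C : eqpm B C -> eqpm (mm A B) (mm A C).
Proof. by move=> [->|->]; [left | right; rewrite (mmN A C).1]. Qed.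

Lemma eqpm_mmr A B C : eqpm B C -> eqpm (mm B A) (mm C A).
Proof. by move=> [->|->]; [left | right; rewrite (mmN C A).2]. Qed.

Lemma eqpm_cancel X A B : mdet X * mdet X = 1 -> eqpm (mm X A) (mm X B) -> eqpm A B.
Proof.
(* The adjugate of [X], which is its inverse up to sign. *)
move=> dX; pose Y : M2 := let: (a, b, c, d) := X in (d, - b, - c, a).
have YX C : mm Y (mm X C) = let: (a, b, c, d) := C in
    (mdet X * a, mdet X * b, mdet X * c, mdet X * d).
  by rewrite /Y; case: (X) (C) => [[[? ?] ?] ?] [[[? ?] ?] ?]; mring.
have XE C : eqpm C (mm Y (mm X C)).
  have /eqP : mdet X ^+ 2 = 1 by rewrite expr2.
  rewrite sqrf_eq1 YX => /orP[/eqP ->|/eqP ->]; case: C => [[[a b] c] d].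
    by left; rewrite !mul1r.
  by right; rewrite /mneg !mulN1r !opprK.
move=> h; apply: eqpm_trans (XE A) _; apply: eqpm_trans (eqpm_sym (XE B)).
exact: eqpm_mml.
Qed.

(* The reflections of the upper half-plane in the sides of the ideal triangle with
   vertices [0], [1] and infinity. *)
Definition side_refl (j : nat) : M2 :=
  match j with 0%N => (1, 0, 0, -1) | 1%N => (-1, 2, 0, 1) | _ => (1, 0, 2, -1) end.

Definition side_act (j : nat) (A : M2) : M2 := mm (side_refl j) A.

Lemma side_actK j : involutive (side_act j).
Proof.
have e : mm (side_refl j) (side_refl j) = mone by case: j => [|[|j]].
by move=> A; rewrite /side_act mmA e mm1l.
Qed.

Definition word_mx (w : seq nat) : M2 := evalw side_act w mone.

Lemma word_mx_eval w A : evalw side_act w A = mm (word_mx w) A.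
Proof.
rewrite /word_mx; elim: w => [|j w IH] /=; first by rewrite mm1l.
by rewrite /side_act -mmA -IH.
Qed.

Lemma word_mx_det w : mdet (word_mx w) = (-1) ^+ size w.
Proof.
rewrite /word_mx; elim: w => //= j w IH; rewrite /side_act mdet_mm IH exprS; congr (_ * _).
by case: j => [|[|j]].
Qed.

(** Congruence to the identity modulo 2, a property of the three reflections and hence of all
    words. *)
Definition odd_diag (A : M2) := let: (a, b, c, d) := A in
  exists x y z u : int, [/\ a = 2 * x + 1, b = 2 * y, c = 2 * z & d = 2 * u + 1].

Lemma word_mx_odd w : odd_diag (word_mx w).
Proof.
rewrite /word_mx; elim: w => [|j w IH] /=; first by exists 0, 0, 0, 0.
move: IH; case: (evalw _ _ _) => [[[a b] c] d] [x [y [z [u [-> -> -> ->]]]]].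
case: j => [|[|j]]; rewrite /side_act /side_refl /mm /odd_diag.
- by exists x, y, (- z), (- u - 1); split; ring.
- by exists (- x - 1 + 2 * z), (- y + 2 * u + 1), z, u; split; ring.
- by exists x, y, (2 * x + 1 - z), (2 * y - u - 1); split; ring.
Qed.

(* The symmetries of the ideal triangle fixing one side. *)
Definition flip_mx (b : bool) : M2 := if b then (0, 1, 1, 0) else (1, 0, 1, -1).

Definition flip (b : bool) (j : nat) : nat :=
  if b then (if j == 1 then 2 else if j == 2 then 1 else j)%N
  else (if j == 0 then 2 else if j == 2 then 0 else j)%N.

Lemma flip_inj b : injective (flip b).
Proof. by case: b => j k; rewrite /flip; do ?case: eqP; lia. Qed.

Lemma flip_le2 b j : (j <= 2)%N -> (flip b j <= 2)%N.
Proof. by case: b; rewrite /flip; do ?case: eqP; lia. Qed.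

Lemma flip_mxK b : mm (flip_mx b) (flip_mx b) = mone. Proof. by case: b. Qed.

Lemma flip_mx_side b j : (j <= 2)%N ->
  eqpm (mm (side_refl (flip b j)) (flip_mx b)) (mm (flip_mx b) (side_refl j)).
Proof. by case: b; case: j => [|[|[|j]]] // _; first [by left | by right]. Qed.

Lemma flip_word b w : (forall j, j \in w -> (j <= 2)%N) ->
  eqpm (mm (word_mx (map (flip b) w)) (flip_mx b)) (mm (flip_mx b) (word_mx w)).
Proof.
elim: w => [|j w IH] wl; first by rewrite mm1l mm1r; left.
have wE i v : word_mx (i :: v) = mm (side_refl i) (word_mx v) by [].
rewrite map_cons !wE -mmA; apply: eqpm_trans (eqpm_mml _ (IH _)) _.
  by move=> k kw; apply: wl; rewrite inE kw orbT.
rewrite !mmA; apply: eqpm_mmr; apply: flip_mx_side; apply: wl; exact: mem_head.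
Qed.

(** The lower left entry of the fourth power is c t (t^2 - 2), where t is the trace; [c] is odd and
    2 is not a square. *)
Lemma order4_trace (a b c d z : int) : mdet (a, b, c, d) = 1 -> c = 2 * z + 1 ->
  eqpm (mm (mm (mm (a, b, c, d) (a, b, c, d)) (a, b, c, d)) (a, b, c, d)) mone -> d = - a.
Proof.
rewrite /mdet => e cz h.
have : c * (a + d) * ((a + d) ^+ 2 - 2) = 0.
  transitivity (c * (a + d) * (a ^+ 2 + 2 * (b * c) + d ^+ 2)).
    by rewrite (_ : b * c = a * d - 1); [ring | rewrite -e; ring].
  transitivity (((c * a + d * c) * a + (c * b + d * d) * c) * a +
                ((c * a + d * c) * b + (c * b + d * d) * d) * c); first by ring.
  by case: h => -[_ _ ->].
move=> /eqP; rewrite !mulf_eq0 => /orP[/orP[/eqP c0|/eqP d0]|/eqP q0]; [lia | lia | exfalso].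
by move: q0; move: (a + d) => t q0; have [] : (t <= -2 \/ t = -1 \/ t = 0 \/ t = 1 \/ 2 <= t)%R; nia.
Qed.

(* With traceless [A] and [B], the trace [t] of [A B] satisfies [|t| >= 2] by AM-GM, while
   the first entries of [A B A] and [B A B] are [t a + a'] and [t a' + a]. *)
Lemma no_braid (A B : M2) : mdet A = 1 -> mdet B = 1 ->
  (exists2 w, odd_diag w & A = mm (flip_mx true) w) ->
  (exists2 w, odd_diag w & B = mm (flip_mx false) w) ->
  eqpm (mm (mm (mm A A) A) A) mone -> eqpm (mm (mm (mm B B) B) B) mone ->
  eqpm (mm (mm A B) A) (mm (mm B A) B) -> False.
Proof.
move=> dA dB [[[[? ?] ?] ?] [x [y [z [u [-> -> -> ->]]]]] eA].
move=> [[[[? ?] ?] ?] [x' [y' [z' [u' [-> -> -> ->]]]]] eB].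
case: A B dA dB eA eB => [[[a b] c] d] [[[a' b'] c'] d'] dA dB.
rewrite /flip_mx /mm => -[ea eb ec ed] [ea' eb' ec' ed'] oA oB.
have da : d = - a by apply: (order4_trace (z := x) dA) => //; lia.
have da' : d' = - a' by apply: (order4_trace (z := x' - z') dB) => //; lia.
have {}ea : a = 2 * z by lia.
have {}ea' : a' = 2 * x' + 1 by lia.
have {}dA : b * c = - 1 - a ^+ 2 by move: dA; rewrite /mdet da; lia.
have {}dB : b' * c' = - 1 - a' ^+ 2 by move: dB; rewrite /mdet da'; lia.
rewrite {oA oB} da da' {d d' da da' eb ec ed eb' ec' ed'}.
pose t := 2 * (a * a') + b * c' + c * b'.
have amgm : (t - 2 * (a * a')) ^+ 2 >= 4 * ((1 + a ^+ 2) * (1 + a' ^+ 2)).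
  have -> : (1 + a ^+ 2) * (1 + a' ^+ 2) = (b * c) * (b' * c') by rewrite dA dB; ring.
  rewrite -subr_ge0 /t.
  have -> : (2 * (a * a') + b * c' + c * b' - 2 * (a * a')) ^+ 2 - 4 * (b * c * (b' * c'))
      = (b * c' - c * b') ^+ 2 by ring.
  exact: sqr_ge0.
have e1 : (a * a' + b * c') * a + (a * b' + b * - a') * c = t * a + a'.
  transitivity (t * a - a' * (a ^+ 2 + b * c)); first by rewrite /t; ring.
  by rewrite dA; ring.
have e2 : (a' * a + b' * c) * a' + (a' * b + b' * - a) * c' = t * a' + a.
  transitivity (t * a' - a * (a' ^+ 2 + b' * c')); first by rewrite /t; ring.
  by rewrite dB; ring.
(* [a] is even and [a'] is odd, which excludes a = a' and a = - a'. So t is 1 or -1, against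
   [amgm]. *)
rewrite /eqpm /mneg => -[] [h _ _ _]; move: h; rewrite e1 e2; clearbody t => h.
  have /eqP : (t - 1) * (a - a') = 0 by rewrite (_ : _ * _ = (t * a + a') - (t * a' + a)); [rewrite h subrr | ring].
  rewrite mulf_eq0 => /orP[/eqP t1|/eqP]; last by lia.
  have {}t1 : t = 1 by lia.
  by move: amgm; rewrite t1; move: (sqr_ge0 (a + a')) (sqr_ge0 a) (sqr_ge0 a'); lra.
have /eqP : (t + 1) * (a + a') = 0 by rewrite (_ : _ * _ = (t * a + a') + (t * a' + a)); [rewrite h; ring | ring].
rewrite mulf_eq0 => /orP[/eqP t1|/eqP]; last by lia.
have {}t1 : t = -1 by lia.
by move: amgm; rewrite t1; move: (sqr_ge0 (a - a')) (sqr_ge0 a) (sqr_ge0 a'); lra.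
Qed.

(** * The equatorial triangle and its half-turns *)

Section Triangle.
Variable R : realType.
Implicit Types (v : V3 R) (q : Quat R).

Definition apex : R := Num.sqrt 3 / 2.

Lemma apex2 : apex ^+ 2 = 3 / 4.
Proof. by rewrite /apex exprMn sqr_sqrtr ?ler0n //; field. Qed.

Lemma apex_gt0 : 0 < apex. Proof. by rewrite divr_gt0 ?sqrtr_gt0 ?ltr0n. Qed.

Definition triangle (k : 'I_3) : V3 R :=
  match (k : nat) with
  | 0%N => (1, 0, 0) | 1%N => (- 2^-1, apex, 0) | _ => (- 2^-1, - apex, 0)
  end.

Lemma triangle_unit k : sq3 (triangle k) = 1.
Proof.
have a2 := apex2; case: k => [[|[|k]] km]; rewrite /triangle /sq3 /= ?sqrrN ?a2 ?expr0n /=.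
- by rewrite expr1n !addr0.
- by field.
- by field.
Qed.

Lemma triangle_inj : injective triangle.
Proof.
have a0 := apex_gt0.
move=> [[|[|[|j]]] jm] [[|[|[|k]]] km] // e; apply: val_inj => //=; move: e; rewrite /triangle /=;
  by case=> *; exfalso; lra.
Qed.

(* The half-turns about the axes through the last and through the middle vertex. *)
Definition half_turn (b : bool) : Quat R := if b then (0, 1, 0, 0) else (0, - 2^-1, apex, 0).

Lemma qn2_half_turn b : qn2 (half_turn b) = 1.
Proof.
have a2 := apex2; case: b; rewrite /qn2 /half_turn expr0n /= ?expr1n ?sqrrN ?a2 !addr0 ?add0r //.
by field.
Qed.

Lemma act_half_turn b v : act (half_turn b) v =
  let: (x, y, z) := v in
  if b then (x, - y, - z) else (- x / 2 - apex * y, - apex * x + y / 2, - z).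
Proof.
have a2 := apex2; rewrite /act qn2_half_turn oner_eq0 invr1 /raw /scale3 /half_turn.
by case: v b => [[x y] z] []; congr (_, _, _); rewrite ?sqrrN ?a2; field.
Qed.

Lemma act_conj_half_turn b v : act (qconj (half_turn b)) v = act (half_turn b) v.
Proof.
rewrite /act qn2_conj; case: eqP => // _; congr scale3.
by case: v b => [[x y] z] []; rewrite /half_turn /qconj /raw; congr (_, _, _); ring.
Qed.

Definition flip_perm (b : bool) : 'S_3 := tperm (if b then 1 else 0) (2 : 'I_3).

Lemma triangle_flip b k : act (half_turn b) (triangle k) = triangle (flip_perm b k).
Proof.
have a2 := apex2; rewrite act_half_turn /flip_perm permE /=.
by case: b; case: k => [[|[|[|k]]] km] //; rewrite /triangle /=; congr (_, _, _); field || nra.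
Qed.

(* The arc of the equator cut out by the triangle, numbered by the opposite vertex. *)
Definition arc v : nat :=
  if v.1.1 < - 2^-1 then 0%N else if - v.1.1 / 2 + apex * v.1.2 < - 2^-1 then 1%N else 2%N.

Lemma arc_le2 v : (arc v <= 2)%N.
Proof. by rewrite /arc; do 2?case: ifP. Qed.

Definition off_triangle v := sq3 v = 1 /\ forall k, v <> triangle k.

(** On the equator the tests that define [arc] change their outcome only at vertices. *)
Lemma equator_off v : off_triangle v -> v.2 = 0 ->
  [/\ v.1.1 ^+ 2 + v.1.2 ^+ 2 = 1, v.1.1 < 1, v.1.1 != - 2^-1 &
      - v.1.1 / 2 + apex * v.1.2 != - 2^-1].
Proof.
have a2 := apex2; have a0 := apex_gt0; case: v => [[x y] z] /= [+ vn] z0.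
rewrite /sq3 z0 expr0n addr0 => v1.
have n0 := vn ord0; have n1 := vn (1 : 'I_3); have n2 := vn (2 : 'I_3).
rewrite /triangle /= z0 in n0 n1 n2.
have yn : x = 1 -> False.
  move=> x1; apply: n0; move: v1; rewrite x1 expr1n => y1.
  have /eqP : y ^+ 2 = 0 by lra.
  by rewrite sqrf_eq0 => /eqP ->.
split=> //.
- rewrite lt_neqAle; apply/andP; split; first by apply/eqP.
  by move: (sqr_ge0 y); nra.
- apply/eqP => xe; have : y ^+ 2 == apex ^+ 2 by apply/eqP; rewrite a2; move: v1; rewrite xe; nra.
  by rewrite eqf_sqr => /orP[/eqP ye|/eqP ye]; [apply: n1 | apply: n2]; rewrite xe ye.
- apply/eqP => de; have xe : x = 1 + 2 * (apex * y) by lra.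
  have /eqP : y * (y + apex) = 0.
    have : (1 + 2 * (apex * y)) ^+ 2 + y ^+ 2 = 1 + 4 * (apex * y) + (4 * apex ^+ 2 + 1) * y ^+ 2 by ring.
    by rewrite -xe v1 a2; nra.
  rewrite mulf_eq0 => /orP[/eqP ye|/eqP ye]; first by apply: yn; rewrite xe ye mulr0 mulr0 addr0.
  apply: n2; have -> : y = - apex by apply/eqP; rewrite -addr_eq0 ye.
  have -> : x = - 2^-1; last by [].
  by rewrite xe (_ : y = - apex) ?mulrN -?expr2 ?a2; [field | apply/eqP; rewrite -addr_eq0 ye].
Qed.

Lemma arc_flip b v : off_triangle v -> v.2 = 0 -> arc (act (half_turn b) v) = flip b (arc v).
Proof.
move=> vo v2; have [] := equator_off vo v2.
have a2 := apex2; have a0 := apex_gt0; rewrite act_half_turn /arc.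
case: v {vo v2} => [[x y] z] /= e x1 xn dn.
pose d := - x / 2 - apex * y.
(* [x], [f] and [d] are the scalar products with the three vertices. Together with [s0] this
   identity shows that exactly one of them is below -1/2. *)
have yz : (- x / 2 + apex * y + 2^-1) * (d + 2^-1) = - ((1 - x) * (x + 2^-1)).
  transitivity ((1 - x) ^+ 2 / 4 - apex ^+ 2 * (x ^+ 2 + y ^+ 2 - x ^+ 2)); first by rewrite /d; field.
  by rewrite e a2; field.
have s0 : (- x / 2 + apex * y + 2^-1) + (d + 2^-1) = 1 - x by rewrite /d; field.
have E : - (- x / 2 - apex * y) / 2 + apex * (- apex * x + y / 2) = - x / 2 + apex * y.
  transitivity (x / 4 - apex ^+ 2 * x + apex * y); first by field.
  by rewrite a2; field.
have E' : - x / 2 + apex * - y = d by rewrite /d mulrN.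
case: b; rewrite /= ?E ?E' -?/d; clear E E'; move: (- x / 2 + apex * y) dn yz s0 => f dn yz s0.
  case: (ltP x (- 2^-1)) => // xl; have {}xl : - 2^-1 < x by rewrite lt_neqAle eq_sym xn.
  by case: (ltP f (- 2^-1)) => fl; case: (ltP d (- 2^-1)) => dl //; exfalso; nra.
case: (ltP x (- 2^-1)) => xl; case: (ltP d (- 2^-1)) => dl; case: (ltP f (- 2^-1)) => fl //; exfalso;
  first [by nra | have {}xl : - 2^-1 < x by (rewrite lt_neqAle eq_sym xn); nra].
Qed.

Lemma arc_cut_ok (P : topologicalType) (p : P) (g : P -> V3 R) :
  ct p g -> off_triangle (g p) -> cut_ok (fun x => (g x).2) (fun x => arc (g x)) p.
Proof.
move=> gc go; split=> [|g2]; first exact: ct_snd gc.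
have [_ _ xn dn] := equator_off go g2.
have xc := ct_fst (ct_fst gc); have yc := ct_snd (ct_fst gc).
have dc : ct p (fun x => - (g x).1.1 / 2 + apex * (g x).1.2) by ctac.
have side (h : P -> R) : ct p h -> h p != - 2^-1 ->
    \forall x \near p, (h x < - 2^-1) = (h p < - 2^-1).
  move=> hc; rewrite neq_lt => /orP[l|l].
    by apply: filterS (near_lt hc (@ct_cst P p R (- 2^-1)) l) => x ->; rewrite l.
  apply: filterS (near_lt (@ct_cst P p R (- 2^-1)) hc l) => x lx.
  by rewrite !ltNge !ltW.
apply: filterS2 (side _ xc xn) (side _ dc dn) => x e1 e2.
by rewrite /arc e1 e2.
Qed.

End Triangle.

(** * Words along products of half-turns *)

Section ThreePoints.
Variable R : realType.
Variable s : UConf 3 (sphere R) -> UConf0 3 (sphere R).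
Hypothesis hs : is_section s.
Local Notation F := (relative s (@triangle_unit R) (@triangle_inj R)).
Implicit Types (q : Quat R) (l : seq bool) (W : seq nat).

Lemma relative_off q : qn2 q != 0 -> off_triangle (F q).
Proof. by move=> q0; split=> [|k]; [exact: sq3_relative | exact: relative_avoid]. Qed.

Lemma relative_half_turn b q : qn2 q != 0 ->
  F (qmul q (half_turn R b)) = act (half_turn R b) (F q).
Proof.
move=> q0; rewrite (@relative_equivariant _ _ s _ _ _ q (half_turn R b) (flip_perm b)) ?act_conj_half_turn //.
  by rewrite qn2_half_turn oner_eq0.
exact: triangle_flip.
Qed.

Definition qone : Quat R := (1, 0, 0, 0).

Definition segment (q q' : Quat R) (t : R) : Quat R :=
  ((1 - t) * q.1.1.1 + t * q'.1.1.1, (1 - t) * q.1.1.2 + t * q'.1.1.2,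
   (1 - t) * q.1.2 + t * q'.1.2, (1 - t) * q.2 + t * q'.2).

Lemma ct_segment (P : topologicalType) (p : P) (q q' : P -> Quat R) (t : P -> R) :
  ct p q -> ct p q' -> ct p t -> ct p (fun x => segment (q x) (q' x) (t x)).
Proof.
move=> qc qc' tc.
have d := ct_snd qc; have abc := ct_fst qc; have c := ct_snd abc; have ab := ct_fst abc.
have b := ct_snd ab; have a := ct_fst ab.
have d' := ct_snd qc'; have abc' := ct_fst qc'; have c' := ct_snd abc'; have ab' := ct_fst abc'.
have b' := ct_snd ab'; have a' := ct_fst ab'.
by rewrite /segment; ctac.
Qed.

Lemma ct_qmul (P : topologicalType) (p : P) (q q' : P -> Quat R) :
  ct p q -> ct p q' -> ct p (fun x => qmul (q x) (q' x)).
Proof.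
move=> qc qc'.
have d := ct_snd qc; have abc := ct_fst qc; have c := ct_snd abc; have ab := ct_fst abc.
have b := ct_snd ab; have a := ct_fst ab.
have d' := ct_snd qc'; have abc' := ct_fst qc'; have c' := ct_snd abc'; have ab' := ct_fst abc'.
have b' := ct_snd ab'; have a' := ct_fst ab'.
have -> : (fun x => qmul (q x) (q' x)) = fun x =>
  let: (a, b, c, d) := ((q x).1.1.1, (q x).1.1.2, (q x).1.2, (q x).2) in
  let: (a', b', c', d') := ((q' x).1.1.1, (q' x).1.1.2, (q' x).1.2, (q' x).2) in
  (a * a' - b * b' - c * c' - d * d', a * b' + b * a' + c * d' - d * c',
   a * c' - b * d' + c * a' + d * b', a * d' + b * c' - c * b' + d * a').
  by apply/funext => x; case: (q x) (q' x) => [[[? ?] ?] ?] [[[? ?] ?] ?].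
by cbv beta iota; ctac.
Qed.

Lemma qmulA (p q r : Quat R) : qmul p (qmul q r) = qmul (qmul p q) r.
Proof.
case: p q r => [[[? ?] ?] ?] [[[? ?] ?] ?] [[[? ?] ?] ?].
by rewrite /qmul; congr (_, _, _, _); ring.
Qed.

Lemma qmul1 (p : Quat R) : qmul qone p = p /\ qmul p qone = p.
Proof. by case: p => [[[? ?] ?] ?]; split; rewrite /qmul /qone; congr (_, _, _, _); ring. Qed.

Lemma segment0 (q q' : Quat R) : segment q q' 0 = q.
Proof. by case: q => [[[? ?] ?] ?]; rewrite /segment /=; congr (_, _, _, _); ring. Qed.

Lemma segment1 (q q' : Quat R) : segment q q' 1 = q'.
Proof. by case: q' => [[[? ?] ?] ?]; rewrite /segment /=; congr (_, _, _, _); ring. Qed.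

Definition spin (b : bool) (t : R) : Quat R := segment qone (half_turn R b) t.

Lemma qn2_spin b (t : R) : qn2 (spin b t) != 0.
Proof.
have e : qn2 (spin b t) = (1 - t) ^+ 2 + t ^+ 2.
  transitivity ((1 - t) ^+ 2 + t ^+ 2 * qn2 (half_turn R b)); last by rewrite qn2_half_turn mulr1.
  by case: b; rewrite /qn2 /spin /segment /=; ring.
rewrite e; apply: lt0r_neq0; have [->|t0] := eqVneq t 0.
  by rewrite subr0 expr1n expr0n /= addr0.
by rewrite ltr_wpDl ?sqr_ge0 // exprn_even_gt0.
Qed.

Lemma ct_spin b (t : R) : ct t (spin b).
Proof. by apply: ct_segment; [exact: ct_cst | exact: ct_cst | exact: ct_id]. Qed.

Lemma relative_cut_ok (P : topologicalType) (p : P) (q : P -> Quat R) :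
  ct p q -> qn2 (q p) != 0 -> cut_ok (fun x => (F (q x)).2) (fun x => arc (F (q x))) p.
Proof.
move=> qc q0; apply: (arc_cut_ok (@ct_relative R 3 s hs _ _ _ P p q qc q0)).
exact: relative_off.
Qed.

(** If the added point always stayed on the equator, the number of its arc would be constant along
    [spin b] and yet be changed by [flip b] at the end; no arc is fixed by both flips. *)
Lemma off_equator : exists2 q, qn2 q != 0 & (F q).2 != 0.
Proof.
apply: contrapT => H.
have e0 q : qn2 q != 0 -> (F q).2 = 0.
  by move=> q0; apply/eqP; apply: contrapT => /negP h; apply: H; exists q.
have one0 : qn2 qone != 0 by rewrite /qn2 /qone expr1n expr0n /= !addr0 oner_eq0.
have fixed b : arc (F qone) = flip b (arc (F qone)).
  rewrite -arc_flip; [|exact: relative_off | exact: e0].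
  rewrite -relative_half_turn // (qmul1 _).1.
  pose r (t : R) := arc (F (spin b t)).
  have okr t : \forall t' \near t, r t' = r t.
    have [_] := @relative_cut_ok R t (spin b) (@ct_spin b t) (qn2_spin b t).
    by apply; apply: e0; exact: qn2_spin.
  have ok : path_ok (fun=> 1 : R) r by move=> t _; split; [exact: ct_cst | move=> _; exact: okr].
  have idK (j : nat) : involutive (fun n : nat => n) by [].
  have l1 : carries (fun _ n => n) (fun=> 1 : R) r (r 0) (r 0).
    by exists (fun=> r 0); split=> // t _; near=> t' => _; rewrite /tau eqxx.
  have l2 : carries (fun _ n => n) (fun=> 1 : R) r (r 0) (r 1).
    by exists r; split=> // t _; apply: filterS (okr t) => t' e _; rewrite /tau eqxx.
  by have := path_fun idK ok l1 l2; rewrite /r /spin segment0 segment1.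
have := fixed true; have := fixed false; have := arc_le2 (F qone).
by rewrite /flip; case: (arc _) => [|[|[|]]].
Unshelve. all: by end_near.
Qed.

Variable q0 : Quat R.
Hypothesis q0n : qn2 q0 != 0.
Hypothesis q0o : (F q0).2 != 0.

Definition view q : V3 R := F (qmul q0 q).

Definition reads (q : R -> Quat R) W := wordof (fun t => (view (q t)).2) (fun t => arc (view (q t))) W.

Lemma qn2_view q : qn2 q != 0 -> qn2 (qmul q0 q) != 0.
Proof. by move=> qn; rewrite qn2_mul mulf_neq0. Qed.

Lemma view_off q : qn2 q != 0 -> off_triangle (view q).
Proof. by move=> /qn2_view; exact: relative_off. Qed.

Lemma view_half_turn b q : qn2 q != 0 -> view (qmul q (half_turn R b)) = act (half_turn R b) (view q).
Proof. by move=> qn; rewrite /view qmulA relative_half_turn // qn2_view. Qed.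

Lemma act_half_turn_2 b (v : V3 R) : (act (half_turn R b) v).2 = - v.2.
Proof. by rewrite act_half_turn; case: v b => [[? ?] ?] []. Qed.

Lemma view_cut_ok (P : topologicalType) (p : P) (q : P -> Quat R) :
  ct p q -> qn2 (q p) != 0 -> cut_ok (fun x => (view (q x)).2) (fun x => arc (view (q x))) p.
Proof.
move=> qc qn; apply: (@relative_cut_ok P p (fun x => qmul q0 (q x))); last exact: qn2_view.
by apply: ct_qmul => //; exact: ct_cst.
Qed.

Fixpoint turns l : Quat R := if l is b :: l' then qmul (half_turn R b) (turns l') else qone.

Lemma qn2_turns l : qn2 (turns l) != 0.
Proof.
elim: l => [|b l IH] /=; first by rewrite /qn2 /qone expr1n expr0n /= !addr0 oner_eq0.
by rewrite qn2_mul qn2_half_turn mul1r.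
Qed.

Fixpoint flips l (j : nat) : nat := if l is b :: l' then flips l' (flip b j) else j.

Fixpoint flips_mx l : M2 := if l is b :: l' then mm (flips_mx l') (flip_mx b) else mone.

Lemma flips_word l W : (forall j, j \in W -> (j <= 2)%N) ->
  eqpm (mm (word_mx (map (flips l) W)) (flips_mx l)) (mm (flips_mx l) (word_mx W)).
Proof.
elim: l W => [|b l IH] W wl /=; first by rewrite map_id mm1l mm1r; left.
rewrite mmA -[map _ W]/(map (flips l \o flip b) W) map_comp.
apply: eqpm_trans (eqpm_mmr _ (IH _ _)) _.
  by move=> j /mapP[k kW ->]; apply: flip_le2; exact: wl.
by rewrite -!mmA; apply: eqpm_mml; exact: flip_word.
Qed.

(** A half-turn on the right exchanges the two sides of the equator and permutes the arcs, so it
    only relabels the word. *)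
Lemma reads_turns l (q : R -> Quat R) W : (forall t : R, ct t q) -> (forall t, qn2 (q t) != 0) ->
  (view (q 0)).2 != 0 -> (view (q 1)).2 != 0 ->
  reads q W -> reads (fun t => qmul (q t) (turns l)) (map (flips l) W).
Proof.
elim: l q W => [|b l IH] q W qc qn v0 v1 hW /=.
  by rewrite map_id; have -> : (fun t => qmul (q t) qone) = q by apply/funext => t; rewrite (qmul1 _).2.
have -> : (fun t => qmul (q t) (qmul (half_turn R b) (turns l))) =
    fun t => qmul (qmul (q t) (half_turn R b)) (turns l) by apply/funext => t; rewrite qmulA.
rewrite -[map _ W]/(map (flips l \o flip b) W) map_comp; apply: IH.
- by move=> t; apply: ct_qmul => //; exact: ct_cst.
- by move=> t; rewrite qn2_mul qn2_half_turn mulr1.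
- by rewrite view_half_turn // act_half_turn_2 oppr_eq0.
- by rewrite view_half_turn // act_half_turn_2 oppr_eq0.
apply: (wordof_relabel (@flip_inj b)) hW => //.
- by move=> t _; apply: view_cut_ok.
- by move=> t; rewrite view_half_turn // act_half_turn_2.
- by move=> t v2; rewrite view_half_turn // arc_flip //; exact: view_off.
Qed.

Lemma reads_spin b : exists W, [/\ reads (spin b) W, odd (size W) & forall j, j \in W -> (j <= 2)%N].
Proof.
have ok : path_ok (fun t => (view (spin b t)).2) (fun t => arc (view (spin b t))).
  by move=> t _; apply: view_cut_ok; [exact: ct_spin | exact: qn2_spin].
have [W hW] := wordof_ex ok; exists W; split=> //; last first.
  by apply: (wordof_letters ok _ hW) => t _; exact: arc_le2.
rewrite (wordof_odd ok hW) /spin segment0 segment1 -[half_turn R b](qmul1 _).1.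
rewrite view_half_turn ?act_half_turn_2 ?(qn2_turns [::]) // /view (qmul1 _).2.
by move: q0o; rewrite oppr_ge0; case: (ltgtP (F q0).2 0).
Qed.

(* The cone with this vertex over the circles [spin b] and their translates avoids the
   quaternion 0. *)
Definition cone_point : Quat R := (0, 0, 1, 1).

Definition visible q := (q.1.1.1 != 0) || (q.1.1.2 != 0).

Lemma visible_segment q (t : R) : visible q -> qn2 (segment q cone_point t) != 0.
Proof.
move=> vq; have [t1|t1] := eqVneq t 1.
  by rewrite t1 segment1 /cone_point /qn2 expr0n expr1n /= !add0r; apply: lt0r_neq0; lra.
have h : 1 - t != 0 by rewrite subr_eq0 eq_sym.
apply: lt0r_neq0; rewrite /qn2 /segment /= !mulr0 !addr0.
move: vq => /orP[x0|x0].
  have p : 0 < ((1 - t) * q.1.1.1) ^+ 2 by rewrite exprn_even_gt0 //= mulf_neq0.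
  by rewrite -!addrA ltr_pwDl // !addr_ge0 // sqr_ge0.
have p : 0 < ((1 - t) * q.1.1.2) ^+ 2 by rewrite exprn_even_gt0 //= mulf_neq0.
by rewrite addrAC -!addrA addrCA ltr_pwDl // !addr_ge0 // sqr_ge0.
Qed.

Definition spoke q W := reads (segment q cone_point) W.

Lemma spoke_ok q : visible q -> path_ok (fun t => (view (segment q cone_point t)).2)
  (fun t => arc (view (segment q cone_point t))).
Proof.
move=> vq t _; apply: view_cut_ok; last exact: visible_segment.
by apply: ct_segment; [exact: ct_cst | exact: ct_cst | exact: ct_id].
Qed.

Lemma spoke_ex q : visible q -> exists W, spoke q W.
Proof. by move=> /spoke_ok /wordof_ex. Qed.

(** The condition under which the cone over the arc from [turns l] to [turns (b :: l)] avoids 0. *)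
Definition steady b l := forall u : R, 0 <= u <= 1 -> visible (qmul (spin b u) (turns l)).

(** The cone over the arc is a disk, so the spoke at one end spells the same transport as the arc
    followed by the spoke at the other end. *)
Lemma spoke_step b l W W' V : steady b l -> spoke (turns l) W -> spoke (turns (b :: l)) W' ->
  reads (fun t => qmul (spin b t) (turns l)) V ->
  word_mx W = mm (word_mx W') (word_mx V).
Proof.
move=> st hW hW' hV.
pose Q (p : R * R) := segment (qmul (spin b p.1) (turns l)) cone_point p.2.
have Qc (p : R * R) : ct p Q.
  have c1 : ct p (fun p : R * R => p.1) := ct_fst (@ct_id _ p).
  apply: ct_segment; [apply: ct_qmul; last exact: ct_cst | exact: ct_cst | exact: ct_snd (@ct_id _ p)].
  exact: (ct_comp c1 (@ct_spin b _)).
have u1 : 0 <= (1 : R) <= 1 by rewrite ler01 lexx.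
have ok : forall u t, 0 <= u <= 1 -> 0 <= t <= 1 ->
    cut_ok (fun p => (view (Q p)).2) (fun p => arc (view (Q p))) (u, t).
  by move=> u t u01 _; apply: view_cut_ok => //; apply: visible_segment; exact: st.
have l1 : carries side_act (fun t => (view (Q (0, t))).2) (fun t => arc (view (Q (0, t)))) mone (word_mx W).
  apply: carries_ext (wordof_carries mone side_actK hW) => t _.
  have -> // : Q (0, t) = segment (turns l) cone_point t.
  by rewrite -[Q _]/(segment (qmul (segment qone _ 0) _) _ t) segment0 (qmul1 _).1.
have l2 : carries side_act (fun u => (view (Q (u, 1))).2) (fun u => arc (view (Q (u, 1))))
    (word_mx W) (word_mx W).
  exists (fun=> word_mx W); split=> // t _; near=> t' => _.
  have Q1 u : Q (u, 1) = cone_point by exact: segment1.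
  by rewrite /tau !Q1 eqxx.
have l3 : carries side_act (fun u => (view (Q (u, 0))).2) (fun u => arc (view (Q (u, 0))))
    mone (word_mx V).
  apply: carries_ext (wordof_carries mone side_actK hV) => t _.
  by have -> // : Q (t, 0) = qmul (spin b t) (turns l) by exact: segment0.
have hR := square side_actK ok l1 l2 l3.
have Q1 t : Q (1, t) = segment (turns (b :: l)) cone_point t by rewrite -[Q _]/(segment (qmul (segment qone _ 1) _) _ t) segment1.
have l4 : carries side_act (fun t => (view (segment (turns (b :: l)) cone_point t)).2)
    (fun t => arc (view (segment (turns (b :: l)) cone_point t))) (word_mx V) (word_mx W).
  by apply: carries_ext hR => t _; rewrite Q1.
have vb : visible (turns (b :: l)).
  by have := st 1 u1; rewrite /spin segment1.
by rewrite (wordof_fun side_actK (spoke_ok vb) hW' l4) word_mx_eval.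
Unshelve. all: by end_near.
Qed.

(** Relabelling by [flips l] is conjugation by [flips_mx l] up to sign. Once this is absorbed, the
    arc contributes the same matrix, [flip_mx b] times the word of [spin b], for every [l], and the
    products telescope along a chain of arcs. *)
Lemma spoke_flip b l W W' V : steady b l -> reads (spin b) V -> (forall j, j \in V -> (j <= 2)%N) ->
  spoke (turns l) W -> spoke (turns (b :: l)) W' ->
  eqpm (mm (word_mx W) (flips_mx l))
    (mm (mm (word_mx W') (flips_mx (b :: l))) (mm (flip_mx b) (word_mx V))).
Proof.
move=> st hV V2 hW hW'.
have hV' : reads (fun t => qmul (spin b t) (turns l)) (map (flips l) V).
  apply: reads_turns => //; [by move=> t; exact: ct_spin | by move=> t; exact: qn2_spin | |].
    by rewrite /spin segment0 /view (qmul1 _).2.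
  rewrite /spin segment1 -[half_turn R b](qmul1 _).1 view_half_turn ?(qn2_turns [::]) //.
  by rewrite act_half_turn_2 oppr_eq0 /view (qmul1 _).2.
rewrite (spoke_step st hW hW' hV') -[flips_mx (b :: l)]/(mm (flips_mx l) (flip_mx b)) -!mmA.
apply: eqpm_mml; apply: eqpm_trans (flips_word l V2) _.
by rewrite [mm (flip_mx b) (mm _ _)]mmA flip_mxK mm1l; left.
Qed.

Local Notation ht b := (half_turn R b).

Lemma turns_values b : [/\ turns [:: b] = ht b, turns [:: b; b] = (-1, 0, 0, 0),
  turns [:: b; b; b] = qmul (-1, 0, 0, 0) (ht b) & turns [:: b; b; b; b] = qone].
Proof.
have a2 := apex2 R; have t1 : turns [:: b] = ht b by rewrite /= (qmul1 _).2.
have t2 : turns [:: b; b] = (-1, 0, 0, 0).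
  rewrite -[turns _]/(qmul (ht b) (turns [:: b])) t1.
  by case: b {t1}; rewrite /half_turn /qmul; congr (_, _, _, _); lra.
split=> //.
  rewrite -[turns _]/(qmul (ht b) (turns [:: b; b])) t2.
  by case: b {t1 t2}; rewrite /half_turn /qmul; congr (_, _, _, _); ring.
rewrite -[turns _]/(qmul (ht b) (qmul (ht b) (turns [:: b; b]))) t2 qmulA.
have -> : qmul (ht b) (ht b) = (-1, 0, 0, 0) 
  by rewrite -t2 -[turns [:: b; b]]/(qmul (ht b) (turns [:: b])) t1.
by rewrite /qmul /qone; congr (_, _, _, _); ring.
Qed.

Lemma turns_mixed b : turns [:: b; ~~ b] = (2^-1, 0, 0, if b then apex R else - apex R) /\
  turns [:: b; ~~ b; b] = (0, 2^-1, apex R, 0).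
Proof.
have a2 := apex2 R.
have [t1 _ _ _] := turns_values (~~ b); have [t1' _ _ _] := turns_values b.
have t2 c : turns [:: c] = ht c -> turns [:: ~~ c; c] = (2^-1, 0, 0, if ~~ c then apex R else - apex R).
  move=> e; rewrite -[turns _]/(qmul (ht (~~ c)) (turns [:: c])) e.
  by case: c e => e; rewrite /half_turn /qmul /=; congr (_, _, _, _); lra.
split; first by have := t2 _ t1; rewrite negbK.
rewrite -[turns _]/(qmul (ht b) (turns [:: ~~ b; b])) (t2 _ t1').
by case: b {t1 t1'}; rewrite /half_turn /qmul /=; congr (_, _, _, _); lra.
Qed.

(** The contradictory [u = 0 /\ u = 1] is a form of absurdity that linear arithmetic can reach. *)
Lemma visible_intro (q : Quat R) (u : R) :
  (q.1.1.1 = 0 -> q.1.1.2 = 0 -> u = 0 /\ u = 1) -> visible q.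
Proof.
move=> h; rewrite /visible; apply: contraT; rewrite negb_or !negbK => /andP[/eqP e1 /eqP e2].
by have [-> /eqP] := h e1 e2; rewrite eq_sym oner_eq0.
Qed.

Lemma steady_powers b :
  [/\ steady b [::], steady b [:: b], steady b [:: b; b] & steady b [:: b; b; b]].
Proof.
have a2 := apex2 R; have [t1 t2 t3 _] := turns_values b.
split=> u _; apply: (visible_intro (u := u)); rewrite ?t1 ?t2 ?t3; case: b {t1 t2 t3};
  rewrite /spin /segment /half_turn /qmul /=; have a2u : apex R ^+ 2 * u = 3 / 4 * u by rewrite a2.
all: by move=> e1 e2; split; lra.
Qed.

Lemma steady_mixed b : steady b [:: ~~ b] /\ steady b [:: ~~ b; b].
Proof.
have a2 := apex2 R; have [t1 _ _ _] := turns_values (~~ b).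
have [+ _] := turns_mixed (~~ b); rewrite negbK => t2.
split=> u _; apply: (visible_intro (u := u)); rewrite ?t1 ?t2; case: b {t1 t2};
  rewrite /spin /segment /half_turn /qmul /=; have a2u : apex R ^+ 2 * u = 3 / 4 * u by rewrite a2.
all: by move=> e1 e2; split; lra.
Qed.

End ThreePoints.

Section NoSectionThree.
Variable R : realType.

Lemma no_section_three : ~ exists s : UConf 3 (sphere R) -> UConf0 3 (sphere R), is_section s.
Proof.
move=> [s hs]; have [q q0 qo] := off_equator hs.
have [U [hU oU U2]] := reads_spin hs q0 qo true.
have [V [hV oV V2]] := reads_spin hs q0 qo false.
pose w b := if b then U else V.
have hw b : reads s q (spin b) (w b) by case: b.
have w2 b : forall j, j \in w b -> (j <= 2)%N by case: b.
pose C b := mm (flip_mx b) (word_mx (w b)).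
(* A flip has determinant -1, and the word of a spin has odd length. *)
have dC b : mdet (C b) = 1.
  by rewrite mdet_mm word_mx_det -signr_odd; case: b; rewrite /w ?oU ?oV.
have step b l W W' : steady R b l -> spoke s q (turns R l) W -> spoke s q (turns R (b :: l)) W' ->
    eqpm (mm (word_mx W) (flips_mx l)) (mm (mm (word_mx W') (flips_mx (b :: l))) (C b)).
  by move=> st; exact: spoke_flip (w2 b).
have sp b l : steady R b l -> exists W, spoke s q (turns R l) W.
  move=> st; apply: (spoke_ex hs q0); have := st 0.
  by rewrite /spin segment0 (qmul1 _).1; apply; rewrite lexx ler01.
have sp' b l : steady R b l -> exists W, spoke s q (turns R (b :: l)) W.
  move=> st; apply: (spoke_ex hs q0); have := st 1.
  by rewrite /spin segment1; apply; rewrite lexx ler01.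
have [W0 h0] : exists W, spoke s q (turns R [::]) W by have [/sp] := steady_powers R true.
have d0 : mdet (word_mx W0) * mdet (word_mx W0) = 1 by rewrite word_mx_det -expr2 sqrr_sign.
(* Four arcs of the same half-turn return to the quaternion 1, hence to the spoke [W0], which
   cancels. *)
have order4 b : eqpm (mm (mm (mm (C b) (C b)) (C b)) (C b)) mone.
  have [s1 s2 s3 s4] := steady_powers R b; have [_ _ _ t4] := turns_values R b.
  have [W1 h1] := sp' _ _ s1; have [W2 h2] := sp' _ _ s2; have [W3 h3] := sp' _ _ s3.
  have h4 : spoke s q (turns R [:: b; b; b; b]) W0 by rewrite t4.
  have e := eqpm_trans (step _ _ _ _ s3 h2 h3) (eqpm_mmr (C b) (step _ _ _ _ s4 h3 h4)).
  have {}e := eqpm_trans (step _ _ _ _ s2 h1 h2) (eqpm_mmr (C b) e).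
  have {}e := eqpm_trans (step _ _ _ _ s1 h0 h1) (eqpm_mmr (C b) e).
  have f4 : flips_mx [:: b; b; b; b] = mone by case: (b).
  by apply: eqpm_sym; apply: eqpm_cancel d0 _; move: e; rewrite f4 /= !mm1r !mmA.
have [W3 h3] : exists W, spoke s q (0, 2^-1, apex R, 0) W.
  by have [_ /sp'] := steady_mixed R true; rewrite (turns_mixed R true).2.
(* Both alternating products of three half-turns end at the same quaternion, hence at the same spoke
   [W3]. *)
have braid b : eqpm (mm (word_mx W0) mone)
    (mm (mm (word_mx W3) (flips_mx [:: b; ~~ b; b])) (mm (mm (C b) (C (~~ b))) (C b))).
  have [s1 _ _ _] := steady_powers R b; have [_ s3] := steady_mixed R b.
  have [s2 _] := steady_mixed R (~~ b); rewrite negbK in s2.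
  have [W1 h1] := sp' _ _ s1; have [W2 h2] := sp' _ _ s2.
  have {}h3 : spoke s q (turns R [:: b; ~~ b; b]) W3 by rewrite (turns_mixed R b).2.
  have e := eqpm_trans (step _ _ _ _ s2 h1 h2) (eqpm_mmr (C (~~ b)) (step _ _ _ _ s3 h2 h3)).
  have {}e := eqpm_trans (step _ _ _ _ s1 h0 h1) (eqpm_mmr (C b) e).
  by move: e; rewrite !mmA.
apply: (no_braid (dC true) (dC false) _ _ (order4 true) (order4 false)).
- by exists (word_mx U) => //; exact: word_mx_odd.
- by exists (word_mx V) => //; exact: word_mx_odd.
pose P b := flips_mx [:: b; ~~ b; b].
have dP : mdet (mm (word_mx W3) (P true)) * mdet (mm (word_mx W3) (P true)) = 1.
  by rewrite mdet_mm word_mx_det (_ : mdet (P true) = -1) // mulrN1 mulrNN -expr2 sqrr_sign.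
(* The two alternating products of flips agree up to sign. *)
have PP : eqpm (P false) (P true) by right.
apply: eqpm_cancel dP _; apply: eqpm_trans (eqpm_sym (braid true)) _.
exact: eqpm_trans (braid false) (eqpm_mmr _ (eqpm_mml _ PP)).
Qed.

End NoSectionThree.
Theorem corollary1p2 (R : realType) :
  (forall n : nat, (3 < n)%N ->
     forall s : UConf n (plane R) -> UConf0 n (plane R),
       is_section s -> adding_point_at_infinity s) /\
  (forall n : nat, (4 < n)%N \/ n = 2%N \/ n = 3%N ->
     ~ exists s : UConf n (sphere R) -> UConf0 n (sphere R), is_section s).
Proof.
split=> [n n3 s|[|[|m]]]; first by apply: plane_sections; exact: ltnW.
- by case=> [|[]].
- by case=> [|[]].
by case=> [m4|[[->]|[->]]]; [apply: no_section_beads; lia | exact: no_section_beads | exact: no_section_three].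
Qed.
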